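(* Let $N,d\ge1$ be integers and let $B^{\overline H,\overline K}$ be an $(N,d)$-bifractional Brownian sheet with indices $\overline H=(H_{i,j})$, $\overline K=(K_{i,j})$, $H_{i,j}\in(0,1)$, $K_{i,j}\in(0,1]$ ($1\le i\le d$, $1\le j\le N$). Put $H_j^*=\max\{H_{i,j}:\ i=1,\dots,d\}$ and $K_j^*=\max\{K_{i,j}:\ i=1,\dots,d\}$. For any $t\in(0,\infty)^N$ and $x\in\mathbb{R}^d$, the local time $L(x,t)$ of $B^{\overline H,\overline K}$ belongs to the Watanabe space $\mathbb{D}^{\alpha,2}$ for every $$0<\alpha<\sum_{j=1}^N\frac{1}{2H_j^*K_j^*}-\frac d2.$$
   Context: For $H\in(0,1)$, $K\in(0,1]$ let $R^{H,K}(s,t)=\frac1{2^K}\big[(t^{2H}+s^{2H})^K-|t-s|^{2HK}\big]$, $s,t\ge 0$. Given $\overline H_i=(H_{i,1},\dots,H_{i,N})$ and $\overline K_i=(K_{i,1},\dots,K_{i,N})$, $i=1,\dots,d$, the $(N,d)$-bifractional Brownian sheet $B^{\overline H,\overline K}(t)=(B^{\overline H_1,\overline K_1}(t),\dots,B^{\overline H_d,\overline K_d}(t))$, $t\in[0,\infty)^N$, has independent components, the $i$-th being a centered real Gaussian field with covariance $\prod_{j=1}^N R^{H_{i,j},K_{i,j}}(s_j,t_j)$. Local time: for $t\in\mathbb{R}_+^N$, $[0,t]=\prod_j[0,t_j]$, $L(x,t)$ is the density of the occupation measure $\mu_t(A)=\int_{[0,t]}\mathbf{1}_A(B^{\overline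 H,\overline K}(s))\,ds$, $A\in\mathcal{B}(\mathbb{R}^d)$. Formally $L(x,t)=\int_{[0,t]}\delta_x(B^{\overline H,\overline K}(s))\,ds$, where $\delta_x(B^{\overline H,\overline K}(s))$ is a distribution in the sense of Watanabe (obtained by approximating the Dirac function $\delta_x$ by Gaussian kernels with variance tending to $0$). Watanabe space: a random variable $F=\sum_{n\ge0}I_n(f_n)$, where $I_n(f_n)$ is the component of $F$ in the $n$-th Wiener chaos of the Gaussian space generated by $B^{\overline H,\overline K}$, belongs to $\mathbb{D}^{\alpha,2}$ if $\|F\|_{\alpha,2}^2:=\sum_{n\ge0}(1+n)^\alpha\|I_n(f_n)\|_2^2<\infty$, with $\|\cdot\|_2$ the $L^2(\Omega)$ norm.
   Formalization: At x = 0 the local time is asserted to exist, and so to lie in D^{α,2}, only if ∑_i H_{i,j}K_{i,j} < 1 for every j; otherwise the approximations of L(0,t) have means tending to infinity (e.g. N = d = 2, H = 1/2, K = 1) and the claim fails. *)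

(* Defs.v *)
From HB Require Import structures.
From mathcomp Require Import all_boot all_order all_algebra.
From mathcomp Require Import all_classical all_reals all_analysis.

Set Implicit Arguments.
Unset Strict Implicit.
Unset Printing Implicit Defensive.

Import Order.TTheory GRing.Theory Num.Theory.
Import numFieldNormedType.Exports.

Local Open Scope classical_set_scope.
Local Open Scope ring_scope.

(* Points of R^n are n-tuples of reals, with the product (Borel) sigma-algebra
   that the library puts on n.-tuple R. *)

Section lebesgue_tuple.
Context {R : realType}.

Definition tuple_cons n (x : measurableTypeR R * n.-tuple R) : n.+1.-tuple R :=
  [tuple of (x.1 : R) :: x.2].

Definition tuple_uncons n (x : n.+1.-tuple R) : measurableTypeR R * n.-tuple R :=
  (thead x, [tuple of behead x]).

Lemma tuple_consK n : cancel (@tuple_cons n) (@tuple_uncons n).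
Proof.
by case=> x s; rewrite /tuple_uncons theadE; congr (_, _); apply: val_inj.
Qed.

Lemma tuple_unconsK n : cancel (@tuple_uncons n) (@tuple_cons n).
Proof. by move=> x; rewrite [RHS]tuple_eta; apply: val_inj. Qed.

Lemma measurable_tuple_cons n : measurable_fun [set: _] (@tuple_cons n).
Proof.
exact: (@measurable_cons _ _ (measurableTypeR R * n.-tuple R)%type R).
Qed.

Lemma measurable_tuple_uncons n : measurable_fun [set: _] (@tuple_uncons n).
Proof.
apply/measurable_fun_pairP; split.
  exact: (@measurable_tnth _ R n.+1 ord0).
exact: measurable_behead.
Qed.

HB.instance Definition _ n := isMeasurableFun.Build _ _ _ _
  (@tuple_cons n) (@measurable_tuple_cons n).

Section push.
Context n (m : {sigma_finite_measure set (n.-tuple R) -> \bar R}).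

Definition lebesgue_cons : set (n.+1.-tuple R) -> \bar R :=
  pushforward (lebesgue_measure \x m)%E (@tuple_cons n).

Let lebesgue_cons0 : lebesgue_cons set0 = 0%E.
Proof. exact: measure0. Qed.

Let lebesgue_cons_ge0 A : (0 <= lebesgue_cons A)%E.
Proof. exact: measure_ge0. Qed.

Let lebesgue_cons_sigma_additive : semi_sigma_additive lebesgue_cons.
Proof. exact: measure_semi_sigma_additive. Qed.

HB.instance Definition _ := isMeasure.Build _ _ _ lebesgue_cons
  lebesgue_cons0 lebesgue_cons_ge0 lebesgue_cons_sigma_additive.

Lemma lebesgue_cons_sigma_finite : sigma_finite setT lebesgue_cons.
Proof.
have /sigma_finiteP[F [FT Fnd mF]] := sigma_finiteT (@lebesgue_measure R).
have /sigma_finiteP[G [GT Gnd mG]] := sigma_finiteT m.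
exists (fun k => @tuple_uncons n @^-1` (F k `*` G k)).
  apply/esym; rewrite -subTset => x _.
  have [i _ Fi] : (\bigcup_i F i) (tuple_uncons x).1 by rewrite -FT.
  have [j _ Gj] : (\bigcup_i G i) (tuple_uncons x).2 by rewrite -GT.
  exists (maxn i j) => //; split.
    exact: (subsetPset _ _ (Fnd _ _ (leq_maxl i j))).
  exact: (subsetPset _ _ (Gnd _ _ (leq_maxr i j))).
move=> k; have [mFk Fkoo] := mF k; have [mGk Gkoo] := mG k; split.
  rewrite -[X in measurable X]setTI.
  by apply: measurable_tuple_uncons => //; exact: measurableX.
rewrite /lebesgue_cons /pushforward (_ : _ @^-1` _ = F k `*` G k); last first.
  by apply/funext => x; rewrite /preimage /mkset tuple_consK.
by rewrite product_measure1E// lte_mul_pinfty// ge0_fin_numE.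
Qed.

HB.instance Definition _ := Measure_isSigmaFinite.Build _ _ _ lebesgue_cons
  lebesgue_cons_sigma_finite.

End push.

(* n-dimensional Lebesgue measure: the n-fold product of the library's
   one-dimensional one, transported along R * R^n = R^(n+1). *)
Fixpoint lebesgue_tuple n : {sigma_finite_measure set (n.-tuple R) -> \bar R} :=
  match n with
  | 0 => [the {sigma_finite_measure set (0.-tuple R) -> \bar R} of
      \d_([tuple] : 0.-tuple R)]
  | n'.+1 => [the {sigma_finite_measure set (n'.+1.-tuple R) -> \bar R} of
      lebesgue_cons (lebesgue_tuple n')]
  end.

End lebesgue_tuple.

Section bifractional_brownian_sheet.
Context {R : realType}.

Definition bifractional_cov (H K s t : R) : R :=
  (2 `^ K)^-1 *
  ((t `^ (2 * H) + s `^ (2 * H)) `^ K - `|t - s| `^ (2 * H * K)).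

Definition orthant N : set (N.-tuple R) :=
  [set s | forall j, 0 <= tnth s j].

Definition box N (t : N.-tuple R) : set (N.-tuple R) :=
  [set s | forall j, 0 <= tnth s j <= tnth t j].

Context {dO : measure_display} {Omega : measurableType dO}
  (P : probability Omega R).

(* Degenerate Gaussian laws are included: the sheet vanishes on the axes.
   The library's normal_prob m 0 is not the Dirac mass at m. *)
Definition gaussian_rv (X : Omega -> R) : Prop :=
  measurable_fun [set: Omega] X /\
  exists m sigma : R, forall A : set R, measurable A ->
    P (X @^-1` A) = if sigma == 0 then \d_m A else normal_prob m sigma A.

Definition gaussian_field (T : Type) (D : set T) (X : T -> Omega -> R) : Prop :=
  forall n (c : 'I_n -> R) (s : 'I_n -> T), (forall k, D (s k)) ->
    gaussian_rv (fun w => \sum_(k < n) c k * X (s k) w).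

Context {N d : nat}.
Implicit Types (H K : 'M[R]_(d, N)) (B : N.-tuple R -> Omega -> d.-tuple R).

(* max {A i j : i}; the base value 0 is harmless as it is only used with
   positive entries and 0 < d. *)
Definition col_max (A : 'M[R]_(d, N)) (j : 'I_N) : R :=
  \big[Num.max/0]_(i < d) A i j.

Definition component B (i : 'I_d) (s : N.-tuple R) (w : Omega) : R :=
  tnth (B s w) i.

Definition component_sigma B (i : 'I_d) : set (set Omega) :=
  <<s [set component B i s @^-1` U | s in @orthant N & U in measurable] >>.

Definition independent_components B : Prop :=
  forall A : 'I_d -> set Omega, (forall i, component_sigma B i (A i)) ->
    P (\bigcap_i A i) = (\prod_(i < d) P (A i))%E.

(* Only the values of B on the orthant matter.  Joint measurability in (s, w)
   is what gives a meaning to the occupation measure. *)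
Record bifractional_sheet H K B : Prop := BifractionalSheet {
  sheet_measurable :
    measurable_fun (@orthant N `*` [set: Omega]) (fun sw => B sw.1 sw.2);
  sheet_independent : independent_components B;
  sheet_gaussian : forall i, gaussian_field (@orthant N) (component B i);
  sheet_centered : forall i s, orthant s -> ('E_P[component B i s] = 0)%E;
  sheet_cov : forall i s t, orthant s -> orthant t ->
    covariance P (component B i s) (component B i t) =
    (\prod_(j < N)
       bifractional_cov (H i j) (K i j) (tnth s j) (tnth t j))%:E }.

Definition L2_cvg (I : Type) (F : set_system I) (X : I -> Omega -> R)
    (Y : Omega -> R) : Prop :=
  [/\ \forall k \near F, X k \in Lfun P 2%:E, Y \in Lfun P 2%:E &
      ('N[P]_2%:E[EFin \o (X k \- Y)%R] @[k --> F] --> 0)%E].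

Definition L2_closure (S : set (Omega -> R)) : set (Omega -> R) :=
  [set Y | exists X : nat -> Omega -> R, (forall n, S (X n)) /\ L2_cvg \oo X Y].

Definition linear_span (S : set (Omega -> R)) : set (Omega -> R) :=
  [set Y | exists n (c : 'I_n -> R) (X : 'I_n -> Omega -> R),
    (forall k, S (X k)) /\ Y = (fun w => \sum_(k < n) c k * X k w)].

Definition gaussian_space B : set (Omega -> R) :=
  L2_closure (linear_span
    [set component B i s | i in [set: 'I_d] & s in @orthant N]).

Fixpoint hermite n : {poly R} :=
  if n is n'.+1 then 'X * hermite n' - (hermite n')^`() else 1.

Definition wiener_chaos B n : set (Omega -> R) :=
  L2_closure (linear_span
    [set (fun w => (hermite n).[xi w]) |
      xi in gaussian_space B `&` [set xi | 'N[P]_2%:E[EFin \o xi] = 1]%E]).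

(* J n is the component I_n(f_n) of F; it is unique up to null sets since
   chaoses of different orders are orthogonal. *)
Definition watanabe B (alpha : R) : set (Omega -> R) :=
  [set F | exists J : nat -> Omega -> R,
    [/\ forall n, wiener_chaos B n (J n),
        L2_cvg \oo (fun m w => \sum_(n < m) J n w) F &
        (\sum_(0 <= n <oo)
           ((1 + n%:R) `^ alpha)%:E * 'N[P]_2%:E[EFin \o J n] ^+ 2 < +oo)%E]].

Definition occupation B (t : N.-tuple R) (w : Omega) (A : set (d.-tuple R)) :
    \bar R :=
  (\int[lebesgue_tuple N]_(s in box t) (\1_A (B s w))%:E)%E.

Definition occupation_density B (t : N.-tuple R)
    (L : d.-tuple R -> Omega -> R) : Prop :=
  [/\ measurable_fun setT (fun xw : d.-tuple R * Omega => L xw.1 xw.2),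
      forall x w, 0 <= L x w &
      {ae P, forall w, forall A, measurable A ->
         occupation B t w A = (\int[lebesgue_tuple d]_(x in A) (L x w)%:E)%E}].

(* The integral over [0, t] of delta_x(B(s)), with delta_x replaced by the
   centered Gaussian kernel on R^d with covariance eps times the identity. *)
Definition kernel_local_time B (t : N.-tuple R) (x : d.-tuple R) (eps : R)
    (w : Omega) : R :=
  \int[lebesgue_tuple N]_(s in box t)
    \prod_(i < d) normal_pdf 0 (Num.sqrt eps) (component B i s w - tnth x i).

(* F is the integral over [0, t] of delta_x(B(s)), i.e. the value at x of the
   local time; the occupation measure alone only determines its density up to
   a Lebesgue-null set of levels x.
   At x = 0 there may be no such F: the expectation of kernel_local_time
   increases, as eps decreases to 0, to
     (2 pi)^(-d/2) prod_j int_0^(t_j) r^(- sum_i H i j * K i j) dr,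
   which is finite iff sum_i H i j * K i j < 1 for every j. *)
Definition local_time_at B (t : N.-tuple R) (x : d.-tuple R)
    (F : Omega -> R) : Prop :=
  L2_cvg 0^'+ (kernel_local_time B t x) F.

End bifractional_brownian_sheet.

(* Main.v *)
(** With sigma_i(s) the standard deviation of the i-th component at s,
    the Gaussian kernel p_eps(B_i(s) - x_i) expands in the normalized Hermite
    polynomials of B_i(s) / sigma_i(s), with coefficients of order
    (k+1)^(-1/4) (sigma_i(s)^2 + eps)^(-1/2) exp(-x_i^2 / (8 (sigma_i(s)^2 + eps)))
    uniformly in eps.  Since distinct components are independent, the squared
    norm of the n-th chaos component J_n of the regularized local time is a
    double integral over s and u of sums over multi-indices m of degree n of
    products of these coefficients with rho_1(s,u)^m_1 ... rho_d(s,u)^m_d, where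
    rho_i is the correlation of the i-th component, so that the sum over n of
    (1+n)^alpha |J_n|^2 is bounded by the double integral of
    prod_j s_j^(-a_j) prod_j u_j^(-a_j) (1 - max_i rho_i(s,u))^(-alpha - d/2)
    with a_j < 1.  As 1 - rho_i(s,u) is at least of order
    max_j |s_j - u_j|^(2 H^*_j K^*_j) away from the axes, this is finite when
    alpha + d/2 < sum_j 1 / (2 H^*_j K^*_j).  The bound being uniform in eps and
    alpha positive, the regularized local times are Cauchy in L^2 as soon as
    each of their chaos components is, which is dominated convergence, and the
    bound passes to the limit.

    The limit L(x) is a density of the occupation measure: by Fatou's lemma,
    E[1_C int_A L(x) dx] is at most E[1_C mu_t(A)] for A closed, hence for lower
    orthants and their complements, and the total masses agree, so all these
    inequalities are equalities. *)
From HB Require Import structures.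
Require Import Defs.
From mathcomp Require Import all_boot all_order all_algebra.
From mathcomp Require Import all_classical all_reals all_analysis.
From mathcomp Require Import measurable_realfun.
From mathcomp Require Import zify lra.

Set Implicit Arguments.
Unset Strict Implicit.
Unset Printing Implicit Defensive.

Import Order.TTheory GRing.Theory Num.Theory.
Import numFieldNormedType.Exports.

Local Open Scope classical_set_scope.
Local Open Scope ring_scope.

(** * Hermite polynomials and the Mehler formula *)

(** The exponent 1/8 in the coefficient bound is a compromise. With the natural weight exp(-y^2/2),
    He_k(y)^2/k! decays uniformly in y only like k^(-1/6), because of the turning points near 2 sqrt
    k; the rate k^(-1/2) that the sum over multi-indices requires holds with exp(-3y^2/4). The
    square of a coefficient carries exp(-y^2), so exp(-y^2/4) is left over, and its root exp(-y^2/8)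
    removes the singularity of the kernel on the axes at a level x <> 0. At x = 0 nothing
    compensates the inverse standard deviations, hence the condition sum_i H_ij K_ij < 1 for every
    j; it is also forced, by Fatou's lemma, as soon as the regularized local times converge.

    The Wiener chaos is the closed span of Hermite polynomials of unit vectors, while the expansion
    produces products of Hermite polynomials integrated over the box. Two facts bridge the gap:
    inverting a Vandermonde system turns such products into combinations of single Hermite
    polynomials, and integrals of bounded fields are L^2 limits of finite averages. *)

Section hermite_algebra.
Context {R : realType}.
Implicit Types (x y : R) (n m : nat).

Notation He n x := ((@hermite R n).[x]).

Lemma deriv_hermiteS n : (@hermite R n.+1)^`() = n.+1%:R *: hermite n.
Proof.
elim: n => [|n IHn].
  by rewrite /= derivC subr0 mulr1 derivX scale1r.
rewrite [hermite n.+2]/= -/(hermite n.+1) derivB derivM derivX mul1r IHn.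
rewrite derivZ -scalerAr -addrA -scalerBr -[in RHS]natr1 scalerDl scale1r addrC.
by [].
Qed.

Lemma hermiteSS n x :
  He n.+2 x = x * He n.+1 x - n.+1%:R * He n x.
Proof.
by rewrite [hermite n.+2]/= -/(hermite n.+1) deriv_hermiteS hornerD hornerN
  hornerM hornerX hornerZ.
Qed.

Lemma hermite0E x : He 0 x = 1.
Proof. by rewrite hornerC. Qed.

Lemma hermite1E x : He 1 x = x.
Proof. by rewrite /= derivC subr0 mulr1 hornerX. Qed.

Lemma hermite_ode n x :
  (hermite n)^`()^`().[x] = x * (hermite n)^`().[x] - n%:R * He n x.
Proof.
case: n => [|n]; first by rewrite /= !derivC !hornerC mulr0 mul0r subr0.
case: n => [|n].
  have -> : (hermite 1)^`() = 1%:P :> {poly R} by rewrite deriv_hermiteS scale1r.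
  by rewrite derivC hornerC horner0 hermite1E; lra.
rewrite !deriv_hermiteS derivZ deriv_hermiteS !hornerZ hermiteSS; lra.
Qed.

Lemma hermite_opp n x : He n (- x) = (- 1) ^+ n * He n x.
Proof.
suff: He n (- x) = (- 1) ^+ n * He n x /\ He n.+1 (- x) = (- 1) ^+ n.+1 * He n.+1 x.
  by case.
elim: n => [|n [IH1 IH2]]; first by rewrite !hermite0E !hermite1E; split; lra.
split=> //; rewrite !hermiteSS IH1 IH2 !exprS; lra.
Qed.

(** For n = 2j, He_n(0)^2/n! is C(2j,j)/4^j, of order n^(-1/2). Squaring avoids roots: the two-step
    induction reduces to (k+1)(k+3) <= (k+2)^2. *)
Lemma hermite0_sqr n :
  (He n 0 ^+ 2 / n`!%:R) ^+ 2 * n.+1%:R <= 1 :> R.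
Proof.
suff: forall n, (He n 0 ^+ 2 / n`!%:R) ^+ 2 * n.+1%:R <= 1 :> R /\
  (He n.+1 0 ^+ 2 / n.+1`!%:R) ^+ 2 * n.+2%:R <= 1 :> R.
  by move=> /(_ n)[].
elim=> [|k [IH0 IH1]]; first by
  rewrite hermite0E hermite1E !expr1n fact0 divr1 expr1n mul1r expr0n/= mul0r
    expr0n/= mul0r ler01.
split => //; rewrite hermiteSS mul0r sub0r sqrrN 2!factS.
have -> : (k.+1%:R * He k 0) ^+ 2 / (k.+2 * (k.+1 * k`!))%:R =
  k.+1%:R / k.+2%:R * (He k 0 ^+ 2 / k`!%:R) :> R.
  rewrite !natrM !invfM.
  have a0 : k.+1%:R / k.+1%:R = 1 :> R by rewrite divff// pnatr_eq0.
  move: a0; set a' := k.+1%:R^-1; set b := k.+2%:R^-1; set c := k`!%:R^-1; set a := k.+1%:R.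
  move: (He k 0) => d a0; clearbody a' b c a.
  rewrite (_ : (a * d) ^+ 2 * _ = a * a' * (a * b * (d ^+ 2 * c))); last by lra.
  by rewrite a0 mul1r.
set u := He k 0 ^+ 2 / k`!%:R in IH0 *.
rewrite exprMn -mulrA.
apply: le_trans IH0.
rewrite mulrCA ler_wpM2l ?sqr_ge0//.
rewrite expr_div_n mulrAC ler_pdivrMr ?exprn_gt0// -!natrX -!natrM.
rewrite ler_nat; lia.
Qed.

Lemma hermite0_sqr_le n : He n 0 ^+ 2 / n`!%:R <= (Num.sqrt n.+1%:R)^-1 :> R.
Proof.
rewrite -(@ler_pXn2r _ 2)// ?nnegrE ?divr_ge0 ?sqr_ge0 ?invr_ge0 ?sqrtr_ge0//.
by rewrite exprVn sqr_sqrtr// -[leRHS]div1r ler_pdivlMr// hermite0_sqr.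
Qed.

Definition convn (u v : nat -> R) n := \sum_(k < n.+1) u k * v (n - k)%N.

Lemma convnC u v n : convn u v n = convn v u n.
Proof.
rewrite /convn (reindex_inj rev_ord_inj)/=; apply: eq_bigr => k _.
have kn : (k <= n)%N by rewrite -ltnS.
by rewrite subSS subKn// mulrC.
Qed.

(** The recurrence on [u] is the coefficient form of F' = (A - Bz)F, that is F = u_0 exp(Az -
    Bz^2/2). The sum is the coefficient of zF'G, expressed through those of FG. *)
Lemma convn_step (u v : nat -> R) A B n :
  u 1%N = A * u 0%N ->
  (forall k, k.+2%:R * u k.+2 = A * u k.+1 - B * u k) ->
  \sum_(k < n.+3) k%:R * u k * v (n.+2 - k)%N = A * convn u v n.+1 - B * convn u v n.
Proof.
move=> h1 h2; rewrite big_ord_recl mul0r mul0r add0r big_ord_recl.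
rewrite /convn [in RHS]big_ord_recl mulrDr mulrA -h1 -addrA mulr_sumr mulr_sumr.
rewrite -sumrB /=; congr (_ + _).
  by rewrite /bump leq0n mul1r subSS.
apply: eq_bigr => k _; rewrite /bump !leq0n !add1n !subSS h2; lra.
Qed.

Lemma convn_rec (u v : nat -> R) A B A' B' n : B + B' = 1 ->
  u 1%N = A * u 0%N -> (forall k, k.+2%:R * u k.+2 = A * u k.+1 - B * u k) ->
  v 1%N = A' * v 0%N -> (forall k, k.+2%:R * v k.+2 = A' * v k.+1 - B' * v k) ->
  n.+2%:R * convn u v n.+2 = (A + A') * convn u v n.+1 - convn u v n.
Proof.
move=> BB u1 u2 v1 v2.
transitivity (\sum_(k < n.+3) k%:R * u k * v (n.+2 - k)%N +
              \sum_(k < n.+3) k%:R * v k * u (n.+2 - k)%N).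
  rewrite [X in _ + X](reindex_inj rev_ord_inj)/= -big_split/= mulr_sumr.
  apply: eq_bigr => k _; have kn : (k <= n.+2)%N by rewrite -ltnS.
  rewrite !subSS subKn// natrB//; lra.
rewrite (convn_step _ _ u1 u2) (convn_step _ _ v1 v2) !(convnC v u).
have -> : B' = 1 - B by lra. lra.
Qed.

(** The generating function exp(tx - t^2/2) at ax + by factors when a^2 + b^2 = 1. In terms of
    coefficients, [convn_rec] shows that both sides satisfy the same three-term recurrence. *)
Lemma hermiteD n x y a b : a ^+ 2 + b ^+ 2 = 1 :> R ->
  He n (a * x + b * y) / n`!%:R =
  convn (fun k => a ^+ k * (He k x / k`!%:R)) (fun k => b ^+ k * (He k y / k`!%:R)) n.
Proof.
have key z c k : k.+2%:R * (c ^+ k.+2 * (He k.+2 z / (k.+2)`!%:R)) =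
   c * z * (c ^+ k.+1 * (He k.+1 z / (k.+1)`!%:R)) - c ^+ 2 * (c ^+ k * (He k z / k`!%:R)) :> R.
  rewrite hermiteSS !factS !natrM !invfM !exprS expr0.
  have h1 : k.+1%:R / k.+1%:R = 1 :> R by rewrite divff// pnatr_eq0.
  have h2 : k.+2%:R / k.+2%:R = 1 :> R by rewrite divff// pnatr_eq0.
  move: h1 h2; set B' := k.+1%:R^-1; set A' := k.+2%:R^-1; set F := k`!%:R^-1; set B := k.+1%:R.
  set A := k.+2%:R; clearbody B' A' F B A.
  move: (He k.+1 z) (He k z) (c ^+ k) => p q ck h1 h2.
  rewrite (_ : A * _ = A * A' * (c * (c * ck) * ((z * p - B * q) * (B' * F)))); last by lra.
  rewrite h2 mul1r.
  rewrite (_ : c * (c * ck) * _ = c * z * (c * ck * (p * (B' * F))) -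
    B * B' * (c * (c * 1) * (ck * (q * F)))); last by lra.
  by rewrite h1 mul1r.
move=> ab; set u := (fun k => a ^+ k * _); set v := (fun k => b ^+ k * _).
suff: He n (a * x + b * y) / n`!%:R = convn u v n /\
      He n.+1 (a * x + b * y) / n.+1`!%:R = convn u v n.+1 by case.
have u1 : u 1%N = a * x * u 0%N.
  by rewrite /u hermite1E hermite0E fact0 factS fact0; lra.
have v1 : v 1%N = b * y * v 0%N.
  by rewrite /v hermite1E hermite0E fact0 factS fact0; lra.
elim: n => [|n [IH1 IH2]].
  rewrite /convn !big_ord_recr !big_ord0 /= !subnn subn0 u1 v1 hermite1E hermite0E.
  by rewrite /u /v !hermite0E factS !fact0 !expr0 !divr1 !mulr1; split; lra.
split=> //; apply: (@mulfI _ n.+2%:R); first by rewrite pnatr_eq0.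
rewrite (convn_rec _ ab u1 (key x a) v1 (key y b)) -IH1 -IH2.
have := key (a * x + b * y) 1 n; rewrite !expr1n !mul1r => ->; lra.
Qed.

(* [v x = expR (- 3 / 8 * x ^+ 2) * He n x] solves the damped equation
   [v'' + x / 2 * v' + Q * v = 0] with [Q = n + 3 / 4 - 3 / 16 * x ^+ 2], so its
   energy [v' ^+ 2 + Q * v ^+ 2 = expR (- (3 / 4) * x ^+ 2) * (T n).[x]]
   decreases for [0 <= x]. *)
Let T n : {poly R} := ((hermite n)^`() - (3 / 4) *: ('X * hermite n)) ^+ 2 +
  ((n%:R + 3 / 4)%:P - (3 / 16) *: 'X^2) * hermite n ^+ 2.

Let TE n x : (T n).[x] = ((hermite n)^`().[x] - 3 / 4 * (x * He n x)) ^+ 2 +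
  (n%:R + 3 / 4 - 3 / 16 * x ^+ 2) * He n x ^+ 2.
Proof. by rewrite /T !hornerE. Qed.

Let dTE n x : (T n)^`().[x] - 3 / 2 * x * (T n).[x] =
  - x * ((hermite n)^`().[x] - 3 / 4 * (x * He n x)) ^+ 2 - 3 / 8 * x * He n x ^+ 2.
Proof.
rewrite TE /T !expr2 derivD !derivM !derivB !derivZ !derivM derivX !derivC.
rewrite !hornerE /= hermite_ode; lra.
Qed.

Let hermite_energy n x : 0 <= x ->
  expR (- (3 / 4) * x ^+ 2) * (T n).[x] <= (T n).[0].
Proof.
move=> x0; pose q : {poly R} := - (3 / 4) *: 'X^2.
pose f x := expR (q.[x]) * (T n).[x].
have df y : is_derive y 1 f (expR q.[y] * (- y * ((hermite n)^`().[y] - 3 / 4 * (y * He n y)) ^+ 2 - 3 / 8 * y * He n y ^+ 2)).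
  rewrite -dTE.
  have h1 : is_derive y 1 (expR \o horner q) (expR q.[y] * q^`().[y]).
    by apply: is_derive1_comp.
  rewrite /f; apply: is_derive_eq.
  have -> : q^`().[y] = - (3 / 2) * y by rewrite /q derivZ derivXn expr1 !hornerE/=; lra.
  rewrite /GRing.scale/=; lra.
have := @ler0_derive1_nincry R f 0.
move=> /(_ _ _ _ 0 x) h; have -> : (T n).[0] = f 0 by rewrite /f /q hornerZ hornerXn expr0n/= mulr0 expR0 mul1r.
have -> : expR (- (3 / 4) * x ^+ 2) * (T n).[x] = f x by rewrite /f /q !hornerE.
apply: h => //.
- move=> y; rewrite in_itv/= andbT => y0; have [_ dfy] := df y; rewrite derive1E dfy.
  rewrite pmulr_rle0 ?expR_gt0//.
  have : 0 <= y * (He n y) ^+ 2 by rewrite mulr_ge0 ?sqr_ge0// ltW.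
  have : 0 <= y * ((hermite n)^`().[y] - 3 / 4 * (y * He n y)) ^+ 2 by rewrite mulr_ge0 ?sqr_ge0// ltW.
  lra.
- apply: derivable_within_continuous => y _; exact: @ex_derive _ _ _ _ _ _ _ (df y).
Qed.

(** Where x^2 <= 4n the coefficient Q of the damped equation is at least (n+1)/4, so the energy
    controls He_n(x)^2. The energy at 0 is at most 2 n! sqrt(n+1), whence the constant 8. *)
Let hermite_bound_in n x : 0 <= x -> x ^+ 2 <= 4 * n%:R ->
  He n x ^+ 2 / n`!%:R * expR (- (3 / 4) * x ^+ 2) <= 8 / Num.sqrt n.+1%:R.
Proof.
move=> x0 xn; have := hermite_energy n x0.
rewrite !TE => h.
have n0 : 0 < n`!%:R^-1 :> R by rewrite invr_gt0 ltr0n fact_gt0.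
have E0 := expR_gt0 (- (3 / 4) * x ^+ 2); set E := expR _ in E0 h *.
set s := Num.sqrt n.+1%:R.
have s0 : 0 < s by rewrite sqrtr_gt0.
have s2 : s ^+ 2 = n%:R + 1 by rewrite sqr_sqrtr// natr1.
have h1 : (hermite n)^`().[0] ^+ 2 / n`!%:R <= s :> R.
  rewrite /s; case: n {h xn n0 s s0 s2} => [|n].
    by rewrite derivC horner0 expr0n/= mul0r sqrtr_ge0.
  rewrite deriv_hermiteS hornerZ exprMn factS natrM invfM.
  have a0 : n.+1%:R / n.+1%:R = 1 :> R by rewrite divff// pnatr_eq0.
  have := hermite0_sqr_le n.
  rewrite (_ : n.+1%:R ^+ 2 * He n 0 ^+ 2 * (n.+1%:R^-1 / n`!%:R) =
    (n.+1%:R / n.+1%:R) * (n.+1%:R * (He n 0 ^+ 2 / n`!%:R))); last first.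
    by move: n.+1%:R n.+1%:R^-1 n`!%:R^-1 => a b c; lra.
  rewrite a0 mul1r => h; apply: (@le_trans _ _ (n.+1%:R * (Num.sqrt n.+1%:R)^-1)).
    by rewrite ler_wpM2l.
  have -> : n.+1%:R = Num.sqrt n.+1%:R ^+ 2 :> R by rewrite sqr_sqrtr.
  rewrite sqrtr_sqr ger0_norm ?sqrtr_ge0// expr2 mulfK ?gt_eqF ?sqrtr_gt0//.
  by rewrite -(sqr_sqrtr (ler0n _ n.+1)) sqrtr_sqr ger0_norm// ler_sqrt// ler_nat.
have h2 : He n 0 ^+ 2 / n`!%:R <= s^-1 := hermite0_sqr_le n.
have h3 : s^-1 * s = 1 by rewrite mulVf// gt_eqF.
have s'0 : 0 < s^-1 by rewrite invr_gt0.
have n1 : 0 <= n%:R :> R by [].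
move: h h1 h2 h3 s'0 n0 xn s2 n1; rewrite mul0r mulr0 subr0 expr0n/= mulr0 subr0.
move: (He n x) (He n 0) ((hermite n)^`().[x]) ((hermite n)^`().[0]) => a b c d.
move: n`!%:R^-1 s^-1 n%:R => F s' N h h1 h2 h3 s'0 F0 xN s2 N0.
have k1 : E * a ^+ 2 * (N + 1) / 4 <= d ^+ 2 + (N + 3 / 4) * b ^+ 2.
  apply: le_trans h; rewrite -[leLHS]add0r.
  rewrite (_ : E * a ^+ 2 * (N + 1) / 4 = E * (a ^+ 2 * ((N + 1) / 4))); last by lra.
  rewrite add0r ler_wpM2l ?(ltW E0)//.
  have : 0 <= a ^+ 2 * (N / 4 * 3 + 1/2  - 3 / 16 * x ^+ 2) by rewrite mulr_ge0 ?sqr_ge0//; lra.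
  have : 0 <= (c - 3 / 4 * (x * a)) ^+ 2 by exact: sqr_ge0.
  lra.
have k2 : a ^+ 2 * F * E * (N + 1) <= 8 * s.
  have : E * a ^+ 2 * (N + 1) / 4 * F <= (d ^+ 2 + (N + 3 / 4) * b ^+ 2) * F.
    by rewrite ler_wpM2r// ltW.
  have : (N + 3 / 4) * (b ^+ 2 * F) <= (N + 1) * s'.
    apply: ler_pM => //; [lra| rewrite mulr_ge0 ?sqr_ge0// ltW//|lra].
  have : (N + 1) * s' = s by rewrite -s2 expr2 -mulrA (mulrC s s') h3 mulr1.
  lra.
have : (a ^+ 2 * F * E * (N + 1)) * s' <= 8 * s * s' by rewrite ler_wpM2r// ltW.
rewrite -s2 => k3.
have : a ^+ 2 * F * E * s * (s' * s) <= 8 * (s' * s) by lra.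
rewrite h3 !mulr1 => k4.
have : a ^+ 2 * F * E * s * s' <= 8 * s' by rewrite ler_wpM2r// ltW.
by rewrite -mulrA (mulrC s s') h3 mulr1.
Qed.

(** The ratio He_{k+1}/He_k stays in [x/2, x]: since k + 1 <= x^2/4, the subtracted term of the
    recurrence is at most half of the leading one. *)
Let hermite_pos_step n x : 0 < x -> 4 * n%:R <= x ^+ 2 ->
  forall k, (k <= n)%N -> [/\ 0 < He k x, He k x <= x ^+ k,
    x / 2 * He k x <= He k.+1 x & He k.+1 x <= x * He k x].
Proof.
move=> x0 xn; elim=> [|k IH] kn.
  by rewrite hermite0E hermite1E expr0 ltr01 lexx; split=> //; lra.
have [h1 h2 h3 h4] := IH (ltnW kn).
have h5 : 0 < He k.+1 x by apply: lt_le_trans h3; rewrite mulr_gt0// divr_gt0.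
split => //.
- by rewrite exprS (le_trans h4)// ler_wpM2l// ltW.
- rewrite hermiteSS.
  have : x / 2 * (x / 2 * He k x) <= x / 2 * He k.+1 x by rewrite ler_wpM2l// divr_ge0// ltW.
  have : k.+1%:R * He k x <= n%:R * He k x by rewrite ler_wpM2r ?ler_nat// ltW.
  have : 4 * n%:R * He k x <= x ^+ 2 * He k x by rewrite ler_wpM2r// ltW.
  lra.
- by rewrite hermiteSS lerBlDr lerDl mulr_ge0// ltW.
Qed.

Let bernoulli n : n%:R / 4 + 1 <= (5 / 4) ^+ n :> R.
Proof.
elim: n => [|n IH]; first by rewrite mul0r add0r expr0.
have : 0 <= n%:R :> R by []. rewrite exprS -natr1; lra.
Qed.

(** Here He_n(x)^2 <= x^(2n) <= 4^n n! exp(x^2/4), so the product is at most 4^n exp(-x^2/2) <= (4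
    exp(-2))^n <= (4/5)^n, which beats (n+1)^(-1/2). *)
Let hermite_bound_out n x : 0 <= x -> 4 * n%:R <= x ^+ 2 ->
  He n x ^+ 2 / n`!%:R * expR (- (3 / 4) * x ^+ 2) <= 8 / Num.sqrt n.+1%:R.
Proof.
have r0 m : 0 < Num.sqrt m.+1%:R :> R by rewrite sqrtr_gt0.
rewrite le_eqVlt => /predU1P[<-|x0 xn].
  rewrite expr0n/= mulr0 expR0 mulr1 => _; apply: (le_trans (hermite0_sqr_le n)).
  by rewrite -[leLHS]mul1r ler_wpM2r ?invr_ge0 ?(ltW (r0 _))//; lra.
have [h1 h2 _ _] := hermite_pos_step x0 xn (leqnn n).
have h3 : He n x ^+ 2 <= (x ^+ 2) ^+ n.
  by rewrite exprAC lerXn2r ?nnegrE ?exprn_ge0// ltW.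
have F0 : 0 < n`!%:R :> R by rewrite ltr0n fact_gt0.
have h4 : (x ^+ 2) ^+ n / n`!%:R <= 4 ^+ n * expR (x ^+ 2 / 4).
  have h : (x ^+ 2 / 4) ^+ n / n`!%:R <= expR (x ^+ 2 / 4).
    case: n {xn h1 h2 h3 F0} => [|n].
      by rewrite expr0 fact0 divr1 -expR0 ler_expR divr_ge0// sqr_ge0.
    apply: le_trans (expR_ge1Dxn n _); last by rewrite divr_ge0// sqr_ge0.
    by rewrite lerDr.
  have -> : (x ^+ 2) ^+ n = 4 ^+ n * (x ^+ 2 / 4) ^+ n.
    by rewrite -exprMn; congr (_ ^+ n); lra.
  by rewrite -mulrA ler_wpM2l ?exprn_ge0.
have E0 := expR_gt0 (- (3 / 4) * x ^+ 2).
apply: (@le_trans _ _ (4 ^+ n * expR (x ^+ 2 / 4) * expR (- (3 / 4) * x ^+ 2))).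
  rewrite ler_wpM2r ?(ltW E0)//; apply: le_trans h4.
  by rewrite ler_wpM2r// invr_ge0 ltW.
rewrite -mulrA -expRD.
have e5 : expR (x ^+ 2 / 4 + - (3 / 4) * x ^+ 2) <= (expR (-2)) ^+ n :> R.
  rewrite -expRM_natr ler_expR; lra.
have e2 : 4 * expR (- 2) <= (5 / 4)^-1 :> R.
  rewrite expRN ler_pdivrMr ?expR_gt0// ler_pdivlMl//.
  have h : 3 / 2 <= expR (1 / 2) :> R by apply: le_trans (expR_ge1Dx _); lra.
  have -> : 2 = (1 / 2) * 4%:R :> R by lra.
  rewrite expRM_natr (@le_trans _ _ ((3 / 2) ^+ 4)) ?lerXn2r ?nnegrE ?expR_ge0//; lra.
apply: (@le_trans _ _ ((5 / 4)^-1 ^+ n)).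
  apply: (@le_trans _ _ ((4 * expR (-2)) ^+ n)); first by rewrite exprMn ler_wpM2l ?exprn_ge0.
  by rewrite lerXn2r ?nnegrE ?mulr_ge0 ?expR_ge0// invr_ge0.
rewrite exprVn; apply: (@le_trans _ _ ((n%:R / 4 + 1)^-1)).
  by rewrite lef_pV2 ?posrE ?exprn_gt0// ?bernoulli//; have : 0 <= n%:R :> R by []; lra.
rewrite -[leLHS]mul1r ler_pdivrMr; last by have : 0 <= n%:R :> R by []; lra.
rewrite mulrAC ler_pdivlMr// mul1r.
have := sqr_sqrtr (ler0n R n.+1); rewrite -natr1 => h.
have : 1 <= Num.sqrt (n%:R + 1) :> R by rewrite natr1 -[leLHS]sqrtr1 ler_sqrt ?ler1n.
move: h; move: (Num.sqrt _) => s; rewrite expr2; nra.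
Qed.

(** A Cramer-type inequality that gains the factor (n+1)^(-1/2) by giving up exp(-x^2/2) for
    exp(-3x^2/4). The curve x^2 = 4n separates the energy argument from the crude bound. *)
Lemma hermite_bound n x :
  He n x ^+ 2 / n`!%:R * expR (- (3 / 4) * x ^+ 2) <= 8 / Num.sqrt n.+1%:R.
Proof.
wlog x0 : x / 0 <= x.
  move=> h; have [/h//|/ltW x0] := leP 0 x.
  have := h (- x); rewrite hermite_opp exprMn sqrr_sign mul1r sqrrN.
  by apply; rewrite oppr_ge0.
have [h|/ltW h] := leP (x ^+ 2) (4 * n%:R).
  exact: hermite_bound_in.
exact: hermite_bound_out.
Qed.

End hermite_algebra.

Section mehler.
Context {R : realType}.
Notation He n x := ((@hermite R n).[x]).
Implicit Types (f g a b : nat -> R) (r : R).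

Definition poly_growth f := exists C k, forall m, `|f m| <= C * m.+1%:R ^+ k.

Lemma poly_growth_cvg f r : poly_growth f -> `|r| < 1 -> cvgn (pseries f r).
Proof.
move=> [C [k fC]] r1.
(* With |r| = q^(k+1), k of the k + 1 factors q^m absorb the polynomial weight (m+1)^k and the last
   one leaves a geometric series. *)
pose q := `|r| `^ (k.+1%:R^-1).
have q0 : 0 <= q by exact: powR_ge0.
have qk : q ^+ k.+1 = `|r| by rewrite -powR_mulrn// -powRrM mulVf// powRr1.
have q1 : q < 1.
  rewrite ltNge; apply/negP => q1; have := exprn_ege1 k.+1 q1; rewrite qk; lra.
have hq m : m.+1%:R * q ^+ m <= (1 - q)^-1.
  rewrite -[leRHS]mul1r ler_pdivlMr; last by lra.
  have -> : m.+1%:R * q ^+ m * (1 - q) <= 1 = (m.+1%:R * q ^+ m * (1 - q) <= 1) by [].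
  have h : 1 - q ^+ m.+1 = (1 - q) * \sum_(i < m.+1) q ^+ i.
    have := subrX1 q m.+1; lra.
  have h2 : m.+1%:R * q ^+ m <= \sum_(i < m.+1) q ^+ i.
    rewrite -[m.+1 in leLHS]card_ord -sumr_const mulr_suml; apply: ler_sum => i _.
    by rewrite mul1r ler_wiXn2l// ?(ltW q1)// -ltnS.
  have h3 : 0 <= q ^+ m.+1 by rewrite exprn_ge0.
  have : m.+1%:R * q ^+ m * (1 - q) <= (\sum_(i < m.+1) q ^+ i) * (1 - q).
    by rewrite ler_wpM2r//; lra.
  lra.
apply: normed_cvg.
have C0 : 0 <= C by have := fC 0; rewrite expr1n mulr1; apply: le_trans.
apply: (@series_le_cvg _ _ (geometric (C * (1 - q)^-1 ^+ k) q)) => //=.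
- by move=> n; rewrite mulr_ge0 ?exprn_ge0// mulr_ge0// exprn_ge0// invr_ge0; lra.
- move=> n; rewrite normrM normrX -qk -exprM mulSn exprD [leRHS]mulrC.
  rewrite mulrCA ler_wpM2l ?exprn_ge0//.
  apply: (le_trans (ler_wpM2r _ (fC n))); first by rewrite exprn_ge0.
  rewrite -mulrA ler_wpM2l// mulnC exprM -exprMn lerXn2r ?nnegrE//.
    by rewrite mulr_ge0// exprn_ge0.
  by rewrite invr_ge0; lra.
- by apply: is_cvg_geometric_series; rewrite ger0_norm.
Qed.

Lemma poly_growth_diffs f : poly_growth f -> poly_growth (pseries_diffs f).
Proof.
move=> [C [k fC]]; exists (C * 2 ^+ k), k.+1 => m.
rewrite /pseries_diffs normrM ger0_norm// (le_trans (ler_wpM2l _ (fC m.+1)))//.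
have C0 : 0 <= C by have := fC 0; rewrite expr1n mulr1; apply: le_trans.
rewrite exprS mulrCA -[leRHS]mulrA ler_wpM2l//.
rewrite [leRHS]mulrCA ler_wpM2l// -exprMn lerXn2r ?nnegrE// -natrM ler_nat; lia.
Qed.

Lemma poly_growth_lin f g c d : poly_growth f -> poly_growth g ->
  poly_growth (fun m => c * f m + d * g m).
Proof.
move=> [C [k fC]] [D [l gD]]; exists (`|c| * C + `|d| * D), (k + l)%N => m.
have C0 : 0 <= C by have := fC 0; rewrite expr1n mulr1; apply: le_trans.
have D0 : 0 <= D by have := gD 0; rewrite expr1n mulr1; apply: le_trans.
rewrite (le_trans (ler_normD _ _))// !normrM mulrDl lerD// -mulrA ler_wpM2l//.
  rewrite (le_trans (fC m))// ler_wpM2l// ler_weXn2l ?leq_addr//.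
  by rewrite ler1n.
rewrite (le_trans (gD m))// ler_wpM2l// ler_weXn2l ?leq_addl//.
by rewrite ler1n.
Qed.

Lemma lim_pseries_lin f g c d r : poly_growth f -> poly_growth g -> `|r| < 1 ->
  limn (pseries (fun m => c * f m + d * g m) r) =
  c * limn (pseries f r) + d * limn (pseries g r).
Proof.
move=> pf pg r1; apply/cvg_lim => //.
rewrite [X in X @ _ --> _](_ : _ = fun n => c * pseries f r n + d * pseries g r n); last first.
  apply/funext => n; rewrite /pseries /series /= !mulr_sumr -big_split/=.
  by apply: eq_bigr => i _; lra.
apply: cvgD; apply: cvgM; try exact: cvg_cst.
  exact: poly_growth_cvg.
exact: poly_growth_cvg.
Qed.

Lemma lim_pseries_shift f a b r : poly_growth a -> poly_growth b -> `|r| < 1 ->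
  f 0%N = a 0%N -> (forall m, f m.+1 = a m.+1 - b m) ->
  limn (pseries f r) = limn (pseries a r) - r * limn (pseries b r).
Proof.
move=> pa pb r1 f0 fS; apply/cvg_lim => //.
rewrite -(cvg_shiftS (pseries f r)).
rewrite [X in X @ _ --> _](_ : _ = fun n => pseries a r n.+1 - r * pseries b r n); last first.
  apply/funext => n; rewrite /pseries /series /= !big_nat_recl// f0 mulr_sumr -addrA.
  congr (_ + _); rewrite -sumrB; apply: eq_bigr => i _; rewrite fS exprS; lra.
apply: cvgB; first by rewrite cvg_shiftS; exact: poly_growth_cvg.
by apply: cvgM; [exact: cvg_cst|exact: poly_growth_cvg].
Qed.

Lemma hermite_growth (y : R) m : `|He m y| <= 3 * expR (3 / 8 * y ^+ 2) * Num.sqrt m`!%:R.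
Proof.
have F0 : 0 < m`!%:R :> R by rewrite ltr0n fact_gt0.
rewrite -sqrtr_sqr -(@ler_pXn2r _ 2)// ?nnegrE ?mulr_ge0 ?expR_ge0 ?sqrtr_ge0//.
rewrite sqr_sqrtr ?sqr_ge0// !exprMn sqr_sqrtr ?(ltW F0)//.
have := hermite_bound m y.
have s1 : 1 <= Num.sqrt m.+1%:R :> R by rewrite -[leLHS]sqrtr1 ler_sqrt// ler1n.
have -> : expR (3 / 8 * y ^+ 2) ^+ 2 = (expR (- (3 / 4) * y ^+ 2))^-1.
  rewrite -expRN -expRM_natr; congr expR; lra.
move=> h; rewrite mulrAC ler_pdivlMr ?expR_gt0// -ler_pdivrMr// mulrAC.
apply: (le_trans h).
rewrite ler_pdivrMr; lra.
Qed.

Section fixed.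
Variables y z : R.

(** Coefficients of U_ij(r) = sum_m He_{m+i}(y) He_{m+j}(z) r^m/m!. Differentiating [U 0 0] in r
    gives [U 1 1], and the three-term recurrence, used in y and in z, ties [U 1 1] linearly to
    [U 0 0] through [U 1 0], [U 0 1] and [U 0 2]. *)
Let f i j m : R := He (m + i) y * He (m + j) z / m`!%:R.

Let fgrowth i j : (i + j <= 2)%N -> poly_growth (f i j).
Proof.
move=> ij.
exists (9 * expR (3 / 8 * y ^+ 2) * expR (3 / 8 * z ^+ 2) * 2 ^+ 2), 2%N => m.
have F0 k : 0 < k`!%:R :> R by rewrite ltr0n fact_gt0.
have hs k : (k <= 2)%N -> Num.sqrt (m + k)`!%:R <= (2 * m.+1%:R) ^+ k * Num.sqrt m`!%:R :> R.
  elim: k => [_|k IH k2]; first by rewrite addn0 expr0 mul1r.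
  rewrite addnS factS natrM sqrtrM// exprS -mulrA ler_pM ?sqrtr_ge0 ?IH 1?ltnW//.
  rewrite -natrM -(@ler_pXn2r _ 2)// ?nnegrE ?sqrtr_ge0// sqr_sqrtr//.
  rewrite -natrX ler_nat; lia.
rewrite /f !normrM (@ger0_norm _ (_^-1)) ?invr_ge0 ?(ltW (F0 _))//.
rewrite ler_pdivrMr//.
apply: le_trans (ler_pM _ _ (hermite_growth y _) (hermite_growth z _)) _ => //.
have h : Num.sqrt (m + i)`!%:R * Num.sqrt (m + j)`!%:R <= (2 * m.+1%:R) ^+ 2 * m`!%:R :> R.
  apply: le_trans (ler_pM (sqrtr_ge0 _) (sqrtr_ge0 _) (hs i _) (hs j _)) _; try lia.
  rewrite mulrACA -exprD -expr2 sqr_sqrtr ?(ltW (F0 _))// ler_wpM2r ?(ltW (F0 _))//.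
  by rewrite ler_weXn2l// -natrM ler1n.
have E0 := expR_gt0 (3 / 8 * y ^+ 2).
have E1 := expR_gt0 (3 / 8 * z ^+ 2).
move: h E0 E1; rewrite exprMn; move: (expR _) (expR _) => a b h E0 E1.
have := ler_wpM2l (_ : 0 <= 9 * a * b) h; rewrite !mulr_ge0 ?(ltW E0) ?(ltW E1)//.
move=> /(_ isT); move: (Num.sqrt _) (Num.sqrt _) (m.+1%:R ^+ 2) => c d e; lra.
Qed.

Let g00 : poly_growth (f 0 0). Proof. exact: fgrowth. Qed.
Let g01 : poly_growth (f 0 1). Proof. exact: fgrowth. Qed.
Let g10 : poly_growth (f 1 0). Proof. exact: fgrowth. Qed.
Let g11 : poly_growth (f 1 1). Proof. exact: fgrowth. Qed.
Let g02 : poly_growth (f 0 2). Proof. exact: fgrowth. Qed.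

Let U i j r : R := limn (pseries (f i j) r).

Let factSV m : (m.+1)`!%:R^-1 = m.+1%:R^-1 * m`!%:R^-1 :> R.
Proof. by rewrite factS natrM invfM. Qed.

Let cancelS m (a : R) : m.+1%:R * (m.+1%:R^-1 * a) = a.
Proof. by rewrite mulrA divff ?mul1r// pnatr_eq0. Qed.

Let U10E r : `|r| < 1 -> U 1 0 r = y * U 0 0 r - r * U 0 1 r.
Proof.
move=> r1.
rewrite /U (lim_pseries_shift (a := fun m => y * f 0 0 m + 0 * f 0 0 m) (b := f 0 1)) //.
- by rewrite lim_pseries_lin// mul0r addr0.
- exact: poly_growth_lin.
- by rewrite /f !addn0 add0n !hermite1E !hermite0E; lra.
- move=> m; rewrite /f !addn0 !addn1 hermiteSS factSV mul0r addr0.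
  rewrite mulrBl mulrBl !mulrA; congr (_ - _).
  by rewrite -!mulrA (mulrCA (He m.+1 z)) (mulrCA (He m y)) cancelS.
Qed.

Let U01E r : `|r| < 1 -> U 0 1 r = z * U 0 0 r - r * U 1 0 r.
Proof.
move=> r1.
rewrite /U (lim_pseries_shift (a := fun m => z * f 0 0 m + 0 * f 0 0 m) (b := f 1 0)) //.
- by rewrite lim_pseries_lin// mul0r addr0.
- exact: poly_growth_lin.
- by rewrite /f !addn0 add0n !hermite1E !hermite0E; lra.
- move=> m; rewrite /f !addn0 !addn1 hermiteSS factSV mul0r addr0.
  rewrite mulrBr mulrBl; congr (_ - _); first by rewrite !mulrA (mulrC z).
  by rewrite -!mulrA (mulrCA (He m z)) cancelS.
Qed.

Let U11E r : `|r| < 1 -> U 1 1 r = y * U 0 1 r - r * U 0 2 r.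
Proof.
move=> r1.
rewrite /U (lim_pseries_shift (a := fun m => y * f 0 1 m + 0 * f 0 0 m) (b := f 0 2)) //.
- by rewrite lim_pseries_lin// mul0r addr0.
- exact: poly_growth_lin.
- by rewrite /f !addn0 add0n !hermite1E !hermite0E; lra.
- move=> m; rewrite /f !addn0 !addn1 addn2 (hermiteSS _ y) factSV mul0r addr0.
  rewrite mulrBl mulrBl !mulrA; congr (_ - _).
  by rewrite -!mulrA (mulrCA (He m.+2 z)) (mulrCA (He m y)) cancelS.
Qed.

Let U02E r : `|r| < 1 -> U 0 2 r = z * U 0 1 r - U 0 0 r - r * U 1 1 r.
Proof.
move=> r1.
rewrite /U (lim_pseries_shift (a := fun m => z * f 0 1 m + (-1) * f 0 0 m) (b := f 1 1)) //.
- by rewrite lim_pseries_lin// mulN1r.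
- exact: poly_growth_lin.
- by rewrite /f !addn0 !add0n hermiteSS !hermite1E !hermite0E; lra.
- move=> m; rewrite /f !addn0 !addn1 !addn2 (hermiteSS _ z) factSV.
  have := cancelS m (m`!%:R^-1); set a := m.+1%:R^-1; set b := m`!%:R^-1.
  rewrite -[m.+2%:R]natr1; set c := m.+1%:R; clearbody a b c.
  move: (He m.+1 y) (He m.+2 z) (He m.+1 z) => p q s h.
  rewrite (_ : p * _ * _ = z * (p * q * (a * b)) - p * s * (c * (a * b)) - p * s * (a * b)); last by lra.
  by rewrite h; lra.
Qed.

Let U00d r : `|r| < 1 -> is_derive r 1 (U 0 0) (U 1 1 r).
Proof.
move=> r1.
have -> : U 1 1 r = limn (pseries (pseries_diffs (f 0 0)) r).
  congr (limn (pseries _ r)); apply/funext => m.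
  rewrite /pseries_diffs /f !addn0 !addn1 factSV.
  by rewrite (mulrCA m.+1%:R) cancelS.
pose K := (1 + `|r|) / 2.
have K0 : 0 <= `|r| by [].
apply: (@pseries_snd_diffs _ _ K); rewrite ?[`|K|]ger0_norm; rewrite ?/K; try lra.
- by apply: poly_growth_cvg => //; rewrite ger0_norm; lra.
- by apply: poly_growth_cvg; [exact: poly_growth_diffs|rewrite ger0_norm; lra].
- by apply: poly_growth_cvg; [do 2 apply: poly_growth_diffs|rewrite ger0_norm; lra].
Qed.

Let U00ode r : `|r| < 1 ->
  (1 - r ^+ 2) ^+ 2 * U 1 1 r = ((y - r * z) * (z - r * y) + r * (1 - r ^+ 2)) * U 0 0 r.
Proof.
move=> r1; have := U10E r1; have := U01E r1; have := U11E r1; have := U02E r1.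
move: (U 0 0 r) (U 0 1 r) (U 1 0 r) (U 1 1 r) (U 0 2 r) => a b c d e he hd hb hc.
have h1 : (1 - r ^+ 2) * b = (z - r * y) * a by rewrite {1}hc in hb; lra.
have h2 : (1 - r ^+ 2) * d = (y - r * z) * b + r * a by rewrite he in hd; lra.
rewrite expr2 -mulrA h2 mulrDr mulrCA h1; lra.
Qed.

Let E r := (r ^+ 2 * (y ^+ 2 + z ^+ 2) - 2 * r * y * z) / (2 * (1 - r ^+ 2)).

(** The Mehler kernel is (1 - r^2)^(-1/2) exp(-E r). Its reciprocal is differentiated, so that its
    product with [U 0 0] turns out constant; writing the root as exp(ln(1 - r^2)/2) makes it the
    exponential of a single function. *)
Let Md r : `|r| < 1 -> is_derive r 1 (fun r => expR (ln (1 - r ^+ 2) / 2 + E r))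
  (expR (ln (1 - r ^+ 2) / 2 + E r) *
   (- r / (1 - r ^+ 2) - (y - r * z) * (z - r * y) / (1 - r ^+ 2) ^+ 2)).
Proof.
move=> r1.
have r2 : 0 < 1 - r ^+ 2.
  rewrite subr_gt0 -real_normK ?num_real//.
  by rewrite exprn_ilt1.
pose s : R := y ^+ 2 + z ^+ 2; pose p := y * z.
have d1 : is_derive r 1 (fun r : R => 1 - r ^+ 2) (- (2 * r)).
  by apply: is_derive_eq; rewrite /GRing.scale/=; lra.
have d2 : is_derive r 1 (@ln R \o (fun r : R => 1 - r ^+ 2)) ((1 - r ^+ 2)^-1 * - (2 * r)).
  by apply: is_derive1_comp; exact: is_derive1_ln.
have d3 : is_derive r 1 (fun r : R => (1 - r ^+ 2)^-1) (2 * r * (1 - r ^+ 2) ^- 2).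
  have := @is_deriveV _ (fun r : R => 1 - r ^+ 2) r _ 1 _ d1.
  rewrite /GRing.scale/= mulrNN mulrC; apply; by rewrite gt_eqF.
pose l (r : R) : R := (@ln R \o (fun r : R => 1 - r ^+ 2)) r * 2^-1 +
  (2^-1 * (r * r * s - 2 * r * p)) * (1 - r ^+ 2)^-1.
have d4 : is_derive r 1 l
   (- r / (1 - r ^+ 2) - (y - r * z) * (z - r * y) / (1 - r ^+ 2) ^+ 2).
  rewrite /l; apply: is_derive_eq; rewrite /GRing.scale/=.
  rewrite -!exprVn; have : (1 - r ^+ 2)^-1 * (1 - r ^+ 2) = 1 by rewrite mulVf// gt_eqF.
  rewrite /s /p; move: ((1 - r ^+ 2)^-1) => i hi.
  have : i = i ^+ 2 * (1 - r ^+ 2) by rewrite expr2 -mulrA hi mulr1.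
  move: (i ^+ 2) => k ->; lra.
rewrite (_ : (fun r : R => expR (ln _ / 2 + _)) = @expR R \o l); last first.
  apply/funext => x /=; congr expR; rewrite /l; congr (_ + _).
  rewrite /E invfM /s /p; move: ((1 - _)^-1) => u; lra.
rewrite (_ : ln _ / 2 + E r = l r); first exact: is_derive1_comp.
rewrite /l /=; congr (_ + _).
rewrite /E invfM /s /p; move: ((1 - _)^-1) => u; lra.
Qed.

(* The recurrences of the Hermite polynomials turn the left-hand side, as a
   function of [r], into the solution of a first-order linear equation. *)
Lemma mehler r : 0 <= r < 1 ->
  (fun n => \sum_(0 <= m < n) He m y * He m z / m`!%:R * r ^+ m) @ \oo -->
  (Num.sqrt (1 - r ^+ 2))^-1 * expR (- E r).
Proof.
move=> /andP[r0 r1].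
have r2 : 0 < 1 - r ^+ 2 by rewrite subr_gt0 exprn_ilt1.
have lim : (fun n => \sum_(0 <= m < n) He m y * He m z / m`!%:R * r ^+ m) @ \oo --> U 0 0 r.
  have h : cvgn (pseries (f 0 0) r) by apply: poly_growth_cvg; rewrite ?ger0_norm.
  have -> : (fun n => \sum_(0 <= m < n) He m y * He m z / m`!%:R * r ^+ m) = pseries (f 0 0) r.
    by apply/funext => n; apply: eq_bigr => m _; rewrite /= /f !addn0.
  exact: h.
suff UE : U 0 0 r * expR (ln (1 - r ^+ 2) / 2 + E r) = 1.
  rewrite (_ : _^-1 * _ = U 0 0 r)//.
  have -> : Num.sqrt (1 - r ^+ 2) = expR (ln (1 - r ^+ 2) / 2).
    by rewrite -powR12_sqrt ?(ltW r2)// /powR gt_eqF// mulrC.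
  rewrite -!expRN -expRD -[LHS]mul1r -[X in X * _]UE -mulrA -expRD.
  by rewrite (_ : _ + _ = 0) ?expR0 ?mulr1//; lra.
pose G r := U 0 0 r * expR (ln (1 - r ^+ 2) / 2 + E r).
have dG (x : R) : `|x| < 1 -> is_derive x 1 G 0.
  move=> x1; have h1 := U00d x1; have h2 := Md x1.
  rewrite /G; apply: is_derive_eq; rewrite /GRing.scale/=.
  have x2 : 0 < 1 - x ^+ 2.
    by rewrite subr_gt0 -real_normK ?num_real// exprn_ilt1.
  have := U00ode x1; move: (U 0 0 x) (U 1 1 x) (expR _) => a b c h.
  have : (1 - x ^+ 2)^-1 * (1 - x ^+ 2) = 1 by rewrite mulVf// gt_eqF.
  rewrite -!exprVn; move: (_^-1) => i hi.
  have -> : b = i ^+ 2 * (((y - x * z) * (z - x * y) + x * (1 - x ^+ 2)) * a).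
    by rewrite -h mulrA -exprMn hi expr1n mul1r.
  have : i = i ^+ 2 * (1 - x ^+ 2) by rewrite expr2 -mulrA hi mulr1.
  move: (i ^+ 2) => k ->; lra.
have G0 : G 0 = 1.
  rewrite /G /E expr0n/= subr0 ln1 !(mul0r, mulr0) subr0 mul0r add0r expR0 mulr1.
  apply/cvg_lim => //; apply: cvg_near_cst; exists 1%N => // n /= n0.
  rewrite /pseries /series/= big_ltn// expr0 /f addn0 !hermite0E fact0 big1_seq ?addr0; first by lra.
  by move=> i; rewrite mem_index_iota => /andP[_ /andP[i0 _]]; rewrite expr0n gtn_eqF// mulr0.
have dG' (x : R) : `|x| < 1 -> derivable G x 1 by move=> /dG[].
have [x||] := @MVT_segment R G (fun=> 0) 0 r r0.
- by rewrite in_itv/= => /andP[x0 xr]; apply: dG; rewrite ger0_norm ?(ltW x0)// (lt_trans xr).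
- apply: derivable_within_continuous => x; rewrite in_itv/= => /andP[x0 xr].
  by apply: dG'; rewrite ger0_norm// (le_lt_trans xr).
- by move=> x _; rewrite mul0r G0 => /eqP; rewrite subr_eq0 => /eqP.
Qed.

End fixed.
End mehler.

(** * Square-integrable random variables *)

Section L2.
Context {R : realType} {d : measure_display} {T : measurableType d}
  (P : probability T R).
Implicit Types f g h : T -> R.

Definition L2 f := measurable_fun setT f /\
  (\int[P]_w ((f w) ^+ 2)%:E < +oo)%E.
Definition ip f g : R := \int[P]_w (f w * g w).
Definition sq f : R := \int[P]_w (f w ^+ 2).

Lemma L2_measurable f : L2 f -> measurable_fun setT f. Proof. by case. Qed.

Lemma L2_integrable_sqr f : L2 f -> P.-integrable setT (EFin \o (fun w => f w ^+ 2)).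
Proof.
move=> [mf fo]; apply/integrableP; split.
  by apply/measurable_EFinP; exact: measurable_funX.
rewrite (eq_integral (fun w => (f w ^+ 2)%:E))// => w _ /=.
by rewrite ger0_norm// sqr_ge0.
Qed.

Lemma L2_integrableM f g : L2 f -> L2 g -> P.-integrable setT (EFin \o (fun w => f w * g w)).
Proof.
move=> Lf Lg; have [mf _] := Lf; have [mg _] := Lg.
have := integrableD measurableT (L2_integrable_sqr Lf) (L2_integrable_sqr Lg).
apply: le_integrable => //.
  by apply/measurable_EFinP; exact: measurable_funM.
move=> w _; rewrite /= lee_fin normrM (ger0_norm (addr_ge0 _ _)) ?sqr_ge0//.
rewrite -[f w ^+ 2]real_normK ?num_real// -[g w ^+ 2]real_normK ?num_real//.
have : 0 <= (`|f w| - `|g w|) ^+ 2 by exact: sqr_ge0.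
have : 0 <= `|f w| * `|g w| by rewrite mulr_ge0.
lra.
Qed.

Lemma sqE f : sq f = ip f f.
Proof. by rewrite /sq /ip; under eq_Rintegral do rewrite expr2. Qed.

Lemma sq_EFin f : L2 f -> (\int[P]_w (f w ^+ 2)%:E = (sq f)%:E)%E.
Proof.
by move=> Lf; rewrite /sq /Rintegral fineK//; exact/integrable_fin_num/L2_integrable_sqr.
Qed.

Lemma sq_ge0 f : 0 <= sq f.
Proof. by apply: Rintegral_ge0 => w _; exact: sqr_ge0. Qed.

Lemma L2_cst c : L2 (cst c).
Proof.
split; first exact: measurable_cst.
rewrite (eq_integral (cst (c ^+ 2)%:E))//.
by rewrite integral_cst//= probability_setT mule1 ltry.
Qed.

Lemma L2_le f g c : measurable_fun setT f -> L2 g -> (forall w, `|f w| <= c * `|g w|) -> L2 f.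
Proof.
move=> mf Lg fg; split=> //.
have := integrableZl measurableT (c ^+ 2) (L2_integrable_sqr Lg).
move=> /integrableP[_]; apply: le_lt_trans; apply: ge0_le_integral => //.
- by move=> w _; rewrite lee_fin sqr_ge0.
- by apply/measurable_EFinP; exact: measurable_funX.
- apply: measurableT_comp => //; apply/measurable_EFinP/measurable_funM => //.
  by apply: measurable_funX; have [] := Lg.
- move=> w _; rewrite /= lee_fin (ger0_norm (mulr_ge0 (sqr_ge0 _) (sqr_ge0 _))).
  rewrite -[f w ^+ 2]real_normK ?num_real// -[g w ^+ 2]real_normK ?num_real// -exprMn.
  have h : 0 <= c * `|g w| := le_trans (normr_ge0 _) (fg w).
  by apply: lerXn2r => //; rewrite nnegrE.
Qed.

Lemma L2Z c f : L2 f -> L2 (fun w => c * f w).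
Proof.
move=> Lf; have [mf _] := Lf; apply: (@L2_le _ f `|c|) => //.
  exact: measurable_funM.
by move=> w; rewrite normrM.
Qed.

Lemma L2D f g : L2 f -> L2 g -> L2 (fun w => f w + g w).
Proof.
move=> Lf Lg; have [mf fo] := Lf; have [mg go] := Lg; split.
  exact: measurable_funD.
have h := integrableZl measurableT 2 (integrableD measurableT (L2_integrable_sqr Lf) (L2_integrable_sqr Lg)).
have /integrableP[h1] := h; apply: le_lt_trans; apply: ge0_le_integral => //.
- by move=> w _; rewrite lee_fin sqr_ge0.
- by apply/measurable_EFinP/measurable_funX; exact: measurable_funD.
- by apply: measurableT_comp.
- move=> w _; rewrite /= lee_fin ger0_norm ?mulr_ge0 ?addr_ge0 ?sqr_ge0//.
  have : 0 <= (f w - g w) ^+ 2 by exact: sqr_ge0.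
  lra.
Qed.

Lemma L2B f g : L2 f -> L2 g -> L2 (fun w => f w - g w).
Proof.
move=> Lf /(L2Z (-1)) Lg; rewrite (_ : (fun w => _) = (fun w => f w + -1 * g w)); first exact: L2D.
by apply/funext => w; rewrite mulN1r.
Qed.

Lemma L2_sum (I : Type) (r : seq I) (p : pred I) (F : I -> T -> R) :
  (forall i, p i -> L2 (F i)) -> L2 (fun w => \sum_(i <- r | p i) F i w).
Proof.
move=> LF; elim: r => [|i r IH].
  by under eq_fun do rewrite big_nil; exact: L2_cst.
under eq_fun do rewrite big_cons; case: (boolP (p i)) => // pi.
by apply: L2D => //; exact: LF.
Qed.

Lemma ipC f g : ip f g = ip g f.
Proof. by rewrite /ip; under eq_Rintegral do rewrite mulrC. Qed.

Lemma ipDl f g h : L2 f -> L2 g -> L2 h -> ip (fun w => f w + g w) h = ip f h + ip g h.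
Proof.
move=> Lf Lg Lh; rewrite /ip; under eq_Rintegral do rewrite mulrDl.
by rewrite RintegralD//; exact: L2_integrableM.
Qed.

Lemma ipZl c f h : L2 f -> L2 h -> ip (fun w => c * f w) h = c * ip f h.
Proof.
move=> Lf Lh; rewrite /ip; under eq_Rintegral do rewrite -mulrA.
by rewrite RintegralZl//; exact: L2_integrableM.
Qed.

Lemma ipZr c f h : L2 f -> L2 h -> ip f (fun w => c * h w) = c * ip f h.
Proof. by move=> Lf Lh; rewrite ipC ipZl// ipC. Qed.

Lemma ipDr f g h : L2 f -> L2 g -> L2 h -> ip h (fun w => f w + g w) = ip h f + ip h g.
Proof. by move=> Lf Lg Lh; rewrite ipC ipDl// !(ipC h). Qed.

Lemma ipBl f g h : L2 f -> L2 g -> L2 h -> ip (fun w => f w - g w) h = ip f h - ip g h.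
Proof.
move=> Lf Lg Lh; rewrite -[- ip g h]mulN1r -ipZl// -ipDl//; last exact: L2Z.
by congr ip; apply/funext => w; rewrite mulN1r.
Qed.

Lemma ip_suml (I : Type) (r : seq I) (p : pred I) (F : I -> T -> R) h :
  (forall i, p i -> L2 (F i)) -> L2 h ->
  ip (fun w => \sum_(i <- r | p i) F i w) h = \sum_(i <- r | p i) ip (F i) h.
Proof.
move=> LF Lh; elim: r => [|i r IH].
  under [in LHS]eq_fun do rewrite big_nil.
  rewrite big_nil /ip; under eq_Rintegral do rewrite mul0r.
  by rewrite Rintegral_cst// mul0r.
under [in LHS]eq_fun do rewrite big_cons; rewrite big_cons; case: (boolP (p i)) => // pi.
rewrite ipDl// ?IH//; [exact: LF|exact: L2_sum].
Qed.

Lemma ip_sumr (I : Type) (r : seq I) (p : pred I) (F : I -> T -> R) h :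
  (forall i, p i -> L2 (F i)) -> L2 h ->
  ip h (fun w => \sum_(i <- r | p i) F i w) = \sum_(i <- r | p i) ip h (F i).
Proof. by move=> LF Lh; rewrite ipC ip_suml//; apply: eq_bigr => i _; rewrite ipC. Qed.

Lemma sqD f g : L2 f -> L2 g ->
  sq (fun w => f w + g w) = sq f + 2 * ip f g + sq g.
Proof.
move=> Lf Lg; rewrite !sqE ipDl ?ipDr//; try exact: L2D.
rewrite (ipC g f); lra.
Qed.

Lemma sqZ c f : L2 f -> sq (fun w => c * f w) = c ^+ 2 * sq f.
Proof. by move=> Lf; rewrite !sqE ipZl ?ipZr//; [rewrite mulrA|exact: L2Z]. Qed.

Lemma sqB f g : L2 f -> L2 g ->
  sq (fun w => f w - g w) = sq f - 2 * ip f g + sq g.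
Proof.
move=> Lf Lg; rewrite (_ : (fun w => _) = (fun w => f w + -1 * g w)).
  by rewrite sqD ?sqZ ?ipZr//; [lra|exact: L2Z].
by apply/funext => w; rewrite mulN1r.
Qed.

Lemma sqBC f g : sq (fun w => f w - g w) = sq (fun w => g w - f w).
Proof. by congr Rintegral; apply/funext => w; rewrite -sqrrN opprB. Qed.

Lemma sqD_le f g : L2 f -> L2 g -> sq (fun w => f w + g w) <= 2 * sq f + 2 * sq g.
Proof.
move=> Lf Lg; have := sq_ge0 (fun w => f w - g w); rewrite sqB// sqD//; lra.
Qed.

Lemma sq_triangle f g h : L2 f -> L2 g -> L2 h ->
  sq (fun w => f w - h w) <= 2 * sq (fun w => f w - g w) + 2 * sq (fun w => g w - h w).
Proof.
move=> Lf Lg Lh; have := sqD_le (L2B Lf Lg) (L2B Lg Lh).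
by under [in X in X <= _]eq_fun do rewrite addrA subrK.
Qed.

Lemma cauchy_schwarz f g : L2 f -> L2 g -> ip f g ^+ 2 <= sq f * sq g.
Proof.
move=> Lf Lg.
have h t : 0 <= t ^+ 2 * sq f + 2 * t * ip f g + sq g.
  have := sq_ge0 (fun w => t * f w + g w).
  by rewrite sqD ?sqZ ?ipZl ?mulrA//; exact: L2Z.
have := sq_ge0 f; rewrite le_eqVlt => /predU1P[f0|f0]; last first.
  have := h (- (ip f g / sq f)).
  have : sq f / sq f = 1 by rewrite divff// gt_eqF.
  move: f0; move: (sq f) (sq f)^-1 (ip f g) (sq g) => A A' B D A0 AA.
  move=> /(mulr_ge0 (ltW A0)).
  rewrite (_ : A * (_ + _ + D) = (A * A') ^+ 2 * B ^+ 2 - 2 * (A * A') * B ^+ 2 + A * D); last by lra.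
  rewrite AA; lra.
rewrite -f0 mul0r; have [->|B0] := eqVneq (ip f g) 0; first by rewrite expr0n.
(* For [sq f = 0] the quadratic is affine in t, and this t gives it the value -1. *)
have := h (- ((sq g + 1) / (2 * ip f g))).
rewrite -f0 mulr0 add0r invfM.
have : (ip f g)^-1 * ip f g = 1 by rewrite mulVf.
move: (ip f g) (ip f g)^-1 (sq g) => B B' D BB.
rewrite (_ : _ + D = D - (D + 1) * (B' * B)); last by lra.
rewrite BB; lra.
Qed.

Lemma L2_fatou (f_ : nat -> T -> R) f c :
  (forall n, measurable_fun setT (f_ n)) -> measurable_fun setT f ->
  (forall w, f_ n w @[n --> \oo] --> f w) ->
  (forall n, (\int[P]_w (f_ n w ^+ 2)%:E <= c%:E)%E) -> L2 f /\ sq f <= c.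
Proof.
move=> mf_ mf fcv fle.
have key : (\int[P]_w (f w ^+ 2)%:E <= c%:E)%E.
  have -> : (\int[P]_w (f w ^+ 2)%:E = \int[P]_w limn_einf (fun n => (f_ n w ^+ 2)%:E))%E.
    apply: eq_integral => w _; apply/esym.
    have h : (f_ n w ^+ 2)%:E @[n --> \oo] --> (f w ^+ 2)%:E.
      apply/fine_cvgP; split; first exact: nearW.
      by rewrite !expr2; under eq_fun do rewrite /= expr2; apply: cvgM.
    by rewrite is_cvg_limn_einfE; [exact/cvg_lim|apply/cvg_ex; eexists; exact: h].
  apply: le_trans (fatou _ _ _ _) _ => //.
  - by move=> n; apply/measurable_EFinP/measurable_funX.
  - by move=> n w _; rewrite lee_fin sqr_ge0.
  - rewrite limn_einf_lim; apply: lime_le; first exact: is_cvg_einfs.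
    apply: nearW => n; apply: le_trans (fle n).
    by apply: ereal_inf_lbound; exists n => /=.
have Lf : L2 f by split => //; exact: le_lt_trans key (ltry _).
by split => //; rewrite -lee_fin -sq_EFin.
Qed.

Lemma Lnorm2_integral f :
  ('N[P]_2%:E[EFin \o f] = (\int[P]_w (f w ^+ 2)%:E) `^ 2^-1)%E.
Proof.
rewrite unlock; congr (_ `^ _)%E.
apply: eq_integral => w _; rewrite poweR_EFin powR_mulrn//.
by rewrite real_normK ?num_real.
Qed.

Lemma L2_Lfun f : L2 f <-> f \in Lfun P 2%:E.
Proof.
split=> [[mf fo]|].
  rewrite inE; apply/andP; split; rewrite inE//=.
  by rewrite /finite_norm Lnorm2_integral poweR_lty.
move=> Lf; have mf : measurable_fun setT f by move: Lf; rewrite inE => /andP[]; rewrite inE.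
split => //; have /integrableP[_] := Lfun2_integrable_sqr Lf.
by under eq_integral do rewrite /= ger0_norm ?sqr_ge0//.
Qed.

Lemma Lnorm2E f : L2 f -> ('N[P]_2%:E[EFin \o f] = (Num.sqrt (sq f))%:E)%E.
Proof.
by move=> Lf; rewrite Lnorm2_integral sq_EFin// poweR_EFin powR12_sqrt// sq_ge0.
Qed.

Lemma Lnorm2_sqr f : L2 f -> ('N[P]_2%:E[EFin \o f] ^+ 2 = (sq f)%:E)%E.
Proof. by move=> Lf; rewrite Lnorm2E// -EFin_expe sqr_sqrtr// sq_ge0. Qed.

End L2.

(** * Hermite moments of Gaussian pairs *)

Section density.
Local Open Scope ereal_scope.
Context {R : realType} {d : measure_display} {T : measurableType d}.
Import HBNNSimple.

Lemma ge0_integral_density (mu nu : {measure set T -> \bar R}) (g : T -> R) (f : T -> \bar R) :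
  measurable_fun setT g -> (forall x, 0 <= g x)%R ->
  (forall A, measurable A -> nu A = \int[mu]_(x in A) (g x)%:E) ->
  measurable_fun setT f -> (forall x, 0 <= f x) ->
  \int[nu]_x f x = \int[mu]_x (f x * (g x)%:E).
Proof.
move=> mg g0 nuE mf f0.
pose f_ := nnsfun_approx measurableT mf.
have step n : \int[nu]_x (f_ n x)%:E = \int[mu]_x ((f_ n x)%:E * (g x)%:E).
  under eq_integral do rewrite fimfunE -fsumEFin//.
  rewrite ge0_integral_fsum//; last 2 first.
  - by move=> y; exact/measurable_EFinP/measurable_funM.
  - by move=> y x _; rewrite nnfun_muleindic_ge0.
  under [in RHS]eq_integral => x _.
    rewrite fimfunE -fsumEFin// ge0_mule_fsuml; last by move=> r; rewrite nnfun_muleindic_ge0.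
    over.
  rewrite [RHS]ge0_integral_fsum//; last 2 first.
  - move=> y; apply: emeasurable_funM; last exact/measurable_EFinP.
    exact/measurable_EFinP/measurable_funM.
  - by move=> y x _; rewrite mule_ge0 ?nnfun_muleindic_ge0 ?lee_fin.
  apply: eq_fsbigr => r /[!inE] -[x _ <-].
  have mB : measurable (f_ n @^-1` [set f_ n x]) by [].
  under eq_integral do rewrite EFinM.
  rewrite ge0_integralZl//; [|by apply/measurable_EFinP|by rewrite lee_fin].
  rewrite integral_indic// setIT nuE//.
  under [in RHS]eq_integral do rewrite EFinM -muleA.
  rewrite [RHS]ge0_integralZl//; last 3 first.
  - by apply: emeasurable_funM; exact/measurable_EFinP.
  - by move=> y _; rewrite mule_ge0// lee_fin.
  - by rewrite lee_fin.
  congr (_ * _); rewrite integral_mkcond; apply: eq_integral => y _.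
  rewrite patchE indicE; case: ifPn => /=; by [rewrite mul1e|rewrite mul0e].
have cv x : (f_ n x)%:E @[n --> \oo] --> f x.
  by apply: cvg_nnsfun_approx => // y _.
transitivity (limn (fun n => \int[nu]_x (f_ n x)%:E)).
  rewrite -monotone_convergence//.
  - by apply: eq_integral => x _; apply/esym/cvg_lim.
  - by move=> n; exact/measurable_EFinP.
  - by move=> n x _; rewrite lee_fin.
  - by move=> x _ a b ab; rewrite lee_fin; exact/lefP/nd_nnsfun_approx.
under eq_fun do rewrite step.
rewrite -monotone_convergence//.
- apply: eq_integral => x _; apply/cvg_lim => //.
  by apply: cvgeMr => //; exact: cv.
- by move=> n; apply: emeasurable_funM; exact/measurable_EFinP.
- by move=> n x _; rewrite mule_ge0// lee_fin.
- by move=> x _ a b ab; rewrite lee_wpmul2r ?lee_fin//; exact/lefP/nd_nnsfun_approx.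
Qed.

End density.

Section gaussian_mgf.
Context {R : realType} {d : measure_display} {T : measurableType d}
  (P : probability T R).
Local Open Scope ereal_scope.

(** Exponential tilting: exp(ax) times the density of N(m, s^2) is a constant times the density of
    N(m + a s^2, s^2), which has mass 1. *)
Lemma integral_expR_normal (m s a : R) : s != 0%R ->
  \int[lebesgue_measure]_x ((expR (a * x))%:E * (normal_pdf m s x)%:E) =
  (expR (a * m + (a * s) ^+ 2 / 2))%:E.
Proof.
move=> s0.
rewrite -[RHS]mule1 -(integral_normal_pdf (m + a * s ^+ 2) s).
rewrite -(@ge0_integralZl _ _ _ lebesgue_measure setT measurableT
  (fun x => (normal_pdf (m + a * s ^+ 2) s x)%:E)); last 3 first.
- by apply/measurable_EFinP; exact: measurable_normal_pdf.
- by move=> x _; rewrite lee_fin normal_pdf_ge0.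
- by rewrite lee_fin expR_ge0.
apply: eq_integral => x _; rewrite -!EFinM !normal_pdfE//; congr EFin.
rewrite mulrCA [RHS]mulrCA; congr (_ * _)%R.
rewrite /normal_fun -!expRD; congr expR.
have s2 : (s ^+ 2 != 0)%R by rewrite expf_neq0.
rewrite -mulr_natl (invfM 2%R) !exprMn.
have : (s ^+ 2 / s ^+ 2 = 1)%R by rewrite divff.
move: (s ^+ 2)%R ((s ^+ 2)^-1)%R => S S' SS.
rewrite (_ : - (x - (m + a * S)) ^+ 2 * (2^-1 * S') =
  - (x - m) ^+ 2 * (2^-1 * S') + (x - m) * a * (S * S') - a ^+ 2 / 2 * S * (S * S'))%R; last by lra.
rewrite SS; lra.
Qed.

(** The formula with s = 0 also covers Dirac laws, so later arguments do not distinguish the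
    degenerate case. *)
Lemma gaussian_mgf (X : T -> R) : gaussian_rv P X ->
  exists m s : R, forall a, \int[P]_w (expR (a * X w))%:E =
  (expR (a * m + (a * s) ^+ 2 / 2))%:E.
Proof.
move=> [mX [m [s law]]]; exists m, s => a.
pose Y : T -> measurableTypeR R := X.
have mY : measurable_fun setT Y := mX.
pose f : measurableTypeR R -> \bar R := fun x => (expR (a * x))%:E.
have mf : measurable_fun setT f.
  apply/measurable_EFinP; exact: measurableT_comp.
have f0 y : 0 <= f y by rewrite lee_fin expR_ge0.
transitivity (\int[pushforward P Y]_y f y); first by rewrite ge0_integral_pushforward.
have [s0|s0] := eqVneq s 0%R.
  transitivity (\int[\d_(m : measurableTypeR R)]_y f y).
    apply: eq_measure_integral => A mA _.
    by have := law A mA; rewrite s0 eqxx; exact.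
  by rewrite integral_dirac// diracT mul1e s0 mulr0 expr0n/= mul0r addr0.
transitivity (\int[normal_prob m s]_y f y).
  apply: eq_measure_integral => A mA _.
  by have := law A mA; rewrite (negbTE s0); exact.
rewrite (@ge0_integral_density _ _ _ lebesgue_measure _ (normal_pdf m s))//.
- exact: integral_expR_normal.
- exact: measurable_normal_pdf.
- by move=> x; rewrite normal_pdf_ge0.
Qed.

End gaussian_mgf.

(** * Uniqueness of the coefficients of a power series *)

Section power_series.
Context {R : realType}.

Lemma pseries_eq0 (c : nat -> R) :
  (forall x, pseries c x @ \oo --> (0 : R)) -> forall n, c n = 0.
Proof.
move=> h n; elim: n c h => [|n IH] c h.
  suff cc : pseries c 0 @ \oo --> c 0%N by exact: (cvg_unique _ cc (h 0)).
  rewrite -cvg_shiftS.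
  rewrite (_ : (fun _ => _) = fun=> c 0%N); first exact: cvg_cst.
  apply/funext => k; rewrite /pseries /series/= big_nat_recl// expr0 mulr1.
  by rewrite big1 ?addr0// => i _; rewrite expr0n mulr0.
(* A series that converges everywhere stays so after termwise differentiation: (k+1)|K|^k <=
   (2a)^(k+1) with a = |K| + 1. *)
have cv (f : nat -> R) K : (forall x, cvgn (pseries f x)) -> cvgn (pseries (pseries_diffs f) K).
  move=> cf.
  pose a : R := `|K| + 1.
  have a1 : 1 <= a by rewrite lerDr.
  have K0 : 0 <= `|K| by [].
  have h1 : cvgn (pseries (fun i => `|f i|) (2 * a)).
    apply: (is_cvg_pseries_inside_norm (cf (2 * a + 1))).
    by rewrite !ger0_norm; lra.
  apply: normed_cvg.
  apply: (@series_le_cvg _ _ (fun i => `|f i.+1| * (2 * a) ^+ i.+1)).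
  - by move=> k /=.
  - by move=> k; rewrite mulr_ge0// exprn_ge0//; lra.
  - move=> k; rewrite /= /pseries_diffs !normrM normrX (ger0_norm (ler0n _ k.+1)).
    rewrite mulrAC mulrC ler_wpM2l// exprMn ler_pM ?exprn_ge0//.
      rewrite -natrX ler_nat; exact/ltnW/ltn_expl.
    apply: (@le_trans _ _ (a ^+ k)); first by rewrite lerXn2r ?nnegrE//; rewrite /a; lra.
    by rewrite ler_weXn2l.
  - have : cvgn (fun n => pseries (fun i => `|f i|) (2 * a) n.+1).
      move: h1 => /cvg_ex[l hl]; apply/cvg_ex; exists l.
      by rewrite (cvg_shiftS (pseries (fun i => `|f i|) (2 * a))).
    rewrite /pseries /series /=; under eq_fun do rewrite big_nat_recl//.
    move=> /cvg_ex[l hl]; apply/cvg_ex; exists (l - `|f 0%N| * (2 * a) ^+ 0).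
    rewrite [X in X @ _ --> _](_ : _ = fun n => (`|f 0%N| * (2 * a) ^+ 0 +
      \sum_(0 <= i < n) `|f i.+1| * (2 * a) ^+ i.+1) - `|f 0%N| * (2 * a) ^+ 0); last first.
      by apply/funext => k /=; rewrite addrC addKr.
    by apply: cvgB => //; exact: cvg_cst.
have c1 x : cvgn (pseries c x) by apply/cvg_ex; exists 0; exact: h.
have c2 x := cv _ x c1.
have c3 x := cv _ x c2.
have d0 x : limn (pseries (pseries_diffs c) x) = 0.
  have := @pseries_snd_diffs R c (`|x| + 1) x (c1 _) (c2 _) (c3 _).
  rewrite (_ : (fun x0 => _) = cst 0); last first.
    by apply/funext => y; apply/cvg_lim => //; exact: h.
  have K0 : 0 <= `|x| by [].
  rewrite [`|_ + 1|]ger0_norm; last by lra.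
  have x1 : `|x| < `|x| + 1 by rewrite ltrDl.
  by move=> /(_ x1) => -[_ <-]; rewrite derive_cst.
have := IH (pseries_diffs c); rewrite /pseries_diffs => H.
have : n.+1%:R * c n.+1 = 0.
  by apply: H => x; rewrite -(d0 x); exact: c2.
by move/eqP; rewrite mulf_eq0 pnatr_eq0 => /eqP.
Qed.

End power_series.

(** * Moments of a Gaussian variable *)

Section gaussian_moments.
Context {R : realType} {d : measure_display} {T : measurableType d}
  (P : probability T R).

(** Moments of the standard Gaussian law: (k-1)!! for even k, 0 for odd k. *)
Fixpoint gmoment (k : nat) : R :=
  match k with
  | 0 => 1
  | 1 => 0
  | k'.+2 => k'.+1%:R * gmoment k'
  end.

(* [|x|^n <= n! (e^x + e^-x)] *)
Lemma gaussian_integrable_pow (X : T -> R) n : gaussian_rv P X ->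
  P.-integrable setT (EFin \o (fun w => X w ^+ n)).
Proof.
move=> gX; have [mX _] := gX; have [m [s mgf]] := gaussian_mgf gX.
have iexp a : P.-integrable setT (EFin \o (fun w => expR (a * X w))).
  apply/integrableP; split.
    apply/measurable_EFinP/measurableT_comp => //.
    by apply: measurable_funM => //.
  rewrite (eq_integral (fun w => (expR (a * X w))%:E)); first by rewrite mgf ltry.
  by move=> w _; rewrite /= ger0_norm// expR_ge0.
have := integrableZl measurableT n`!%:R (integrableD measurableT (iexp 1) (iexp (-1))).
apply: le_integrable => //.
  by apply/measurable_EFinP/measurable_funX.
move=> w _ /=; rewrite lee_fin normrX [leRHS]ger0_norm; last first.
  by rewrite (mulr_ge0 (ler0n _ _))// (addr_ge0 (expR_ge0 _) (expR_ge0 _)).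
rewrite mul1r mulN1r.
have h : `|X w| ^+ n <= n`!%:R * expR `|X w|.
  rewrite mulrC -ler_pdivrMr ?ltr0n ?fact_gt0//.
  case: n => [|n]; first by rewrite expr0 fact0 divr1 -expR0 ler_expR.
  by apply: le_trans (expR_ge1Dxn n (normr_ge0 (X w))); rewrite lerDr.
apply: (le_trans h); rewrite ler_wpM2l//.
have [x0|x0] := ger0P (X w); first by rewrite lerDl expR_ge0.
by rewrite lerDr expR_ge0.
Qed.

Lemma gaussian_L2 (X : T -> R) n : gaussian_rv P X -> L2 P (fun w => X w ^+ n).
Proof.
move=> gX; have [mX _] := gX; split; first exact: measurable_funX.
have /integrableP[_] := gaussian_integrable_pow (n * 2) gX.
by under eq_integral do rewrite /= ger0_norm ?exprM ?sqr_ge0//.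
Qed.

Lemma cvg_expR (x : R) : (fun n => \sum_(0 <= k < n) x ^+ k / k`!%:R) @ \oo --> expR x.
Proof.
have := @is_cvg_series_exp_coeff R x; rewrite /series /exp_coeff /=.
rewrite expRE /pseries /series /=.
rewrite (_ : (fun n => \sum_(0 <= k < n) k`!%:R^-1 * x ^+ k) =
  (fun n => \sum_(0 <= k < n) x ^+ k / k`!%:R))//.
by apply/funext => n; apply: eq_bigr => k _; rewrite mulrC.
Qed.

Lemma sum_expR_le (x : R) n : `|\sum_(0 <= k < n) x ^+ k / k`!%:R| <= expR x + expR (- x).
Proof.
apply: (@le_trans _ _ (\sum_(0 <= k < n) `|x| ^+ k / k`!%:R)).
  apply: (le_trans (ler_norm_sum _ _ _)); apply: ler_sum => k _.
  by rewrite normrM normrX (@ger0_norm _ (_^-1)) ?invr_ge0.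
apply: (@le_trans _ _ (expR `|x|)).
  have := @cvg_expR `|x|; set u := (fun n => _) => uc.
  have -> : expR `|x| = limn u by apply/esym/cvg_lim.
  apply: nondecreasing_cvgn_le; last by apply/cvg_ex; eexists; exact: uc.
  apply/nondecreasing_seqP => k; rewrite /u big_nat_recr//= lerDl.
  by rewrite divr_ge0// exprn_ge0.
have [x0|x0] := ger0P x; first by rewrite lerDl expR_ge0.
by rewrite lerDr expR_ge0.
Qed.

Lemma gmoment_doubleE j : gmoment j.*2 * (2 ^+ j * j`!%:R) = j.*2`!%:R.
Proof.
elim: j => [|j IH]; first by rewrite /= !mul1r.
rewrite doubleS /= (factS j.*2.+1) (factS j.*2) natrM natrM -IH exprS factS natrM.
have -> : j.*2.+2%:R = 2 * j.+1%:R :> R by rewrite -natrM; congr (_%:R); lia.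
lra.
Qed.

Lemma gmoment_odd k : odd k -> gmoment k = 0.
Proof.
suff : (odd k -> gmoment k = 0) /\ (odd k.+1 -> gmoment k.+1 = 0) by case.
elim: k => [|k [h1 h2]]; first by split.
by split=> //= /negPn h; rewrite h1 ?mulr0// -[odd k]negbK.
Qed.

Lemma cvg_expR_sqr (v a : R) :
  pseries (fun k => gmoment k * v ^+ k./2 / k`!%:R) a @ \oo --> expR (a ^+ 2 * v / 2).
Proof.
(* The odd terms vanish, and the first n terms contain [uphalf n] even ones. *)
have h n : pseries (fun k => gmoment k * v ^+ k./2 / k`!%:R) a n =
    \sum_(0 <= j < uphalf n) (a ^+ 2 * v / 2) ^+ j / j`!%:R.
  rewrite /pseries /series /=; elim: n => [|n IH]; first by rewrite !big_nil.
  rewrite big_nat_recr//= {}IH uphalf_half.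
  case: (boolP (odd n)) => on.
    by rewrite gmoment_odd// !mul0r addr0.
  rewrite add0n big_nat_recr//=; congr (_ + _).
  have en : n = n./2.*2 by rewrite -[LHS]odd_double_half (negbTE on).
  set j := n./2 in en *; rewrite en -gmoment_doubleE.
  have f0 : j`!%:R != 0 :> R by rewrite pnatr_eq0 -lt0n fact_gt0.
  have g0 : gmoment j.*2 != 0.
    by apply: contra_neq f0 => h; have := gmoment_doubleE j; rewrite h mul0r => /esym/eqP; rewrite pnatr_eq0 -?lt0n => /eqP; have := fact_gt0 j.*2; lia.
  rewrite !exprMn -mul2n exprM exprVn (invfM (gmoment _)) (invfM (2 ^+ j)).
  have : gmoment (2 * j) / gmoment (2 * j) = 1 by rewrite divff// mul2n.
  rewrite -(exprMn _ a a) -expr2; move: (gmoment _) (gmoment _)^-1 (v ^+ j) ((a ^+ 2) ^+ j) (2 ^+ j)^-1 j`!%:R^-1.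
  move=> g g' p q r t gg; rewrite (_ : g * p * _ * _ = g * g' * (p * q * r * t)); last by lra.
  by rewrite gg; lra.
rewrite (_ : pseries _ a = (fun n => \sum_(0 <= j < n) (a ^+ 2 * v / 2) ^+ j / j`!%:R) \o uphalf); last first.
  by apply/funext => n; exact: h.
suff h2 : uphalf n @[n --> \oo] --> \oo by exact: (cvg_comp _ _ h2 (@cvg_expR _)).
move=> A [N _ NA]; exists N.*2 => // n /= Nn; apply: NA => /=; lia.
Qed.

(* Both sides of [E exp(aX) = exp(a m + (a s)^2 / 2)] are expanded in powers of [a]. *)
Lemma gaussian_moment (X : T -> R) v : gaussian_rv P X ->
  \int[P]_w X w = 0 -> \int[P]_w (X w ^+ 2) = v ->
  forall k, \int[P]_w (X w ^+ k) = gmoment k * v ^+ k./2.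
Proof.
move=> gX X1 X2; have [mX _] := gX; have [m [s mgf]] := gaussian_mgf gX.
have iexp a : P.-integrable setT (EFin \o (fun w => expR (a * (X w - m)))).
  apply/integrableP; split.
    apply/measurable_EFinP/measurableT_comp => //; apply: measurable_funM => //.
    by apply: measurable_funB.
  rewrite (eq_integral (fun w => (expR (- (a * m)))%:E * (expR (a * X w))%:E)%E); last first.
    move=> w _; rewrite /= ger0_norm ?expR_ge0// -EFinM -expRD; congr (expR _)%:E; lra.
  rewrite ge0_integralZl// ?mgf ?ltry//.
  by apply/measurable_EFinP/measurableT_comp => //; exact: measurable_funM.
have mgfc a : \int[P]_w expR (a * (X w - m)) = expR (a ^+ 2 * s ^+ 2 / 2).
  rewrite /Rintegral.
  rewrite (eq_integral (fun w => (expR (- (a * m)))%:E * (expR (a * X w))%:E)%E); last first.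
    move=> w _; rewrite -EFinM -expRD; congr (expR _)%:E; lra.
  rewrite ge0_integralZl//.
    by rewrite mgf /= -expRD; congr expR; lra.
  by apply/measurable_EFinP/measurableT_comp => //; exact: measurable_funM.
have mXm k : measurable_fun setT (fun w => (X w - m) ^+ k).
  by apply: measurable_funX; exact: measurable_funB.
have ipow k : P.-integrable setT (EFin \o (fun w => (X w - m) ^+ k)).
  have := integrableZl measurableT k`!%:R (integrableD measurableT (iexp 1) (iexp (-1))).
  apply: le_integrable => //; first exact/measurable_EFinP.
  move=> w _ /=; rewrite lee_fin normrX mul1r mulN1r [leRHS]ger0_norm; last first.
    by rewrite (mulr_ge0 (ler0n _ _))// (addr_ge0 (expR_ge0 _) (expR_ge0 _)).
  rewrite mulrC -ler_pdivrMr ?ltr0n ?fact_gt0//.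
  have := sum_expR_le `|X w - m| k.+1; rewrite big_nat_recr//= => h.
  have h0 : 0 <= \sum_(0 <= i < k) `|X w - m| ^+ i / i`!%:R.
    by apply: sumr_ge0 => i _; rewrite divr_ge0// exprn_ge0.
  have h1 : 0 <= `|X w - m| ^+ k / k`!%:R by rewrite divr_ge0// exprn_ge0.
  rewrite ger0_norm ?addr_ge0// in h; apply: le_trans (le_trans _ h) _.
    by rewrite lerDr.
  have [x0|x0] := ger0P (X w - m); first by [].
  by rewrite opprK [leRHS]addrC.
have mom a : pseries (fun k => (\int[P]_w ((X w - m) ^+ k)) / k`!%:R) a @ \oo -->
    expR (a ^+ 2 * s ^+ 2 / 2).
  pose f_ n w : \bar R := (\sum_(0 <= k < n) (a * (X w - m)) ^+ k / k`!%:R)%:E.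
  have mf n : measurable_fun setT (f_ n).
    apply/measurable_EFinP; apply: measurable_sum => k.
    apply: measurable_funM => //; apply: measurable_funX; apply: measurable_funM => //.
    exact: measurable_funB.
  have := @dominated_convergence _ _ _ P setT measurableT f_
    (fun w => (expR (a * (X w - m)))%:E)
    (fun w => (expR (a * (X w - m)))%:E + (expR (- a * (X w - m)))%:E)%E mf.
  case.
  - exact: (measurable_int P (iexp a)).
  - by apply: aeW => w _; apply: cvg_EFin; [exact: nearW|exact: cvg_expR].
  - exact: (integrableD measurableT (iexp a) (iexp (- a))).
  - by apply: aeW => w n _; rewrite /f_ /= lee_fin mulNr; exact: sum_expR_le.
  move=> _ _; have <- : ((expR (a ^+ 2 * s ^+ 2 / 2))%:E = \int[P]_w (expR (a * (X w - m)))%:E)%E.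
    by rewrite -mgfc /Rintegral fineK//; exact: (integrable_fin_num measurableT (iexp a)).
  move=> /fine_cvgP[_].
  apply: cvg_trans; apply: near_eq_cvg; apply: nearW => n /=.
  rewrite /pseries /series /= /f_.
  have -> : (\int[P]_w (\sum_(0 <= k < n) (a * (X w - m)) ^+ k / k`!%:R)%:E =
      \sum_(0 <= k < n) \int[P]_w ((a ^+ k / k`!%:R) * (X w - m) ^+ k)%:E)%E.
    rewrite -integral_sum//; last first.
      by move=> k; exact: (integrableZl measurableT (a ^+ k / k`!%:R) (ipow k)).
    apply: eq_integral => w _; rewrite -sumEFin; apply: eq_bigr => k _.
    by congr EFin; rewrite exprMn; lra.
  rewrite (eq_bigr (fun k => (a ^+ k / k`!%:R * \int[P]_w ((X w - m) ^+ k))%:E)).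
    by rewrite sumEFin; apply: eq_bigr => k _; lra.
  move=> k _; under eq_integral do rewrite EFinM.
  rewrite (integralZl measurableT (ipow k)) [RHS]EFinM; congr (_ * _)%E.
  by rewrite /Rintegral fineK//; exact: (integrable_fin_num measurableT (ipow k)).
have momE := @pseries_eq0 _ (fun k => (\int[P]_w ((X w - m) ^+ k)) / k`!%:R - gmoment k * (s ^+ 2) ^+ k./2 / k`!%:R).
have {}momE k : \int[P]_w ((X w - m) ^+ k) = gmoment k * (s ^+ 2) ^+ k./2.
  have f0 : k`!%:R != 0 :> R by rewrite pnatr_eq0 -lt0n fact_gt0.
  apply: (mulIf (invr_neq0 f0)); apply/eqP; rewrite -subr_eq0; apply/eqP.
  move: k {f0}; apply: momE => a; rewrite -(subrr (expR (a ^+ 2 * s ^+ 2 / 2))).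
  rewrite (_ : pseries _ a = pseries (fun k => (\int[P]_w ((X w - m) ^+ k)) / k`!%:R) a
     \- pseries (fun k => gmoment k * (s ^+ 2) ^+ k./2 / k`!%:R) a); last first.
    apply/funext => n; rewrite /pseries /series /= -sumrB.
    by apply: eq_bigr => i _; rewrite mulrBl.
  by apply: cvgB; [exact: mom|exact: cvg_expR_sqr].
(* [m] and [s] come from the existential in [gaussian_rv]; the first two moments identify them. *)
have m0 : m = 0.
  have := momE 1%N; rewrite mul0r; under eq_Rintegral do rewrite expr1.
  rewrite RintegralB//; last 2 first.
  - by have := gaussian_integrable_pow 1 gX.
  - exact: finite_measure_integrable_cst.
  rewrite X1 Rintegral_cst// sub0r.
  by rewrite /= probability_setT /= mulr1 => /eqP; rewrite oppr_eq0 => /eqP.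
have sv : v = s ^+ 2.
  have := momE 2%N; rewrite m0; under eq_Rintegral do rewrite subr0.
  by rewrite X2 /= !mul1r.
move=> k; have := momE k; rewrite m0 sv.
by under eq_Rintegral do rewrite subr0.
Qed.

End gaussian_moments.

Section poly_aux.
Context {R : realType}.

Lemma poly_eq_fun (p q : {poly R}) : (forall x, p.[x] = q.[x]) -> p = q.
Proof.
move=> pq; apply/eqP; rewrite -subr_eq0; apply/negPn/negP => h.
pose s := [seq (i%:R : R) | i <- iota 0 (size (p - q))].
have /(_ s) := max_poly_roots h.
have -> : all (root (p - q)) s.
  by apply/allP => x _; rewrite rootE !hornerE pq subrr.
have -> : uniq s.
  rewrite map_inj_uniq ?iota_uniq// => i j /eqP.
  by rewrite eqr_nat => /eqP.
by move=> /(_ isT isT); rewrite size_map size_iota ltnn.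
Qed.

Lemma poly_lin_ind (A : {poly R} -> Prop) :
  (forall p q, A p -> A q -> A (p + q)) -> (forall c p, A p -> A (c *: p)) ->
  (forall j, A 'X^j) -> forall p, A p.
Proof.
move=> AD AZ AX p; rewrite -[p]coefK poly_def.
by apply: (big_ind A) => //; [rewrite -(scale0r 'X^0); exact: AZ|move=> i _; exact: AZ].
Qed.

End poly_aux.

(** * Hermite polynomials of two jointly Gaussian variables *)

Section two_point.
Context {R : realType} {d : measure_display} {T : measurableType d}
  (P : probability T R).

Section one_side.
Variables (X Y : T -> R) (rho : R).
Hypothesis gXY : forall a b, gaussian_rv P (fun w => a * X w + b * Y w).
Hypothesis X1 : \int[P]_w X w = 0.
Hypothesis Y1 : \int[P]_w Y w = 0.
Hypothesis X2 : \int[P]_w (X w ^+ 2) = 1.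
Hypothesis Y2 : \int[P]_w (Y w ^+ 2) = 1.
Hypothesis XY : \int[P]_w (X w * Y w) = rho.

Let gX : gaussian_rv P X.
Proof.
have := gXY 1 0; congr gaussian_rv; apply/funext => w.
by rewrite mul1r mul0r addr0.
Qed.

Let gY : gaussian_rv P Y.
Proof.
have := gXY 0 1; congr gaussian_rv; apply/funext => w.
by rewrite mul1r mul0r add0r.
Qed.

Let LX j : L2 P (fun w => X w ^+ j). Proof. exact: gaussian_L2. Qed.
Let LY j : L2 P (fun w => Y w ^+ j). Proof. exact: gaussian_L2. Qed.

Let M j l := ip P (fun w => X w ^+ j) (fun w => Y w ^+ l).

(** As polynomials in t, [U] is the variance of X + tY and [Q k] its k-th moment. Only the laws of
    linear combinations of X and Y are known, so mixed moments are read off as coefficients of these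
    polynomials. *)
Let U : {poly R} := 1 + (2 * rho) *: 'X + 'X^2.
Let Q k : {poly R} := \poly_(l < k.+1) ('C(k, l)%:R * M (k - l) l).

Let QE k : Q k = gmoment k *: U ^+ k./2.
Proof.
apply: poly_eq_fun => t; rewrite hornerZ horner_exp /U !hornerE.
have gZ : gaussian_rv P (fun w => X w + t * Y w).
  by have := gXY 1 t; congr gaussian_rv; apply/funext => w; rewrite mul1r.
have LX1 : L2 P X by have := LX 1; under eq_fun do rewrite expr1.
have LY1 : L2 P Y by have := LY 1; under eq_fun do rewrite expr1.
have iX : P.-integrable setT (EFin \o X).
  by have := gaussian_integrable_pow 1 gX; under eq_fun do rewrite expr1.
have iY : P.-integrable setT (EFin \o Y).
  by have := gaussian_integrable_pow 1 gY; under eq_fun do rewrite expr1.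
have Z1 : \int[P]_w (X w + t * Y w) = 0.
  rewrite RintegralD// ?RintegralZl// ?X1 ?Y1 ?mulr0 ?addr0//.
  by have := integrableZl measurableT t iY; apply: eq_integrable.
have Z2 : \int[P]_w ((X w + t * Y w) ^+ 2) = 1 + 2 * rho * t + t ^+ 2.
  have := @sqD _ _ _ P X (fun w => t * Y w) LX1 (L2Z t LY1).
  rewrite sqZ// ipZr// /sq /ip X2 Y2 XY => ->; lra.
rewrite -(gaussian_moment gZ Z1 Z2) horner_poly /M.
transitivity (\sum_(i < k.+1) \int[P]_w ((X w ^+ (k - i) * Y w ^+ i) * ('C(k, i)%:R * t ^+ i))).
  apply: eq_bigr => i _; rewrite RintegralZr//; last exact: L2_integrableM.
  by rewrite /ip; lra.
rewrite /Rintegral.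
under [in RHS]eq_integral do rewrite exprDn -sumEFin.
rewrite integral_sum//; last first.
  move=> i; have h := integrableZl measurableT (t ^+ i * 'C(k, i)%:R) (L2_integrableM (LX (k - i)) (LY i)).
  by apply: eq_integrable h => // w _; rewrite /= -EFinM exprMn -mulr_natl; congr EFin; lra.
rewrite -[LHS]/(fine _%:E) -sumEFin; congr fine; apply: eq_bigr => i _.
rewrite fineK; last first.
  apply: integrable_fin_num => //.
  have h := integrableZl measurableT (t ^+ i * 'C(k, i)%:R) (L2_integrableM (LX (k - i)) (LY i)).
  by apply: eq_integrable h => // w _; rewrite /= -EFinM; congr EFin; lra.
by apply: eq_integral => w _; congr EFin; rewrite exprMn -mulr_natl; lra.
Qed.

(** Gaussian integration by parts on monomials, obtained by comparing the coefficients of t^l in a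
    differential identity for [Q] with k = j + l. *)
Let stein0 j l : M j.+1 l = j%:R * M j.-1 l + rho * l%:R * M j l.-1.
Proof.
pose k := (j + l)%N.
have [k0|k0] := posnP k.
  have [-> ->] : j = 0%N /\ l = 0%N by rewrite /k in k0; lia.
  rewrite /M /ip !mul0r mulr0 mul0r addr0 -[RHS]X1.
  by apply: eq_Rintegral => w _; rewrite expr1 expr0 mulr1.
(* The operator k + 1 - t d/dt multiplies t^l by k + 1 - l, and (k+1-l) C(k+1,l) = (k+1) C(k,l). On
   powers of the variance it acts through 2U - tU' = 2(1 + rho t). *)
have key : k.+1%:R *: Q k.+1 - 'X * (Q k.+1)^`() =
    (k.+1 * k)%:R *: ((1 + rho *: 'X) * Q k.-1).
  case: k k0 => // k' _; rewrite !QE derivZ deriv_exp /= -/gmoment.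
  case: (boolP (odd k')) => ok.
    by rewrite gmoment_odd// !mulr0 !scale0r mulr0 subr0 mulr0 !scaler0.
  have ek : k'.+2%:R = 2 * (k'./2.+1)%:R :> R.
    rewrite -[in LHS](odd_double_half k') (negbTE ok) add0n -natrM; congr (_%:R); lia.
  have dU : U^`() = (2 * rho)%:P + 2%:R *: 'X.
    by rewrite /U !derivD derivZ derivXn derivX derivC add0r alg_polyC expr1 scaler_nat.
  apply: poly_eq_fun => t; rewrite dU exprS natrM ek !hornerE hornerMn !hornerE /=.
  rewrite -[X in _ - _ * X]mulr_natr.
  move: (k'./2.+1)%:R (_ ^+ k'./2) (gmoment k') k'.+1%:R => a b c e.
  lra.
have := congr1 (fun p : {poly R} => p`_l) key.
rewrite coefB !coefZ coefXM coef_deriv mulrDl mul1r coefD -scalerAl coefZ coefXM !coef_poly.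
have -> : (l < k.+2)%N by rewrite /k; lia.
have -> : (l < k.-1.+1)%N = (0 < j)%N by rewrite /k in k0 *; lia.
have -> : (l.-1 < k.-1.+1)%N by rewrite /k in k0 *; lia.
have -> : (k.+1 - l = j.+1)%N by rewrite /k; lia.
have -> : (k.-1 - l = j.-1)%N by rewrite /k; lia.
have e1 : (k.+1 - l)%:R * 'C(k.+1, l)%:R = k.+1%:R * 'C(k, l)%:R :> R.
  by rewrite -!natrM -(mul_bin_down k.+1).
have e2 : k%:R * 'C(k.-1, l)%:R = j%:R * 'C(k, l)%:R :> R.
  by rewrite -!natrM mul_bin_down /k addnK.
have C0 : 0 < k.+1%:R * 'C(k, l)%:R :> R.
  by rewrite mulr_gt0// ltr0n// bin_gt0 /k leq_addl.
rewrite natrM => h; apply: (mulfI (lt0r_neq0 C0)).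
have lE : (if l == 0%N then 0 else (if (l.-1.+1 < k.+2)%N then
    'C(k.+1, l.-1.+1)%:R * M (k.+1 - l.-1.+1) l.-1.+1 else 0) *+ l.-1.+1) =
    l%:R * ('C(k.+1, l)%:R * M j.+1 l).
  have [l0|l0] := posnP l; first by rewrite l0 mul0r.
  rewrite prednK// ifT; last by rewrite /k; lia.
  have -> : (k.+1 - l = j.+1)%N by rewrite /k; lia.
  by rewrite -mulr_natl.
rewrite lE in h.
have rE : k%:R * (if l == 0%N then 0 else 'C(k.-1, l.-1)%:R * M (k.-1 - l.-1) l.-1) =
    l%:R * 'C(k, l)%:R * M j l.-1.
  have [l0|l0] := posnP l; first by rewrite l0 mulr0 !mul0r.
  rewrite (_ : (k.-1 - l.-1 = j)%N); last by rewrite /k; lia.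
  rewrite mulrA -!natrM; congr (_%:R * _).
  by have := mul_bin_diag k l.-1; rewrite prednK.
have jE : k%:R * (if (0 < j)%N then 'C(k.-1, l)%:R * M j.-1 l else 0) =
    j%:R * 'C(k, l)%:R * M j.-1 l.
  case: (posnP j) => [->|j0]; first by rewrite mulr0 !mul0r.
  by rewrite mulrA e2.
move: h; rewrite -[X in _ = X]mulrA mulrDr jE (mulrCA k%:R) rE.
have : (k.+1 - l)%:R = k.+1%:R - l%:R :> R by rewrite natrB// /k; lia.
move=> e3; rewrite e3 in e1; move: e1.
move: k.+1%:R l%:R j%:R 'C(k.+1, l)%:R 'C(k, l)%:R (M j.+1 l) (M j.-1 l) (M j l.-1).
move=> a b c e f m1 m2 m3 e1 h.
have : (a - b) * e * m1 = a * (c * f * m2 + rho * (b * f * m3)) by lra.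
rewrite e1; lra.
Qed.

Notation E2 p q := (ip P (fun w => p.[X w]) (fun w => q.[Y w])).

Lemma L2_hornerX (p : {poly R}) : L2 P (fun w => p.[X w]).
Proof.
under eq_fun do rewrite horner_coef.
by apply: L2_sum => i _; exact: L2Z.
Qed.

Lemma L2_hornerY (p : {poly R}) : L2 P (fun w => p.[Y w]).
Proof.
under eq_fun do rewrite horner_coef.
by apply: L2_sum => i _; exact: L2Z.
Qed.

Let E2D p p' q : E2 (p + p') q = E2 p q + E2 p' q.
Proof.
rewrite -ipDl; [|exact: L2_hornerX|exact: L2_hornerX|exact: L2_hornerY].
by congr ip; apply/funext => w; rewrite hornerD.
Qed.

Let E2Z c p q : E2 (c *: p) q = c * E2 p q.
Proof.
rewrite -ipZl; [|exact: L2_hornerX|exact: L2_hornerY].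
by congr ip; apply/funext => w; rewrite hornerZ.
Qed.

Let E2Dr p q q' : E2 p (q + q') = E2 p q + E2 p q'.
Proof.
rewrite -ipDr; [|exact: L2_hornerY|exact: L2_hornerY|exact: L2_hornerX].
by congr ip; apply/funext => w; rewrite hornerD.
Qed.

Let E2Zr c p q : E2 p (c *: q) = c * E2 p q.
Proof.
rewrite -ipZr; [|exact: L2_hornerX|exact: L2_hornerY].
by congr ip; apply/funext => w; rewrite hornerZ.
Qed.

Let E2M j l : E2 'X^j 'X^l = M j l.
Proof. by congr ip; apply/funext => w; rewrite hornerXn. Qed.

Lemma gaussian_stein p q : E2 ('X * p) q = E2 p^`() q + rho * E2 p q^`().
Proof.
move: q; apply: poly_lin_ind => [q q' h h'|c q h|l].
- by rewrite derivD !E2Dr h h'; lra.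
- by rewrite derivZ !E2Zr h; lra.
move: p; apply: poly_lin_ind => [p p' h h'|c p h|j].
- by rewrite derivD mulrDr !E2D h h'; lra.
- by rewrite derivZ -scalerAr !E2Z h; lra.
have dX i : ('X^i)^`() = i%:R *: 'X^(i.-1) :> {poly R} by rewrite derivXn scaler_nat.
by rewrite -exprS !dX E2Z E2Zr !E2M stein0 mulrA.
Qed.

(** As He_{n+1} = X He_n - He_n', integration by parts cancels the derivative of He_n and leaves
    only the one falling on [q]. *)
Lemma hermite_raise n q : E2 (hermite n.+1) q = rho * E2 (hermite n) q^`().
Proof.
have -> : hermite n.+1 = 'X * hermite n + (- 1) *: (hermite n)^`() :> {poly R}.
  by rewrite scaleN1r.
rewrite E2D E2Z gaussian_stein; lra.
Qed.

End one_side.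

Lemma hermite_two_point (X Y : T -> R) (rho : R) :
  (forall a b, gaussian_rv P (fun w => a * X w + b * Y w)) ->
  \int[P]_w X w = 0 -> \int[P]_w Y w = 0 ->
  \int[P]_w (X w ^+ 2) = 1 -> \int[P]_w (Y w ^+ 2) = 1 ->
  \int[P]_w (X w * Y w) = rho ->
  forall n m, ip P (fun w => (hermite n).[X w]) (fun w => (hermite m).[Y w]) =
    if n == m then n`!%:R * rho ^+ n else 0.
Proof.
move=> gXY X1 Y1 X2 Y2 XY.
have gYX a b : gaussian_rv P (fun w => a * Y w + b * X w).
  by have := gXY b a; congr gaussian_rv; apply/funext => w; rewrite addrC.
have YX : \int[P]_w (Y w * X w) = rho by under eq_Rintegral do rewrite mulrC.
have LX := L2_hornerX gXY. have LY := L2_hornerY gXY.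
have ip0 (h : T -> R) : ip P h (fun w => (0 : {poly R}).[Y w]) = 0.
  rewrite /ip; under eq_Rintegral do rewrite horner0 mulr0.
  by rewrite Rintegral_cst// mul0r.
have ip0' (h : T -> R) : ip P h (fun w => (0 : {poly R}).[X w]) = 0.
  rewrite /ip; under eq_Rintegral do rewrite horner0 mulr0.
  by rewrite Rintegral_cst// mul0r.
elim=> [|n IH] [|m].
- rewrite /ip; under eq_Rintegral do rewrite !hornerC mulr1.
  by rewrite Rintegral_cst//= probability_setT/= fact0.
- by rewrite ipC (hermite_raise gYX Y1 X1 Y2 X2 YX) derivC ip0' mulr0.
- by rewrite (hermite_raise gXY X1 Y1 X2 Y2 XY) derivC ip0 mulr0.
- rewrite (hermite_raise gXY X1 Y1 X2 Y2 XY) deriv_hermiteS eqSS.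
  under [X in ip _ _ X]eq_fun do rewrite hornerZ.
  rewrite ipZr// IH; case: eqP => [->|_]; last by rewrite !mulr0.
  by rewrite factS natrM exprS; lra.
Qed.

End two_point.

(** * Integrals over boxes *)

Section lebesgue_product.
Context {R : realType}.
Local Open Scope ereal_scope.

Lemma lebesgue_tuple0E (f : 0.-tuple R -> \bar R) : measurable_fun setT f ->
  \int[lebesgue_tuple 0]_x f x = f [tuple].
Proof.
by move=> mf; rewrite integral_dirac// diracT mul1e.
Qed.

Lemma lebesgue_tupleSE n (f : n.+1.-tuple R -> \bar R) : measurable_fun setT f ->
  (forall x, 0 <= f x) ->
  \int[lebesgue_tuple n.+1]_x f x =
  \int[lebesgue_measure]_x \int[lebesgue_tuple n]_y f (tuple_cons (x, y)).
Proof.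
move=> mf f0.
transitivity (\int[pushforward (lebesgue_measure \x lebesgue_tuple n) (@tuple_cons R n)]_x f x).
  by [].
rewrite ge0_integral_pushforward//=.
by rewrite fubini_tonelli1//; exact: measurableT_comp.
Qed.

Lemma tnth_tuple_cons0 n (x : R) (y : n.-tuple R) : tnth (tuple_cons (x, y)) ord0 = x.
Proof. by []. Qed.

Lemma tnth_tuple_consS n (x : R) (y : n.-tuple R) i :
  tnth (tuple_cons (x, y)) (lift ord0 i) = tnth y i.
Proof. by rewrite /tuple_cons tnthS. Qed.

Lemma emeasurable_prod d (T : measurableType d) (I : Type) (r : seq I) (g : I -> T -> \bar R) :
  (forall i, measurable_fun setT (g i)) ->
  measurable_fun setT (fun x => \prod_(i <- r) g i x).
Proof.
move=> mg; elim: r => [|i r IH].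
  by under eq_fun do rewrite big_nil; exact: measurable_cst.
by under eq_fun do rewrite big_cons; exact: emeasurable_funM.
Qed.

Lemma measurable_tuple_prod n (g : 'I_n -> R -> \bar R) : (forall i, measurable_fun setT (g i)) ->
  measurable_fun setT (fun x : n.-tuple R => \prod_(i < n) g i (tnth x i)).
Proof.
move=> mg; apply: emeasurable_prod => i.
by apply: measurableT_comp => //; exact: measurable_tnth.
Qed.

Lemma ge0_integral_tuple_prod n (f : 'I_n -> R -> \bar R) :
  (forall i, measurable_fun setT (f i)) -> (forall i x, 0 <= f i x) ->
  \int[lebesgue_tuple n]_x \prod_(i < n) f i (tnth x i) =
  \prod_(i < n) \int[lebesgue_measure]_x f i x.
Proof.
elim: n f => [|n IH] f mf f0.
  rewrite lebesgue_tuple0E; first by rewrite !big_ord0.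
  under eq_fun do rewrite big_ord0; exact: measurable_cst.
rewrite lebesgue_tupleSE; [|exact: measurable_tuple_prod|by move=> x; exact: prode_ge0].
transitivity (\int[lebesgue_measure]_x (f ord0 x * \prod_(i < n) \int[lebesgue_measure]_x0 f (lift ord0 i) x0)).
  apply: eq_integral => x _.
  under eq_integral do rewrite big_ord_recl tnth_tuple_cons0.
  transitivity (f ord0 x * \int[lebesgue_tuple n]_y \prod_(i < n) f (lift ord0 i) (tnth y i)).
    rewrite -ge0_integralZl//; last 2 first.
    - exact: (@measurable_tuple_prod n (fun i => f (lift ord0 i)) (fun i => mf _)).
    - by move=> y _; apply: prode_ge0.
    apply: eq_integral => y _; congr (_ * _).
    by apply: eq_bigr => i _; rewrite tnth_tuple_consS.
  by rewrite (IH (fun i => f (lift ord0 i))).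
rewrite ge0_integralZr//; first by rewrite big_ord_recl.
- exact: mf.
- by apply: prode_ge0 => i _; exact: integral_ge0.
Qed.

Lemma lebesgue_tuple_coord0 n (i : 'I_n) (c : R) :
  lebesgue_tuple n [set x | tnth x i = c] = 0.
Proof.
have mS : measurable [set x : n.-tuple R | tnth x i = c].
  rewrite (_ : [set x | _] = setT `&` (fun x : n.-tuple R => tnth x i) @^-1` [set c]).
    by apply: measurable_tnth => //; exact: measurable_set1.
  by rewrite setTI.
pose f (j : 'I_n) (x : R) : \bar R := if j == i then (\1_[set c] x)%:E else 1.
transitivity (\int[lebesgue_tuple n]_x \prod_(j < n) f j (tnth x j)).
  rewrite -(setIT [set x | _]) -integral_indic//; apply: eq_integral => x _.
  rewrite (bigD1 i)//= big1 ?mule1; last by move=> j ji; rewrite /f (negbTE ji).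
  rewrite /f eqxx !indicE.
  by rewrite (_ : (tnth x i \in [set c]) = (x \in [set x | tnth x i = c]))//; apply/idP/idP; rewrite !inE.
rewrite ge0_integral_tuple_prod; last 2 first.
- move=> j; rewrite /f; case: eqP => _; last exact: measurable_cst.
  apply/measurable_EFinP; exact: measurable_indic.
- by move=> j x; rewrite /f; case: eqP => // _; rewrite lee_fin.
rewrite (bigD1 i)//= /f eqxx integral_indic//= setIT.
by rewrite (lebesgue_measure_set1 c) mul0e.
Qed.

Lemma measurable_tuple_box n (A : 'I_n -> set R) : (forall i, measurable (A i)) ->
  measurable [set x : n.-tuple R | forall i, A i (tnth x i)].
Proof.
move=> mA.
rewrite (_ : [set x | _] = \bigcap_(i in [set: 'I_n]) ((fun x : n.-tuple R => tnth x i) @^-1` A i)).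
  apply: fin_bigcap_measurable => // i _; rewrite -[X in measurable X]setTI.
  by apply: measurable_tnth.
by apply/seteqP; split => x /= h i; [move=> _; exact: h|exact: h].
Qed.

End lebesgue_product.

Section improper.
Context {R : realType}.
Local Open Scope ereal_scope.

(** The integrand may blow up at both ends, so the interval is exhausted by compact ones; bounding
    [F] between its end values takes the place of continuity at [a] and [b]. *)
Lemma integral_le_antiderivative (f F : R -> R) (a b : R) : (a < b)%R ->
  (forall x, a < x < b -> 0 <= f x)%R ->
  {in `]a, b[, continuous f} ->
  (forall x, (a < x < b)%R -> is_derive x 1%R F (f x)) ->
  (forall x, (a < x < b)%R -> F a <= F x <= F b)%R ->
  \int[lebesgue_measure]_(x in `]a, b[) (f x)%:E <= (F b - F a)%:E.
Proof.
move=> ab f0 cf dF Fab.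
(* Less than half the length, so that the compact intervals [I n] are nonempty, and decreasing to
   0. *)
pose e n : R := ((b - a) / 2 / n.+2%:R)%R.
pose I n := `[(a + e n)%R, (b - e n)%R]%classic : set R.
have ba : (0 < b - a)%R by rewrite subr_gt0.
have e0 n : (0 < e n)%R by rewrite !divr_gt0.
have e1 n : (e n < (b - a) / 2)%R.
  by rewrite ltr_pdivrMr// ltr_pMr ?ltr1n// divr_gt0.
have eS m n : (m <= n)%N -> (e n <= e m)%R.
  by move=> mn; rewrite ler_pM2l ?divr_gt0// lef_pV2 ?posrE// ler_nat.
have mf : measurable_fun (`]a, b[%classic : set R) f by apply: open_continuous_measurable_fun => // x; rewrite inE; exact: cf.
have inn n x : (a + e n <= x <= b - e n)%R -> (a < x < b)%R.
  by move=> /andP[h1 h2]; have := e0 n; move=> h; apply/andP; split; lra.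
have Isub n : I n `<=` `]a, b[.
  by move=> x; rewrite /I /= !in_itv/=; exact: inn.
have ctF x : (a < x < b)%R -> {for x, continuous F}.
  move=> xab; apply: differentiable_continuous; apply/derivable1_diffP.
  by have [] := dF x xab.
have intI n : \int[lebesgue_measure]_(x in I n) (f x)%:E <= (F b - F a)%:E.
  have abn : (a + e n < b - e n)%R by have := e1 n; lra.
  rewrite (@continuous_FTC2 R f F) => [||||x xI]; first 1 last.
  - exact: abn.
  - apply: continuous_in_subspaceT => x; rewrite inE/= in_itv/= => /inn xab.
    by apply: cf; rewrite in_itv.
  - split.
    + move=> x; rewrite in_itv/= => /andP[h1 h2].
      by have [] := dF x (inn n _ _); rewrite ?(ltW h1) ?(ltW h2).
    + apply: cvg_at_right_filter; apply: ctF; apply: (inn n); rewrite lexx ltW//.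
    + apply: cvg_at_left_filter; apply: ctF; apply: (inn n); rewrite lexx ltW//.
  - have xab : (a < x < b)%R.
      by apply: (inn n); move: xI; rewrite in_itv/= => /andP[h1 h2]; rewrite !ltW.
    by rewrite derive1E; have [_ ->] := dF x xab.
  have h1 : (a + e n <= b - e n <= b - e n)%R by rewrite lexx ltW.
  have h2 : (a + e n <= a + e n <= b - e n)%R by rewrite lexx ltW.
  have /andP[_ h3] := Fab _ (inn _ _ h1).
  have /andP[h4 _] := Fab _ (inn _ _ h2).
  by rewrite -EFinB lee_fin lerB.
pose g n := (fun x => (f x)%:E) \_ (I n).
have gE n : \int[lebesgue_measure]_(x in `]a, b[) g n x = \int[lebesgue_measure]_(x in I n) (f x)%:E.
  by rewrite -[in RHS](setIidr (@Isub n)) integral_mkcondr.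
have cv : (fun n => \int[lebesgue_measure]_(x in `]a, b[) g n x) @ \oo -->
    \int[lebesgue_measure]_(x in `]a, b[) limn (g ^~ x).
  apply: cvg_monotone_convergence => //.
  - move=> n; apply/measurable_restrict => //; first exact: measurable_itv.
    by apply/measurable_EFinP; apply: measurable_funS mf => //; exact: subIsetl.
  - move=> n x; rewrite /= in_itv/= => xab; rewrite /g patchE; case: ifPn => // _.
    by rewrite lee_fin f0.
  - move=> x; rewrite /= in_itv/= => xab m n mn; rewrite /g !patchE.
    case: ifPn => xm; last by case: ifPn => // _; rewrite lee_fin f0.
    rewrite mem_set//; move: xm; rewrite inE /I /= !in_itv/= => /andP[h1 h2].
    have := eS _ _ mn; move=> h; apply/andP; split; lra.
have -> : \int[lebesgue_measure]_(x in `]a, b[) (f x)%:E = \int[lebesgue_measure]_(x in `]a, b[) limn (g ^~ x).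
  apply: eq_integral => x; rewrite inE/= in_itv/= => /andP[ax xb].
  apply/esym/cvg_lim => //; apply: cvg_near_cst.
  pose D := (Num.min (x - a) (b - x) / ((b - a) / 2))%R.
  have D0 : (0 < D)%R by rewrite divr_gt0// ?divr_gt0// lt_min !subr_gt0 ax.
  near=> n.
  rewrite /g patchE mem_set// /I /= in_itv/=.
  have : (e n <= Num.min (x - a) (b - x))%R.
    have h : (n.+2%:R^-1 <= D)%R.
      apply: (@le_trans _ _ n.+1%:R^-1%R).
        by rewrite lef_pV2 ?posrE// ler_nat.
      by near: n; apply: filterS (near_infty_natSinv_lt (PosNum D0)) => n /ltW.
    by move: h; rewrite /D ler_pdivlMr ?divr_gt0// mulrC.
  by rewrite le_min => /andP[h1 h2]; apply/andP; split; lra.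
have <- := cvg_lim (@ereal_hausdorff R) cv.
apply: lime_le; first by apply/cvg_ex; eexists; exact: cv.
by apply: nearW => n; rewrite gE.
Unshelve. all: by end_near. Qed.

End improper.

(** * The bifractional covariance *)

Section bifractional_bound.
Context {R : realType}.
Implicit Types s t u v x y a b p H K : R.

Lemma powR_homo x y p : 0 <= p -> 0 <= x -> x <= y -> x `^ p <= y `^ p.
Proof. by move=> p0 x0 xy; rewrite ge0_ler_powR// nnegrE// (le_trans x0). Qed.

Lemma powR_addr x p q : 0 < x -> x `^ (p + q) = x `^ p * x `^ q.
Proof. by move=> x0; rewrite powRD//; apply/implyP => _; rewrite gt_eqF. Qed.

Lemma powR_le1 x p : 0 <= p -> 0 <= x <= 1 -> x `^ p <= 1.
Proof. by move=> p0 /andP[x0 x1]; have := powR_homo p0 x0 x1; rewrite powR1. Qed.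

Lemma powR_exp_anti x p q : 0 <= x <= 1 -> 0 < q -> q <= p -> x `^ p <= x `^ q.
Proof.
move=> /andP[x0 x1] q0 qp; have [->|xn0] := eqVneq x 0.
  by rewrite !powR0 ?gt_eqF// (lt_le_trans q0).
by apply: ger_powR => //; rewrite lt_neqAle eq_sym xn0 x0.
Qed.

(** The fractions a/(a+b) and b/(a+b) sum to 1 and lie in [0,1], where the power K <= 1 does not
    decrease them. *)
Lemma powR_subadd a b K : 0 <= a -> 0 <= b -> 0 < K <= 1 ->
  (a + b) `^ K <= a `^ K + b `^ K.
Proof.
move=> a0 b0 /andP[K0 K1]; have [s0|sn0] := eqVneq (a + b) 0.
  by rewrite s0 powR0 ?gt_eqF// addr_ge0// powR_ge0.
have sp : 0 < a + b by rewrite lt_neqAle eq_sym sn0 addr_ge0.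
have part c : 0 <= c -> c <= a + b -> c / (a + b) * (a + b) `^ K <= c `^ K.
  move=> c0 cs; have [->|cn0] := eqVneq c 0; first by rewrite !mul0r powR_ge0.
  have cE : c = c / (a + b) * (a + b) by rewrite divfK// gt_eqF.
  rewrite [in leRHS]cE powRM ?divr_ge0 ?(ltW sp)//.
  rewrite ler_pM2r ?powR_gt0//; apply: ger1_powR => //.
  rewrite divr_gt0//= ?ler_pdivrMr ?mul1r//.
  by rewrite lt_neqAle eq_sym cn0.
apply: le_trans (lerD (part a a0 _) (part b b0 _)); rewrite ?lerDl ?lerDr//.
by rewrite -!mulrDl divff// mul1r.
Qed.

(** The chain is (1-z)^K <= exp(-Kz) <= 1/(1+Kz) <= 1 - Kz/2, the last inequality because Kz <=
    1. *)
Lemma powR_bernoulli z K : 0 <= z <= 1 -> 0 < K <= 1 -> (1 - z) `^ K <= 1 - K * z / 2.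
Proof.
move=> /andP[z0 z1] /andP[K0 K1].
have Kz0 : 0 <= K * z by rewrite mulr_ge0// ltW.
have Kz1 : K * z <= 1 by rewrite mulr_ile1// ltW.
have [->|zn1] := eqVneq z 1; first by rewrite subrr powR0 ?gt_eqF//; lra.
have oz : 0 < 1 - z by rewrite subr_gt0 lt_neqAle zn1.
have h1 : (1 - z) `^ K <= expR (- (K * z)).
  rewrite -mulrN mulrC expRM; apply: powR_homo; [exact: ltW|exact: ltW|].
  exact: expR_ge1Dx.
apply: (le_trans h1); rewrite expRN.
have h2 : 1 + K * z <= expR (K * z) by exact: expR_ge1Dx.
apply: (@le_trans _ _ (1 + K * z)^-1).
  by rewrite lef_pV2 ?posrE ?expR_gt0//; lra.
rewrite -[leLHS]mul1r ler_pdivrMr; last by lra.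
move: Kz0 Kz1; move: (K * z) => q; nra.
Qed.

(* [v^H + (1-v)^H - 1] vanishes at both ends exactly like [v^H (1-v)^H]. *)
Lemma powR_superadd v H : 0 <= v <= 1 -> 0 < H < 1 ->
  (1 - 2 `^ (H - 1)) * (v `^ H * (1 - v) `^ H) <= v `^ H + (1 - v) `^ H - 1.
Proof.
move=> + /andP[H0 H1].
wlog : v / v <= 1 / 2.
  move=> wh /andP[v0 v1]; have [h|h] := leP v (1 / 2); first by apply: wh => //; rewrite v0.
  have := wh (1 - v); rewrite subKr [(1 - v) `^ H * _]mulrC [(1 - v) `^ H + _]addrC; apply.
    by lra.
  by apply/andP; split; lra.
move=> v2 /andP[v0 v1].
have [->|vn0] := eqVneq v 0.
  by rewrite subr0 powR1 powR0 ?gt_eqF//; lra.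
have vp : 0 < v by rewrite lt_neqAle eq_sym vn0.
have h1 : 1 - v <= (1 - v) `^ H.
  by apply: ger1_powR; [apply/andP; split; lra|exact: ltW].
have h2 : (1 - v) `^ H <= 1.
  by apply: powR_le1; [exact: ltW|apply/andP; split; lra].
have c0 : 0 <= 1 - 2 `^ (H - 1) :> R.
  rewrite subr_ge0 -[leRHS](powRr0 (2 : R)) ler_powR//; lra.
have h3 : (1 - 2 `^ (H - 1)) * (v `^ H * (1 - v) `^ H) <= (1 - 2 `^ (H - 1)) * v `^ H.
  by rewrite ler_wpM2l// ler_piMr// powR_ge0.
apply: (le_trans h3).
have h4 : v <= 2 `^ (H - 1) * v `^ H.
  have {1}-> : v = v `^ (1 - H) * v `^ H.
    by rewrite -powR_addr// subrK powRr1// ltW.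
  rewrite ler_pM2r ?powR_gt0//.
  have -> : (2 : R) `^ (H - 1) = (1 / 2) `^ (1 - H).
    by rewrite mul1r -(powR_inv1 (ler0n R 2)) -powRrM mulN1r opprB.
  by apply: powR_homo; lra.
move: h4 h1; lra.
Qed.

(** Here v stands for the ratio of the two times. For v <= v0 the left-hand side is at most
    v^(HK)/2. Otherwise put a = v^H, write 1 + v^(2H) = 2a + (1-a)^2 and use subadditivity of the
    power K: 2^K v^(HK) is the main term, and (1-a)^(2K) is below (1-v)^(2HK) by a definite factor
    thanks to [powR_superadd]. *)
Lemma bifractional_corr_ratio H K : 0 < H < 1 -> 0 < K <= 1 ->
  exists c, [/\ 0 < c, c <= 1 & forall v, 0 < v <= 1 ->
    (2 `^ K)^-1 * ((1 + v `^ (2 * H)) `^ K - (1 - v) `^ (2 * H * K)) <=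
    v `^ (H * K) * (1 - c * (1 - v) `^ (2 * H * K))].
Proof.
move=> H01 K01; have /andP[H0 H1] := H01; have /andP[K0 K1] := K01.
have HK0 : 0 < H * K by rewrite mulr_gt0.
have HK1 : H * K < 1 by rewrite (le_lt_trans _ H1)// ler_piMr// ltW.
have HHK : 0 <= H - H * K by rewrite subr_ge0 ler_piMr// ltW.
have K2 : 1 <= (2 : R) `^ K by rewrite -[leLHS](powRr0 (2 : R)) ler_powR//; [lra|exact: ltW].
have K2i : (2 `^ K)^-1 <= 1 :> R by rewrite invf_le1// (lt_le_trans ltr01).
have K2p : 0 < (2 `^ K)^-1 :> R by rewrite invr_gt0 (lt_le_trans ltr01).
pose c1 : R := 1 - 2 `^ (H - 1).
have c10 : 0 < c1.
  have -> : c1 = 1 - (1 / 2) `^ (1 - H).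
    by rewrite mul1r -(powR_inv1 (ler0n R 2)) -powRrM mulN1r opprB.
  have : (1 / 2 : R) `^ (1 - H) < 1 `^ (1 - H).
    by rewrite gt0_ltr_powR ?nnegrE//; lra.
  by rewrite powR1 subr_gt0.
have c11 : c1 <= 1 by rewrite lerBlDr lerDl powR_ge0.
(* Chosen so that v^(HK) <= 1/4 and v^(1-HK) <= 1/8 for v <= v0: with p = v^(HK) and v = p v^(1-HK),
   the bracket is at most p^2 + 2v <= p/2. *)
pose v0 : R := Num.min ((1 / 4) `^ (H * K)^-1) ((1 / 8) `^ (1 - H * K)^-1).
have v00 : 0 < v0 by rewrite lt_min !powR_gt0//; lra.
have v0A : v0 `^ (H * K) <= 1 / 4.
  have := @powR_homo v0 ((1 / 4) `^ (H * K)^-1) _ (ltW HK0) (ltW v00).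
  rewrite -powRrM mulVf ?gt_eqF// powRr1; last lra.
  by apply; rewrite ge_min lexx.
have v0B : v0 `^ (1 - H * K) <= 1 / 8.
  have := @powR_homo v0 ((1 / 8) `^ (1 - H * K)^-1) (1 - H * K) _ (ltW v00).
  rewrite -powRrM mulVf ?gt_eqF ?subr_gt0// powRr1; last lra.
  by apply; [lra|rewrite ge_min lexx orbT].
(* The bound 1/2 serves the small ratios; the other term is the gain obtained for v >= v0, where v^H
   >= v0^(H-HK) v^(HK). *)
pose c : R := Num.min (1 / 2) ((2 `^ K)^-1 * (K * c1 / 2) * Num.min 1 (v0 `^ (H - H * K))).
have c0 : 0 < c.
  by rewrite lt_min !mulr_gt0 ?invr_gt0// ?lt_min ?powR_gt0//; lra.
exists c; split => //; first by rewrite ge_min; apply/orP; left; lra.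
move=> v /andP[vp v1].
have q0 : 0 <= (1 - v) `^ (2 * H * K) by exact: powR_ge0.
have q1 : (1 - v) `^ (2 * H * K) <= 1.
  by apply: powR_le1; [rewrite -mulrA; lra|apply/andP; split; lra].
have HKE x : 0 <= x -> x `^ (2 * H * K) = (x `^ (H * K)) ^+ 2.
  move=> x0; have -> : 2 * H * K = (H * K) * 2 by lra.
  by rewrite [LHS]powRrM (powR_mulrn 2)// powR_ge0.
have [vv0|/ltW vv0] := leP v v0.
  have a1 : (1 + v `^ (2 * H)) `^ K <= 1 + v `^ (2 * H * K).
    have := @powR_subadd 1 (v `^ (2 * H)) K ler01 (powR_ge0 _ _) K01.
    by rewrite powR1 -powRrM.
  have a2 : 1 - 2 * v <= (1 - v) `^ (2 * H * K).
    have h : (1 - v) `^ 2%:R <= (1 - v) `^ (2 * H * K).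
      apply: powR_exp_anti; [by apply/andP; split; lra|by rewrite -mulrA; lra|].
      by rewrite -mulrA; lra.
    by move: h; rewrite powR_mulrn; nra.
  have a3 : v = v `^ (H * K) * v `^ (1 - H * K).
    by rewrite -powR_addr// addrC subrK powRr1// ltW.
  have a4 : v `^ (H * K) <= 1 / 4.
    by apply: le_trans v0A; apply: powR_homo => //; exact: ltW.
  have a5 : v `^ (1 - H * K) <= 1 / 8.
    by apply: le_trans v0B; apply: powR_homo => //; lra.
  have a6 : 0 < v `^ (H * K) by rewrite powR_gt0.
  have a7 : c <= 1 / 2 by rewrite ge_min lexx.
  have a8 : (1 + v `^ (2 * H)) `^ K - (1 - v) `^ (2 * H * K) <= v `^ (H * K) / 2.
    move: a1 a2; rewrite (HKE _ (ltW vp)) [in 2 * v]a3.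
    move: a4 a5 a6; move: (v `^ (H * K)) (v `^ (1 - H * K)) (_ `^ K) (_ `^ (2 * H * K)).
    move=> a b x y; nra.
  apply: (@le_trans _ _ ((2 `^ K)^-1 * (v `^ (H * K) / 2))).
    by rewrite ler_wpM2l// ltW.
  apply: (@le_trans _ _ (v `^ (H * K) / 2)).
    by rewrite ler_piMl// ltW// divr_gt0.
  rewrite ler_pM2l//; move: q0 q1 a7 c0; move: (_ `^ (2 * H * K)); move: c => c' y; nra.
pose a := v `^ H; pose q := (1 - v) `^ H.
have a0 : 0 < a by rewrite powR_gt0.
have a1 : a <= 1 by apply: powR_le1; [exact: ltW|rewrite (ltW vp)].
have ov0 : 0 <= 1 - v by lra.
have q00 : 0 <= q by exact: powR_ge0.
have key : 1 - a <= q * (1 - c1 * a).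
  have := @powR_superadd v H _ H01; rewrite (ltW vp) v1 => /(_ isT).
  rewrite -/c1 -/a -/q; move=> h; nra.
have ca0 : 0 <= c1 * a by rewrite mulr_ge0// ltW.
have ca1 : c1 * a <= 1 by rewrite mulr_ile1// ltW.
have key2 : (1 - a) `^ (2 * K) <= (1 - v) `^ (2 * H * K) * (1 - K * (c1 * a) / 2).
  apply: (@le_trans _ _ ((q * (1 - c1 * a)) `^ (2 * K))).
    by apply: powR_homo => //; lra.
  rewrite powRM//; last by lra.
  have -> : q `^ (2 * K) = (1 - v) `^ (2 * H * K) by rewrite -powRrM mulrA [H * 2]mulrC.
  rewrite ler_wpM2l//; apply: (@le_trans _ _ ((1 - c1 * a) `^ K)).
    by apply: powR_exp_anti => //; [apply/andP; split; lra|lra].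
  by apply: powR_bernoulli => //; apply/andP; split.
have key3 : (1 + v `^ (2 * H)) `^ K <= 2 `^ K * v `^ (H * K) + (1 - a) `^ (2 * K).
  have -> : 1 + v `^ (2 * H) = 2 * a + (1 - a) ^+ 2.
    rewrite [2 * H]mulrC powRrM (powR_mulrn 2) ?powR_ge0// -/a; lra.
  apply: (le_trans (@powR_subadd (2 * a) ((1 - a) ^+ 2) K _ _ K01)).
  - by rewrite mulr_ge0// ltW.
  - exact: sqr_ge0.
  - rewrite powRM ?ler0n ?(ltW a0)// /a -powRrM lerD2l.
    by rewrite [in leRHS]powRrM (powR_mulrn 2) ?subr_ge0.
have cE : c * v `^ (H * K) <= (2 `^ K)^-1 * (K * c1 / 2) * a.
  apply: (@le_trans _ _ ((2 `^ K)^-1 * (K * c1 / 2) * v0 `^ (H - H * K) * v `^ (H * K))).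
    rewrite ler_pM2r ?powR_gt0// ge_min; apply/orP; right.
    rewrite ler_wpM2l ?ge_min ?lexx ?orbT//.
    by rewrite ltW// !mulr_gt0// invr_gt0.
  rewrite -mulrA ler_pM2l; last by rewrite !mulr_gt0// invr_gt0.
  have -> : a = v `^ (H - H * K) * v `^ (H * K) by rewrite -powR_addr// subrK.
  by rewrite ler_pM2r ?powR_gt0// powR_homo// ltW.
have k2K : (2 `^ K)^-1 * 2 `^ K = 1 :> R by rewrite mulVf// gt_eqF// (lt_le_trans ltr01).
have : (2 `^ K)^-1 * ((1 + v `^ (2 * H)) `^ K - (1 - v) `^ (2 * H * K)) <=
  (2 `^ K)^-1 * (2 `^ K * v `^ (H * K) - (1 - v) `^ (2 * H * K) * (K * c1 / 2 * a)).
  rewrite ler_wpM2l; [by []|exact: ltW|].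
  by move: key2 key3; move: ((1 - v) `^ _) => y; lra.
move/le_trans; apply.
rewrite mulrBr [_^-1 * (2 `^ K * _)]mulrA k2K mul1r [leRHS]mulrBr mulr1 lerD2l lerN2.
have := ler_wpM2r q0 cE.
move: (2 `^ K)^-1 ((1 - v) `^ _) (v `^ _) => i y z; clear; lra.
Qed.

Lemma bifractional_covC H K s t : bifractional_cov H K s t = bifractional_cov H K t s.
Proof. by rewrite /bifractional_cov [t `^ _ + _]addrC distrC. Qed.

Lemma bifractional_cov_ge0 H K s t : 0 < H -> 0 < K -> 0 <= s -> 0 <= t ->
  0 <= bifractional_cov H K s t.
Proof.
move=> H0 K0; wlog st : s t / s <= t => [wh s0 t0|s0 t0].
  have [st|ts] := orP (le_total s t); first exact: wh.
  by rewrite bifractional_covC wh.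
rewrite mulr_ge0 ?invr_ge0 ?powR_ge0// subr_ge0 powRrM.
apply: powR_homo; [exact: ltW|exact: powR_ge0|].
rewrite ger0_norm ?subr_ge0//; apply: (@le_trans _ _ (t `^ (2 * H))).
  by apply: powR_homo; [lra|rewrite subr_ge0|lra].
by rewrite lerDl powR_ge0.
Qed.

Lemma bifractional_cov_diag H K s : 0 < H -> 0 < K -> 0 <= s ->
  bifractional_cov H K s s = s `^ (H * K) * s `^ (H * K).
Proof.
move=> H0 K0 s0; rewrite /bifractional_cov subrr normr0 powR0 ?subr0; last first.
  by rewrite gt_eqF// !mulr_gt0.
have -> : s `^ (2 * H) + s `^ (2 * H) = 2 * s `^ (2 * H) by lra.
rewrite powRM ?powR_ge0 ?ler0n// mulKf ?gt_eqF ?powR_gt0//.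
rewrite -powRrM -expr2 -(powR_mulrn 2) ?powR_ge0// -powRrM; congr (_ `^ _); lra.
Qed.

(** By homogeneity, for s <= t the covariance is t^(2HK) times a function of the ratio s/t, to which
    the one-variable estimate applies. *)
Lemma bifractional_cov_le H K : 0 < H < 1 -> 0 < K <= 1 ->
  exists c, [/\ 0 < c, c <= 1 & forall s t, 0 < s -> 0 < t ->
    bifractional_cov H K s t <=
    s `^ (H * K) * t `^ (H * K) * (1 - c * (`|t - s| / Num.max s t) `^ (2 * H * K))].
Proof.
move=> H01 K01; have [c [c0 c1 cle]] := bifractional_corr_ratio H01 K01.
exists c; split => //; move=> s t.
wlog st : s t / s <= t => [wh s0 t0|s0 t0].
  have [st|ts] := orP (le_total s t); first exact: wh.
  by rewrite bifractional_covC distrC maxC [s `^ _ * _]mulrC wh.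
rewrite max_r// ger0_norm ?subr_ge0//.
have vE : s = t * (s / t) by rewrite mulrC divfK// gt_eqF.
set v := s / t in vE *.
have v0 : 0 < v by rewrite divr_gt0.
have v1 : v <= 1 by rewrite ler_pdivrMr// mul1r.
have -> : (t - s) / t = 1 - v by rewrite mulrBl divff// gt_eqF.
clearbody v; have := cle v; rewrite v0 v1 => /(_ isT) h.
have -> : bifractional_cov H K s t = t `^ (2 * H * K) *
    ((2 `^ K)^-1 * ((1 + v `^ (2 * H)) `^ K - (1 - v) `^ (2 * H * K))).
  rewrite /bifractional_cov ger0_norm ?subr_ge0// mulrCA; congr (_ * _).
  have -> : t - s = t * (1 - v) by rewrite mulrBr mulr1 -vE.
  have -> : t `^ (2 * H) + s `^ (2 * H) = t `^ (2 * H) * (1 + v `^ (2 * H)).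
    by rewrite vE powRM ?(ltW t0) ?(ltW v0)// mulrDr mulr1.
  rewrite !powRM ?powR_ge0 ?(ltW t0) ?subr_ge0// ?addr_ge0 ?powR_ge0//.
  by rewrite -powRrM mulrBr.
have -> : s `^ (H * K) * t `^ (H * K) = t `^ (2 * H * K) * v `^ (H * K).
  rewrite vE powRM ?(ltW t0) ?(ltW v0)// mulrAC -powR_addr//.
  by congr (_ `^ _ * _); lra.
by rewrite -[leRHS]mulrA ler_pM2l ?powR_gt0.
Qed.

End bifractional_bound.

(** * Integrals of power singularities in one variable *)

Section one_dim_kernel.
Context {R : realType}.
Implicit Types a b k s u T : R.

Lemma continuous_powR a x : 0 < x -> {for x, continuous (fun y : R => y `^ a)}.
Proof.
move=> x0; apply: differentiable_continuous; apply/derivable1_diffP.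
by have [] := is_derive1_powR a x0.
Qed.

Lemma is_derive_powR_comp (g : R -> R) a x dg : 0 < g x -> is_derive x 1 g dg ->
  is_derive x 1 (fun y => g y `^ a) (a * g x `^ (a - 1) * dg).
Proof.
move=> g0 dg1; exact: (@is_derive1_comp R (fun y => y `^ a) g x _ dg (is_derive1_powR a g0)).
Qed.

Lemma integral_itv_oc_oo (a b : R) (f : R -> \bar R) : a < b ->
  measurable_fun `]a, b] f -> (forall x, `]a, b]%classic x -> (0 <= f x)%E) ->
  (\int[lebesgue_measure]_(x in `]a, b]) f x = \int[lebesgue_measure]_(x in `]a, b[) f x)%E.
Proof.
move=> ab mf f0; rewrite -(@setUitv1 _ _ (BRight a) b true) ?bnd_simp// in mf f0 *.
rewrite ge0_integral_setU//= ?integral_set1 ?adde0//.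
by apply/disj_setPS => x [/=]; rewrite in_itv/= => /andP[_ xb] xE; move: xb; rewrite xE ltxx.
Qed.

Lemma integral_powR_le b T : 0 < b -> 0 < T ->
  (\int[lebesgue_measure]_(s in `]0%R, T]) (s `^ (b - 1))%:E <= (T `^ b / b)%:E)%E.
Proof.
move=> b0 T0; rewrite integral_itv_oc_oo//; last 2 first.
- by apply/measurable_EFinP; apply: measurable_funTS; exact: measurable_powR.
- by move=> x _; rewrite lee_fin powR_ge0.
have -> : T `^ b / b = T `^ b / b - 0 `^ b / b by rewrite powR0 ?gt_eqF// mul0r subr0.
apply: (@integral_le_antiderivative R (fun s => s `^ (b - 1)) (fun s => s `^ b / b)) => //.
- by move=> x _; exact: powR_ge0.
- by move=> x; rewrite in_itv/= => /andP[x0 _]; exact: continuous_powR.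
- move=> x /andP[x0 _].
  have h := is_deriveZ b^-1 (is_derive1_powR b x0).
  have -> : (fun s => s `^ b / b) = b^-1 \*: (fun s : R => s `^ b).
    by apply/funext => s /=; rewrite mulrC.
  by apply: is_derive_eq h _; rewrite /GRing.scale/= mulKf ?gt_eqF.
- move=> x /andP[x0 xT]; rewrite !ler_pM2r ?invr_gt0//.
  by apply/andP; split; apply: powR_homo => //; exact: ltW.
Qed.

(** The factor s^(b-1) is, up to b, the Jacobian of s -> s^b, so the kernel has an elementary
    antiderivative: the singularity at s = 0 and the one on the diagonal are integrated at once,
    uniformly in u. On the diagonal the value is set by hand, since 0^(-k) is 0 by convention. *)
Definition power_kernel b k s u : \bar R :=
  if s == u then +oo%E else (s `^ (b - 1) * `|s `^ b - u `^ b| `^ (- k))%:E.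

Lemma power_kernel_ge0 b k s u : (0 <= power_kernel b k s u)%E.
Proof. by rewrite /power_kernel; case: ifPn => // _; rewrite lee_fin mulr_ge0 ?powR_ge0. Qed.

Lemma measurable_power_kernel b k :
  measurable_fun setT (fun su : measurableTypeR R * measurableTypeR R => power_kernel b k su.1 su.2).
Proof.
apply: measurable_fun_ifT.
- rewrite (_ : (fun x => _) = (fun x : measurableTypeR R * measurableTypeR R => x.1 - x.2 == 0)).
    apply: measurable_fun_eqr => //; apply: measurable_funB; [exact: measurable_fst|exact: measurable_snd].
  by apply/funext => x; rewrite subr_eq0.
- exact: measurable_cst.
- apply/measurable_EFinP; apply: measurable_funM.
    by apply: (@measurableT_comp _ _ _ _ _ _ (fun s : R => s `^ (b - 1))); [exact: measurable_powR|exact: measurable_fst].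
  apply: (@measurableT_comp _ _ _ _ _ _ (fun s : R => s `^ (- k))); first exact: measurable_powR.
  apply: (@measurableT_comp _ _ _ _ _ _ (@Num.norm R R)); first exact: normr_measurable.
  apply: measurable_funB.
    by apply: (@measurableT_comp _ _ _ _ _ _ (fun s : R => s `^ b)); [exact: measurable_powR|exact: measurable_fst].
  by apply: (@measurableT_comp _ _ _ _ _ _ (fun s : R => s `^ b)); [exact: measurable_powR|exact: measurable_snd].
Qed.

Lemma integral_power_kernel_below b k u : 0 < b -> 0 < k < 1 -> 0 < u ->
  (\int[lebesgue_measure]_(s in `]0%R, u[) power_kernel b k s u <=
   ((u `^ b) `^ (1 - k) / (b * (1 - k)))%:E)%E.
Proof.
move=> b0 /andP[k0 k1] u0.
have e0 : 0 < 1 - k by rewrite subr_gt0.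
have be0 : 0 < b * (1 - k) by rewrite mulr_gt0.
pose g s := u `^ b - s `^ b.
have gpos s : 0 < s < u -> 0 < g s.
  by move=> /andP[s0 su]; rewrite subr_gt0 gt0_ltr_powR ?nnegrE// ltW.
pose f s := s `^ (b - 1) * g s `^ (- k).
pose F s := - (b * (1 - k))^-1 * g s `^ (1 - k).
rewrite [leLHS](_ : _ = \int[lebesgue_measure]_(s in `]0%R, u[) (f s)%:E)%E; last first.
  apply: eq_integral.
  move=> s; rewrite inE/= in_itv/= => /andP[s0 su]; rewrite /power_kernel lt_eqF//.
  by rewrite distrC ger0_norm// ltW// gpos ?s0.
have dg s : 0 < s -> is_derive s 1 g (- (b * s `^ (b - 1))).
  move=> s0; have h := is_deriveB (is_derive_cst (u `^ b) s 1) (is_derive1_powR b s0).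
  by apply: is_derive_eq h _; rewrite sub0r.
have -> : (u `^ b) `^ (1 - k) / (b * (1 - k)) = F u - F 0.
  have -> : F u = 0 by rewrite /F /g (subrr (u `^ b)) powR0 ?mulr0// gt_eqF.
  have -> : F 0 = - ((u `^ b) `^ (1 - k) / (b * (1 - k))).
    by rewrite /F /g (@powR0 _ b) ?gt_eqF// (subr0 (u `^ b)) mulNr mulrC.
  by rewrite sub0r opprK.
apply: integral_le_antiderivative => //.
- by move=> s _; rewrite mulr_ge0 ?powR_ge0.
- move=> s; rewrite in_itv/= => su; have /andP[s0 _] := su.
  apply: cvgM; first exact: continuous_powR.
  apply: (@continuous_comp _ _ _ g (fun y => y `^ (- k))); last exact: continuous_powR (gpos _ su).
  by apply: cvgB; [exact: cvg_cst|exact: continuous_powR].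
- move=> s su; have /andP[s0 _] := su.
  have h := is_deriveZ (- (b * (1 - k))^-1) (is_derive_powR_comp (1 - k) (gpos _ su) (dg s s0)).
  apply: is_derive_eq h _; rewrite /GRing.scale/= /f addrAC subrr add0r.
  have bb : (b * (1 - k))^-1 * (b * (1 - k)) = 1 by rewrite mulVf// gt_eqF.
  move: bb; move: (b * (1 - k))^-1 (g s `^ _) (s `^ _) => i x y bb.
  have -> : - i * ((1 - k) * x * - (b * y)) = i * (b * (1 - k)) * (y * x) by lra.
  by rewrite bb mul1r.
- have Fd x y : 0 <= x -> x <= y -> y <= u -> F x <= F y.
    move=> x0 xy yu; rewrite /F; apply: ler_wnM2l; first by rewrite oppr_le0 invr_ge0 ltW.
    apply: powR_homo; [exact: ltW| |].
      by rewrite subr_ge0; apply: powR_homo; [exact: ltW|exact: le_trans xy|].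
    by rewrite /g lerD2l lerN2; apply: powR_homo => //; exact: ltW.
  by move=> s /andP[s0 su]; apply/andP; split; apply: Fd => //; exact: ltW.
Qed.

Lemma integral_power_kernel_above b k u T : 0 < b -> 0 < k < 1 -> 0 < u -> u < T ->
  (\int[lebesgue_measure]_(s in `]u, T[) power_kernel b k s u <=
   ((T `^ b) `^ (1 - k) / (b * (1 - k)))%:E)%E.
Proof.
move=> b0 /andP[k0 k1] u0 uT.
have e0 : 0 < 1 - k by rewrite subr_gt0.
have be0 : 0 < b * (1 - k) by rewrite mulr_gt0.
pose g s := s `^ b - u `^ b.
have gpos s : u < s < T -> 0 < g s.
  move=> /andP[s0 su]; rewrite subr_gt0 gt0_ltr_powR ?nnegrE//; first exact: ltW.
  by rewrite ltW// (lt_trans u0).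
pose f s := s `^ (b - 1) * g s `^ (- k).
pose F s := (b * (1 - k))^-1 * g s `^ (1 - k).
rewrite [leLHS](_ : _ = \int[lebesgue_measure]_(s in `]u, T[) (f s)%:E)%E; last first.
  apply: eq_integral.
  move=> s; rewrite inE/= in_itv/= => /andP[s0 su]; rewrite /power_kernel gt_eqF//.
  by rewrite ger0_norm// ltW// gpos ?s0.
have dg s : 0 < s -> is_derive s 1 g (b * s `^ (b - 1)).
  move=> s0; have h := is_deriveB (is_derive1_powR b s0) (is_derive_cst (u `^ b) s 1).
  by apply: is_derive_eq h _; rewrite subr0.
have gd x y : u <= x -> x <= y -> g x `^ (1 - k) <= g y `^ (1 - k).
  move=> x0 xy; apply: powR_homo; [exact: ltW| |].
    by rewrite subr_ge0 powR_homo ?(ltW b0)// ltW.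
  by rewrite lerD2r powR_homo ?(ltW b0)// (le_trans (ltW u0)).
apply: (@le_trans _ _ (F T - F u)%:E); last first.
  have -> : F u = 0 by rewrite /F /g (subrr (u `^ b)) powR0 ?mulr0// gt_eqF.
  rewrite subr0 lee_fin /F mulrC; apply: ler_wpM2r; first by rewrite invr_ge0 ltW.
  apply: powR_homo; [exact: ltW| |].
    by rewrite subr_ge0 powR_homo ?(ltW b0) ?(ltW u0)// ltW.
  by rewrite lerBlDr lerDl powR_ge0.
apply: integral_le_antiderivative => //.
- by move=> s _; rewrite mulr_ge0 ?powR_ge0.
- move=> s; rewrite in_itv/= => su; have /andP[s0 _] := su.
  have sp := lt_trans u0 s0.
  apply: cvgM; first exact: continuous_powR.
  apply: (@continuous_comp _ _ _ g (fun y => y `^ (- k))); last exact: continuous_powR (gpos _ su).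
  by apply: cvgB; [exact: continuous_powR|exact: cvg_cst].
- move=> s su; have /andP[s0 _] := su.
  have sp := lt_trans u0 s0.
  have h := is_deriveZ (b * (1 - k))^-1 (is_derive_powR_comp (1 - k) (gpos _ su) (dg s sp)).
  apply: is_derive_eq h _; rewrite /GRing.scale/= /f addrAC subrr add0r.
  have bb : (b * (1 - k))^-1 * (b * (1 - k)) = 1 by rewrite mulVf// gt_eqF.
  move: bb; move: (b * (1 - k))^-1 (g s `^ _) (s `^ _) => i x y bb.
  have -> : i * ((1 - k) * x * (b * y)) = i * (b * (1 - k)) * (y * x) by lra.
  by rewrite bb mul1r.
- have Fd x y : u <= x -> x <= y -> F x <= F y.
    move=> ux xy; rewrite /F; apply: ler_wpM2l; first by rewrite invr_ge0 ltW.
    exact: gd.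
  by move=> s /andP[s0 su]; apply/andP; split; apply: Fd => //; exact: ltW.
Qed.

Lemma integral_power_kernel b k T : 0 < b -> 0 < k < 1 -> 0 < T ->
  exists C, 0 <= C /\ forall u, 0 < u <= T ->
    (\int[lebesgue_measure]_(s in `]0%R, T]) power_kernel b k s u <= C%:E)%E.
Proof.
move=> b0 k01 T0.
pose Q := (T `^ b) `^ (1 - k) / (b * (1 - k)).
have Q0 : 0 <= Q.
  by have /andP[k0 k1] := k01; rewrite divr_ge0 ?powR_ge0 ?mulr_ge0 ?subr_ge0// ltW.
exists (Q + Q); split; first by rewrite addr_ge0.
move=> u /andP[u0 uT].
have mk D : measurable D -> measurable_fun (D : set (measurableTypeR R)) (power_kernel b k ^~ u).
  move=> mD; apply: measurable_funTS.
  exact: (measurableT_comp (measurable_power_kernel b k) (measurable_pair2 u)).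
have Iu : (\int[lebesgue_measure]_(s in `]0%R, u]) power_kernel b k s u <= Q%:E)%E.
  rewrite integral_itv_oc_oo//; last 2 first.
  - by apply: mk; exact: measurable_itv.
  - by move=> x _; exact: power_kernel_ge0.
  apply: (le_trans (integral_power_kernel_below b0 k01 u0)); rewrite lee_fin.
  have /andP[k0 k1] := k01.
  have e0 : 0 <= 1 - k by rewrite subr_ge0 ltW.
  apply: ler_wpM2r; first by rewrite invr_ge0 mulr_ge0// ltW.
  by apply: powR_homo => //; [exact: powR_ge0|apply: powR_homo => //; exact: ltW].
move: uT; rewrite le_eqVlt => /predU1P[uE|uT].
  by rewrite -[X in `]_, X]]uE (le_trans Iu)// lee_fin lerDl.
have -> : `]0, T]%classic = `]0, u] `|` `]u, T] :> set R.
  by rewrite -itv_bndbnd_setU// bnd_simp ltW.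
rewrite ge0_integral_setU//=; last 3 first.
- by apply: mk; exact: measurableU.
- by move=> x _; exact: power_kernel_ge0.
- apply/disj_setPS => x [/=]; rewrite !in_itv/= => /andP[_ xu] /andP[ux _].
  by move: (lt_le_trans ux xu); rewrite ltxx.
rewrite EFinD; apply: leeD => //.
rewrite integral_itv_oc_oo//; last 2 first.
- by apply: mk; exact: measurable_itv.
- by move=> x _; exact: power_kernel_ge0.
exact: integral_power_kernel_above.
Qed.

(** The converse of [integral_powR_le], used to show that a local time at level 0 forces the
    integrability condition there. *)
Lemma integral_powR_lty a T : 0 < T ->
  (\int[lebesgue_measure]_(s in `]0%R, T]) (s `^ (- a))%:E < +oo)%E -> a < 1.
Proof.
move=> T0; apply: contraTT; rewrite -leNgt => a1; rewrite -leNgt.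
pose m := Num.min T 1.
have m0 : 0 < m by rewrite lt_min T0 ltr01.
suff -> : (\int[lebesgue_measure]_(s in `]0%R, T]) (s `^ (- a))%:E = +oo)%E by [].
apply: eq_infty => r; pose q := `|r| + 1.
have q0 : 0 < q by rewrite ltr_wpDl.
(* On [x, m] the integral of 1/s is exactly q, and s^(-a) >= 1/s there because m <= 1 <= a. *)
pose x := m * expR (- q).
have x0 : 0 < x by rewrite mulr_gt0// expR_gt0.
have xm : x < m by rewrite gtr_pMr// expR_lt1 oppr_lt0.
have inx y : x <= y <= m -> 0 < y by move=> /andP[xy _]; exact: lt_le_trans xy.
have cV y : 0 < y -> {for y, continuous (fun z : R => z^-1)}.
  by move=> y0; apply: inv_continuous; rewrite gt_eqF.
have intV : (\int[lebesgue_measure]_(s in `[x, m]) (s^-1)%:E = q%:E)%E.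
  rewrite (@continuous_FTC2 R (fun s => s^-1) (@ln R)) => [||||y yI]; first 1 last.
  - exact: xm.
  - apply: continuous_in_subspaceT => y; rewrite inE/= in_itv/= => /inx.
    exact: cV.
  - have cln y : 0 < y -> {for y, continuous (@ln R)} by move=> ?; exact: continuous_ln.
    split.
    + move=> y; rewrite in_itv/= => /andP[h1 h2].
      by have [] := is_derive1_ln (lt_trans x0 h1).
    + by apply: cvg_at_right_filter; exact: cln.
    + by apply: cvg_at_left_filter; exact: cln.
  - have y0 : 0 < y by move: yI; rewrite in_itv/= => /andP[h1 h2]; exact: lt_trans h1.
    by rewrite derive1E; have [_ ->] := is_derive1_ln y0.
  by rewrite /x lnM ?posrE ?expR_gt0// expRK -EFinB; congr (_%:E); lra.
apply: (@le_trans _ _ q%:E).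
  by rewrite lee_fin /q (le_trans (ler_norm r))// lerDl.
rewrite -intV.
have mp D : measurable_fun (D : set (measurableTypeR R)) (fun s : measurableTypeR R => (s `^ (- a))%:E).
  by apply/measurable_EFinP; apply: measurable_funTS; exact: measurable_powR.
apply: (@le_trans _ _ (\int[lebesgue_measure]_(s in `[x, m]) (s `^ (- a))%:E)%E).
  apply: ge0_le_integral => //.
  - by move=> y /=; rewrite in_itv/= => /inx y0; rewrite lee_fin invr_ge0 ltW.
  - apply/measurable_EFinP; apply: subspace_continuous_measurable_fun => //.
    by apply: continuous_in_subspaceT => y; rewrite inE/= in_itv/= => /inx; exact: cV.
  - move=> y; rewrite /= in_itv/= => yxm; have y0 := inx _ yxm; have /andP[_ ym] := yxm.
    rewrite lee_fin powRN lef_pV2 ?posrE ?powR_gt0//; apply: ge1r_powR => //.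
    by rewrite y0 (le_trans ym)// ge_min lexx orbT.
apply: ge0_subset_integral => //.
- by move=> y _; rewrite lee_fin powR_ge0.
- move=> y; rewrite /= !in_itv/= => yxm; rewrite (inx _ yxm)/=.
  by have /andP[_ ym] := yxm; rewrite (le_trans ym)// ge_min lexx.
Qed.

End one_dim_kernel.

Section box_integral.
Context {R : realType}.

(** Unlike [box], this leaves out the axes, a null set on which the variances vanish. *)
Definition posbox N (t : N.-tuple R) : set (N.-tuple R) :=
  [set s | forall j, 0 < tnth s j <= tnth t j].

Lemma measurable_posbox N (t : N.-tuple R) : measurable (posbox t).
Proof.
have := @measurable_tuple_box R N (fun j => `]0, tnth t j]%classic) (fun j => measurable_itv _).
congr (measurable _); apply/seteqP; split => x /= h j; have := h j; rewrite in_itv//.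
Qed.

Local Open Scope ereal_scope.

Lemma ge0_integral_posbox_prod N (t : N.-tuple R) (f : 'I_N -> R -> \bar R) :
  (forall i, measurable_fun setT (f i)) -> (forall i x, 0 <= f i x) ->
  \int[lebesgue_tuple N]_(x in posbox t) \prod_(i < N) f i (tnth x i) =
  \prod_(i < N) \int[lebesgue_measure]_(x in `]0%R, tnth t i]) f i x.
Proof.
move=> mf f0; under [RHS]eq_bigr do rewrite integral_mkcond.
rewrite -(@ge0_integral_tuple_prod R N (fun i => f i \_ `]0%R, tnth t i])); last 2 first.
- by move=> i; apply/(measurable_restrictT _ _).1 => //; apply: measurable_funTS.
- by move=> i x; rewrite patchE; case: ifPn.
rewrite integral_mkcond; apply: eq_integral => x _; rewrite patchE; case: ifPn => [|].
  rewrite inE => xt; apply: eq_bigr => i _; rewrite patchE mem_set//= in_itv/=; exact: xt.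
move=> xt; have [i xi] : exists i, ~ (0 < tnth x i <= tnth t i)%R.
  by apply/existsNP => h; move: xt; rewrite mem_set.
by rewrite (bigD1 i)//= patchE memNset ?mul0e//= in_itv.
Qed.

Lemma lee_prod (I : Type) (r : seq I) (f g : I -> \bar R) :
  (forall i, 0 <= f i) -> (forall i, f i <= g i) ->
  \prod_(i <- r) f i <= \prod_(i <- r) g i.
Proof.
move=> f0 fg; elim: r => [|i r IH]; first by rewrite !big_nil.
by rewrite !big_cons lee_pmul// prode_ge0.
Qed.

Lemma prod_EFin_lty (I : Type) (r : seq I) (f : I -> \bar R) :
  (forall i, 0 <= f i < +oo) -> \prod_(i <- r) f i < +oo.
Proof.
move=> fi; elim: r => [|i r IH]; first by rewrite big_nil ltry.
rewrite big_cons lte_mul_pinfty ?(andP (fi i)).1//.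
by have /andP[f0 foo] := fi i; rewrite ge0_fin_numE.
Qed.

Lemma prod_pinfty (I : finType) (f : I -> \bar R) j : (forall i, 0 < f i) -> f j = +oo ->
  \prod_(i in I) f i = +oo.
Proof.
move=> f0 fj; rewrite (bigD1 j)//= fj gt0_mulye//.
by elim/big_ind : _ => // *; exact: mule_gt0.
Qed.

End box_integral.

(** * Correlations of the sheet and an integrable kernel dominating their singularity *)

Section correlation.
Context {R : realType} {N d : nat}.
Variables (H K : 'M[R]_(d, N)).
Hypothesis H01 : forall i j, 0 < H i j < 1.
Hypothesis K01 : forall i j, 0 < K i j <= 1.

Definition sheet_sd i (s : N.-tuple R) : R := \prod_(j < N) tnth s j `^ (H i j * K i j).

Definition sheet_corr i (s u : N.-tuple R) : R :=
  \prod_(j < N) (bifractional_cov (H i j) (K i j) (tnth s j) (tnth u j) /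
    (tnth s j `^ (H i j * K i j) * tnth u j `^ (H i j * K i j))).

Let hm j : R := col_max H j * col_max K j.

Lemma col_max_ge (A : 'M[R]_(d, N)) i j : A i j <= col_max A j.
Proof. exact: (le_bigmax _ (fun i => A i j) i). Qed.

Lemma powR_sum (I : Type) (r : seq I) (w : I -> R) (x : R) : 0 < x ->
  x `^ (\sum_(i <- r) w i) = \prod_(i <- r) x `^ w i.
Proof.
move=> x0; elim: r => [|i r IH]; first by rewrite !big_nil powRr0.
by rewrite !big_cons powR_addr// IH.
Qed.

Lemma prod_powR (I : Type) (r : seq I) (f : I -> R) (p : R) : (forall i, 0 <= f i) ->
  (\prod_(i <- r) f i) `^ p = \prod_(i <- r) f i `^ p.
Proof.
move=> f0; elim: r => [|i r IH]; first by rewrite !big_nil powR1.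
by rewrite !big_cons powRM ?IH// prodr_ge0.
Qed.

Lemma prod_le_factor (I : finType) (f : I -> R) j : (forall i, 0 <= f i <= 1) ->
  \prod_(i in I) f i <= f j.
Proof.
move=> f01; rewrite (bigD1 j)//= ler_piMr//; first by have /andP[] := f01 j.
by apply: prodr_ile1 => i _; exact: f01.
Qed.

(** Relative increments only decrease when passing to powers b <= 1 and to the larger normalization
    t. This trades |s - u| for the difference of powers that [power_kernel] can integrate. *)
Let ratio_ge (b s u t : R) : 0 < b <= 1 -> 0 < s <= t -> 0 < u <= t ->
  `|s `^ b - u `^ b| / t `^ b <= `|u - s| / Num.max s u.
Proof.
move=> /andP[b0 b1]; wlog su : s u / s <= u => [wh s0 u0|/andP[s0 st] /andP[u0 ut]].
  have [su|us] := orP (le_total s u); first exact: wh.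
  by rewrite distrC maxC (distrC u); apply: wh.
have sub : s `^ b <= u `^ b by apply: powR_homo => //; exact: ltW.
rewrite max_r// ler0_norm ?subr_le0// opprB ger0_norm ?subr_ge0//.
have ub0 : 0 < u `^ b by rewrite powR_gt0.
apply: (@le_trans _ _ ((u `^ b - s `^ b) / u `^ b)).
  rewrite ler_wpM2l ?subr_ge0// lef_pV2 ?posrE ?powR_gt0//; last exact: lt_le_trans ut.
  by apply: powR_homo => //; exact: ltW.
rewrite !mulrBl !divff ?gt_eqF// lerD2l lerN2.
have -> : s `^ b / u `^ b = (s / u) `^ b.
  have {1}-> : s = s / u * u by rewrite divfK// gt_eqF.
  rewrite (powRM b (divr_ge0 (ltW s0) (ltW u0)) (ltW u0)).
  by rewrite -mulrA divff ?mulr1// gt_eqF.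
by apply: ger1_powR => //; rewrite divr_gt0//= ler_pdivrMr// mul1r.
Qed.

(* [1 - corr] is at least its worst one-coordinate factor, hence at least any
   weighted geometric mean of these factors; the weights proportional to
   [1 / hm j] make all exponents equal. *)
Lemma sheet_corr_le : (0 < N)%N -> (0 < d)%N ->
  let S := \sum_(j < N) (hm j)^-1 in
  0 < S /\
  exists c, [/\ 0 < c, c <= 1 & forall i (b : 'I_N -> R) (t s u : N.-tuple R),
    (forall j, 0 < b j <= 1) -> posbox t s -> posbox t u ->
    (forall j, tnth s j != tnth u j) ->
    0 <= sheet_corr i s u <= 1 - c * \prod_(j < N)
      (`|tnth s j `^ b j - tnth u j `^ b j| / tnth t j `^ b j) `^ (2 / S)].
Proof.
move=> N0 d0 S.
have h0 i j : 0 < H i j * K i j.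
  by have /andP[? _] := H01 i j; have /andP[? _] := K01 i j; rewrite mulr_gt0.
have hle i j : H i j * K i j <= hm j.
  have /andP[? _] := H01 i j; have /andP[? _] := K01 i j.
  by apply: ler_pM; rewrite ?col_max_ge// ltW.
have hm0 j : 0 < hm j by apply: lt_le_trans (hle (Ordinal d0) j).
have S0 : 0 < S.
  rewrite /S (bigD1 (Ordinal N0))//= ltr_pwDl ?invr_gt0//.
  by apply: sumr_ge0 => j _; rewrite invr_ge0 ltW.
split => //.
have /choice [cf cfP] : forall ij : 'I_d * 'I_N, exists c, [/\ 0 < c, c <= 1 & forall s t, 0 < s -> 0 < t ->
    bifractional_cov (H ij.1 ij.2) (K ij.1 ij.2) s t <=
    s `^ (H ij.1 ij.2 * K ij.1 ij.2) * t `^ (H ij.1 ij.2 * K ij.1 ij.2) *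
    (1 - c * (`|t - s| / Num.max s t) `^ (2 * H ij.1 ij.2 * K ij.1 ij.2))].
  by move=> [i j]; exact: bifractional_cov_le.
pose c := \prod_ij cf ij.
have c0 : 0 < c by apply: prodr_gt0 => ij _; have [] := cfP ij.
have cle ij : c <= cf ij.
  by apply: prod_le_factor => kl; have [h1 h2 _] := cfP kl; rewrite (ltW h1).
have c1 : c <= 1 by apply: le_trans (cle (Ordinal d0, Ordinal N0)) _; have [] := cfP (Ordinal d0, Ordinal N0).
exists c; split => // i b t s u b01 st ut su.
have s0 j : 0 < tnth s j by have /andP[] := st j.
have u0 j : 0 < tnth u j by have /andP[] := ut j.
have t0 j : 0 < tnth t j by have /andP[h1 h2] := st j; exact: lt_le_trans h2.
pose r j := bifractional_cov (H i j) (K i j) (tnth s j) (tnth u j) /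
    (tnth s j `^ (H i j * K i j) * tnth u j `^ (H i j * K i j)).
pose de j := `|tnth u j - tnth s j| / Num.max (tnth s j) (tnth u j).
have de0 j : 0 < de j.
  by rewrite divr_gt0 ?normr_gt0 ?subr_eq0 1?eq_sym ?su// lt_max s0.
have de1 j : de j <= 1.
  rewrite ler_pdivrMr ?lt_max ?s0// mul1r ler_norml.
  have := s0 j; have := u0 j.
  by have /orP[h|h] := le_total (tnth s j) (tnth u j); [rewrite max_r|rewrite max_l] => // ? ?; apply/andP; split; lra.
have den0 j : 0 < tnth s j `^ (H i j * K i j) * tnth u j `^ (H i j * K i j).
  by rewrite mulr_gt0// powR_gt0.
have r0 j : 0 <= r j.
  rewrite divr_ge0 ?(ltW (den0 j))//; apply: bifractional_cov_ge0.
  - by have /andP[] := H01 i j.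
  - by have /andP[] := K01 i j.
  - exact: ltW.
  - exact: ltW.
have rle j : r j <= 1 - c * de j `^ (2 * hm j).
  have [_ _ h] := cfP (i, j).
  apply: (@le_trans _ _ (1 - cf (i, j) * de j `^ (2 * H i j * K i j))).
    by rewrite ler_pdivrMr// [leRHS]mulrC; exact: h.
  rewrite lerD2l lerN2; apply: ler_pM; rewrite ?powR_ge0 ?(ltW c0)//.
  apply: powR_exp_anti; first by rewrite (ltW (de0 j)) de1.
    by rewrite -mulrA mulr_gt0.
  by rewrite -mulrA ler_pM2l.
have r1 j : 0 <= r j <= 1.
  by rewrite r0 (le_trans (rle j))// gerBl mulr_ge0 ?powR_ge0// ltW.
apply/andP; split; first by apply: prodr_ge0 => j _; exact: r0.
set x := \prod_(j < N) (_ `^ (2 / S)).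
suff : c * x <= 1 - sheet_corr i s u by lra.
set y := 1 - sheet_corr i s u.
have yle j : c * de j `^ (2 * hm j) <= y.
  have h1 : sheet_corr i s u <= r j := prod_le_factor j r1.
  by have := rle j; rewrite /y; lra.
have y0 : 0 < y by apply: lt_le_trans (yle (Ordinal N0)); rewrite mulr_gt0// powR_gt0.
pose w j := (hm j)^-1 / S.
have w0 j : 0 < w j by rewrite divr_gt0 ?invr_gt0.
have w1 : \sum_(j < N) w j = 1 by rewrite -mulr_suml divff// gt_eqF.
have -> : y = \prod_(j < N) y `^ w j by rewrite -powR_sum// w1 powRr1// ltW.
have -> : c = \prod_(j < N) c `^ w j by rewrite -powR_sum// w1 powRr1// ltW.
rewrite -big_split/=; apply: ler_prod => j _.
rewrite mulr_ge0 ?powR_ge0//=; apply: le_trans (powR_homo (ltW (w0 j)) _ (yle j)); last first.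
  by rewrite mulr_ge0 ?powR_ge0// ltW.
rewrite [leRHS]powRM ?powR_ge0 ?(ltW c0)//; apply: ler_wpM2l; first exact: powR_ge0.
rewrite -powRrM.
have -> : 2 * hm j * w j = 2 / S.
  rewrite /w; have : hm j * (hm j)^-1 = 1 by rewrite divff// gt_eqF.
  by move: (hm j)^-1 S^-1 => p q hp; rewrite -mulrA [hm j * _]mulrA hp mul1r.
apply: powR_homo; [by rewrite divr_ge0// ltW|by rewrite divr_ge0 ?powR_ge0|].
exact: ratio_ge.
Qed.

(* Off the set [s j = u j], whose corr is [1], the kernel [W] dominates
   [G s * G u * (1 - corr)^(-beta)] for the singular weights [G]. *)
Lemma corr_kernel (a : 'I_N -> R) (beta : R) (t : N.-tuple R) : (0 < N)%N -> (0 < d)%N ->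
  (forall j, 0 <= a j < 1) -> (forall j, 0 < tnth t j) ->
  0 < beta < \sum_(j < N) (2 * col_max H j * col_max K j)^-1 ->
  exists W : N.-tuple R -> N.-tuple R -> \bar R,
  [/\ measurable_fun setT (fun su => W su.1 su.2), (forall s u, 0 <= W s u)%E,
     (\int[lebesgue_tuple N]_(u in posbox t) \int[lebesgue_tuple N]_(s in posbox t) W s u < +oo)%E
   & forall s u, posbox t s -> posbox t u -> exists rb, [/\ 0 <= rb <= 1,
       rb < 1 -> forall i, 0 <= sheet_corr i s u <= rb,
       rb < 1 -> (((\prod_(j < N) tnth s j `^ (- a j))%R * (\prod_(j < N) tnth u j `^ (- a j))%R *
                 (1 - rb) `^ (- beta))%R%:E <= W s u)%E &
       rb = 1 -> W s u = +oo%E]].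
Proof.
move=> N0 d0 a01 t0 /andP[b0 bS].
have [S0 [c [c0 c1 cP]]] := sheet_corr_le N0 d0.
set S := \sum_(j < N) _ in S0 cP.
have SE : \sum_(j < N) (2 * col_max H j * col_max K j)^-1 = S / 2.
  rewrite mulr_suml; apply: eq_bigr => j _; rewrite -mulrA -/(hm j).
  by rewrite invfM mulrC.
rewrite SE in bS.
(* Raising the bound of [sheet_corr_le] to the power -beta leaves the exponent -k in each
   coordinate; k < 1 is exactly the upper bound assumed on [beta]. *)
pose k := 2 * beta / S.
have k01 : 0 < k < 1.
  apply/andP; split; first by rewrite divr_gt0// mulr_gt0.
  by rewrite ltr_pdivrMr// mul1r; lra.
(* With this b the weight s^(-a) is the factor s^(b-1) of [power_kernel]. *)
pose b j := 1 - a j.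
have b01 j : 0 < b j <= 1.
  by have /andP[h1 h2] := a01 j; rewrite /b; apply/andP; split; lra.
have bp j : 0 < b j by have /andP[] := b01 j.
pose C' := c `^ (- beta) * \prod_(j < N) (tnth t j `^ b j) `^ k.
have C'0 : 0 < C'.
  by rewrite mulr_gt0 ?powR_gt0// prodr_gt0// => j _; rewrite !powR_gt0.
pose f j x y : \bar R := (power_kernel (b j) k x y * (y `^ (b j - 1))%:E)%E.
have f0 j x y : (0 <= f j x y)%E.
  by rewrite mule_ge0 ?power_kernel_ge0// lee_fin powR_ge0.
pose W (s u : N.-tuple R) := (C'%:E * \prod_(j < N) f j (tnth s j) (tnth u j))%E.
have W0 s u : (0 <= W s u)%E.
  by rewrite mule_ge0 ?lee_fin ?(ltW C'0)// prode_ge0.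
have mf j : measurable_fun setT (fun xy : measurableTypeR R * measurableTypeR R => f j xy.1 xy.2).
  apply: emeasurable_funM; first exact: measurable_power_kernel.
  apply/measurable_EFinP.
  by apply: (@measurableT_comp _ _ _ _ _ _ (fun y : R => y `^ (b j - 1))); [exact: measurable_powR|exact: measurable_snd].
have mW : measurable_fun setT (fun su : N.-tuple R * N.-tuple R => W su.1 su.2).
  apply: emeasurable_funM; first exact: measurable_cst.
  apply: emeasurable_prod => j.
  apply: (@measurableT_comp _ _ _ _ _ _ _ _ (fun su : N.-tuple R * N.-tuple R => (tnth su.1 j : measurableTypeR R, tnth su.2 j : measurableTypeR R)) (mf j)).
  apply/measurable_fun_pairP; split.
    by apply: (@measurableT_comp _ _ _ _ _ _ (fun s : N.-tuple R => tnth s j)); [exact: measurable_tnth|exact: measurable_fst].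
  by apply: (@measurableT_comp _ _ _ _ _ _ (fun s : N.-tuple R => tnth s j)); [exact: measurable_tnth|exact: measurable_snd].
exists W; split => //.
- have /choice [Cf CfP] : forall j, exists C, 0 <= C /\ forall u, 0 < u <= tnth t j ->
    (\int[lebesgue_measure]_(s in `]0%R, tnth t j]) power_kernel (b j) k s u <= C%:E)%E.
    by move=> j; exact: integral_power_kernel.
  have intW u : posbox t u -> (\int[lebesgue_tuple N]_(s in posbox t) W s u <=
    C'%:E * \prod_(j < N) ((Cf j)%:E * (tnth u j `^ (b j - 1))%:E))%E.
    move=> ut; rewrite ge0_integralZl//; last 4 first.
    - exact: measurable_posbox.
    - apply: measurable_funTS; apply: (@measurable_tuple_prod R N (fun j x => f j x (tnth u j))) => j.
      exact: (measurableT_comp (mf j) (measurable_pair2 (tnth u j : measurableTypeR R))).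
    - by move=> s _; exact: prode_ge0.
    - by rewrite lee_fin ltW.
    rewrite lee_pmul2l//.
    rewrite (@ge0_integral_posbox_prod R N t (fun j x => f j x (tnth u j))) => [||//]; last first.
      by move=> j; exact: (measurableT_comp (mf j) (measurable_pair2 (tnth u j : measurableTypeR R))).
    apply: lee_prod => j; first by apply: integral_ge0.
    rewrite ge0_integralZr//; last 3 first.
    - apply: measurable_funTS.
      exact: (measurableT_comp (measurable_power_kernel (b j) k) (measurable_pair2 (tnth u j : measurableTypeR R))).
    - by move=> x _; exact: power_kernel_ge0.
    - by rewrite lee_fin powR_ge0.
    apply: lee_wpmul2r; first by rewrite lee_fin powR_ge0.
    by apply: (CfP j).2; exact: ut.
  have mg j : measurable_fun setT (fun y : R => (Cf j)%:E * (y `^ (b j - 1))%:E)%E.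
    by apply/measurable_EFinP; apply: measurable_funM => //; exact: measurable_powR.
  have g0 j (y : R) : (0 <= (Cf j)%:E * (y `^ (b j - 1))%:E)%E.
    by rewrite -EFinM lee_fin mulr_ge0 ?powR_ge0//; have [] := CfP j.
  apply: (@le_lt_trans _ _ (\int[lebesgue_tuple N]_(u in posbox t)
     (C'%:E * \prod_(j < N) ((Cf j)%:E * (tnth u j `^ (b j - 1))%:E)))%E).
    apply: ge0_le_integral => //.
    - exact: measurable_posbox.
    - by move=> u _; exact: integral_ge0.
    - apply: measurable_funTS.
      under eq_fun do rewrite integral_mkcond.
      have mW2 : measurable_fun setT (fun us : N.-tuple R * N.-tuple R => ((W ^~ us.1) \_ (posbox t)) us.2).
        rewrite (_ : (fun _ => _) = (fun us => W us.2 us.1) \_ (setT `*` posbox t)); last first.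
          apply/funext => us; rewrite !patchE; congr (if _ then _ else _).
          by apply/idP/idP; rewrite !inE => h; [split|case: h].
        apply/(measurable_restrictT _ _).1; first exact: measurableX (measurable_posbox t).
        apply: measurable_funTS.
        exact: (measurableT_comp mW (@measurable_swap _ _ _ _)).
      apply: (measurable_fun_fubini_tonelli_F (m2 := lebesgue_tuple N) _ mW2) => us.
      by rewrite patchE; case: ifPn.
    - apply: measurable_funTS; apply: emeasurable_funM; first exact: measurable_cst.
      exact: (@measurable_tuple_prod R N (fun j y => (Cf j)%:E * (y `^ (b j - 1))%:E)%E).
  rewrite ge0_integralZl//; last 4 first.
  - exact: measurable_posbox.
  - apply: measurable_funTS.
    exact: (@measurable_tuple_prod R N (fun j y => (Cf j)%:E * (y `^ (b j - 1))%:E)%E).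
  - by move=> u _; exact: prode_ge0.
  - by rewrite lee_fin ltW.
  rewrite (@ge0_integral_posbox_prod R N t (fun j y => (Cf j)%:E * (y `^ (b j - 1))%:E)%E)//.
  rewrite lte_mul_pinfty ?lee_fin ?(ltW C'0)//.
  apply: prod_EFin_lty => j; rewrite integral_ge0//= ge0_integralZl//; last 3 first.
  - by apply/measurable_EFinP; apply: measurable_funTS; exact: measurable_powR.
  - by move=> x _; rewrite lee_fin powR_ge0.
  - by rewrite lee_fin; have [] := CfP j.
  rewrite lte_mul_pinfty ?lee_fin//; first by have [] := CfP j.
  exact: le_lt_trans (integral_powR_le (bp j) (t0 j)) (ltry _).
- move=> s u st ut.
  have s0 j : 0 < tnth s j by have /andP[] := st j.
  have u0 j : 0 < tnth u j by have /andP[] := ut j.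
  (* If s and u share a coordinate, one factor of [W] is infinite and the others are positive, so
     [rb = 1] is a valid choice. *)
  have [[j sj]|/forallNP su] := pselect (exists j, tnth s j = tnth u j).
    exists 1; rewrite ltxx ler01 lexx; split => // _.
    rewrite /W (prod_pinfty (j := j)) ?gt0_muley ?lte_fin//.
      move=> i; rewrite /f; apply: mule_gt0; rewrite ?lte_fin ?powR_gt0//.
      rewrite /power_kernel; case: ifPn => // siui; rewrite lte_fin mulr_gt0 ?powR_gt0//.
      rewrite normr_gt0 subr_eq0; apply: contra siui => /eqP h; apply/eqP.
      have := congr1 (fun x => x `^ (b i)^-1) h.
      by rewrite -!powRrM divff ?gt_eqF// !powRr1// ltW.
    by rewrite /f /power_kernel sj eqxx gt0_mulye// lte_fin powR_gt0.
  have su' j : tnth s j != tnth u j by apply/eqP; exact: su.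
  pose x j := `|tnth s j `^ b j - tnth u j `^ b j|.
  have x0 j : 0 < x j.
    rewrite normr_gt0 subr_eq0; apply: contra (su' j) => /eqP h; apply/eqP.
    have := congr1 (fun x => x `^ (b j)^-1) h.
    by rewrite -!powRrM divff ?gt_eqF// !powRr1// ltW.
  have tb0 j : 0 < tnth t j `^ b j by rewrite powR_gt0.
  pose p := \prod_(j < N) (x j / tnth t j `^ b j) `^ (2 / S).
  have p0 : 0 < p by apply: prodr_gt0 => j _; rewrite powR_gt0// divr_gt0.
  have cp i : 0 <= sheet_corr i s u <= 1 - c * p by apply: cP.
  have cp0 : 0 < c * p by rewrite mulr_gt0.
  exists (1 - c * p); split.
  + have /andP[h1 h2] := cp (Ordinal d0); apply/andP; split; last lra.
    exact: le_trans h2.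
  + by [].
  + move=> _; rewrite subKr /W.
    have fE j : f j (tnth s j) (tnth u j) =
       (tnth s j `^ (- a j) * x j `^ (- k) * tnth u j `^ (- a j))%:E.
      by rewrite /f /power_kernel (negbTE (su' j)) -EFinM /b addrAC subrr add0r.
    under [in leRHS]eq_bigr do rewrite fE.
    rewrite prodEFin -EFinM lee_fin !big_split/= [(c * p) `^ _]powRM ?(ltW c0) ?(ltW p0)//.
    have -> : p `^ (- beta) = (\prod_(j < N) (tnth t j `^ b j) `^ k) * \prod_(j < N) x j `^ (- k).
      rewrite -big_split/= /p prod_powR; last by move=> j; exact: powR_ge0.
      apply: eq_bigr => j _; rewrite -powRrM.
      have -> : 2 / S * - beta = - k by rewrite /k; move: S^-1 => q; lra.
      rewrite powRM ?(ltW (x0 j)) ?invr_ge0 ?(ltW (tb0 j))// mulrC; congr (_ * _).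
      by rewrite -(powR_inv1 (ltW (tb0 j))) -powRrM mulN1r opprK.
    rewrite /C'; move: (c `^ (- beta)) (\prod_(j < N) (tnth t j `^ b j) `^ k) => q1 q2.
    move: (\prod_(j < N) tnth s j `^ (- a j)) (\prod_(j < N) x j `^ (- k)) => q3 q4.
    by move: (\prod_(j < N) tnth u j `^ (- a j)) => q5; lra.
  + by move=> h; have := cp0; rewrite -[c * p](subKr 1) h subrr ltxx.
Qed.

End correlation.

(** * Independence *)

Section transfer.
Local Open Scope ereal_scope.
Import HBNNSimple.
Context {R : realType} {d' : measure_display} {T' : measurableType d'}.

Let sfun_integral d (T : measurableType d) (mu : {measure set T -> \bar R}) (X : T -> T') (g : T -> R)
    (f : {nnsfun T' >-> R}) :
  measurable_fun setT X -> measurable_fun setT g -> (forall x, 0 <= g x)%R ->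
  \int[mu]_x ((f (X x))%:E * (g x)%:E) =
  \sum_(y \in range f) (y%:E * \int[mu]_(x in X @^-1` (f @^-1` [set y])) (g x)%:E).
Proof.
move=> mX mg g0.
have mB y : measurable (X @^-1` (f @^-1` [set y])).
  by rewrite -[X in measurable X]setTI; apply: mX.
have mi y : measurable_fun setT (fun x => \1_(f @^-1` [set y]) (X x) : R).
  by apply: (measurableT_comp _ mX); exact: measurable_indic.
under eq_integral => x _.
  rewrite fimfunE -fsumEFin// ge0_mule_fsuml; last by move=> r; rewrite nnfun_muleindic_ge0.
  over.
rewrite ge0_integral_fsum//; last 2 first.
- move=> y; apply: emeasurable_funM; last exact/measurable_EFinP.
  by apply/measurable_EFinP/measurable_funM.
- by move=> y x _; rewrite mule_ge0 ?nnfun_muleindic_ge0 ?lee_fin.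
apply: eq_fsbigr => r /[!inE] -[x _ <-].
under eq_integral do rewrite EFinM -muleA.
rewrite ge0_integralZl//; last 3 first.
- by apply: emeasurable_funM; exact/measurable_EFinP.
- by move=> y _; rewrite mule_ge0// lee_fin.
- by rewrite lee_fin.
congr (_ * _); rewrite [RHS]integral_mkcond; apply: eq_integral => y _.
rewrite patchE indicE.
rewrite (_ : (X y \in f @^-1` [set f x]) = (y \in X @^-1` (f @^-1` [set f x]))); last first.
  by apply/idP/idP; rewrite !inE.
by case: ifPn => /=; [rewrite mul1e|rewrite mul0e].
Qed.

(** The weighted measures have the same image; approximation by simple functions extends this from
    sets to nonnegative functions, without building the weighted measures themselves. *)
Lemma ge0_integral_transfer d1 d2 (T1 : measurableType d1) (T2 : measurableType d2)
    (mu1 : {measure set T1 -> \bar R}) (mu2 : {measure set T2 -> \bar R})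
    (X1 : T1 -> T') (X2 : T2 -> T') (g1 : T1 -> R) (g2 : T2 -> R) (f : T' -> \bar R) :
  measurable_fun setT X1 -> measurable_fun setT X2 ->
  measurable_fun setT g1 -> measurable_fun setT g2 ->
  (forall x, 0 <= g1 x)%R -> (forall x, 0 <= g2 x)%R ->
  (forall A, measurable A ->
    \int[mu1]_(x in X1 @^-1` A) (g1 x)%:E = \int[mu2]_(x in X2 @^-1` A) (g2 x)%:E) ->
  measurable_fun setT f -> (forall x, 0 <= f x) ->
  \int[mu1]_x (f (X1 x) * (g1 x)%:E) = \int[mu2]_x (f (X2 x) * (g2 x)%:E).
Proof.
move=> mX1 mX2 mg1 mg2 g10 g20 E mf f0.
pose f_ := nnsfun_approx measurableT mf.
have cv x : (f_ n x)%:E @[n --> \oo] --> f x by apply: cvg_nnsfun_approx => // y _.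
have half d (T : measurableType d) (mu : {measure set T -> \bar R}) (X : T -> T') (g : T -> R) :
  measurable_fun setT X -> measurable_fun setT g -> (forall x, 0 <= g x)%R ->
  \int[mu]_x (f (X x) * (g x)%:E) = limn (fun n => \int[mu]_x ((f_ n (X x))%:E * (g x)%:E)).
  move=> mX mg g0; rewrite -monotone_convergence//.
  - apply: eq_integral => x _; apply/esym/cvg_lim => //.
    by apply: cvgeMr => //; exact: cv.
  - move=> n; apply: emeasurable_funM; apply/measurable_EFinP => //.
    exact: measurableT_comp.
  - by move=> n x _; rewrite mule_ge0// lee_fin.
  - by move=> x _ a b ab; rewrite lee_wpmul2r ?lee_fin//; exact/lefP/nd_nnsfun_approx.
rewrite !half//; congr (limn _); apply/funext => n; rewrite !sfun_integral//.
by apply: eq_fsbigr => y _; rewrite E.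
Qed.

End transfer.

Section independence.
Context {R : realType} {d0 : measure_display} {T : measurableType d0}
  (P : probability T R) (d : nat) (G : 'I_d -> set (set T)).
Hypothesis Gm : forall i A, G i A -> measurable A.
Hypothesis indep : forall A : 'I_d -> set T, (forall i, G i (A i)) ->
  P (\bigcap_i A i) = (\prod_(i < d) P (A i))%E.

Definition Gmeas i (Z : T -> R) := forall U : set (measurableTypeR R), measurable U -> G i (Z @^-1` U).

Lemma Gmeas_comp i Z (g : R -> R) : measurable_fun setT (g : measurableTypeR R -> measurableTypeR R) ->
  Gmeas i Z -> Gmeas i (g \o Z).
Proof.
by move=> mg mZ U mU; apply: (mZ (g @^-1` U)); rewrite -[X in measurable X]setTI; apply: mg.
Qed.

Lemma Gmeas_measurable i Z : Gmeas i Z -> measurable_fun setT Z.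
Proof. by move=> mZ _ U mU; rewrite setTI; apply: (Gm (i := i)); exact: mZ. Qed.

Local Open Scope ereal_scope.

Lemma ge0_indep_prod (Z : 'I_d -> T -> R) : (forall i, Gmeas i (Z i)) ->
  (forall i w, 0 <= Z i w)%R -> (forall i, \int[P]_w (Z i w)%:E < +oo) ->
  \int[P]_w (\prod_(i < d) Z i w)%:E = \prod_(i < d) \int[P]_w (Z i w)%:E.
Proof.
move=> mZ Z0 iZ.
have mZ' i : measurable_fun setT (Z i) := Gmeas_measurable (mZ i).
(* Hybrid argument: the first k factors are the variables, the others indicators of events of their
   sigma-algebras. Turning one indicator into a variable is an instance of
   [ge0_integral_transfer]. *)
pose F k (A : 'I_d -> set T) (i : 'I_d) w : R := if (i < k)%N then Z i w else \1_(A i) w.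
pose M k (A : 'I_d -> set T) (i : 'I_d) := if (i < k)%N then \int[P]_w (Z i w)%:E else P (A i).
have claim k : (k <= d)%N -> forall A, (forall i, G i (A i)) ->
    \int[P]_w (\prod_(i < d) F k A i w)%:E = \prod_(i < d) M k A i.
  elim: k => [_ A GA|k IH kd A GA].
    transitivity (\int[P]_w (\1_(\bigcap_i A i) w)%:E).
      apply: eq_integral => w _; congr (_%:E); rewrite /F /= indicE.
      have [wA|wA] := boolP (w \in _).
        by rewrite big1// => i _; rewrite indicE mem_set//; move: wA; rewrite inE => /(_ i); apply.
      have [i wi] : exists i, ~ A i w.
        by apply/existsNP => h; move: wA; rewrite mem_set// => i _; exact: h.
      by rewrite (bigD1 i)//= indicE memNset// mul0r.
    rewrite integral_indic//; last by apply: fin_bigcap_measurable => // i _; exact: Gm (GA i).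
    by rewrite setIT; exact: indep.
  pose i0 := Ordinal kd.
  pose W w := (\prod_(i < d | i != i0) F k.+1 A i w)%R.
  pose c := \prod_(i < d | i != i0) M k.+1 A i.
  have M0 i : 0 <= M k.+1 A i.
    by rewrite /M; case: ifP => _; [apply: integral_ge0 => w _; rewrite lee_fin|].
  have Mfin i : M k.+1 A i \is a fin_num.
    rewrite ge0_fin_numE// /M; case: ifP => _ //.
    by rewrite (le_lt_trans (probability_le1 P (Gm (GA i))))// ltry.
  have c0 : 0 <= c by apply: prode_ge0.
  have cfin : c \is a fin_num by elim/big_ind : c {c0} => // x y; exact: fin_numM.
  have mF i : measurable_fun setT (F k.+1 A i).
    by rewrite /F; case: (i < k.+1)%N; [exact: mZ'|apply: measurable_indic; exact: Gm (GA i)].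
  have F0 i w : (0 <= F k.+1 A i w)%R by rewrite /F; case: ifP.
  have mW : measurable_fun setT W.
    rewrite /W; under eq_fun do rewrite big_mkcond/=.
    by apply: measurable_prod => i _; case: (i != i0); [exact: mF|exact: measurable_cst].
  have W0 w : (0 <= W w)%R by apply: prodr_ge0.
  have eqi i : i != i0 -> (i < k.+1)%N = (i < k)%N.
    by move=> ii0; rewrite ltnS leq_eqVlt orbC; case: ltnP => //= _; apply/negbTE.
  transitivity (\int[P]_w ((Z i0 w)%:E * (W w)%:E)).
    apply: eq_integral => w _; rewrite -EFinM (bigD1 i0)//= /F ltnSn; congr ((_ * _)%:E).
  rewrite (bigD1 i0)//= -/c.
  have pos (x : R) : (0 <= x)%R -> (`|x|)%R = x by move=> ?; rewrite ger0_norm.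
  (* The transferred function must be nonnegative on all reals, so the absolute value stands in for
     the identity. *)
  pose nrm (x : measurableTypeR R) : \bar R := (`|x : R|%R)%:E.
  transitivity (\int[P]_w (nrm (Z i0 w) * (W w)%:E)).
    by apply: eq_integral => w _; rewrite /nrm pos.
  rewrite (@ge0_integral_transfer R _ (measurableTypeR R) _ _ T T P P (Z i0) (Z i0) W (cst (fine c)) nrm)//; last 3 first.
  - move=> U mU; pose A' i := if i == i0 then Z i0 @^-1` U else A i.
    have GA' i : G i (A' i) by rewrite /A'; case: eqP => [->|_] //; exact: mZ.
    have := IH (ltnW kd) A' GA'; rewrite (bigD1 (F := M k A') i0)//=.
    have -> : M k A' i0 = P (Z i0 @^-1` U) by rewrite /M ltnn /A' eqxx.
    have -> : \prod_(i < d | i != i0) M k A' i = c.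
      by apply: eq_bigr => i ii0; rewrite /M /A' eqi// (negbTE ii0).
    have mZU : measurable (Z i0 @^-1` U) by apply: (Gm (i := i0)); exact: mZ.
    rewrite integral_cst// fineK// [c * _]muleC => <-.
    rewrite integral_mkcond; apply: eq_integral => w _.
    rewrite patchE (bigD1 i0)//= {1}/F ltnn /A' eqxx indicE.
    have -> : (\prod_(i < d | i != i0) F k A' i w)%R = W w.
      by apply: eq_bigr => i ii0; rewrite /F /A' eqi// (negbTE ii0).
    by case: ifP => _; rewrite ?mul1r ?mul0r.
  - by apply/measurable_EFinP; exact: normr_measurable.
  - by move=> x; rewrite lee_fin.
  under eq_integral do rewrite /= fineK//.
  rewrite ge0_integralZr//; last 2 first.
  - by apply/measurable_EFinP; apply: (measurableT_comp (@normr_measurable R setT)); exact: mZ'.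
  - by move=> w _; rewrite lee_fin.
  rewrite /M ltnSn; congr (_ * _); by apply: eq_integral => w _; rewrite /nrm pos.
  exact: mZ'.
  exact: mZ'.
  by move=> w; rewrite /= fine_ge0.
have := claim d (leqnn d) (fun i => Z i @^-1` setT) (fun i => mZ i setT measurableT).
rewrite /F /M; under eq_integral do under eq_bigr do rewrite ltn_ord.
by under [RHS]eq_bigr do rewrite ltn_ord.
Qed.

Lemma indep_prod_integrable (Z : 'I_d -> T -> R) : (forall i, Gmeas i (Z i)) ->
  (forall i, P.-integrable setT (EFin \o Z i)) ->
  P.-integrable setT (EFin \o (fun w => \prod_(i < d) Z i w)%R).
Proof.
move=> mZ iZ; apply/integrableP; split.
  apply/measurable_EFinP; apply: measurable_prod => i _; exact: Gmeas_measurable (mZ i).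
under eq_integral do rewrite /= normr_prod.
rewrite (ge0_indep_prod (Z := fun i w => `|Z i w|%R))//.
- apply: prod_EFin_lty => i; rewrite integral_ge0//=.
  by have /integrableP[_] := iZ i.
- by move=> i; apply: (Gmeas_comp (g := Num.norm)) => //; exact: normr_measurable.
- by move=> i; have /integrableP[_] := iZ i.
Qed.

Lemma indep_prod (Z : 'I_d -> T -> R) : (forall i, Gmeas i (Z i)) ->
  (forall i, P.-integrable setT (EFin \o Z i)) ->
  (\int[P]_w (\prod_(i < d) Z i w) = \prod_(i < d) \int[P]_w Z i w)%R.
Proof.
move=> mZ iZ.
(* Induction on the number k of leading factors of unknown sign; in the step, the last of them is
   split into its positive and negative parts. *)
have claim k : (k <= d)%N -> forall Z : 'I_d -> T -> R, (forall i, Gmeas i (Z i)) ->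
  (forall i, P.-integrable setT (EFin \o Z i)) ->
  (forall (i : 'I_d) w, (k <= i)%N -> 0 <= Z i w)%R ->
  (\int[P]_w (\prod_(i < d) Z i w) = \prod_(i < d) \int[P]_w Z i w)%R.
  elim: k => [_ {}Z {}mZ {}iZ Z0|k IH kd {}Z {}mZ {}iZ Z0].
    rewrite /Rintegral ge0_indep_prod//; last 2 first.
    - by move=> i w; exact: Z0.
    - move=> i; have /integrableP[_] := iZ i; congr (_ < _).
      by apply: eq_integral => w _ /=; rewrite ger0_norm ?Z0.
    have fin i : \int[P]_w (Z i w)%:E \is a fin_num.
      exact: (integrable_fin_num measurableT (iZ i)).
    elim: (index_enum _) => [|i r IH]; first by rewrite !big_nil.
    by rewrite !big_cons fineM ?IH//; elim/big_ind : _ => // x y; exact: fin_numM.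
  pose i0 := Ordinal kd.
  pose Zp i w := if i == i0 then Num.max (Z i w) 0%R else Z i w.
  pose Zn i w := if i == i0 then Num.max (- Z i w)%R 0%R else Z i w.
  have mp : forall i, Gmeas i (Zp i).
    move=> i; rewrite /Zp; case: eqP => _ //.
    apply: (Gmeas_comp (g := fun x => Num.max x 0%R)) => //.
    by apply: measurable_maxr.
  have mn : forall i, Gmeas i (Zn i).
    move=> i; rewrite /Zn; case: eqP => _ //.
    apply: (Gmeas_comp (g := fun x => Num.max (- x) 0%R)%R) => //.
    by apply: measurable_maxr => //; exact: measurable_oppr.
  have ip i : P.-integrable setT (EFin \o Zp i).
    apply: le_integrable (iZ i) => //; first by apply/measurable_EFinP; exact: Gmeas_measurable (mp i).
    move=> w _; rewrite /= lee_fin /Zp; case: eqP => // _.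
    by case: (leP (Z i w) 0%R) => h; rewrite ?normr0 ?normr_ge0.
  have iN i : P.-integrable setT (EFin \o Zn i).
    apply: le_integrable (iZ i) => //; first by apply/measurable_EFinP; exact: Gmeas_measurable (mn i).
    move=> w _; rewrite /= lee_fin /Zn; case: eqP => // _.
    by case: (leP (- Z i w)%R 0%R) => h; rewrite ?normr0 ?normrN ?normr_ge0.
  have ge0k (Y : 'I_d -> T -> R) : (forall w, 0 <= Y i0 w)%R -> (forall i, i != i0 -> Y i = Z i) ->
      forall (i : 'I_d) w, (k <= i)%N -> (0 <= Y i w)%R.
    move=> Y0 YZ i w ki; have [->//|ii0] := eqVneq i i0.
    by rewrite YZ// Z0// ltn_neqAle ki andbT eq_sym.
  have p0 (i : 'I_d) w : (k <= i)%N -> (0 <= Zp i w)%R.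
    apply: ge0k => [v|j ji]; first by rewrite /Zp eqxx le_max lexx orbT.
    by apply/funext => v; rewrite /Zp (negbTE ji).
  have n0 (i : 'I_d) w : (k <= i)%N -> (0 <= Zn i w)%R.
    apply: ge0k => [v|j ji]; first by rewrite /Zn eqxx le_max lexx orbT.
    by apply/funext => v; rewrite /Zn (negbTE ji).
  have ZE w : Z i0 w = (Zp i0 w - Zn i0 w)%R.
    by rewrite /Zp /Zn eqxx; case: (leP (Z i0 w) 0%R); case: (leP (- Z i0 w)%R 0%R); lra.
  have rest (Y : 'I_d -> T -> R) w : (forall i, i != i0 -> Y i = Z i) ->
     (\prod_(i < d | i != i0) Y i w = \prod_(i < d | i != i0) Z i w)%R.
    by move=> YZ; apply: eq_bigr => i /YZ ->.
  have restI (Y : 'I_d -> T -> R) : (forall i, i != i0 -> Y i = Z i) ->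
     (\prod_(i < d | i != i0) \int[P]_w Y i w = \prod_(i < d | i != i0) \int[P]_w Z i w)%R.
    by move=> YZ; apply: eq_bigr => i /YZ ->.
  have Zpi i : i != i0 -> Zp i = Z i by move=> ii; apply/funext => w; rewrite /Zp (negbTE ii).
  have Zni i : i != i0 -> Zn i = Z i by move=> ii; apply/funext => w; rewrite /Zn (negbTE ii).
  rewrite (bigD1 i0)//=.
  transitivity (\int[P]_w (\prod_(i < d) Zp i w - \prod_(i < d) Zn i w))%R.
    apply: eq_Rintegral => w _; rewrite (bigD1 i0)//= [X in _ = (X - _)%R](bigD1 i0)//= [X in _ = (_ - X)%R](bigD1 i0)//=.
    rewrite (rest Zp)// (rest Zn)//.
    by rewrite ZE mulrBl.
  rewrite RintegralB//; [|exact: indep_prod_integrable|exact: indep_prod_integrable].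
  rewrite !IH ?(ltnW kd)// [X in (X - _)%R](bigD1 i0)//= [X in (_ - X)%R](bigD1 i0)//= (restI Zp)// (restI Zn)// -mulrBl; congr (_ * _)%R.
  rewrite -RintegralB//.
  by apply: eq_Rintegral => w _; rewrite ZE.
by apply: (claim d) => // i w; rewrite leqNgt ltn_ord.
Qed.

End independence.

(** * Averages of square-integrable fields *)

Section param_integral.
Context {R : realType} {dS : measure_display} {S : measurableType dS}
  (nu : {finite_measure set S -> \bar R})
  {dT : measure_display} {T : measurableType dT} (P : probability T R).
Implicit Types X Y : S -> T -> R.

Definition pint X w : R := \int[nu]_s X s w.

(** Joint measurability and second moments bounded uniformly in s are what Fubini's theorem asks
    for, [nu] being finite. *)
Definition L2field X := measurable_fun setT (fun sw : S * T => X sw.1 sw.2) /\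
  exists c : R, forall s, (\int[P]_w (X s w ^+ 2)%:E <= c%:E)%E.

Local Notation L2 := (L2 P).
Local Notation ip := (ip P).
Local Notation sq := (sq P).

Lemma finite_measure_lty : (nu setT < +oo)%E.
Proof. exact: fin_num_fun_lty. Qed.

(** The left-hand side is the double integral of f(s)f(u) <= (f(s)^2 + f(u)^2)/2; this route allows
    infinite integrals. *)
Lemma integral_sqr_le (f : S -> R) : measurable_fun setT f -> (forall s, 0 <= f s) ->
  ((\int[nu]_s (f s)%:E) * (\int[nu]_s (f s)%:E) <= nu setT * \int[nu]_s (f s ^+ 2)%:E)%E.
Proof.
move=> mf f0.
have mfE : measurable_fun setT (EFin \o f) by exact/measurable_EFinP.
have m2 : measurable_fun setT (fun s => (f s ^+ 2)%:E).
  by apply/measurable_EFinP; exact: measurable_funX.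
set F := (\int[nu]_s (f s)%:E)%E; set Q := (\int[nu]_s (f s ^+ 2)%:E)%E.
have F0 : (0 <= F)%E by apply: integral_ge0 => s _; rewrite lee_fin.
have Q0 : (0 <= Q)%E by apply: integral_ge0 => s _; rewrite lee_fin sqr_ge0.
have V0 : (0 <= nu setT)%E by [].
have h0 s : (0 <= ((1 / 2 * f s ^+ 2)%:E))%E by rewrite lee_fin mulr_ge0 ?sqr_ge0.
have mh : measurable_fun setT (fun s => (1 / 2 * f s ^+ 2)%:E).
  by apply/measurable_EFinP; apply: measurable_funM => //; exact: measurable_funX.
have hQ : (\int[nu]_s (1 / 2 * f s ^+ 2)%:E = (1 / 2)%:E * Q)%E.
  by under eq_integral do rewrite EFinM; rewrite ge0_integralZl// ?lee_fin// => s _; rewrite lee_fin sqr_ge0.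
have -> : (F * F = \int[nu]_s ((f s)%:E * F))%E.
  rewrite ge0_integralZr//.
  by move=> s _; rewrite lee_fin.
apply: (@le_trans _ _ (\int[nu]_s ((1 / 2 * f s ^+ 2)%:E * nu setT + (1 / 2)%:E * Q))%E).
  apply: ge0_le_integral => //.
  - by move=> s _; rewrite mule_ge0// lee_fin.
  - by apply: emeasurable_funM => //; exact: measurable_cst.
  - by apply: emeasurable_funD; [apply: emeasurable_funM => //|]; exact: measurable_cst.
  - move=> s _; rewrite -hQ -integral_cst// -ge0_integralD//; last first.
      by move=> u _; rewrite /= lee_fin mulr_ge0 ?sqr_ge0.
    rewrite -ge0_integralZl ?lee_fin// => [|u _]; last by rewrite lee_fin.
    apply: ge0_le_integral => //.
    + by move=> u _; rewrite mule_ge0// lee_fin.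
    + by apply: emeasurable_funM => //; exact: measurable_cst.
    + by apply: emeasurable_funD => //; exact: measurable_cst.
    + by move=> u _; rewrite -EFinM -EFinD lee_fin; have := sqr_ge0 (f s - f u); nra.
rewrite ge0_integralD//; last 3 first.
- by move=> s _; rewrite mule_ge0.
- by apply: emeasurable_funM => //; exact: measurable_cst.
- by move=> s _; rewrite mule_ge0.
rewrite ge0_integralZr// hQ integral_cst//.
have v0 : 0 <= fine (nu setT) by exact: fine_ge0.
have VE : nu setT = (fine (nu setT))%:E by rewrite fineK// fin_num_measure.
rewrite [X in (_ + _ * X <= _)%E]VE [X in (_ * X + _ <= _)%E]VE [X in (_ <= X * _)%E]VE.
clear hQ VE; clearbody Q; move: v0 Q0; move: (fine _) => v v0; case: Q => [q q0| _|]//.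
  by rewrite -!EFinM -EFinD lee_fin; lra.
move: v0; rewrite le_eqVlt => /predU1P[<-|v0]; first by rewrite !mule0 mul0e adde0.
by rewrite [leRHS]gt0_muley ?lte_fin// leey.
Qed.

Lemma L2field_L2 X s : L2field X -> L2 (X s).
Proof.
move=> [mX [c cX]]; split; last exact: le_lt_trans (cX s) (ltry _).
exact: (measurableT_comp mX (measurable_pair1 s)).
Qed.

Lemma L2field_sq X : L2field X -> exists c, forall s, sq (X s) <= c.
Proof.
move=> LX; have [mX [c cX]] := LX; exists c => s.
by rewrite -lee_fin -sq_EFin//; exact: L2field_L2.
Qed.

Lemma L2field_integrableM X (Z : T -> R) : L2field X -> L2 Z ->
  (nu \x P)%E.-integrable setT (fun sw => (Z sw.2 * X sw.1 sw.2)%:E).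
Proof.
move=> LX LZ; have [mX [c cX]] := LX; have [mZ Zoo] := LZ.
have mZX : measurable_fun setT (fun sw : S * T => (Z sw.2 * X sw.1 sw.2)%:E).
  apply/measurable_EFinP; apply: measurable_funM => //.
  exact: (measurableT_comp mZ (@measurable_snd _ _ _ _)).
apply/integrable12ltyP => //.
have mX' s : measurable_fun setT (X s) := L2_measurable (L2field_L2 s LX).
apply: (@le_lt_trans _ _ (\int[nu]_s (sq Z + c)%:E)%E); last first.
  by rewrite integral_cst// lte_mul_pinfty ?finite_measure_lty// lee_fin
    addr_ge0 ?sq_ge0// -lee_fin (le_trans _ (cX point))// integral_ge0// => w _; rewrite lee_fin sqr_ge0.
apply: ge0_le_integral => //.
- by move=> s _; exact: integral_ge0.
- have h := @measurable_fun_fubini_tonelli_F _ _ S T R P (fun sw => `|(Z sw.2 * X sw.1 sw.2)%:E|%E).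
  by apply: h => //; exact: measurableT_comp.
- move=> s _; rewrite EFinD -sq_EFin//; apply: le_trans (leeD2l _ (cX s)).
  rewrite -ge0_integralD//; last 4 first.
  + by move=> w _; rewrite lee_fin sqr_ge0.
  + by apply/measurable_EFinP; exact: measurable_funX.
  + by move=> w _; rewrite lee_fin sqr_ge0.
  + by apply/measurable_EFinP; exact: measurable_funX.
  apply: ge0_le_integral => //.
  + apply: measurableT_comp => //; apply/measurable_EFinP.
    exact: (measurable_funM mZ (mX' s)).
  + by apply: emeasurable_funD; apply/measurable_EFinP; exact: measurable_funX.
  + move=> w _; rewrite /= -EFinD lee_fin normrM.
    rewrite -[Z w ^+ 2]real_normK ?num_real// -[X s w ^+ 2]real_normK ?num_real//.
    have := normr_ge0 (Z w); have := normr_ge0 (X s w).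
    move: `|Z w| `|X s w| => a b b0 a0; nra.
Qed.

Lemma L2field_integrable X : L2field X ->
  (nu \x P)%E.-integrable setT (fun sw => (X sw.1 sw.2)%:E).
Proof.
move=> LX; have := L2field_integrableM LX (L2_cst P 1).
by under eq_fun do rewrite mul1r.
Qed.

Lemma L2field_ae X : L2field X -> {ae P, forall w, nu.-integrable setT (fun s => (X s w)%:E)}.
Proof. by move=> /L2field_integrable; exact: ae_integrable2. Qed.

Lemma measurable_pint X : L2field X -> measurable_fun setT (pint X).
Proof.
move=> /L2field_integrable /measurable_fubini_G mX.
exact: (measurableT_comp (@fine_measurable R setT measurableT) mX).
Qed.

Lemma L2field_integral_sqr_lty X : L2field X ->
  (\int[nu]_s \int[P]_w (X s w ^+ 2)%:E < +oo)%E.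
Proof.
move=> LX; have [mX [c cX]] := LX.
have c0 : 0 <= c.
  by rewrite -lee_fin (le_trans _ (cX point))// integral_ge0// => w _; rewrite lee_fin sqr_ge0.
apply: (@le_lt_trans _ _ (\int[nu]_s c%:E)%E); last first.
  by rewrite integral_cst// lte_mul_pinfty ?finite_measure_lty.
apply: ge0_le_integral => //.
- by move=> s _; apply: integral_ge0 => w _; rewrite lee_fin sqr_ge0.
- have h := @measurable_fun_fubini_tonelli_F _ _ S T R P (fun sw => (X sw.1 sw.2 ^+ 2)%:E).
  apply: h => [|x]; last by rewrite lee_fin sqr_ge0.
  by apply/measurable_EFinP; exact: measurable_funX.
Qed.

Lemma integral_pint_sqr_le X : L2field X ->
  (\int[P]_w (pint X w ^+ 2)%:E <= nu setT * \int[nu]_s (sq (X s))%:E)%E.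
Proof.
move=> LX; have [mX [c cX]] := LX.
have m2 : measurable_fun setT (fun sw : S * T => (X sw.1 sw.2 ^+ 2)%:E).
  by apply/measurable_EFinP; exact: measurable_funX.
have X2 (sw : S * T) : (0 <= (X sw.1 sw.2 ^+ 2)%:E)%E by rewrite lee_fin sqr_ge0.
have mXw w : measurable_fun setT (X ^~ w) by exact: (measurableT_comp mX (measurable_pair2 w)).
have mG := @measurable_fun_fubini_tonelli_G _ _ S T R nu _ m2 X2.
apply: (@le_trans _ _ (\int[P]_w (nu setT * \int[nu]_s (X s w ^+ 2)%:E))%E).
  apply: ge0_le_integral => //.
  - by move=> w _; rewrite lee_fin sqr_ge0.
  - by apply/measurable_EFinP; apply: measurable_funX; exact: measurable_pint.
  - by apply: emeasurable_funM => //; exact: measurable_cst.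
  - move=> w _; have := @integral_sqr_le (fun s => `|X s w|) (measurableT_comp (@normr_measurable R setT) (mXw w)) (fun=> normr_ge0 _).
    under [X in (_ <= _ * X)%E -> _]eq_integral do rewrite real_normK ?num_real//.
    apply: le_trans; rewrite /pint /Rintegral.
    (* Where the path integral is not finite, [pint] has the default value 0. *)
    have [fI|] := boolP ((\int[nu]_s (X s w)%:E)%E \is a fin_num); last first.
      rewrite fin_numE negb_and !negbK => I.
      have -> : fine (\int[nu]_s (X s w)%:E)%E = 0 by case/orP: I => /eqP ->.
      by rewrite expr0n/= mule_ge0// integral_ge0.
    have h : (`|(fine (\int[nu]_s (X s w)%:E)%E)%:E| <= \int[nu]_s `|(X s w)%:E|)%E.
      by rewrite fineK//; apply: le_abse_integral => //; exact/measurable_EFinP.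
    by rewrite -(real_normK (num_real _)) expr2 EFinM; apply: lee_pmul.
rewrite ge0_integralZl//; last first.
  by move=> w _; apply: integral_ge0 => s _; rewrite lee_fin sqr_ge0.
apply: lee_wpmul2l => //.
have h := @fubini_tonelli _ _ S T R nu P _ m2 X2; rewrite /= in h; rewrite -h.
by under eq_integral => s _ do rewrite (sq_EFin (L2field_L2 s LX)).
Qed.

Lemma pint_L2 X : L2field X -> L2 (pint X).
Proof.
move=> LX; split; first exact: measurable_pint.
apply: le_lt_trans (integral_pint_sqr_le LX) _.
rewrite lte_mul_pinfty ?fin_num_measure//.
under eq_integral => s _ do rewrite -(sq_EFin (L2field_L2 s LX)).
exact: L2field_integral_sqr_lty.
Qed.

Lemma sq_pint_le X : L2field X -> ((sq (pint X))%:E <= nu setT * \int[nu]_s (sq (X s))%:E)%E.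
Proof.
by move=> LX; rewrite -sq_EFin; [exact: integral_pint_sqr_le|exact: pint_L2].
Qed.

Lemma integrable_ip_field X Z : L2field X -> L2 Z -> nu.-integrable setT (fun s => (ip Z (X s))%:E).
Proof.
move=> LX LZ; have h := integrable_fubini_F (L2field_integrableM LX LZ).
apply: eq_integrable h => // s _; rewrite /fubini_F /ip /Rintegral fineK//.
by apply: integrable_fin_num => //; exact: L2_integrableM (L2field_L2 s LX).
Qed.

Lemma ip_pint X Z : L2field X -> L2 Z -> ip Z (pint X) = \int[nu]_s ip Z (X s).
Proof.
move=> LX LZ; rewrite {1}/ip /Rintegral; congr fine.
transitivity (\int[P]_w \int[nu]_s (Z w * X s w)%:E)%E.
  apply: ae_eq_integral => //.
  - apply/measurable_EFinP; apply: measurable_funM; first by have [] := LZ.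
    exact: measurable_pint.
  - exact: (measurable_fubini_G (L2field_integrableM LX LZ)).
  - have := L2field_ae LX; apply: filterS => w iX _.
    under eq_integral do rewrite EFinM.
    by rewrite integralZl// EFinM /pint /Rintegral fineK//; exact: integrable_fin_num.
have := Fubini (L2field_integrableM LX LZ); rewrite /= => <-.
apply: eq_integral => s _; rewrite /Rintegral fineK//.
by apply: integrable_fin_num => //; exact: L2_integrableM (L2field_L2 s LX).
Qed.

Lemma ip_pint2 X Y : L2field X -> L2field Y ->
  ip (pint X) (pint Y) = \int[nu]_s \int[nu]_u ip (X u) (Y s).
Proof.
move=> LX LY; rewrite ip_pint//; last exact: pint_L2.
apply: eq_Rintegral => s _.
have LYs := L2field_L2 s LY; rewrite (ipC P (pint X) (Y s)) (ip_pint LX LYs).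
by apply: eq_Rintegral => u _; rewrite ipC.
Qed.

Lemma L2fieldD X Y : L2field X -> L2field Y -> L2field (fun s w => X s w + Y s w).
Proof.
move=> LX LY; have [mX _] := LX; have [mY _] := LY; split; first exact: measurable_funD.
have [c cX] := L2field_sq LX; have [e eY] := L2field_sq LY.
exists (2 * c + 2 * e) => s.
have LXs := L2field_L2 s LX; have LYs := L2field_L2 s LY.
rewrite sq_EFin ?lee_fin; last exact: L2D.
by apply: le_trans (sqD_le LXs LYs) _; have := cX s; have := eY s; lra.
Qed.

Lemma L2fieldM (a : S -> R) X c : measurable_fun setT a -> (forall s, `|a s| <= c) ->
  L2field X -> L2field (fun s w => a s * X s w).
Proof.
move=> ma ac LX; have [mX _] := LX; split.
  apply: measurable_funM => //.
  exact: (measurableT_comp ma (@measurable_fst _ _ _ _)).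
have [e eX] := L2field_sq LX.
have c0 : 0 <= c by exact: le_trans (ac point).
have e0 : 0 <= e by exact: le_trans (sq_ge0 P (X point)) (eX point).
exists (c ^+ 2 * e) => s; have LXs := L2field_L2 s LX.
rewrite sq_EFin ?lee_fin; last exact: L2Z.
rewrite sqZ//; apply: ler_pM => //; [exact: sqr_ge0|exact: sq_ge0|].
by rewrite -(real_normK (num_real (a s))) lerXn2r ?nnegrE.
Qed.

Lemma L2field_cst0 : L2field (fun _ _ => 0).
Proof.
split; first exact: measurable_cst.
by exists 0 => s; under eq_integral do rewrite expr0n/=; rewrite integral0.
Qed.

Lemma L2field_sum (I : Type) (r : seq I) (p : pred I) (X : I -> S -> T -> R) :
  (forall i, p i -> L2field (X i)) -> L2field (fun s w => \sum_(i <- r | p i) X i s w).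
Proof.
move=> LX; elim: r => [|i r IH].
  by rewrite (_ : (fun _ _ => _) = (fun _ _ => 0)); [exact: L2field_cst0|apply/funext => s; apply/funext => w; rewrite big_nil].
have [pi|npi] := boolP (p i); last first.
  by rewrite (_ : (fun _ _ => _) = (fun s w => \sum_(i <- r | p i) X i s w))//;
    apply/funext => s; apply/funext => w; rewrite big_cons (negbTE npi).
rewrite (_ : (fun _ _ => _) = (fun s w => X i s w + \sum_(i <- r | p i) X i s w)).
  by apply: L2fieldD => //; exact: LX.
by apply/funext => s; apply/funext => w; rewrite big_cons pi.
Qed.

Lemma L2fieldB X Y : L2field X -> L2field Y -> L2field (fun s w => X s w - Y s w).
Proof.
move=> LX LY; have := L2fieldD LX (@L2fieldM (cst (-1)) Y `|-1| (measurable_cst _) (fun=> lexx _) LY).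
by rewrite (_ : (fun s w => X s w + _) = (fun s w => X s w - Y s w))//;
  apply/funext => s; apply/funext => w; rewrite mulN1r.
Qed.

Lemma sq_ae f g : measurable_fun setT f -> measurable_fun setT g ->
  {ae P, forall w, f w = g w} -> sq f = sq g.
Proof.
move=> mf mg fg; rewrite /sq /Rintegral; congr fine; apply: ae_eq_integral => //.
- by apply/measurable_EFinP; exact: measurable_funX.
- by apply/measurable_EFinP; exact: measurable_funX.
- by apply: filterS fg => w -> _.
Qed.

Lemma pintB X Y : L2field X -> L2field Y ->
  {ae P, forall w, pint (fun s w => X s w - Y s w) w = pint X w - pint Y w}.
Proof.
move=> LX LY; have := L2field_ae LX; have := L2field_ae LY.
by apply: filterS2 => w iY iX; rewrite /pint RintegralB.
Qed.

Lemma pintD X Y : L2field X -> L2field Y ->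
  {ae P, forall w, pint (fun s w => X s w + Y s w) w = pint X w + pint Y w}.
Proof.
move=> LX LY; have := L2field_ae LX; have := L2field_ae LY.
by apply: filterS2 => w iY iX; rewrite /pint RintegralD.
Qed.

Lemma sq_pintB X Y : L2field X -> L2field Y ->
  sq (fun w => pint X w - pint Y w) = sq (pint (fun s w => X s w - Y s w)).
Proof.
move=> LX LY; apply: sq_ae.
- by apply: measurable_funB; exact: measurable_pint.
- by apply: measurable_pint; exact: L2fieldB.
- by have := pintB LX LY; apply: filterS => w ->.
Qed.

Lemma pint_sum (I : Type) (r : seq I) (p : pred I) (X : I -> S -> T -> R) :
  (forall i, p i -> L2field (X i)) ->
  {ae P, forall w, pint (fun s w => \sum_(i <- r | p i) X i s w) w = \sum_(i <- r | p i) pint (X i) w}.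
Proof.
move=> LX; elim: r => [|i r IH].
  apply: aeW => w; rewrite big_nil /pint.
  by under eq_Rintegral do rewrite big_nil; rewrite /Rintegral integral0.
have [pi|npi] := boolP (p i); last first.
  apply: filterS IH => w; rewrite big_cons (negbTE npi) => <-; rewrite /pint.
  by apply: eq_Rintegral => s _; rewrite big_cons (negbTE npi).
have := pintD (LX i pi) (L2field_sum r LX).
apply: filterS2 IH => w IH h; rewrite big_cons pi -IH -h /pint.
by apply: eq_Rintegral => s _; rewrite big_cons pi.
Qed.

End param_integral.

(** * Hermite expansion of the Gaussian kernel *)

Section geometric_sums.
Context {R : realType}.

Lemma sum_geo_le (q : R) m n : 0 <= q < 1 -> \sum_(m <= k < n) q ^+ k <= (1 - q)^-1.
Proof.
move=> /andP[q0 q1]; have oq : 0 < 1 - q by rewrite subr_gt0.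
apply: (@le_trans _ _ (\sum_(0 <= k < n) q ^+ k)).
  have [mn|nm] := leqP m n.
    by rewrite [leRHS](big_cat_nat (n := m) (p := n))//= lerDr sumr_ge0// => k _; rewrite exprn_ge0.
  by rewrite big_geq ?(ltnW nm)// sumr_ge0// => k _; rewrite exprn_ge0.
rewrite -[leRHS]mul1r ler_pdivlMr// mulrC.
have -> : (1 - q) * \sum_(0 <= k < n) q ^+ k = 1 - q ^+ n.
  elim: n => [|n IH]; first by rewrite big_geq// mulr0 expr0 subrr.
  by rewrite big_nat_recr//= mulrDr IH exprS; lra.
by rewrite gerBl exprn_ge0.
Qed.

Lemma sum_invsqrt_le n : \sum_(0 <= k < n) (Num.sqrt k.+1%:R)^-1 <= 2 * Num.sqrt n%:R :> R.
Proof.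
elim: n => [|n IH]; first by rewrite big_geq// sqrtr0 mulr0.
rewrite big_nat_recr//=; apply: (le_trans (lerD IH (lexx _))).
have s0 : 0 < Num.sqrt n.+1%:R :> R by rewrite sqrtr_gt0.
have sn : 0 <= Num.sqrt n%:R :> R by exact: sqrtr_ge0.
have e1 : Num.sqrt n.+1%:R ^+ 2 = n%:R + 1 :> R by rewrite sqr_sqrtr// -natr1.
have e2 : Num.sqrt n%:R ^+ 2 = n%:R :> R by rewrite sqr_sqrtr.
rewrite -lerBrDl -div1r ler_pdivrMr//.
move: s0 sn e1 e2; move: (Num.sqrt _) (Num.sqrt _) => y x; nra.
Qed.

(** Cut at m of order 1/(1-q): below, q^k <= 1 and the terms (k+1)^(-1/2) sum to at most 2 sqrt m;
    above, (k+1)^(-1/2) <= sqrt(1-q) and the geometric series sums to at most 1/(1-q). *)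
Lemma sum_invsqrt_geo (q : R) n : 0 <= q < 1 ->
  \sum_(0 <= k < n) (Num.sqrt k.+1%:R)^-1 * q ^+ k <= 4 * (1 - q) `^ (- (1 / 2)).
Proof.
move=> q01; have /andP[q0 q1] := q01; have oq : 0 < 1 - q by rewrite subr_gt0.
set p := (1 - q)^-1.
have p1 : 1 <= p by rewrite /p invf_ge1// gerBl.
have p0 : 0 < p by exact: lt_le_trans p1.
pose m := (Num.truncn p).+1.
have pm : p < m%:R by rewrite -truncn_lt_nat ?ltW.
have mp : m%:R <= 2 * p.
  have : (Num.truncn p)%:R <= p by rewrite truncn_le ltW.
  by rewrite /m -natr1; lra.
have term k : 0 <= (Num.sqrt k.+1%:R)^-1 * q ^+ k.
  by rewrite mulr_ge0 ?exprn_ge0// invr_ge0 sqrtr_ge0.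
apply: (@le_trans _ _ (\sum_(0 <= k < m + n) (Num.sqrt k.+1%:R)^-1 * q ^+ k)).
  by rewrite (big_cat_nat (n := n) (p := m + n))//= ?leq_addl// lerDl sumr_ge0.
rewrite (big_cat_nat (n := m))//= ?leq_addr//.
have h1 : \sum_(0 <= k < m) (Num.sqrt k.+1%:R)^-1 * q ^+ k <= 2 * Num.sqrt m%:R.
  apply: le_trans (sum_invsqrt_le m); apply: ler_sum => k _.
  by rewrite ler_piMr ?invr_ge0 ?sqrtr_ge0// exprn_ile1// ltW.
have h2 : \sum_(m <= k < m + n) (Num.sqrt k.+1%:R)^-1 * q ^+ k <= (Num.sqrt p)^-1 * p.
  apply: (@le_trans _ _ (\sum_(m <= k < m + n) (Num.sqrt p)^-1 * q ^+ k)).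
    apply: ler_sum_nat => k /andP[mk _]; apply: ler_wpM2r; first exact: exprn_ge0.
    rewrite lef_pV2 ?posrE ?sqrtr_gt0// ler_wsqrtr// (le_trans (ltW pm))// ler_nat.
    exact: leqW.
  by rewrite -mulr_sumr ler_wpM2l ?invr_ge0 ?sqrtr_ge0// sum_geo_le.
apply: (le_trans (lerD h1 h2)).
have sp0 : 0 < Num.sqrt p by rewrite sqrtr_gt0.
have -> : (1 - q) `^ (- (1 / 2)) = Num.sqrt p.
  rewrite -powR12_sqrt ?(ltW p0)// /p -(powR_inv1 (ltW oq)) -powRrM.
  by congr (_ `^ _); lra.
have h3 : Num.sqrt m%:R <= 3 / 2 * Num.sqrt p.
  rewrite -[3 / 2]ger0_norm// -sqrtr_sqr -sqrtrM ?sqr_ge0// ler_wsqrtr//; lra.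
have h4 : (Num.sqrt p)^-1 * p = Num.sqrt p.
  by rewrite -{2}[p]sqr_sqrtr ?(ltW p0)// expr2 mulKf// gt_eqF.
by rewrite h4; lra.
Qed.

(** (1+n)(1-q) is compared with exp(n(1-q)/a), whose power a is cancelled by q^n <= exp(-n(1-q)). *)
Lemma pow_poly_geo (a : R) : 0 < a -> exists C, 0 < C /\ forall q n, 0 <= q < 1 ->
  (1 + n%:R) `^ a * q ^+ n <= C * (1 - q) `^ (- a).
Proof.
move=> a0; pose c := Num.max 1 a; exists (c `^ a).
have c1 : 1 <= c by rewrite le_max lexx.
have ca : a <= c by rewrite le_max lexx orbT.
have c0 : 0 < c by exact: lt_le_trans c1.
split; first by rewrite powR_gt0.
move=> q n /andP[q0 q1]; have oq : 0 < 1 - q by rewrite subr_gt0.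
have pa : 0 < (1 - q) `^ a by rewrite powR_gt0.
rewrite powRN ler_pdivlMr// mulrAC -powRM ?(ltW oq)//.
set z := n%:R * (1 - q).
have z0 : 0 <= z by rewrite mulr_ge0// ltW.
have zE : expR z = expR (z / a) `^ a by rewrite -expRM divfK// gt_eqF.
have h1 : (1 + n%:R) * (1 - q) <= c * expR (z / a).
  apply: (@le_trans _ _ (c * (1 + z / a))); last by rewrite ler_pM2l// expR_ge1Dx.
  have -> : (1 + n%:R) * (1 - q) = (1 - q) + z by rewrite /z; lra.
  rewrite mulrDr mulr1; apply: lerD; first by lra.
  by rewrite mulrA ler_pdivlMr// mulrC ler_wpM2r.
have h2 : q ^+ n <= expR (- z).
  rewrite /z -mulrN mulrC expRM_natr; apply: lerXn2r; rewrite ?nnegrE ?expR_ge0//.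
  by have := expR_ge1Dx (- (1 - q)); lra.
apply: (@le_trans _ _ ((c * expR (z / a)) `^ a * expR (- z))).
  apply: ler_pM; rewrite ?powR_ge0 ?exprn_ge0//.
  by apply: powR_homo => //; [exact: ltW|rewrite mulr_ge0// ltW].
rewrite powRM ?expR_ge0 ?(ltW c0)// -zE -mulrA -expRD subrr expR0 mulr1//.
Qed.

(** Half of the geometric decay, q^|m| with q = sqrt r, pays for (1+|m|)^a; the other half lets the
    sum factor into d one-dimensional ones of order (1-q)^(-1/2). Finally 1 - r <= 2(1-q). *)
Lemma sum_multi_index d (a : R) : 0 < a -> exists C, 0 < C /\ forall r M, 0 <= r < 1 ->
  \sum_(m : {ffun 'I_d -> 'I_M}) (1 + (\sum_(i < d) m i)%:R) `^ a *
    (\prod_(i < d) ((Num.sqrt (m i).+1%:R)^-1 * r ^+ m i)) <=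
  C * (1 - r) `^ (- (a + d%:R / 2)).
Proof.
move=> a0; have [C [C0 CP]] := pow_poly_geo a0.
exists (C * 4 ^+ d * 2 `^ (a + d%:R / 2)); split.
  by rewrite !mulr_gt0 ?powR_gt0.
move=> r M /andP[r0 r1]; pose q := Num.sqrt r.
have q0 : 0 <= q by exact: sqrtr_ge0.
have qr : q ^+ 2 = r by rewrite sqr_sqrtr.
have q1 : q < 1 by rewrite -(ltr_pXn2r (n := 2)) ?nnegrE// qr expr1n.
have oq : 0 < 1 - q by rewrite subr_gt0.
have q01 : 0 <= q < 1 by rewrite q0.
apply: (@le_trans _ _ (\sum_(m : {ffun 'I_d -> 'I_M}) C * (1 - q) `^ (- a) *
    (\prod_(i < d) ((Num.sqrt (m i).+1%:R)^-1 * q ^+ m i)))).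
  apply: ler_sum => m _; rewrite !big_split/=.
  have h e : \prod_(i < d) e ^+ m i = e ^+ (\sum_(i < d) m i) :> R by rewrite expr_sum.
  rewrite !h -qr -exprM mulnC exprM [_ ^+ 2]expr2.
  have := CP q (\sum_(i < d) m i)%N q01.
  set x := (_ `^ a) ; set y := q ^+ _; set z := \prod_(i < d) _ => hx.
  have z0 : 0 <= z by apply: prodr_ge0 => i _; rewrite invr_ge0 sqrtr_ge0.
  have y0 : 0 <= y by exact: exprn_ge0.
  have := ler_wpM2r (mulr_ge0 z0 y0) hx; lra.
rewrite -mulr_sumr -(bigA_distr_bigA (fun (_ : 'I_d) (k : 'I_M) => (Num.sqrt k.+1%:R)^-1 * q ^+ k)).
rewrite -[leRHS]mulrA -[leRHS]mulrA -[leLHS]mulrA ler_pM2l//.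
rewrite prodr_const card_ord.
have S0 : 0 <= \sum_(k < M) (Num.sqrt k.+1%:R)^-1 * q ^+ k.
  by apply: sumr_ge0 => k _; rewrite mulr_ge0 ?exprn_ge0// invr_ge0 sqrtr_ge0.
have S1 : \sum_(k < M) (Num.sqrt k.+1%:R)^-1 * q ^+ k <= 4 * (1 - q) `^ (- (1 / 2)).
  by have := sum_invsqrt_geo M q01; rewrite big_mkord.
apply: (@le_trans _ _ ((1 - q) `^ (- a) * (4 * (1 - q) `^ (- (1 / 2))) ^+ d)).
  by rewrite ler_wpM2l ?powR_ge0// lerXn2r ?nnegrE// mulr_ge0 ?powR_ge0.
rewrite exprMn mulrCA ler_pM2l ?exprn_gt0// -powR_mulrn ?powR_ge0// -powRrM -powR_addr//.
have -> : - a + - (1 / 2) * d%:R = - (a + d%:R / 2) by lra.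
rewrite !powRN ler_pdivlMr ?powR_gt0 ?subr_gt0// mulrC -ler_pdivlMr ?invr_gt0 ?powR_gt0// invrK.
rewrite -powRM ?(ltW oq)//; apply: powR_homo.
- by rewrite addr_ge0// ltW.
- by lra.
- by rewrite -qr; nra.
Qed.

End geometric_sums.

(** * Hermite coefficients of the Gaussian kernel and their uniform bounds *)

Section coefficients.
Context {R : realType}.
Implicit Types eps x z sg : R.

Definition hermiteN k z : R := (hermite k).[z] / Num.sqrt k`!%:R.

(* Hermite coefficients of the Gaussian kernel [z |-> p_eps (sg z - x)]. *)
Definition coef eps x sg k : R :=
  (sg / Num.sqrt (sg ^+ 2 + eps)) ^+ k * (Num.sqrt (sg ^+ 2 + eps))^-1 * (Num.sqrt (pi *+ 2))^-1 *
  expR (- (x / Num.sqrt (sg ^+ 2 + eps)) ^+ 2 / 2) * hermiteN k (x / Num.sqrt (sg ^+ 2 + eps)).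

(** The part of the coefficient bound that does not depend on k: exp(-y^2/8) is what remains of
    exp(-y^2/2) once [hermite_bound] has used exp(-3y^2/8). *)
Definition gdom eps x sg : R :=
  (Num.sqrt (sg ^+ 2 + eps))^-1 * expR (- (x / Num.sqrt (sg ^+ 2 + eps)) ^+ 2 / 8).

Lemma hermiteNM k y z : hermiteN k y * hermiteN k z = (hermite k).[y] * (hermite k).[z] / k`!%:R.
Proof.
rewrite /hermiteN mulrACA -invfM -expr2 sqr_sqrtr//.
Qed.

(** Mehler's formula with y = x/sqrt(sg^2+eps) and r = sg/sqrt(sg^2+eps), so that 1 - r^2 =
    eps/(sg^2+eps): a positive eps keeps r below 1. *)
Lemma kernel_expansion eps x sg z : 0 < eps -> 0 <= sg ->
  (fun n => \sum_(0 <= k < n) coef eps x sg k * hermiteN k z) @ \oo -->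
  normal_pdf 0 (Num.sqrt eps) (sg * z - x).
Proof.
move=> e0 s0; set v := sg ^+ 2 + eps; pose w := (Num.sqrt v)^-1.
have v0 : 0 < v by rewrite ltr_wpDl ?sqr_ge0.
have sv0 : 0 < Num.sqrt v by rewrite sqrtr_gt0.
have w0 : 0 < w by rewrite invr_gt0.
have wv : w ^+ 2 * v = 1 by rewrite /w exprVn sqr_sqrtr ?(ltW v0)// mulVf// gt_eqF.
pose y := x * w; pose r := sg * w.
have r0 : 0 <= r by rewrite mulr_ge0// ltW.
have r2 : 1 - r ^+ 2 = eps * w ^+ 2.
  have : w ^+ 2 * (sg ^+ 2 + eps) = 1 by [].
  by rewrite /r exprMn; move: (w ^+ 2) (sg ^+ 2) => a b; lra.
have r1 : r < 1.
  rewrite -(ltr_pXn2r (n := 2)) ?nnegrE// expr1n -subr_gt0 r2 mulr_gt0// exprn_gt0//.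
pose c := w * (Num.sqrt (pi *+ 2))^-1 * expR (- y ^+ 2 / 2).
have -> : (fun n => \sum_(0 <= k < n) coef eps x sg k * hermiteN k z) =
    (fun n => c * \sum_(0 <= k < n) (hermite k).[y] * (hermite k).[z] / k`!%:R * r ^+ k).
  apply/funext => n; rewrite mulr_sumr; apply: eq_bigr => k _.
  rewrite -hermiteNM /coef -/v -/w -/y -/r /c.
  by move: (hermiteN k y) (hermiteN k z) (r ^+ k) (expR _) (_^-1) => a1 a2 a3 a4 a5; lra.
have r01 : 0 <= r < 1 by rewrite r0.
have lim := @mehler R y z r r01.
have := cvgM (cvg_cst c) lim.
set E := expR _; rewrite (_ : normal_pdf _ _ _ = c * ((Num.sqrt (1 - r ^+ 2))^-1 * E)).
  by apply.
have se : Num.sqrt eps != 0 by rewrite gt_eqF// sqrtr_gt0.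
rewrite normal_pdfE// /normal_peak /normal_fun subr0 sqr_sqrtr ?(ltW e0)//.
have -> : (Num.sqrt (eps * pi *+ 2))^-1 = (Num.sqrt eps)^-1 * (Num.sqrt (pi *+ 2))^-1.
  by rewrite -mulrnAr sqrtrM ?(ltW e0)// invfM.
have -> : (Num.sqrt (1 - r ^+ 2))^-1 = (Num.sqrt eps)^-1 * w^-1.
  by rewrite r2 sqrtrM ?(ltW e0)// sqrtr_sqr gtr0_norm// invfM.
have -> : c * ((Num.sqrt eps)^-1 * w^-1 * E) = (w * w^-1) *
   ((Num.sqrt eps)^-1 * (Num.sqrt (pi *+ 2))^-1 * (expR (- y ^+ 2 / 2) * E)).
  rewrite /c; move: (_^-1) (_^-1) (_^-1) (expR _) => a1 a2 a3 a4; lra.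
rewrite divff ?gt_eqF// mul1r; congr (_ * _); rewrite /E -expRD; congr expR.
have i0 : (2 * (1 - r ^+ 2))^-1 = eps^-1 / 2 * v.
  rewrite r2 (invfM 2) (invfM eps); have -> : (w ^+ 2)^-1 = v.
    by apply: (mulfI (_ : w ^+ 2 != 0)); rewrite ?wv ?divff// gt_eqF// exprn_gt0.
  lra.
rewrite i0 -[eps *+ 2]mulr_natr invfM.
have ee : eps^-1 * eps = 1 by rewrite mulVf// gt_eqF.
have h1 : v * r ^+ 2 = sg ^+ 2 by rewrite /r exprMn mulrCA [v * _]mulrC wv mulr1.
have h2 : v * (r * y) = sg * x.
  transitivity (sg * x * (w ^+ 2 * v)); last by rewrite wv mulr1.
  by rewrite /r /y; move: (v) (w) => a b; lra.
have h3 : v * y ^+ 2 = x ^+ 2 by rewrite /y exprMn mulrCA [v * _]mulrC wv mulr1.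
have h4 : sg ^+ 2 * y ^+ 2 = x ^+ 2 - eps * y ^+ 2 by rewrite -h3 /v; lra.
have h5 : eps^-1 * (eps * y ^+ 2) = y ^+ 2 by rewrite mulrA ee mul1r.
have -> : (r ^+ 2 * (y ^+ 2 + z ^+ 2) - 2 * r * y * z) * (eps^-1 / 2 * v) =
   eps^-1 / 2 * (sg ^+ 2 * y ^+ 2 + sg ^+ 2 * z ^+ 2 - 2 * (sg * x) * z).
  by rewrite -h1 -h2; move: (r ^+ 2) (y ^+ 2) (z ^+ 2) (eps^-1) => a b c' i; lra.
rewrite h4; move: h5; move: (y ^+ 2) (eps^-1) => b i.
have -> : (sg * z - x) ^+ 2 = sg ^+ 2 * z ^+ 2 - 2 * (sg * x) * z + x ^+ 2 by lra.
by move: (sg ^+ 2 * z ^+ 2) (sg * x * z) (x ^+ 2) => p q s h5; lra.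
Qed.

(** Squared, the claim is [hermite_bound] at y; the constant 4 is 8 times the bound 1/2 for 1/(2
    pi). *)
Lemma coef_le eps x sg k : 0 < sg ^+ 2 + eps -> 0 <= sg ->
  `|coef eps x sg k| <= 2 * gdom eps x sg * (Num.sqrt (Num.sqrt k.+1%:R))^-1 *
    (sg / Num.sqrt (sg ^+ 2 + eps)) ^+ k.
Proof.
move=> v0 s0; set v := sg ^+ 2 + eps in v0 *; rewrite /coef /gdom -/v.
have sv0 : 0 < Num.sqrt v by rewrite sqrtr_gt0.
pose w := (Num.sqrt v)^-1; have w0 : 0 < w by rewrite invr_gt0.
rewrite -/w; have : 0 <= sg * w by rewrite mulr_ge0// ltW.
move: (x * w) (sg * w) => y r r0.
have q0 : 0 < Num.sqrt k.+1%:R :> R by rewrite sqrtr_gt0.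
have p0 : 0 < Num.sqrt (pi *+ 2) :> R by rewrite sqrtr_gt0 pmulrn_lgt0// pi_gt0.
have k0 : (0 : R) < k`!%:R by rewrite ltr0n fact_gt0.
rewrite -(ler_pXn2r (n := 2)) ?nnegrE//; last first.
  by rewrite !mulr_ge0 ?expR_ge0 ?exprn_ge0 ?(ltW w0)// invr_ge0 sqrtr_ge0.
rewrite real_normK ?num_real// !exprMn.
have -> : (Num.sqrt k`!%:R)^-1 ^+ 2 = k`!%:R^-1 :> R.
  by rewrite exprVn sqr_sqrtr// ltW.
have -> : (Num.sqrt (pi *+ 2))^-1 ^+ 2 = (pi *+ 2)^-1 :> R.
  by rewrite exprVn sqr_sqrtr// mulrn_wge0// pi_ge0.
have -> : (Num.sqrt (Num.sqrt k.+1%:R))^-1 ^+ 2 = (Num.sqrt k.+1%:R)^-1 :> R.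
  by rewrite exprVn sqr_sqrtr// ltW.
have eE (a : R) : expR (a * y ^+ 2) ^+ 2 = expR ((2 * a) * y ^+ 2).
  by rewrite -expRM_natr; congr expR; lra.
have -> : - y ^+ 2 / 2 = (- (1 / 2)) * y ^+ 2 by lra.
have -> : - y ^+ 2 / 8 = (- (1 / 8)) * y ^+ 2 by lra.
rewrite !eE.
have -> : expR (2 * - (1 / 2) * y ^+ 2) = expR (- (3 / 4) * y ^+ 2) * expR (2 * - (1 / 8) * y ^+ 2).
  by rewrite -expRD; congr expR; lra.
have hb := hermite_bound k y.
have pi1 : (pi *+ 2)^-1 <= 1 / 2 :> R.
  rewrite -[pi *+ 2]mulr_natr invfM mulrC.
  have := pi_ge2 R => p2; have : pi^-1 <= 1 :> R by rewrite invf_le1; [lra|rewrite pi_gt0].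
  lra.
have pi0 : 0 <= (pi *+ 2)^-1 :> R by rewrite invr_ge0 mulrn_wge0// pi_ge0.
move: hb; set h := _ ^+ 2 / _ ; set e1 := expR _; set e2 := expR _.
have h0 : 0 <= h by rewrite divr_ge0 ?sqr_ge0// ltW.
have e10 : 0 <= e1 by exact: expR_ge0.
have e20 : 0 <= e2 by exact: expR_ge0.
move=> hb.
have hp : (pi *+ 2)^-1 * (h * e1) <= 4 * (Num.sqrt k.+1%:R)^-1.
  apply: (@le_trans _ _ (1 / 2 * (8 / Num.sqrt k.+1%:R))); last by lra.
  by apply: ler_pM => //; rewrite mulr_ge0.
have rk : 0 <= r ^+ k ^+ 2 * w ^+ 2 * e2.
  by apply: mulr_ge0 => //; apply: mulr_ge0; exact: sqr_ge0.
have := ler_wpM2l rk hp.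
move: (r ^+ k ^+ 2) (w ^+ 2) ((_ *+ _)^-1) ((Num.sqrt _)^-1) => a1 a2 a3 a4; lra.
Qed.

Lemma coef_cvg x sg k : 0 < sg -> coef eps x sg k @[eps --> 0^'+] --> coef 0 x sg k.
Proof.
move=> s0; apply: cvg_at_right_filter.
have v0 : 0 < sg ^+ 2 + 0 by rewrite addr0 exprn_gt0.
have cv : Num.sqrt (sg ^+ 2 + eps) @[eps --> (0 : R)] --> Num.sqrt (sg ^+ 2 + 0).
  apply: (@continuous_comp _ _ _ (fun eps => sg ^+ 2 + eps) Num.sqrt); last exact: sqrt_continuous.
  by apply: cvgD; [exact: cvg_cst|exact: cvg_id].
have ci : (Num.sqrt (sg ^+ 2 + eps))^-1 @[eps --> (0 : R)] --> (Num.sqrt (sg ^+ 2 + 0))^-1.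
  by apply: cvgV => //; rewrite gt_eqF// sqrtr_gt0.
have cy : x / Num.sqrt (sg ^+ 2 + eps) @[eps --> (0 : R)] --> x / Num.sqrt (sg ^+ 2 + 0).
  by apply: cvgM => //; exact: cvg_cst.
have cr : (sg / Num.sqrt (sg ^+ 2 + eps)) ^+ k @[eps --> (0 : R)] --> (sg / Num.sqrt (sg ^+ 2 + 0)) ^+ k.
  have h : sg / Num.sqrt (sg ^+ 2 + eps) @[eps --> (0 : R)] --> sg / Num.sqrt (sg ^+ 2 + 0).
    by apply: cvgM => //; exact: cvg_cst.
  exact: (cvg_comp _ _ h (@exprn_continuous R k _)).
have ce : expR (- (x / Num.sqrt (sg ^+ 2 + eps)) ^+ 2 / 2) @[eps --> (0 : R)] -->
    expR (- (x / Num.sqrt (sg ^+ 2 + 0)) ^+ 2 / 2).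
  have h : - (x / Num.sqrt (sg ^+ 2 + eps)) ^+ 2 / 2 @[eps --> (0 : R)] -->
      - (x / Num.sqrt (sg ^+ 2 + 0)) ^+ 2 / 2.
    apply: cvgM; last exact: cvg_cst.
    by apply: cvgN; exact: (cvg_comp _ _ cy (@exprn_continuous R 2 _)).
  exact: (cvg_comp _ _ h (@continuous_expR R _)).
have ch : hermiteN k (x / Num.sqrt (sg ^+ 2 + eps)) @[eps --> (0 : R)] -->
    hermiteN k (x / Num.sqrt (sg ^+ 2 + 0)).
  apply: cvgM; last exact: cvg_cst.
  exact: (cvg_comp _ _ cy (@continuous_horner R (hermite k) _)).
apply: cvgM => //; apply: cvgM => //; apply: cvgM; last exact: cvg_cst.
exact: cvgM.
Qed.

Lemma gdom_ge0 eps x sg : 0 <= gdom eps x sg.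
Proof. by rewrite mulr_ge0 ?expR_ge0// invr_ge0 sqrtr_ge0. Qed.

Lemma gdom0_le eps sg : 0 <= eps -> 0 < sg -> gdom eps 0 sg <= sg^-1.
Proof.
move=> e0 s0; rewrite /gdom mul0r expr0n/= oppr0 mul0r expR0 mulr1.
rewrite lef_pV2 ?posrE ?sqrtr_gt0 ?ltr_pwDl ?exprn_gt0//.
by rewrite -[leLHS]gtr0_norm// -sqrtr_sqr ler_wsqrtr// lerDl.
Qed.

Lemma gdom_le eps x sg : 0 < sg ^+ 2 + eps -> gdom eps x sg <= (sg ^+ 2 + eps) `^ (- (1 / 2)).
Proof.
move=> v0; rewrite powRN div1r powR12_sqrt ?(ltW v0)// /gdom ler_piMr ?invr_ge0 ?sqrtr_ge0//.
by rewrite -expR0 ler_expR mulNr oppr_le0 divr_ge0 ?sqr_ge0.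
Qed.

Lemma powR_expR_bound (p : R) : 0 < p -> exists C, 0 <= C /\ forall z, 0 <= z -> z `^ p * expR (- z) <= C.
Proof.
move=> p0; exists (p `^ p); split; first exact: powR_ge0.
move=> z z0.
have h : z <= p * expR (z / p).
  rewrite -ler_pdivrMl// mulrC; apply: le_trans (expR_ge1Dx _); lra.
apply: (@le_trans _ _ ((p * expR (z / p)) `^ p * expR (- z))).
  by rewrite ler_wpM2r ?expR_ge0// powR_homo// ltW.
rewrite powRM ?expR_ge0 ?(ltW p0)// -expRM divfK ?gt_eqF// -mulrA -expRD subrr expR0 mulr1//.
Qed.

End coefficients.

(** * Domination of the coefficients near the axes, uniformly in the regularization *)

Section domination.
Context {R : realType} {N d : nat}.
Variables (H K : 'M[R]_(d, N)).
Hypothesis H01 : forall i j, 0 < H i j < 1.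
Hypothesis K01 : forall i j, 0 < K i j <= 1.

Let h0 i j : 0 < H i j * K i j.
Proof. by have /andP[? _] := H01 i j; have /andP[? _] := K01 i j; rewrite mulr_gt0. Qed.

Lemma sheet_sd_gt0 i t s : posbox t s -> 0 < sheet_sd H K i s.
Proof. by move=> st; apply: prodr_gt0 => j _; rewrite powR_gt0//; have /andP[] := st j. Qed.

(** At x = 0 each factor is at most an inverse standard deviation, which gives a_j = sum_i H_ij
    K_ij. If x_k <> 0, every regularized variance is at least a constant times the power q of the
    k-th one, V_k; the product is then at most a constant times V_k^(-qd/2) exp(-x_k^2/(8 V_k)),
    which is bounded, so a = 0 works. *)
Lemma gdom_dominated (x : d.-tuple R) (t : N.-tuple R) :
  ((forall i, tnth x i = 0) -> forall j, \sum_(i < d) H i j * K i j < 1) ->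
  exists C (a : 'I_N -> R), [/\ 0 <= C, forall j, 0 <= a j < 1 &
    forall eps s, 0 <= eps <= 1 -> posbox t s ->
      \prod_(i < d) gdom eps (tnth x i) (sheet_sd H K i s) <= C * \prod_(j < N) tnth s j `^ (- a j)].
Proof.
move=> xcond.
have [x0|/existsNP [k /eqP xk]] := pselect (forall i, tnth x i = 0).
  exists 1, (fun j => \sum_(i < d) H i j * K i j); split => //.
    by move=> j; rewrite xcond// sumr_ge0// => i _; exact: ltW.
  move=> eps s /andP[e0 e1] st; rewrite mul1r.
  have s0 j : 0 < tnth s j by have /andP[] := st j.
  apply: (@le_trans _ _ (\prod_(i < d) (sheet_sd H K i s)^-1)).
    apply: ler_prod => i _; rewrite gdom_ge0 x0/=.
    by apply: gdom0_le => //; exact: sheet_sd_gt0 st.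
  rewrite /sheet_sd; under eq_bigr do rewrite -prodfV.
  rewrite exchange_big/=; apply: ler_prod => j _; rewrite prodr_ge0; last first.
    by move=> i _; rewrite invr_ge0 powR_ge0.
  rewrite /= -sumrN powR_sum//; apply: ler_prod => i _.
  by rewrite invr_ge0 powR_ge0/= powRN.
have [t0|/existsNP [j0 /negP tj0]] := pselect (forall j, 0 < tnth t j); last first.
  exists 0, (fun=> 0); split => // [j|eps s _ st]; first by rewrite lexx ltr01.
  by have /andP[h1 h2] := st j0; move: tj0; rewrite (lt_le_trans h1 h2).
(* Large enough for H_ij K_ij <= q H_kj K_kj for all i and j, and at least 1 so that eps^q <=
   eps. *)
pose q := 1 + \sum_(i < d) \sum_(j < N) (H i j * K i j) / (H k j * K k j).
have q1 : 1 <= q.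
  by rewrite lerDl sumr_ge0// => i _; rewrite sumr_ge0// => j _; rewrite divr_ge0// ltW.
have q0 : 0 < q by exact: lt_le_trans q1.
have hq i j : H i j * K i j <= q * (H k j * K k j).
  rewrite -ler_pdivrMr// /q (bigD1 i)//= (bigD1 j)//=.
  set A := \sum_(_ < N | _) _; set B := \sum_(_ < d | _) _.
  have A0 : 0 <= A by apply: sumr_ge0 => l _; rewrite divr_ge0// ltW.
  have B0 : 0 <= B by apply: sumr_ge0 => m _; rewrite sumr_ge0// => l _; rewrite divr_ge0// ltW.
  by move: (_ / _) => z; lra.
pose st_ i := sheet_sd H K i t.
have tt : posbox t t by move=> j; rewrite t0 lexx.
have st0 i : 0 < st_ i by exact: sheet_sd_gt0 tt.
(* The comparison is normalized at the corner t, so that it concerns powers of the ratios s_j/t_j <=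
   1. *)
pose c i := st_ i / st_ k `^ q.
have c0 i : 0 < c i by rewrite divr_gt0// powR_gt0.
have sdle i s : posbox t s -> c i * sheet_sd H K k s `^ q <= sheet_sd H K i s.
  move=> st.
  have s0 j : 0 < tnth s j by have /andP[] := st j.
  rewrite /c /st_ /sheet_sd !prod_powR; last 2 first.
  - by move=> j; exact: powR_ge0.
  - by move=> j; exact: powR_ge0.
  rewrite -prodfV -!big_split/=; apply: ler_prod => j _.
  rewrite !mulr_ge0 ?powR_ge0 ?invr_ge0 ?powR_ge0//= -!powRrM.
  rewrite -powRN -powR_addr// -[leRHS](divfK (_ : tnth t j `^ (H i j * K i j) != 0)) ?gt_eqF ?powR_gt0//.
  rewrite [leRHS]mulrC [X in X * _ <= _]powR_addr// -[leLHS]mulrA.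
  apply: ler_wpM2l; first exact: powR_ge0.
  have -> : tnth t j `^ (- (H k j * K k j * q)) * tnth s j `^ (H k j * K k j * q) = (tnth s j / tnth t j) `^ (H k j * K k j * q).
    rewrite [RHS]powRM ?invr_ge0 ?(ltW (s0 _)) ?(ltW (t0 _))// mulrC; congr (_ * _).
    by rewrite -(powR_inv1 (ltW (t0 j))) -powRrM mulN1r.
  have -> : tnth s j `^ (H i j * K i j) / tnth t j `^ (H i j * K i j) = (tnth s j / tnth t j) `^ (H i j * K i j).
    rewrite [RHS]powRM ?invr_ge0 ?(ltW (s0 _)) ?(ltW (t0 _))//; congr (_ * _).
    by rewrite -(powR_inv1 (ltW (t0 j))) -powRrM mulN1r powRN.
  apply: powR_exp_anti; [|exact: h0|by rewrite [leRHS]mulrC].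
  have /andP[_ sjt] := st j.
  by rewrite divr_ge0 ?(ltW (s0 _)) ?(ltW (t0 _))//= ler_pdivrMr// mul1r.
pose e i := Num.min 1 (c i ^+ 2) / 2 `^ q.
have e0 i : 0 < e i by rewrite divr_gt0 ?powR_gt0// lt_min ltr01 exprn_gt0.
have vle i eps s : 0 <= eps <= 1 -> posbox t s ->
   e i * (sheet_sd H K k s ^+ 2 + eps) `^ q <= sheet_sd H K i s ^+ 2 + eps.
  move=> /andP[ep0 ep1] st.
  set a := sheet_sd H K k s ^+ 2.
  have a0 : 0 <= a by exact: sqr_ge0.
  have h1 : (a + eps) `^ q <= 2 `^ q * (a `^ q + eps).
    have eq : eps `^ q <= eps.
      have [->|en] := eqVneq eps 0; first by rewrite powR0// gt_eqF.
      by apply: ge1r_powR => //; rewrite lt_neqAle eq_sym en ep0.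
    apply: (@le_trans _ _ ((2 * Num.max a eps) `^ q)).
      apply: powR_homo; [exact: ltW|exact: addr_ge0|].
      have := le_max a a eps; have := le_max eps a eps; rewrite !lexx orbT/= => h2 h3.
      by move: h2 h3; lra.
    rewrite powRM ?ler0n ?le_max ?a0// ler_wpM2l ?powR_ge0//.
    have [_|_] := leP a eps; first by rewrite (le_trans eq)// lerDr powR_ge0.
    by rewrite lerDl.
  apply: (@le_trans _ _ (e i * (2 `^ q * (a `^ q + eps)))).
    by rewrite ler_wpM2l// ltW.
  rewrite /e mulrA divfK ?gt_eqF ?powR_gt0// mulrDr; apply: lerD; last first.
    by rewrite ler_piMl// ge_min lexx.
  apply: (@le_trans _ _ (c i ^+ 2 * a `^ q)).
    by rewrite ler_wpM2r ?powR_ge0// ge_min lexx orbT.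
  have sk0 : 0 <= sheet_sd H K k s by apply: ltW; exact: sheet_sd_gt0 st.
  have -> : a `^ q = (sheet_sd H K k s `^ q) ^+ 2.
    by rewrite /a -powR_mulrn// -powRrM mulrC powRrM powR_mulrn// powR_ge0.
  rewrite -exprMn lerXn2r ?nnegrE//.
  - by rewrite mulr_ge0 ?powR_ge0// ltW.
  - by apply: ltW; exact: sheet_sd_gt0 st.
  - exact: sdle.
pose p := q * d%:R / 2.
have d0 : (0 < d)%N by apply: leq_ltn_trans (ltn_ord k).
have p0 : 0 < p by rewrite !mulr_gt0// ?ltr0n// invr_gt0.
have [C [C0 CP]] := powR_expR_bound p0.
pose b := tnth x k ^+ 2 / 8.
have b0 : 0 < b by rewrite divr_gt0// lt_neqAle eq_sym sqrf_eq0 xk sqr_ge0.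
exists ((\prod_(i < d) e i `^ (- (1 / 2))) * (b `^ (- p) * C)), (fun=> 0); split.
- by rewrite !mulr_ge0 ?powR_ge0// prodr_ge0// => i _; exact: powR_ge0.
- by move=> j; rewrite lexx ltr01.
move=> eps s ep st; have /andP[ep0 _] := ep.
rewrite [X in _ <= _ * X]big1 ?mulr1; last by move=> j _; rewrite oppr0 powRr0.
pose V i := sheet_sd H K i s ^+ 2 + eps.
have V0 i : 0 < V i.
  by rewrite ltr_pwDl// exprn_gt0//; exact: sheet_sd_gt0 st.
rewrite /gdom big_split/=.
apply: (@le_trans _ _ ((\prod_(i < d) (e i `^ (- (1 / 2)) * V k `^ (- (q / 2)))) * expR (- (b / V k)))).
  apply: ler_pM.
  - by apply: prodr_ge0 => i _; rewrite invr_ge0 sqrtr_ge0.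
  - by apply: prodr_ge0 => i _; exact: expR_ge0.
  - apply: ler_prod => i _; rewrite invr_ge0 sqrtr_ge0/= -/(V i).
    have -> : (Num.sqrt (V i))^-1 = V i `^ (- (1 / 2)).
      by rewrite powRN div1r powR12_sqrt// ltW.
    have -> : V k `^ (- (q / 2)) = (V k `^ q) `^ (- (1 / 2)).
      by rewrite -powRrM; congr (_ `^ _); lra.
    have ev : 0 < e i * V k `^ q by apply: mulr_gt0 => //; exact: powR_gt0.
    rewrite -powRM ?powR_ge0 ?(ltW (e0 _))// !powRN.
    rewrite lef_pV2 ?posrE; [|exact: powR_gt0|exact: powR_gt0].
    by apply: powR_homo; [lra|exact: ltW|exact: vle].
  - have -> : expR (- (b / V k)) = expR (- (tnth x k / Num.sqrt (V k)) ^+ 2 / 8).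
      congr expR; rewrite exprMn exprVn sqr_sqrtr ?(ltW (V0 _))// /b; lra.
    apply: (prod_le_factor (f := fun i => expR (- (tnth x i / Num.sqrt (V i)) ^+ 2 / 8))) => i.
    by rewrite expR_ge0 -expR0 ler_expR mulNr oppr_le0 divr_ge0 ?sqr_ge0.
rewrite big_split/= prodr_const card_ord -mulrA ler_wpM2l; [by []| |].
  by apply: prodr_ge0 => i _; exact: powR_ge0.
rewrite -powR_mulrn ?powR_ge0// -powRrM.
have -> : - (q / 2) * d%:R = - p by rewrite /p; lra.
have -> : V k `^ (- p) = b `^ (- p) * (b / V k) `^ p.
  rewrite powRM ?invr_ge0 ?(ltW b0) ?(ltW (V0 _))// mulrA -powR_addr// addNr powRr0 mul1r.
  by rewrite -(powR_inv1 (ltW (V0 k))) -powRrM mulN1r.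
rewrite -mulrA ler_wpM2l ?powR_ge0//; apply: CP.
by rewrite divr_ge0 ?(ltW b0) ?(ltW (V0 _)).
Qed.

End domination.

(** * Chaos expansion of averaged fields *)

Section multi_index.
Context {R : realType} {d : nat}.
Implicit Types f g : ('I_d -> nat) -> R.

(** The entries of a multi-index of degree n are at most n, so this finite index type loses none; by
    [lev_box] any larger box gives the same sum. *)
Definition lev n f : R := \sum_(m : {ffun 'I_d -> 'I_n.+1} | (\sum_(i < d) m i == n)%N) f (fun i => m i).

Lemma lev_box n M f : (n < M)%N ->
  lev n f = \sum_(m : {ffun 'I_d -> 'I_M} | (\sum_(i < d) m i == n)%N) f (fun i => m i).
Proof.
case: M => // M; rewrite ltnS => nM.
pose h (m : {ffun 'I_d -> 'I_n.+1}) : {ffun 'I_d -> 'I_M.+1} := [ffun i => inord (m i)].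
pose h' (m : {ffun 'I_d -> 'I_M.+1}) : {ffun 'I_d -> 'I_n.+1} := [ffun i => inord (m i)].
have hE m i : h m i = m i :> nat.
  by rewrite ffunE inordK// ltnS (leq_trans _ nM)// -ltnS.
have h'E (m : {ffun 'I_d -> 'I_M.+1}) i : (\sum_(i < d) m i == n)%N -> h' m i = m i :> nat.
  by move=> /eqP mn; rewrite ffunE inordK// ltnS -mn (bigD1 i)//= leq_addr.
rewrite /lev [RHS](reindex_onto h h')/=; last first.
  move=> m /[dup] mn /eqP mE; apply/ffunP => i; apply: val_inj => /=.
  by rewrite hE h'E.
apply: eq_big => [m|m _].
  have -> : (\sum_(i < d) h m i = \sum_(i < d) m i)%N by apply: eq_bigr => i _; exact: hE.
  case: eqP => //= /eqP mn; apply/esym/eqP/ffunP => i; apply: val_inj => /=.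
  have hmn : (\sum_(i < d) h m i == n)%N.
    by rewrite (eq_bigr (fun i => m i : nat)) ?mn// => l _; exact: hE.
  by rewrite h'E// hE.
by congr f; apply/funext => i; rewrite hE.
Qed.

Lemma sum_lev M M' f : (M <= M')%N ->
  \sum_(n < M) lev n f = \sum_(m : {ffun 'I_d -> 'I_M'} | (\sum_(i < d) m i < M)%N) f (fun i => m i).
Proof.
move=> MM'; rewrite (eq_bigr (fun n : 'I_M => \sum_(m : {ffun 'I_d -> 'I_M'} | (\sum_(i < d) m i == n)%N) f (fun i => m i))); last first.
  by move=> n _; rewrite (lev_box (M := M'))// (leq_trans _ MM').
rewrite [RHS](partition_big (fun m : {ffun 'I_d -> 'I_M'} => inord (\sum_(i < d) m i)%N : 'I_M.-1.+1) predT)//=.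
case: M MM' => [|M] MM'; first by rewrite !big_ord0 big_ord1 big_pred0.
apply: eq_bigr => n _; apply: eq_bigl => m.
apply/idP/idP => [/eqP mn|/andP[mM /eqP <-]]; last by rewrite inordK.
by rewrite mn ltn_ord/=; apply/eqP/val_inj; rewrite /= inordK.
Qed.

Lemma lev_le n f g : (forall m, f m <= g m) -> lev n f <= lev n g.
Proof. by move=> fg; apply: ler_sum. Qed.

Lemma lev_ge0 n f : (forall m, 0 <= f m) -> 0 <= lev n f.
Proof. by move=> f0; apply: sumr_ge0. Qed.

Lemma lev_norm n f : `|lev n f| <= lev n (fun m => `|f m|).
Proof. exact: ler_norm_sum. Qed.

End multi_index.

Section chaos_fields.
Context {R : realType} {dS : measure_display} {S : measurableType dS}
  (nu : {finite_measure set S -> \bar R})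
  {dT : measure_display} {T : measurableType dT} (P : probability T R) {d : nat}.
Variables (xi : 'I_d -> S -> T -> R) (rho : 'I_d -> S -> S -> R).

Definition hermite_prod (m : 'I_d -> nat) s w : R := \prod_(i < d) hermiteN (m i) (xi i s w).

Hypothesis mxi : forall i, measurable_fun setT (fun sw : S * T => xi i sw.1 sw.2).
Hypothesis hpL2 : forall m s, L2 P (hermite_prod m s).
Hypothesis hp_ip : forall m n s u, ip P (hermite_prod m s) (hermite_prod n u) =
  if [forall i, m i == n i] then \prod_(i < d) rho i s u ^+ m i else 0.
Hypothesis rho01 : forall i s u, 0 <= rho i s u <= 1.
Hypothesis rho_diag : forall i s, rho i s s = 1.
Hypothesis mrho : forall i, measurable_fun setT (fun su : S * S => rho i su.1 su.2).

Local Notation L2 := (L2 P).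
Local Notation ip := (ip P).
Local Notation sq := (sq P).
Local Notation L2field := (L2field P).
Local Notation pint := (pint nu).

Definition good_weight (A : ('I_d -> nat) -> S -> R) := forall m, measurable_fun setT (A m) /\
  exists c, forall s, `|A m s| <= c.

(** Degree-n part of a Hermite expansion with coefficients [A]; its integral [chaosJ] plays the role
    of the n-th chaos component of the integrated field. *)
Definition chaos_field (A : ('I_d -> nat) -> S -> R) n s w : R :=
  lev n (fun m => A m s * hermite_prod m s w).

Definition chaosJ A n := pint (chaos_field A n).

Lemma hermite_prod_field m : L2field (hermite_prod m).
Proof.
split.
  apply: measurable_prod => i _.
  apply: measurable_funM; last exact: measurable_cst.
  apply: (measurableT_comp _ (mxi i)); apply: continuous_measurable_fun.
  exact: continuous_horner.
exists 1 => s; rewrite sq_EFin ?hpL2// sqE hp_ip.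
rewrite (_ : [forall i, _]) ?lee_fin; last by apply/forallP => i.
by rewrite big1// => i _; rewrite rho_diag expr1n.
Qed.

Lemma weight_field A m : good_weight A -> L2field (fun s w => A m s * hermite_prod m s w).
Proof.
by move=> /(_ m)[mA [c cA]]; apply: L2fieldM mA cA _; exact: hermite_prod_field.
Qed.

Lemma chaos_field_L2 A n : good_weight A -> L2field (chaos_field A n).
Proof. by move=> gA; apply: L2field_sum => m _; exact: weight_field. Qed.

Lemma ip_weights (A : ('I_d -> nat) -> S -> R) M (p q : pred {ffun 'I_d -> 'I_M}) s u :
  ip (fun w => \sum_(m : {ffun 'I_d -> 'I_M} | p m) A (fun i => m i) s * hermite_prod (fun i => m i) s w)
     (fun w => \sum_(m : {ffun 'I_d -> 'I_M} | q m) A (fun i => m i) u * hermite_prod (fun i => m i) u w) =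
  \sum_(m : {ffun 'I_d -> 'I_M} | p m && q m)
     A (fun i => m i) s * A (fun i => m i) u * \prod_(i < d) rho i s u ^+ m i.
Proof.
have LA m v : L2 (fun w => A m v * hermite_prod m v w) by apply: L2Z.
rewrite ip_suml//; last by apply: L2_sum.
rewrite big_mkcondr/=; apply: eq_bigr => m pm.
rewrite ip_sumr//.
have E (k : {ffun 'I_d -> 'I_M}) : ip (fun w => A (fun i => m i) s * hermite_prod (fun i => m i) s w)
    (fun w => A (fun i => k i) u * hermite_prod (fun i => k i) u w) =
    if k == m then A (fun i => m i) s * A (fun i => m i) u * \prod_(i < d) rho i s u ^+ m i else 0.
  rewrite ipZl// ipZr// hp_ip.
  have -> : [forall i, (m i : nat) == k i] = (k == m).
    apply/forallP/eqP => [h|->//]; apply/ffunP => i; apply: val_inj => /=.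
    by have /eqP := h i.
  by case: eqP => [->|_]; rewrite ?mulrA// !mulr0.
rewrite (eq_bigr _ (fun k _ => E k)).
rewrite big_mkcond/= (bigD1 m)//= eqxx [X in _ + X]big1 ?addr0//.
by move=> k km; rewrite (negbTE km); case: ifP.
Qed.

Lemma ip_chaos_field A n s u : ip (chaos_field A n s) (chaos_field A n u) =
  lev n (fun m => A m s * A m u * \prod_(i < d) rho i s u ^+ m i).
Proof.
rewrite /chaos_field /lev ip_weights; apply: eq_bigl => m; exact: andbb.
Qed.

Lemma ip_chaos_field_neq A n k s u : n != k -> ip (chaos_field A n s) (chaos_field A k u) = 0.
Proof.
move=> nk; rewrite /chaos_field.
have nM : (n < (maxn n k).+1)%N by rewrite ltnS leq_maxl.
have kM : (k < (maxn n k).+1)%N by rewrite ltnS leq_maxr.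
rewrite (_ : (fun w => _) = (fun w => \sum_(m : {ffun 'I_d -> 'I_(maxn n k).+1} | (\sum_(i < d) m i == n)%N) A (fun i => m i) s * hermite_prod (fun i => m i) s w)); last first.
  by apply/funext => w; rewrite (lev_box _ nM).
rewrite [X in ip _ X](_ : _ = (fun w => \sum_(m : {ffun 'I_d -> 'I_(maxn n k).+1} | (\sum_(i < d) m i == k)%N) A (fun i => m i) u * hermite_prod (fun i => m i) u w)); last first.
  by apply/funext => w; rewrite (lev_box _ kM).
rewrite ip_weights big_pred0// => m; apply/negP => /andP[/eqP -> /eqP h].
by rewrite h eqxx in nk.
Qed.

Lemma chaosJ_orth A n k : good_weight A -> n != k -> ip (chaosJ A n) (chaosJ A k) = 0.
Proof.
move=> gA nk; rewrite ip_pint2; [|exact: chaos_field_L2|exact: chaos_field_L2].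
under eq_Rintegral => s _.
  under eq_Rintegral => u _ do rewrite ip_chaos_field_neq//.
  rewrite Rintegral_cst// mul0r.
  over.
by rewrite Rintegral_cst// mul0r.
Qed.

Lemma chaosJ_L2 A n : good_weight A -> L2 (chaosJ A n).
Proof. by move=> gA; apply: pint_L2; exact: chaos_field_L2. Qed.

Lemma sq_chaosJB A A' n : good_weight A -> good_weight A' ->
  sq (fun w => chaosJ A n w - chaosJ A' n w) = sq (chaosJ (fun m s => A m s - A' m s) n).
Proof.
move=> gA gA'; rewrite sq_pintB; [|exact: chaos_field_L2|exact: chaos_field_L2].
congr (sq (pint _)); apply/funext => s; apply/funext => w.
by rewrite /chaos_field /lev -sumrB; apply: eq_bigr => m _; rewrite mulrBl.
Qed.

Lemma measurable_weight2 A m : good_weight A ->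
  measurable_fun setT (fun su : S * S => `|A m su.1| * `|A m su.2| * \prod_(i < d) rho i su.2 su.1 ^+ m i).
Proof.
move=> /(_ m)[mA _]; have mn : measurable_fun setT (fun s => `|A m s|).
  exact: (measurableT_comp (@normr_measurable R setT) mA).
apply: measurable_funM.
  apply: measurable_funM.
    exact: (measurableT_comp mn (@measurable_fst _ _ _ _)).
  exact: (measurableT_comp mn (@measurable_snd _ _ _ _)).
apply: measurable_prod => i _; apply: measurable_funX.
exact: (measurableT_comp (mrho i) (@measurable_swap _ _ _ _)).
Qed.

Lemma weight2_ge0 (A : ('I_d -> nat) -> S -> R) m s u : 0 <= `|A m s| * `|A m u| * \prod_(i < d) rho i u s ^+ m i.
Proof.
by rewrite !mulr_ge0// prodr_ge0// => i _; rewrite exprn_ge0//; have /andP[] := rho01 i u s.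
Qed.

Lemma sq_chaosJ_le A n : good_weight A ->
  ((sq (chaosJ A n))%:E <= \int[nu]_s \int[nu]_u
    (lev n (fun m => `|A m s| * `|A m u| * \prod_(i < d) rho i u s ^+ m i))%:E)%E.
Proof.
move=> gA; have LJ := chaos_field_L2 n gA.
set F := fun s u => lev n (fun m => `|A m s| * `|A m u| * \prod_(i < d) rho i u s ^+ m i).
have F0 s u : 0 <= F s u by apply: lev_ge0 => m; exact: weight2_ge0.
have mF : measurable_fun setT (fun su : S * S => (F su.1 su.2)%:E).
  apply/measurable_EFinP; rewrite /F /lev; under eq_fun do rewrite big_mkcond/=.
  apply: measurable_sum => m; case: (_ == n)%N; last exact: measurable_cst.
  exact: measurable_weight2.
have mFu s : measurable_fun setT (fun u => (F s u)%:E).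
  exact: (measurableT_comp mF (measurable_pair1 s)).
have mI : measurable_fun setT (fun s => \int[nu]_u (F s u)%:E)%E.
  have h := @measurable_fun_fubini_tonelli_F _ _ S S R nu (fun su => (F su.1 su.2)%:E) mF.
  by apply: h => su; rewrite lee_fin.
have fineI (x y : \bar R) : (`|x| <= y -> (`|fine x|%:E <= y))%E.
  case: x => [r| |] //=; rewrite ?normr0//; move=> h; apply: le_trans h; exact: leey.
have h1 s : (`|(\int[nu]_u ip (chaos_field A n u) (chaos_field A n s))|%:E <= \int[nu]_u (F s u)%:E)%E.
  apply: fineI.
  have mi : measurable_fun setT (fun u => (ip (chaos_field A n u) (chaos_field A n s))%:E).
    have /integrableP[] := integrable_ip_field nu LJ (L2field_L2 s LJ).
    by under eq_fun do rewrite ipC.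
  apply: (le_trans (le_abse_integral nu measurableT mi)); apply: ge0_le_integral => //.
  - exact: measurableT_comp.
  - move=> u _; rewrite /= lee_fin ip_chaos_field; apply: le_trans (lev_norm _ _) _.
    apply: lev_le => m; rewrite !normrM [`|A m u| * _]mulrC ler_wpM2l// ger0_norm//.
    by rewrite prodr_ge0// => i _; rewrite exprn_ge0//; have /andP[] := rho01 i u s.
rewrite sqE ip_pint2// -[X in (X%:E <= _)%E]ger0_norm; last first.
  by rewrite -ip_pint2// -sqE sq_ge0.
apply: fineI.
have mi : measurable_fun setT (fun s => (\int[nu]_u ip (chaos_field A n u) (chaos_field A n s))%:E).
  have /integrableP[+ _] := integrable_ip_field nu LJ (pint_L2 nu LJ).
  congr (measurable_fun _ _); apply/funext => s; congr EFin.
  rewrite ipC (ip_pint nu LJ (L2field_L2 s LJ)).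
  by apply: eq_Rintegral => u _; exact: ipC.
apply: (le_trans (le_abse_integral nu measurableT mi)); apply: ge0_le_integral => //.
  exact: measurableT_comp.
by move=> s _; exact: h1.
Qed.

(** The sum over n goes inside the double integral before any estimate, so a single pointwise bound
    by [W] handles all orders at once. *)
Lemma chaosJ_weighted_sum A M (alpha : R) (W : S -> S -> \bar R) : good_weight A ->
  measurable_fun setT (fun su : S * S => W su.1 su.2) -> (forall s u, 0 <= W s u)%E ->
  (forall s u, ((\sum_(n < M) (1 + n%:R) `^ alpha *
     lev n (fun m => `|A m s| * `|A m u| * \prod_(i < d) rho i u s ^+ m i))%:E <= W u s)%E) ->
  ((\sum_(n < M) (1 + n%:R) `^ alpha * sq (chaosJ A n))%:E <= \int[nu]_s \int[nu]_u W u s)%E.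
Proof.
move=> gA mW W0 dom.
pose F n s u := (1 + n%:R) `^ alpha *
     lev n (fun m => `|A m s| * `|A m u| * \prod_(i < d) rho i u s ^+ m i).
have l0 n s u : 0 <= lev n (fun m => `|A m s| * `|A m u| * \prod_(i < d) rho i u s ^+ m i).
  by apply: lev_ge0 => m; exact: weight2_ge0.
have F0 n s u : (0 <= (F n s u)%:E)%E by rewrite lee_fin mulr_ge0 ?powR_ge0.
have ml n : measurable_fun setT (fun su : S * S =>
    (lev n (fun m => `|A m su.1| * `|A m su.2| * \prod_(i < d) rho i su.2 su.1 ^+ m i))%:E).
  apply/measurable_EFinP; rewrite /lev; under eq_fun do rewrite big_mkcond/=.
  apply: measurable_sum => m; case: (_ == n)%N; last exact: measurable_cst.
  exact: measurable_weight2.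
have mF n : measurable_fun setT (fun su : S * S => (F n su.1 su.2)%:E).
  by under eq_fun do rewrite EFinM; apply: emeasurable_funM => //; exact: measurable_cst.
have mFu n s : measurable_fun setT (fun u => (F n s u)%:E).
  exact: (measurableT_comp (mF n) (measurable_pair1 s)).
have mI n : measurable_fun setT (fun s => \int[nu]_u (F n s u)%:E)%E.
  have h := @measurable_fun_fubini_tonelli_F _ _ S S R nu (fun su => (F n su.1 su.2)%:E) (mF n).
  by apply: h => su; exact: F0.
have mWs : measurable_fun setT (fun su : S * S => W su.2 su.1).
  exact: (measurableT_comp mW (@measurable_swap _ _ _ _)).
apply: (@le_trans _ _ (\sum_(n < M) \int[nu]_s \int[nu]_u (F n s u)%:E)%E).
  rewrite -sumEFin; apply: lee_sum => n _; rewrite EFinM.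
  apply: le_trans (lee_wpmul2l _ (sq_chaosJ_le n gA)) _; first by rewrite lee_fin powR_ge0.
  have mlu s : measurable_fun setT (fun u =>
    (lev n (fun m => `|A m s| * `|A m u| * \prod_(i < d) rho i u s ^+ m i))%:E).
    exact: (measurableT_comp (ml n) (measurable_pair1 s)).
  have mlI : measurable_fun setT (fun s => \int[nu]_u
    (lev n (fun m => `|A m s| * `|A m u| * \prod_(i < d) rho i u s ^+ m i))%:E)%E.
    have h := @measurable_fun_fubini_tonelli_F _ _ S S R nu _ (ml n).
    by apply: h => su; rewrite lee_fin; exact: l0.
  rewrite -ge0_integralZl ?lee_fin ?powR_ge0//; last first.
    by move=> s _; apply: integral_ge0 => u _; rewrite lee_fin l0.
  apply: ge0_le_integral => //.
  - by move=> s _; rewrite mule_ge0 ?lee_fin ?powR_ge0//; apply: integral_ge0 => u _; rewrite lee_fin l0.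
  - by apply: emeasurable_funM => //; exact: measurable_cst.
  - move=> s _; rewrite -ge0_integralZl ?lee_fin ?powR_ge0//.
    by move=> u _; rewrite lee_fin l0.
rewrite -ge0_integral_sum//; last by move=> n s _; apply: integral_ge0.
apply: ge0_le_integral => //.
- by move=> s _; apply: sume_ge0 => n _; apply: integral_ge0.
- by apply: emeasurable_sum.
- have h := @measurable_fun_fubini_tonelli_F _ _ S S R nu (fun su => W su.2 su.1) mWs.
  by apply: h => su.
- move=> s _; rewrite -ge0_integral_sum//.
  apply: ge0_le_integral => //.
  + by move=> u _; apply: sume_ge0.
  + by apply: emeasurable_sum.
  + exact: (measurableT_comp mWs (measurable_pair1 s)).
  + by move=> u _; rewrite sumEFin; exact: dom.
Qed.

(** The correlations are bounded by 1: cruder than [sq_chaosJ_le], but in terms of L^1 norms of the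
    weights only, hence suited to the difference of two regularizations. *)
Lemma sq_chaosJ_le_L1 A n : good_weight A ->
  ((sq (chaosJ A n))%:E <= \sum_(m : {ffun 'I_d -> 'I_n.+1})
    (\int[nu]_s (`|A (fun i => m i) s|)%:E) * (\int[nu]_s (`|A (fun i => m i) s|)%:E))%E.
Proof.
move=> gA; apply: le_trans (sq_chaosJ_le n gA) _.
have ma m : measurable_fun setT (fun s => (`|A m s|)%:E).
  by apply/measurable_EFinP; apply: (measurableT_comp (@normr_measurable R setT)); have [] := gA m.
have mi (m : {ffun 'I_d -> 'I_n.+1}) : (0 <= \int[nu]_u (`|A (fun i => m i) u|)%:E)%E by exact: integral_ge0.
under [leRHS]eq_bigr => m _ do rewrite -ge0_integralZr//.
rewrite -ge0_integral_sum//; last 2 first.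
- by move=> m; apply: emeasurable_funM => //; exact: measurable_cst.
- by move=> m s _; rewrite mule_ge0.
have ml : measurable_fun setT (fun su : S * S =>
    (lev n (fun m => `|A m su.1| * `|A m su.2| * \prod_(i < d) rho i su.2 su.1 ^+ m i))%:E).
  apply/measurable_EFinP; rewrite /lev; under eq_fun do rewrite big_mkcond/=.
  apply: measurable_sum => m; case: (_ == n)%N; last exact: measurable_cst.
  exact: measurable_weight2.
apply: ge0_le_integral => //.
- by move=> s _; apply: integral_ge0 => u _; rewrite lee_fin lev_ge0// => m; exact: weight2_ge0.
- have h := @measurable_fun_fubini_tonelli_F _ _ S S R nu _ ml.
  by apply: h => su; rewrite lee_fin lev_ge0// => m; exact: weight2_ge0.
- by apply: emeasurable_sum => m; apply: emeasurable_funM => //; exact: measurable_cst.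
- move=> s _.
  under [leRHS]eq_bigr => m _ do rewrite -ge0_integralZl//.
  rewrite -ge0_integral_sum//; last by move=> m; apply: emeasurable_funM => //; exact: measurable_cst.
  apply: ge0_le_integral => //.
  + by move=> u _; rewrite lee_fin lev_ge0// => m; exact: weight2_ge0.
  + exact: (measurableT_comp ml (measurable_pair1 s)).
  + by apply: emeasurable_sum => m; apply: emeasurable_funM => //; exact: measurable_cst.
  + move=> u _; under eq_bigr do rewrite -EFinM.
    rewrite sumEFin lee_fin /lev big_mkcond/=; apply: ler_sum => m _.
    case: ifP => _; last by rewrite mulr_ge0.
    rewrite ler_piMr ?mulr_ge0//; apply: prodr_ile1 => i _.
    by have /andP[h1 h2] := rho01 i u s; rewrite exprn_ge0//= exprn_ile1.
Qed.

(** The pointwise hypothesis concerns sums over boxes of multi-indices, whereas chaos orders are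
    degrees. Geometric decay of the coefficients bounds the L^2 difference between a box sum and the
    truncation at degree M by [eta M], uniformly in s and in the box; Fatou's lemma lets the box
    grow. *)
Lemma chaos_expansion (c : 'I_d -> nat -> S -> R) (D r : R) (X : S -> T -> R) :
  (forall i k, measurable_fun setT (c i k)) -> 0 <= D -> 0 <= r < 1 ->
  (forall i k s, `|c i k s| <= D * r ^+ k) -> L2field X ->
  (forall s w, (fun n => \prod_(i < d) \sum_(0 <= k < n) c i k s * hermiteN k (xi i s w)) @ \oo --> X s w) ->
  sq (fun w => pint X w - \sum_(n < M) chaosJ (fun m s => \prod_(i < d) c i (m i) s) n w) @[M --> \oo] --> 0.
Proof.
move=> mc D0 /andP[r0 r1] cD LX cvX.
have or : 0 < 1 - r by rewrite subr_gt0.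
pose A (m : 'I_d -> nat) s := \prod_(i < d) c i (m i) s.
have AD m s : `|A m s| <= D ^+ d * r ^+ (\sum_(i < d) m i).
  rewrite normr_prod; apply: (@le_trans _ _ (\prod_(i < d) (D * r ^+ m i))).
    by apply: ler_prod => i _; rewrite normr_ge0 cD.
  by rewrite big_split/= prodr_const card_ord expr_sum.
have gA : good_weight A.
  move=> m; split; first by apply: measurable_prod => i _.
  exists (D ^+ d) => s; apply: le_trans (AD m s) _.
  by rewrite ler_piMr ?exprn_ge0// exprn_ile1// ltW.
pose SM M s w := \sum_(n < M) chaos_field A n s w.
have LS M : L2field (SM M) by apply: L2field_sum => n _; exact: chaos_field_L2.
pose box M s w := \sum_(m : {ffun 'I_d -> 'I_M}) A (fun i => m i) s * hermite_prod (fun i => m i) s w.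
have boxE M s w : box M s w = \prod_(i < d) \sum_(0 <= k < M) c i k s * hermiteN k (xi i s w).
  under [RHS]eq_bigr do rewrite big_mkord.
  rewrite (bigA_distr_bigA (fun i (k : 'I_M) => c i k s * hermiteN k (xi i s w))).
  by apply: eq_bigr => m _; rewrite big_split.
have SME M M' s w : (M <= M')%N -> SM M s w =
    \sum_(m : {ffun 'I_d -> 'I_M'} | (\sum_(i < d) m i < M)%N) A (fun i => m i) s * hermite_prod (fun i => m i) s w.
  by move=> MM'; rewrite /SM /chaos_field (sum_lev _ MM').
(* Bounds the sum of D^(2d) r^(2|m|) over |m| >= M: one factor r^|m| gives r^M, the other sums to at
   most (1-r)^(-d). *)
pose eta M := (D ^+ d) ^+ 2 * (r ^+ M * (1 - r)^-1 ^+ d).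
have diff M M' s : (M <= M')%N -> sq (fun w => box M' s w - SM M s w) <= eta M.
  move=> MM'.
  rewrite (_ : (fun w => _) = (fun w => \sum_(m : {ffun 'I_d -> 'I_M'} | ~~ (\sum_(i < d) m i < M)%N)
       A (fun i => m i) s * hermite_prod (fun i => m i) s w)); last first.
    apply/funext => w; rewrite (SME M M')// /box.
    rewrite (bigID (fun m : {ffun 'I_d -> 'I_M'} => (\sum_(i < d) m i < M)%N))/= addrAC subrr add0r.
    by [].
  rewrite sqE ip_weights; under eq_bigl do rewrite andbb.
  apply: (@le_trans _ _ (\sum_(m : {ffun 'I_d -> 'I_M'}) (D ^+ d) ^+ 2 * (r ^+ M * \prod_(i < d) r ^+ m i))).
    rewrite big_mkcond/=; apply: ler_sum => m _; case: ifP => h; last first.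
      by rewrite !mulr_ge0 ?exprn_ge0// prodr_ge0// => i _; rewrite exprn_ge0.
    rewrite big1 ?mulr1; last by move=> i _; rewrite rho_diag expr1n.
    rewrite -expr2 -real_normK ?num_real//.
    apply: (@le_trans _ _ ((D ^+ d * r ^+ (\sum_(i < d) m i)) ^+ 2)).
      by rewrite lerXn2r ?nnegrE ?mulr_ge0 ?exprn_ge0// AD.
    rewrite exprMn ler_wpM2l ?exprn_ge0// expr2 -expr_sum ler_wpM2r ?exprn_ge0//.
    by rewrite ler_wiXn2l ?(ltW r1)// leqNgt.
  rewrite -!mulr_sumr ler_wpM2l ?exprn_ge0// ler_wpM2l ?exprn_ge0//.
  rewrite -(bigA_distr_bigA (fun (_ : 'I_d) (k : 'I_M') => r ^+ k)) prodr_const card_ord.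
  rewrite lerXn2r ?nnegrE ?invr_ge0 ?(ltW or)//.
    by apply: sumr_ge0 => k _; rewrite exprn_ge0.
  by have := @sum_geo_le R r 0 M'; rewrite big_mkord r0 r1; apply.
have sqX M s : sq (fun w => X s w - SM M s w) <= eta M.
  have LB j : L2 (fun w => box (M + j)%N s w - SM M s w).
    apply: L2B; last exact: L2field_L2.
    by apply: L2_sum => m _; apply: L2Z.
  apply: (@L2_fatou _ _ _ P (fun j w => box (M + j)%N s w - SM M s w) _ _ _ _ _ _).2.
  - by move=> j; exact: L2_measurable (LB j).
  - exact: (measurable_funB (L2_measurable (L2field_L2 s LX)) (L2_measurable (L2field_L2 s (LS M)))).
  - move=> w; apply: cvgB; last exact: cvg_cst.
    have := cvX s w; under eq_fun do rewrite -boxE.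
    by rewrite -(cvg_shiftn M); under eq_fun do rewrite addnC.
  - by move=> j; rewrite sq_EFin ?lee_fin ?diff ?leq_addr.
have V0 : 0 <= fine (nu setT) by exact: fine_ge0.
have bound M : sq (fun w => pint X w - \sum_(n < M) chaosJ A n w) <= fine (nu setT) ^+ 2 * eta M.
  have -> : sq (fun w => pint X w - \sum_(n < M) chaosJ A n w) = sq (pint (fun s w => X s w - SM M s w)).
    rewrite -sq_pintB//; apply: sq_ae.
    - apply: measurable_funB; first exact: (measurable_pint nu LX).
      by apply: measurable_sum => n; exact: (measurable_pint nu (chaos_field_L2 n gA)).
    - exact: (measurable_funB (measurable_pint nu LX) (measurable_pint nu (LS M))).
    - have := pint_sum nu (index_enum 'I_M) (p := predT) (fun n _ => chaos_field_L2 n gA).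
      by apply: filterS => w ->.
  rewrite -lee_fin; apply: le_trans (sq_pint_le nu (L2fieldB LX (LS M))) _.
  have nuE : nu setT = (fine (nu setT))%:E by rewrite fineK// fin_num_measure.
  apply: (@le_trans _ _ (nu setT * \int[nu]_s (eta M)%:E)%E).
    apply: lee_wpmul2l => //; apply: ge0_le_integral => //.
    - by move=> s _; rewrite lee_fin sq_ge0.
    - have h := @measurable_fun_fubini_tonelli_F _ _ S T R P (fun sw => ((X sw.1 sw.2 - SM M sw.1 sw.2) ^+ 2)%:E).
      have LB := L2fieldB LX (LS M).
      under eq_fun => s do rewrite -(sq_EFin (L2field_L2 s LB)).
      apply: h => [|sw]; last by rewrite lee_fin sqr_ge0.
      by apply/measurable_EFinP; apply: measurable_funX; have [] := LB.
    - by move=> s _; rewrite lee_fin.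
  rewrite integral_cst// [X in (X * _)%E]nuE [X in (_ * (_ * X))%E]nuE -!EFinM lee_fin expr2.
  by rewrite [eta M * _]mulrC mulrA.
have etaC : fine (nu setT) ^+ 2 * eta M @[M --> \oo] --> 0.
  rewrite -[X in _ --> X](mulr0 (fine (nu setT) ^+ 2)); apply: cvgM; first exact: cvg_cst.
  rewrite -[X in _ --> X](mulr0 ((D ^+ d) ^+ 2)); apply: cvgM; first exact: cvg_cst.
  rewrite -[X in _ --> X](mul0r ((1 - r)^-1 ^+ d)); apply: cvgM; last exact: cvg_cst.
  by apply: cvg_expr; rewrite ger0_norm.
apply: squeeze_cvgr etaC; last exact: cvg_cst.
by apply: nearW => M; rewrite sq_ge0 bound.
Qed.

End chaos_fields.

(** * Completeness *)

Section completeness.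
Context {R : realType} {dT : measure_display} {T : measurableType dT} (P : probability T R).
Local Notation L2 := (L2 P).
Local Notation ip := (ip P).
Local Notation sq := (sq P).

Lemma sq_le (f g : T -> R) : measurable_fun setT f -> L2 g -> (forall w, `|f w| <= `|g w|) -> sq f <= sq g.
Proof.
move=> mf Lg fg; have Lf : L2 f by apply: (L2_le (c := 1) mf Lg) => w; rewrite mul1r.
rewrite -lee_fin -!sq_EFin//; apply: ge0_le_integral => //.
- by move=> w _; rewrite lee_fin sqr_ge0.
- by apply/measurable_EFinP; exact: measurable_funX.
- by apply/measurable_EFinP; apply: measurable_funX; have [] := Lg.
- move=> w _; rewrite lee_fin -(real_normK (num_real (f w))) -(real_normK (num_real (g w))).
  by rewrite lerXn2r ?nnegrE.
Qed.

Lemma L2_ae_eq (f g : T -> R) : measurable_fun setT f -> measurable_fun setT g ->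
  {ae P, forall w, f w = g w} -> L2 g -> L2 f.
Proof.
move=> mf mg fg [_ goo]; split => //.
have -> : (\int[P]_w (f w ^+ 2)%:E = \int[P]_w (g w ^+ 2)%:E)%E => //.
apply: ae_eq_integral => //.
- by apply/measurable_EFinP; exact: measurable_funX.
- by apply/measurable_EFinP; exact: measurable_funX.
- by apply: filterS fg => w -> _.
Qed.

(** Multiplication by the indicator of a set of full measure reduces to convergence everywhere. *)
Lemma L2_fatou_ae (f_ : nat -> T -> R) (f : T -> R) (c : R) :
  (forall n, L2 (f_ n)) -> measurable_fun setT f ->
  {ae P, forall w, f_ n w @[n --> \oo] --> f w} ->
  (forall n, sq (f_ n) <= c) -> L2 f /\ sq f <= c.
Proof.
move=> Lf_ mf [A [mA A0 Asub]] fle.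
pose i : T -> R := \1_(~` A).
have mi : measurable_fun setT i by apply: measurable_indic; exact: measurableC.
have ieq (g : T -> R) : {ae P, forall w, g w * i w = g w}.
  exists A; split => // w /= h; apply: contrapT => wA; apply: h.
  by rewrite /i indicE mem_set// mulr1.
have Lfi n : L2 (fun w => f_ n w * i w).
  by apply: L2_ae_eq (ieq (f_ n)) (Lf_ n); [apply: measurable_funM => //|]; have [] := Lf_ n.
have [||Lfi' sqfi] := @L2_fatou _ _ _ P (fun n w => f_ n w * i w) (fun w => f w * i w) c (fun n => L2_measurable (Lfi n)) (measurable_funM mf mi).
- move=> w; rewrite /i indicE; have [wA|wA] := boolP (w \in ~` A).
    rewrite mulr1; under eq_fun do rewrite mulr1.
    by apply: contrapT => h; move: wA; rewrite inE; apply; apply: Asub.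
  by rewrite mulr0; under eq_fun do rewrite mulr0; exact: cvg_cst.
- move=> n; rewrite sq_EFin// lee_fin; apply: le_trans (fle n).
  rewrite le_eqVlt; apply/orP; left; apply/eqP; apply: sq_ae; last exact: ieq.
    exact: L2_measurable (Lfi n).
  exact: L2_measurable (Lf_ n).
have ieq' : {ae P, forall w, f w = f w * i w} by apply: filterS (ieq f) => w ->.
split; first exact: (L2_ae_eq mf (L2_measurable Lfi') ieq' Lfi').
by rewrite (sq_ae mf (L2_measurable Lfi') ieq').
Qed.

Lemma abs_integral_sq_le f c : 0 < c -> L2 f -> (\int[P]_w `|(f w)%:E| <= (c * sq f + c^-1)%:E)%E.
Proof.
move=> c0 Lf; have [mf _] := Lf.
rewrite EFinD EFinM -sq_EFin//.
have -> : (c^-1%:E = \int[P]_w (c^-1)%:E)%E by rewrite integral_cst//= probability_setT mule1.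
rewrite -ge0_integralZl ?lee_fin ?(ltW c0)//; last 2 first.
- by apply/measurable_EFinP; exact: measurable_funX.
- by move=> w _; rewrite lee_fin sqr_ge0.
rewrite -ge0_integralD//; last 3 first.
- by move=> w _; rewrite -EFinM lee_fin mulr_ge0 ?sqr_ge0// ltW.
- by apply: emeasurable_funM; [exact: measurable_cst|apply/measurable_EFinP; exact: measurable_funX].
- by move=> w _; rewrite lee_fin invr_ge0 ltW.
apply: ge0_le_integral => //.
- by apply: measurableT_comp => //; exact/measurable_EFinP.
- by apply: emeasurable_funD => //; apply: emeasurable_funM; [exact: measurable_cst|apply/measurable_EFinP; exact: measurable_funX].
- move=> w _; rewrite -EFinM -EFinD lee_fin -(real_normK (num_real (f w))).
  have cc : c * c^-1 = 1 by rewrite divff// gt_eqF.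
  have ci : 0 < c^-1 by rewrite invr_gt0.
  move: `|f w| c^-1 cc ci => x i cc ci.
  have : 0 <= i * (c * x - 1) ^+ 2 by rewrite mulr_ge0 ?sqr_ge0// ltW.
  have -> : i * (c * x - 1) ^+ 2 = c * i * (c * x ^+ 2) - 2 * (c * i) * x + i by lra.
  have : 0 <= c * x ^+ 2 by rewrite mulr_ge0 ?sqr_ge0// ltW.
  by rewrite cc; lra.
Qed.

(** Fast L^2 convergence makes the telescoping series absolutely integrable, hence almost surely
    convergent. *)
Lemma fast_cauchy_ae (g : nat -> T -> R) : (forall j, L2 (g j)) ->
  (forall j, sq (fun w => g j.+1 w - g j w) <= (16^-1) ^+ j) ->
  {ae P, forall w, cvgn (g ^~ w)}.
Proof.
move=> Lg gle; pose D j w := g j.+1 w - g j w.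
have LD j : L2 (D j) by exact: L2B.
have mD j : measurable_fun setT (fun w => `|(D j w)%:E|%E).
  by apply: measurableT_comp => //; apply/measurable_EFinP; exact: L2_measurable (LD j).
have ID j : (\int[P]_w `|(D j w)%:E| <= (2 * (4^-1) ^+ j)%:E)%E.
  (* With the squares bounded by 16^(-j), c = 4^j makes both terms at most 4^(-j), which is
     summable. *)
  apply: (le_trans (abs_integral_sq_le (c := 4 ^+ j) _ (LD j))); first by rewrite exprn_gt0.
  rewrite lee_fin -exprVn mulr2n mulrDl !mul1r lerD2r.
  apply: (@le_trans _ _ (4 ^+ j * (16^-1) ^+ j)); first by apply: ler_wpM2l; [exact: exprn_ge0|exact: gle].
  by rewrite -exprMn; apply: lerXn2r; rewrite ?nnegrE; lra.
have sumfin : (\sum_(0 <= j <oo) \int[P]_w `|(D j w)%:E| < +oo)%E.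
  apply: (@le_lt_trans _ _ (4 : R)%:E); last exact: ltry.
  apply: lime_le; first by apply: is_cvg_nneseries => j _ _; exact: integral_ge0.
  apply: nearW => n; apply: (@le_trans _ _ (\sum_(0 <= j < n) (2 * (4^-1) ^+ j)%:E)%E).
    by apply: lee_sum => j _; exact: ID.
  rewrite sumEFin lee_fin -mulr_sumr.
  have -> : \sum_(0 <= j < n) (4^-1 : R) ^+ j = 4 / 3 * (1 - (4^-1) ^+ n).
    elim: n => [|n IH]; first by rewrite big_geq// expr0 subrr mulr0.
    by rewrite big_nat_recr//= IH exprS; lra.
  have : 0 <= (4^-1 : R) ^+ n by exact: exprn_ge0.
  lra.
rewrite -integral_nneseries// in sumfin.
have iD : P.-integrable setT (fun w => \sum_(0 <= j <oo) `|(D j w)%:E|)%E.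
  apply/integrableP; split; first by apply: ge0_emeasurable_sum.
  rewrite (eq_integral (fun w => \sum_(0 <= j <oo) `|(D j w)%:E|)%E)// => w _.
  by rewrite gee0_abs// nneseries_ge0.
have := integrable_ae measurableT iD; apply: filterS => w /(_ I) wfin.
have cs : cvgn (series (D ^~ w)).
  apply: normed_cvg; apply: nondecreasing_is_cvgn.
    by apply/nondecreasing_seqP => n; rewrite [leRHS]seriesSr lerDl; exact: normr_ge0.
  exists (fine (\sum_(0 <= j <oo) `|(D j w)%:E|)%E) => _ [n _ <-].
  rewrite -lee_fin fineK// /series/= -sumEFin.
  by apply: nneseries_lim_ge.
have -> : g ^~ w = (fun n => g 0%N w + series (D ^~ w) n).
  apply/funext => n; rewrite /series/= telescope_sumr// addrC subrK//.
by apply: is_cvgD => //; exact: is_cvg_cst.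
Qed.

End completeness.

Section parametrized_completeness.
Context {R : realType} {dT : measure_display} {T : measurableType dT} (P : probability T R)
  {dX : measure_display} {X : measurableType dX}.
Local Notation L2 := (L2 P).
Local Notation sq := (sq P).

Definition xintegral (h : X -> T -> R) x : \bar R := (\int[P]_w (h x w ^+ 2)%:E)%E.

Lemma measurable_xintegral (h : X -> T -> R) :
  measurable_fun setT (fun xw : X * T => h xw.1 xw.2) ->
  measurable_fun setT (xintegral h).
Proof.
move=> mh.
have H := @measurable_fun_fubini_tonelli_F _ _ X T R P (fun xw => (h xw.1 xw.2 ^+ 2)%:E).
apply: H => [|xw]; last by rewrite lee_fin sqr_ge0.
by apply/measurable_EFinP; exact: measurable_funX.
Qed.

(* The subsequence is chosen measurably in [x] so that the limit is jointly
   measurable. *)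
Lemma L2_complete_param (f : nat -> X -> T -> R) (D : set X) :
  (forall n, measurable_fun setT (fun xw : X * T => f n xw.1 xw.2)) ->
  (forall x, D x -> forall n, L2 (f n x)) ->
  (forall x, D x -> forall e, 0 < e -> exists n0, forall m n, (n0 <= m)%N -> (n0 <= n)%N ->
     sq (fun w => f m x w - f n x w) <= e) ->
  exists L : X -> T -> R, measurable_fun setT (fun xw : X * T => L xw.1 xw.2) /\
    forall x, D x -> L2 (L x) /\ sq (fun w => f n x w - L x w) @[n --> \oo] --> 0.
Proof.
move=> mf Lf cau.
pose dl j : R := (16^-1) ^+ j.
have dl0 j : 0 < dl j by rewrite exprn_gt0.
pose df m n (x : X) (w : T) := f m x w - f n x w.
have mdf m n : measurable_fun setT (fun xw : X * T => df m n xw.1 xw.2) by exact: measurable_funB.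
(* The points where all gaps are at most 16^(-j) from rank k on; [kk j x] is the least such rank, or
   0 when there is none. Countable operations keep both measurable. *)
pose E j k : set X := [set x | forall m n, (k <= m)%N -> (k <= n)%N ->
  (xintegral (df m n) x <= (dl j)%:E)%E].
have mE j k : measurable (E j k).
  rewrite (_ : E j k = \bigcap_(m in [set m | (k <= m)%N]) \bigcap_(n in [set n | (k <= n)%N])
      [set x | (xintegral (df m n) x <= (dl j)%:E)%E]); last first.
    by apply/seteqP; split => x /= h m; [move=> km n kn; exact: h|move=> n km kn; exact: (h m km n kn)].
  apply: bigcap_measurable => [|m _]; first by exists k => /=.
  apply: bigcap_measurable => [|n _]; first by exists k => /=.
  rewrite -[X in measurable X]setTI; apply: emeasurable_fun_infty_c => //.
  exact: measurable_xintegral.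
pose kk j x : nat := match pselect (exists k, `[< E j k x >]) with
  | left e => ex_minn e | right _ => 0%N end.
have mkk j k : measurable [set x | kk j x = k].
  rewrite (_ : [set x | _] = (E j k `&` \bigcap_(l in [set l | (l < k)%N]) ~` E j l) `|`
     (if k == 0%N then \bigcap_l ~` E j l else set0)); last first.
    apply/seteqP; split => x /=; rewrite /kk; case: pselect => [e|ne].
    - case: ex_minnP => l /asboolP El lmin <-; left; split => // i /= il Ei.
      by move: il; rewrite ltnNge lmin//; apply/asboolP.
    - move=> <-; right => /= l _ El; apply: ne; exists l; exact/asboolP.
    - case: ex_minnP => l /asboolP El lmin [[Ek h]|].
        apply/eqP; rewrite eqn_leq lmin ?andbT; last exact/asboolP.
        by rewrite leqNgt; apply/negP => kl; apply: (h l).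
      by case: eqP => // k0 h; exfalso; apply: (h l I).
    - by case=> [[Ek _]|]; [exfalso; apply: ne; exists k; exact/asboolP|case: eqP].
  apply: measurableU.
    apply: measurableI => //; apply: bigcap_measurableType => l _; exact: measurableC.
  case: eqP => _ //; apply: bigcap_measurableType => l _; exact: measurableC.
pose g j x w := f (kk j x) x w.
have mg j : measurable_fun setT (fun xw : X * T => g j xw.1 xw.2).
  have -> : [set: X * T] = \bigcup_k ([set x | kk j x = k] `*` setT).
    by apply/seteqP; split => // -[x w] _; exists (kk j x).
  apply/measurable_fun_bigcup; first by move=> k; exact: measurableX.
  move=> k; apply: (eq_measurable_fun (fun xw : X * T => f k xw.1 xw.2)).
    by move=> [x w]; rewrite inE/= => -[kE _]; rewrite /g kE.
  by apply: measurable_funTS; exact: mf.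
(* The upper limit is defined for all x and w and jointly measurable; for x in [D] it is almost
   surely the limit. *)
pose L x w := fine (limn_esup (fun j => (g j x w)%:E)).
have mL : measurable_fun setT (fun xw : X * T => L xw.1 xw.2).
  apply: (measurableT_comp (@fine_measurable R setT measurableT)).
  by apply: measurable_fun_limn_esup => j; apply/measurable_EFinP; exact: mg.
exists L; split => // x Dx.
have Lfx n : L2 (f n x) := Lf x Dx n.
have EP j k : E j k x <-> (forall m n, (k <= m)%N -> (k <= n)%N -> sq (df m n x) <= dl j).
  split => h m n km kn; have := h m n km kn; by rewrite /xintegral sq_EFin ?lee_fin//; exact: L2B.
have exk j : exists k, `[< E j k x >].
  have [k kP] := cau x Dx _ (dl0 j); exists k; apply/asboolP/EP => m n km kn; exact: kP.
have kE j : E j (kk j x) x /\ forall k, E j k x -> (kk j x <= k)%N.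
  rewrite /kk; case: pselect => // e; case: ex_minnP => l /asboolP El lmin; split => // k Ek.
  by apply: lmin; exact/asboolP.
have dlS i j : (i <= j)%N -> dl j <= dl i.
  by move=> ij; apply: ler_wiXn2l => //; lra.
have kmono i j : (i <= j)%N -> (kk i x <= kk j x)%N.
  move=> ij; apply: (kE i).2; apply/EP => m n km kn.
  by apply: le_trans (dlS _ _ ij); have /EP := (kE j).1; apply.
have Lg j : L2 (g j x) by exact: Lfx.
have gle i j : (j <= i)%N -> sq (fun w => g i x w - g j x w) <= dl j.
  by move=> ji; have /EP := (kE j).1; apply => //; exact: kmono.
have cae := fast_cauchy_ae Lg (fun j => gle _ _ (leqnSn j)).
have cL : {ae P, forall w, g n x w @[n --> \oo] --> L x w}.
  apply: filterS cae => w cw.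
  have cE : (g j x w)%:E @[j --> \oo] --> (limn (fun j => g j x w))%:E.
    by apply/cvg_EFin; [exact: nearW|exact: cw].
  rewrite /L is_cvg_limn_esupE; last by apply/cvg_ex; eexists; exact: cE.
  by rewrite (cvg_lim _ cE).
have mLx : measurable_fun setT (L x) by exact: (measurableT_comp mL (measurable_pair1 x)).
have LgL j : L2 (fun w => L x w - g j x w) /\ sq (fun w => L x w - g j x w) <= dl j.
  apply: (@L2_fatou_ae _ _ _ P (fun i w => g (i + j)%N x w - g j x w)).
  - by move=> i; exact: L2B.
  - by apply: measurable_funB => //; exact: L2_measurable (Lg j).
  - apply: filterS cL => w cw; apply: cvgB; last exact: cvg_cst.
    by have := cw; rewrite -(cvg_shiftn j).
  - by move=> i; apply: gle; rewrite leq_addl.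
have LLx : L2 (L x).
  have := L2D (LgL 0%N).1 (Lg 0%N); congr (L2 _).
  by apply/funext => w; rewrite subrK.
split => //; apply/cvgrPdist_le => e e0.
have [j jP] : exists j, 4 * dl j <= e.
  have : (dl \o id) @ \oo --> 0 by apply: cvg_expr; rewrite ger0_norm; lra.
  move=> /cvgrPdist_le /(_ (e / 4)) []; first by rewrite divr_gt0.
  move=> j _ /(_ j (leqnn j)); rewrite /= sub0r normrN ger0_norm ?(ltW (dl0 _))// => h.
  by exists j; move: h; move: (dl j) => y; lra.
exists (kk j x) => // n /= kn; rewrite sub0r normrN ger0_norm ?sq_ge0//.
apply: (le_trans (sq_triangle (Lfx n) (Lg j) LLx)).
have h1 : sq (fun w => f n x w - g j x w) <= dl j.
  by have /EP := (kE j).1; apply.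
have h2 : sq (fun w => g j x w - L x w) <= dl j by rewrite sqBC; exact: (LgL j).2.
by apply: le_trans jP; move: h1 h2; move: (sq _) (sq _) (dl j) => a b c; lra.
Qed.


End parametrized_completeness.

(** * Limits in L^2 under a uniform weighted bound on the chaos components *)

Section hilbert.
Context {R : realType} {dT : measure_display} {T : measurableType dT} (P : probability T R).
Local Notation L2 := (L2 P).
Local Notation ip := (ip P).
Local Notation sq := (sq P).

Lemma L2_complete (f : nat -> T -> R) : (forall n, L2 (f n)) ->
  (forall e, 0 < e -> exists n0, forall m n, (n0 <= m)%N -> (n0 <= n)%N ->
     sq (fun w => f m w - f n w) <= e) ->
  exists L, L2 L /\ sq (fun w => f n w - L w) @[n --> \oo] --> 0.
Proof.
move=> Lf cau.
have [|_ _ //||L [_ LP]] := @L2_complete_param R _ T P _ bool (fun n _ => f n) setT.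
- by move=> n; apply: (measurableT_comp _ (@measurable_snd _ _ _ _)); have [] := Lf n.
- by move=> _ _; exact: cau.
by exists (L true); exact: LP.
Qed.

Lemma sq_sum_le (f : nat -> T -> R) M : (forall n, L2 (f n)) ->
  sq (fun w => \sum_(n < M) f n w) <= 2 ^+ M * \sum_(n < M) sq (f n).
Proof.
move=> Lf; elim: M => [|M IH].
  rewrite (_ : (fun w => _) = cst 0); last by apply/funext => w; rewrite big_ord0.
  by rewrite big_ord0 mulr0 /sq; under eq_Rintegral do rewrite expr0n/=; rewrite Rintegral_cst// mul0r.
rewrite (_ : (fun w => _) = (fun w => \sum_(n < M) f n w + f M w)); last first.
  by apply/funext => w; rewrite big_ord_recr.
have LS : L2 (fun w => \sum_(n < M) f n w) by apply: L2_sum.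
apply: (le_trans (sqD_le LS (Lf M))); rewrite big_ord_recr/= mulrDr exprS.
have h1 : 1 <= 2 ^+ M :> R by rewrite exprn_ege1// ler1n.
have := sq_ge0 P (f M); move: IH h1; move: (sq _) (sq _) (2 ^+ M) (\sum_(_ < _) _) => a b c e; nra.
Qed.

Lemma sq_sum_orth (f : nat -> T -> R) (a b : nat) : (forall n, L2 (f n)) ->
  (forall n k, n != k -> ip (f n) (f k) = 0) ->
  sq (fun w => \sum_(a <= n < b) f n w) = \sum_(a <= n < b) sq (f n).
Proof.
move=> Lf orth; rewrite sqE ip_suml//; last by apply: L2_sum.
apply: eq_big_nat => n nab; rewrite ip_sumr//.
rewrite (bigD1_seq n) ?iota_uniq ?mem_index_iota//= -sqE big1 ?addr0// => k kn.
by rewrite orth// eq_sym.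
Qed.

Section limit.
Variables (alpha C : R) (L : R -> T -> R) (J : R -> nat -> T -> R).
Hypothesis alpha0 : 0 < alpha.
Hypothesis LL : forall e, 0 < e <= 1 -> L2 (L e).
Hypothesis LJ : forall e n, 0 < e <= 1 -> L2 (J e n).
Hypothesis orth : forall e n k, 0 < e <= 1 -> n != k -> ip (J e n) (J e k) = 0.
Hypothesis expansion : forall e, 0 < e <= 1 ->
  sq (fun w => L e w - \sum_(n < M) J e n w) @[M --> \oo] --> 0.
Hypothesis energy : forall e M, 0 < e <= 1 -> \sum_(n < M) (1 + n%:R) `^ alpha * sq (J e n) <= C.
Hypothesis cauchyJ : forall n del, 0 < del -> exists e0, 0 < e0 /\ forall e e', 0 < e <= 1 -> 0 < e' <= 1 ->
  e <= e0 -> e' <= e0 -> sq (fun w => J e n w - J e' n w) <= del.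

Let C0 : 0 <= C.
Proof. by have := @energy 1 0%N; rewrite big_ord0 lexx ltr01; apply. Qed.

(** Since alpha > 0, the weighted bound makes the tails of the expansions small uniformly in e;
    convergence then only has to be checked component by component. *)
Let tail M := (1 + M%:R) `^ (- alpha) * C.

Let tail_cvg : tail M @[M --> \oo] --> 0.
Proof.
rewrite -[X in _ --> X](mul0r C); apply: cvgM; last exact: cvg_cst.
apply/cvgrPdist_le => e e0; near=> M; rewrite sub0r normrN ger0_norm ?powR_ge0//.
have p0 : 0 < 1 + M%:R :> R by rewrite ltr_pwDl.
rewrite powRN -[leRHS]invrK lef_pV2 ?posrE ?powR_gt0 ?invr_gt0//.
have -> : e^-1 = (e^-1 `^ alpha^-1) `^ alpha.
  by rewrite -powRrM mulVf ?gt_eqF// powRr1// invr_ge0 ltW.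
apply: powR_homo; [exact: ltW|exact: powR_ge0|].
apply: (@le_trans _ _ M%:R); last by rewrite lerDr.
by near: M; exact: nbhs_infty_ger.
Unshelve. all: by end_near. Qed.

Let S e M w := \sum_(n < M) J e n w.

Let LS e M : 0 < e <= 1 -> L2 (S e M).
Proof. by move=> e1; apply: L2_sum => n _; exact: LJ. Qed.

Let tail_le e M : 0 < e <= 1 -> sq (fun w => L e w - S e M w) <= 2 * tail M.
Proof.
move=> e1; have Le := LL e1.
have inner M' : (M <= M')%N -> sq (fun w => S e M' w - S e M w) <= tail M.
  move=> MM'; rewrite (_ : (fun w => _) = (fun w => \sum_(M <= n < M') J e n w)); last first.
    apply/funext => w; rewrite /S -!(big_mkord predT (fun n => J e n w)).
    by rewrite (big_cat_nat (n := M) (p := M'))//= addrAC subrr add0r.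
  rewrite sq_sum_orth; [|by move=> n; exact: LJ|by move=> n k; exact: orth].
  rewrite /tail powRN mulrC ler_pdivlMr ?powR_gt0 ?ltr_pwDl// mulr_suml.
  apply: le_trans (energy M' e1).
  rewrite -(big_mkord predT (fun n => (1 + n%:R) `^ alpha * sq (J e n))).
  rewrite [leRHS](big_cat_nat (n := M) (p := M'))//= -[leLHS]add0r; apply: lerD.
    by apply: sumr_ge0 => n _; rewrite mulr_ge0 ?powR_ge0 ?sq_ge0.
  apply: ler_sum_nat => n /andP[Mn _]; rewrite mulrC ler_wpM2r ?sq_ge0//.
  by apply: powR_homo; [exact: ltW|rewrite addr_ge0|rewrite lerD2l ler_nat].
apply/ler_addgt0Pl => del d0.
have /cvgrPdist_le /(_ (del / 2)) [|M0 _ M0P] := expansion e1; first by rewrite divr_gt0.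
have := M0P (maxn M0 M) (leq_maxl _ _); rewrite /= sub0r normrN ger0_norm ?sq_ge0// => h1.
have h2 := inner _ (leq_maxr M0 M).
apply: (le_trans (sq_triangle Le (LS (maxn M0 M) e1) (LS M e1))).
by move: h1 h2; rewrite -/(S e (maxn M0 M)); move: (sq _) (sq _) (tail M) => a b c; lra.
Qed.

Lemma hilbert_cauchy del : 0 < del -> exists e0, 0 < e0 /\ forall e e', 0 < e <= 1 -> 0 < e' <= 1 ->
  e <= e0 -> e' <= e0 -> sq (fun w => L e w - L e' w) <= del.
Proof.
move=> d0.
have [M MP] : exists M, tail M <= del / 32.
  move: tail_cvg => /cvgrPdist_le /(_ (del / 32)) [|M _ /(_ M (leqnn M))]; first by rewrite divr_gt0.
  by rewrite /= sub0r normrN => h; exists M; exact: le_trans (ler_norm _) h.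
(* Compensates the factor 2^M of [sq_sum_le] and the number of terms. *)
pose dM := del / 32 / (2 ^+ M * M.+1%:R).
have dM0 : 0 < dM by rewrite !divr_gt0// mulr_gt0// exprn_gt0.
have /choice [ef efP] : forall n : 'I_M, exists e0, 0 < e0 /\ forall e e', 0 < e <= 1 -> 0 < e' <= 1 ->
  e <= e0 -> e' <= e0 -> sq (fun w => J e n w - J e' n w) <= dM by move=> n; exact: cauchyJ.
exists (\big[Num.min/1]_(n < M) ef n); split.
  by elim/big_ind : _ => // [x y x0 y0|n _]; [rewrite lt_min x0|have [] := efP n].
move=> e e' e1 e'1 ee ee'.
have h n : sq (fun w => J e n w - J e' n w) <= dM \/ (M <= n)%N.
  have [nM|] := ltnP n M; last by right.
  left; have [_ H] := efP (Ordinal nM); apply: H => //.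
  - by apply: le_trans ee _; exact: bigmin_le_cond.
  - by apply: le_trans ee' _; exact: bigmin_le_cond.
have hS : sq (fun w => S e M w - S e' M w) <= del / 32.
  rewrite (_ : (fun w => _) = (fun w => \sum_(n < M) (J e n w - J e' n w))); last first.
    by apply/funext => w; rewrite /S sumrB.
  apply: le_trans (@sq_sum_le (fun n w => J e n w - J e' n w) M _) _.
    by move=> n; apply: L2B; exact: LJ.
  apply: (@le_trans _ _ (2 ^+ M * (M.+1%:R * dM))).
    rewrite ler_wpM2l ?exprn_ge0//.
    apply: (@le_trans _ _ (\sum_(n < M) dM)).
      by apply: ler_sum => n _; have [//|] := h n; rewrite leqNgt ltn_ord.
    by rewrite sumr_const card_ord -[leLHS]mulr_natl ler_wpM2r ?(ltW dM0)// ler_nat.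
  by rewrite /dM mulrA mulrCA divff ?mulr1// gt_eqF// mulr_gt0// exprn_gt0.
have t1 := tail_le M e1; have t2 := tail_le M e'1.
have Le := LL e1; have Le' := LL e'1; have S1 := LS M e1; have S2 := LS M e'1.
apply: (le_trans (sq_triangle Le S1 Le')).
have := sq_triangle S1 S2 Le'; rewrite sqBC in t2.
move: t1 t2 MP hS; move: (tail M) => tM.
move: (sq (fun w => L e w - S e M w)) (sq (fun w => S e' M w - L e' w)) (sq (fun w => S e M w - S e' M w)) (sq (fun w => S e M w - L e' w)).
by move=> a b c f; lra.
Qed.

(** The components of the limit are the limits of the components. The factor 2 in the energy bound,
    like the 8 in the tail bound of the proof, comes from using sq(f + g) <= 2 sq f + 2 sq g. *)
Lemma hilbert_limit F : L2 F -> sq (fun w => L e w - F w) @[e --> 0^'+] --> 0 ->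
  exists Jl : nat -> T -> R, [/\ forall n, L2 (Jl n),
    forall n, sq (fun w => J (k.+1%:R^-1) n w - Jl n w) @[k --> \oo] --> 0,
    sq (fun w => F w - \sum_(n < M) Jl n w) @[M --> \oo] --> 0 &
    forall M, \sum_(n < M) (1 + n%:R) `^ alpha * sq (Jl n) <= 2 * C].
Proof.
move=> LF LcF.
pose ek k : R := k.+1%:R^-1.
have ek1 k : 0 < ek k <= 1 by rewrite invr_gt0 ltr0n/= invf_le1// ler1n.
have ekle e0 : 0 < e0 -> exists k0, forall k, (k0 <= k)%N -> ek k <= e0.
  move=> h; have [k0 _ kP] := near_infty_natSinv_lt (PosNum h).
  by exists k0 => k kk; exact/ltW/kP.
have /choice [Jl JlP] : forall n, exists Jn, L2 Jn /\ sq (fun w => J (ek k) n w - Jn w) @[k --> \oo] --> 0.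
  move=> n; apply: L2_complete => [k|del d0]; first exact: LJ.
  have [e0 [e00 eP]] := cauchyJ n d0; have [k0 kP] := ekle _ e00.
  by exists k0 => k l kk ll; apply: eP; rewrite ?ek1 ?kP.
have LJl n : L2 (Jl n) := (JlP n).1.
have sum_cvg M (c : nat -> R) : \sum_(n < M) c n * sq (fun w => J (ek k) n w - Jl n w) @[k --> \oo] --> 0.
  rewrite -[X in _ --> X](_ : \sum_(n < M) c n * 0 = 0); last by apply: big1 => n _; rewrite mulr0.
  elim: M => [|M IH].
    by under eq_fun do rewrite big_ord0; rewrite big_ord0; exact: cvg_cst.
  under eq_fun do rewrite big_ord_recr/=; rewrite big_ord_recr/=; apply: cvgD => //.
  by apply: cvgM; [exact: cvg_cst|exact: (JlP M).2].
have LF_cvg : sq (fun w => L (ek k) w - F w) @[k --> \oo] --> 0.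
  move/cvg_at_rightP : LcF; apply; split => [k|]; first by have /andP[] := ek1 k.
  apply/cvgrPdist_le => e0 e00; have [k0 kP] := ekle _ e00; exists k0 => // k /= kk.
  by rewrite sub0r normrN ger0_norm ?kP//; have /andP[/ltW] := ek1 k.
exists Jl; split => //.
- by move=> n; exact: (JlP n).2.
- have bound M : sq (fun w => F w - \sum_(n < M) Jl n w) <= 8 * tail M.
    apply/ler_addgt0Pl => del d0.
    have hc : sq (fun w => L (ek k) w - F w) + \sum_(n < M) 2 ^+ M * sq (fun w => J (ek k) n w - Jl n w) @[k --> \oo] --> 0.
      by rewrite -[X in _ --> X](addr0 0); apply: cvgD => //; exact: (sum_cvg M (fun=> 2 ^+ M)).
    move: hc => /cvgrPdist_le /(_ (del / 8)) [|k _ /(_ k (leqnn k))].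
      by rewrite divr_gt0.
    rewrite /= sub0r normrN => /(le_trans (ler_norm _)) hk.
    have h3 : sq (fun w => S (ek k) M w - \sum_(n < M) Jl n w) <= \sum_(n < M) 2 ^+ M * sq (fun w => J (ek k) n w - Jl n w).
      rewrite (_ : (fun w => _) = (fun w => \sum_(n < M) (J (ek k) n w - Jl n w))); last first.
        by apply/funext => w; rewrite /S sumrB.
      apply: le_trans (@sq_sum_le (fun n w => J (ek k) n w - Jl n w) M _) _.
        by move=> n; apply: L2B => //; exact: LJ.
      by rewrite mulr_sumr.
    have LSl : L2 (fun w => \sum_(n < M) Jl n w) by apply: L2_sum.
    have t1 := tail_le M (ek1 k).
    have LLk := LL (ek1 k); have LSk := LS M (ek1 k).
    have h1 := sq_triangle LF LLk LSl; have h2 := sq_triangle LLk LSk LSl.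
    apply: (le_trans h1).
    have eFL : sq (fun w => L (ek k) w - F w) = sq (fun w => F w - L (ek k) w) by exact: sqBC.
    rewrite eFL in hk.
    move: hk h2 h3 t1; have := sq_ge0 P (fun w => F w - L (ek k) w).
    move: (sq (fun w => F w - L (ek k) w)) (sq (fun w => L (ek k) w - \sum_(n < M) Jl n w)) (sq (fun w => L (ek k) w - S (ek k) M w))
      (sq (fun w => S (ek k) M w - \sum_(n < M) Jl n w)) (\sum_(_ < _) _) (tail M) => a b c f g h; lra.
  apply: (@squeeze_cvgr _ _ _ _ (cst 0) (fun M => 8 * tail M)).
  + by apply: nearW => M; rewrite sq_ge0 bound.
  + exact: cvg_cst.
  + by rewrite -[X in _ --> X](mulr0 8); apply: cvgM => //; exact: cvg_cst.
- move=> M; apply/ler_addgt0Pl => del d0.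
  have := sum_cvg M (fun n => (1 + n%:R) `^ alpha) => /cvgrPdist_le /(_ (del / 2)) [|k _ /(_ k (leqnn k))].
    by rewrite divr_gt0.
  rewrite /= sub0r normrN => /(le_trans (ler_norm _)) hk.
  have h : \sum_(n < M) (1 + n%:R) `^ alpha * sq (Jl n) <=
     \sum_(n < M) (2 * ((1 + n%:R) `^ alpha * sq (J (ek k) n)) + 2 * ((1 + n%:R) `^ alpha * sq (fun w => J (ek k) n w - Jl n w))).
    apply: ler_sum => n _; have LJk := LJ n (ek1 k).
    have := sqD_le LJk (L2B (LJl n) LJk).
    rewrite (_ : (fun w => J (ek k) n w + _) = Jl n); last by apply/funext => w; rewrite addrC subrK.
    rewrite [X in _ <= _ + 2 * X]sqBC.
    have := powR_ge0 (1 + n%:R) alpha; move: (_ `^ _) (sq _) (sq _) (sq _) => a b c f; nra.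
  rewrite big_split/= -!mulr_sumr in h.
  apply: (le_trans h); have := energy M (ek1 k); lra.
Qed.

End limit.
End hilbert.

(** * Membership in the Wiener chaoses *)

Section spans.
Context {R : realType} {dT : measure_display} {T : measurableType dT} (P : probability T R).
Implicit Types (G : set (T -> R)) (f g : T -> R).
Local Notation L2 := (L2 P).
Local Notation ip := (ip P).
Local Notation sq := (sq P).
Local Notation He n x := ((hermite n).[x]).

Lemma span_gen G f : G f -> linear_span G f.
Proof.
move=> Gf; exists 1%N, (fun=> 1), (fun=> f); split => //.
by apply/funext => w; rewrite big_ord1 mul1r.
Qed.

Lemma span0 G : linear_span G (fun=> 0).
Proof.
exists 0%N, (fun=> 0), (fun _ _ => 0); split; first by case.
by apply/funext => w; rewrite big_ord0.
Qed.

Lemma spanZ G c f : linear_span G f -> linear_span G (fun w => c * f w).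
Proof.
move=> [n [a [X [GX ->]]]]; exists n, (fun k => c * a k), X; split => //.
by apply/funext => w; rewrite mulr_sumr; apply: eq_bigr => k _; rewrite mulrA.
Qed.

Lemma spanD G f g : linear_span G f -> linear_span G g -> linear_span G (fun w => f w + g w).
Proof.
move=> [n [a [X [GX ->]]]] [m [b [Y [GY ->]]]].
exists (n + m)%N, (fun k => match fintype.split k with inl i => a i | inr j => b j end),
  (fun k => match fintype.split k with inl i => X i | inr j => Y j end); split.
  by move=> k; case: (fintype.split k) => i.
apply/funext => w; rewrite big_split_ord/=; congr (_ + _); apply: eq_bigr => k _.
  by rewrite (unsplitK (inl k : 'I_n + 'I_m)%type).
by rewrite (unsplitK (inr k : 'I_n + 'I_m)%type).
Qed.

Lemma span_sum G (I : Type) (r : seq I) (p : pred I) (F : I -> T -> R) :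
  (forall i, p i -> linear_span G (F i)) -> linear_span G (fun w => \sum_(i <- r | p i) F i w).
Proof.
move=> GF; elim: r => [|i r IH].
  by rewrite (_ : (fun w => _) = (fun=> 0)); [exact: span0|apply/funext => w; rewrite big_nil].
have [pi|npi] := boolP (p i); last first.
  by rewrite (_ : (fun w => _) = (fun w => \sum_(i <- r | p i) F i w))//;
    apply/funext => w; rewrite big_cons (negbTE npi).
rewrite (_ : (fun w => _) = (fun w => F i w + \sum_(i <- r | p i) F i w)).
  by apply: spanD => //; exact: GF.
by apply/funext => w; rewrite big_cons pi.
Qed.

Lemma span_L2 G f : G `<=` L2 -> linear_span G f -> L2 f.
Proof. by move=> GL [n [c [X [GX ->]]]]; apply: L2_sum => k _; apply: L2Z; exact: GL. Qed.

Lemma L2_cvgP (I : Type) (F : set_system I) (X : I -> T -> R) Y : Filter F ->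
  (\forall k \near F, L2 (X k)) -> L2 Y ->
  (sq (fun w => X k w - Y w) @[k --> F] --> 0) <-> L2_cvg P F X Y.
Proof.
move=> FF LX LY.
have LXY : \forall k \near F, L2 (fun w => X k w - Y w).
  by apply: filterS LX => k LXk; exact: L2B.
split => [h|[_ _ h]].
  split; first by apply: filterS LX => k; move/L2_Lfun.
    exact/L2_Lfun.
  have h2 : (Num.sqrt (sq (fun w => X k w - Y w)))%:E @[k --> F] --> 0%E.
    apply/cvg_EFin; first exact: nearW.
    by rewrite -[X in _ --> X](sqrtr0 R); apply: cvg_comp h _; exact: sqrt_continuous.
  apply: cvg_trans h2; apply: near_eq_cvg; apply: filterS LXY => k Lk.
  by rewrite Lnorm2E.
have h2 : (Num.sqrt (sq (fun w => X k w - Y w)))%:E @[k --> F] --> 0%E.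
  apply: cvg_trans h; apply: near_eq_cvg; apply: filterS LXY => k Lk.
  by rewrite Lnorm2E.
move/fine_cvgP : h2 => [_ h2].
have h3 : Num.sqrt (sq (fun w => X k w - Y w)) ^+ 2 @[k --> F] --> (0 : R) ^+ 2.
  exact: (cvg_comp _ _ h2 (@exprn_continuous R 2 (0 : R))).
rewrite expr0n/= in h3; apply: cvg_trans h3; apply: near_eq_cvg; apply: nearW => k.
by rewrite sqr_sqrtr// sq_ge0.
Qed.

Lemma closureP G Y : G `<=` L2 ->
  L2_closure P (linear_span G) Y <->
  L2 Y /\ forall e, 0 < e -> exists X, linear_span G X /\ sq (fun w => X w - Y w) <= e.
Proof.
move=> GL; split => [[X [SX XY]]|[LY h]].
  have LX k : L2 (X k) by exact: span_L2 GL (SX k).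
  have LY : L2 Y by case: XY => _ /L2_Lfun.
  split => // e e0.
  have h : sq (fun w => X k w - Y w) @[k --> \oo] --> 0 by apply/L2_cvgP => //; exact: nearW.
  move/cvgrPdist_le : h => /(_ e e0) [].
  by move=> k _ /(_ k (leqnn k)); rewrite /= sub0r normrN => hk; exists (X k); split => //; exact: le_trans (ler_norm _) hk.
have /choice [X XP] : forall k : nat, exists X, linear_span G X /\ sq (fun w => X w - Y w) <= k.+1%:R^-1.
  by move=> k; apply: h; rewrite invr_gt0.
exists X; split; first by move=> k; have [] := XP k.
have LX k : L2 (X k) by apply: span_L2 GL _; have [] := XP k.
apply/L2_cvgP => //; first exact: nearW.
apply/cvgrPdist_le => e e0; have [k0 _ kP] := near_infty_natSinv_lt (PosNum e0).
exists k0 => // k /= kk; rewrite sub0r normrN ger0_norm ?sq_ge0//.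
by have [_ /le_trans] := XP k; apply; exact/ltW/kP.
Qed.

Lemma closure_mono G G' : G `<=` G' -> L2_closure P (linear_span G) `<=` L2_closure P (linear_span G').
Proof.
move=> GG Y [X [SX XY]]; exists X; split => // k.
by have [n [c [Z [GZ ->]]]] := SX k; exists n, c, Z; split => // l; exact: GG.
Qed.

Lemma span_closure G Y : G `<=` L2 -> linear_span G Y -> L2_closure P (linear_span G) Y.
Proof.
move=> GL SY; apply/closureP => //; split; first exact: span_L2 SY.
move=> e e0; exists Y; split => //; rewrite /sq; under eq_Rintegral do rewrite subrr expr0n/=.
by rewrite Rintegral_cst// mul0r ltW.
Qed.

Lemma closure_lim G (Yk : nat -> T -> R) Y : G `<=` L2 ->
  (forall k, L2_closure P (linear_span G) (Yk k)) -> L2 Y ->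
  sq (fun w => Yk k w - Y w) @[k --> \oo] --> 0 -> L2_closure P (linear_span G) Y.
Proof.
move=> GL Sk LY cv; apply/closureP => //; split => // e e0.
move/cvgrPdist_le : cv => /(_ (e / 4)) [|k _ /(_ k (leqnn k))]; first by rewrite divr_gt0.
rewrite /= sub0r normrN => /(le_trans (ler_norm _)) hk.
have /closureP [//|LYk /(_ (e / 4))[|X [SX hX]]] := Sk k; first by rewrite divr_gt0.
exists X; split => //; apply: le_trans (sq_triangle (span_L2 GL SX) LYk LY) _.
by move: hk hX; move: (sq _) (sq _) => a b; lra.
Qed.

(* Greedy sampling: the average of a bounded family lies in the closed span;
   each sample is chosen to be obtuse to the accumulated error. *)
Lemma pint_closure dS (S : measurableType dS) (nu : {finite_measure set S -> \bar R})
    (X : S -> T -> R) G : G `<=` L2 -> L2field P X ->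
  (forall s, linear_span G (X s)) -> L2_closure P (linear_span G) (pint nu X).
Proof.
move=> GL LX SX; have LJ := pint_L2 nu LX; set J := pint nu X in LJ *.
have nuE : nu setT = (fine (nu setT))%:E by rewrite fineK// fin_num_measure.
have [V0|Vn0] := eqVneq (nu setT) 0%E.
  apply: span_closure => //; rewrite (_ : J = fun=> 0); first exact: span0.
  apply/funext => w; rewrite /J /pint /Rintegral.
  have mXw : measurable_fun setT (fun s => (X s w)%:E).
    by apply/measurable_EFinP; have [mX _] := LX; exact: (measurableT_comp mX (measurable_pair2 w)).
  by rewrite null_set_integral.
pose v := fine (nu setT).
have v0 : 0 < v by rewrite -lte_fin /v -nuE lt_neqAle eq_sym Vn0/=.
have LXs s := L2field_L2 s LX.
have [c cX] := L2field_sq LX.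
pose D s w := J w - v * X s w.
have LD s : L2 (D s) by apply: L2B => //; exact: L2Z.
pose C := 2 * sq J + 2 * (v ^+ 2 * c).
have DC s : sq (D s) <= C.
  have h := sqD_le LJ (L2Z (- v) (LXs s)).
  rewrite (_ : (fun w => J w + _) = D s) in h; last by apply/funext => w; rewrite mulNr.
  apply: (le_trans h); rewrite lerD2l ler_pM2l// sqZ// sqrrN ler_wpM2l ?sqr_ge0//.
have c0 : 0 <= c by exact: le_trans (sq_ge0 P (X point)) (cX point).
have C0 : 0 <= C by rewrite addr_ge0// mulr_ge0 ?sq_ge0// mulr_ge0 ?sqr_ge0.
(* The integral of [ip Z (D s)] over s vanishes, so it cannot be positive for every s. *)
have key Z : L2 Z -> exists s, ip Z (D s) <= 0.
  move=> LZ; apply: contrapT => /forallNP h.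
  have hpos s : 0 < ip Z (D s) by rewrite ltNge; apply/negP; exact: h.
  have hE s : ip Z (D s) = ip Z J - v * ip Z (X s).
    by rewrite /D ipC ipBl//; [rewrite ipZl// ipC [ip (X s) Z]ipC|exact: L2Z].
  have iX := integrable_ip_field nu LX LZ.
  have ivX : nu.-integrable setT (EFin \o (fun s => v * ip Z (X s))).
    by rewrite (_ : _ \o _ = (fun s => v%:E * (ip Z (X s))%:E)%E)//; exact: integrableZl.
  have icst : nu.-integrable setT (EFin \o cst (ip Z J)).
    exact: finite_measure_integrable_cst.
  have ih : nu.-integrable setT (EFin \o (fun s => ip Z (D s))).
    rewrite (_ : _ \o _ = (fun s => ((ip Z J)%:E - (v * ip Z (X s))%:E)%E)).
      exact: (integrableB measurableT icst ivX).
    by apply/funext => s /=; rewrite hE.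
  have i0 : \int[nu]_s ip Z (D s) = 0.
    under eq_Rintegral do rewrite hE.
    rewrite RintegralB// RintegralZl// Rintegral_cst// -ip_pint// -/J -/v mulrC subrr//.
  have : (\int[nu]_s `|(ip Z (D s))%:E| = 0)%E.
    under eq_integral => s _ do rewrite gee0_abs ?lee_fin ?(ltW (hpos s))//.
    by rewrite -[LHS]fineK ?integrable_fin_num//; move: i0; rewrite /Rintegral => ->.
  move/ae_eq_integral_abs => [//||N [mN N0 sub]]; first by have /integrableP[] := ih.
  have : nu setT = 0%E.
    apply/eqP; rewrite eq_le measure_ge0 andbT -N0 le_measure ?inE//.
    move=> s _; apply: sub => /= /(_ I) [] h1; have := hpos s; by rewrite h1 ltxx.
  by move/eqP; rewrite (negbTE Vn0).
(* An obtuse new term adds at most [C] to the squared error; after division by m the squared error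
   is at most C/m. *)
have samples m : exists Y, linear_span G Y /\ sq (fun w => m%:R * J w - v * Y w) <= m%:R * C.
  elim: m => [|m [Y [SY Yle]]].
    exists (fun=> 0); split; first exact: span0.
    rewrite mul0r (_ : (fun w => _) = cst 0); last by apply/funext => w; rewrite mul0r mulr0 subrr.
    by rewrite /sq; under eq_Rintegral do rewrite expr0n/=; rewrite Rintegral_cst// mul0r.
  have LY := span_L2 GL SY.
  pose Z w := m%:R * J w - v * Y w.
  have LZ : L2 Z by apply: L2B; exact: L2Z.
  have [s sP] := key Z LZ.
  exists (fun w => Y w + X s w); split; first exact: spanD.
  rewrite (_ : (fun w => _) = (fun w => Z w + D s w)); last first.
    by apply/funext => w; rewrite /Z /D -natr1; lra.
  rewrite sqD// -natr1 mulrDl mul1r.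
  by move: Yle sP (DC s); rewrite -/Z; move: (sq Z) (sq (D s)) (ip Z (D s)) => a b e; lra.
apply/closureP => //; split => // e e0.
pose m := (Num.truncn (C / e)).+1.
have m0 : (0 : R) < m%:R by [].
have Cm : C <= m%:R * e.
  have : C / e < m%:R by rewrite -truncn_lt_nat// divr_ge0// ltW.
  by rewrite ltr_pdivrMr// => /ltW.
have [Y [SY Yle]] := samples m.
exists (fun w => (m%:R^-1 * v) * Y w); split; first exact: spanZ.
have LY := span_L2 GL SY.
have -> : (fun w => m%:R^-1 * v * Y w - J w) = (fun w => - m%:R^-1 * (m%:R * J w - v * Y w)).
  apply/funext => w; have mm : m%:R^-1 * m%:R = 1 :> R by rewrite mulVf// gt_eqF.
  have -> : - m%:R^-1 * (m%:R * J w - v * Y w) = m%:R^-1 * v * Y w - (m%:R^-1 * m%:R) * J w.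
    by move: (m%:R^-1 : R) (m%:R : R) (J w) (Y w) => a b f g; lra.
  by rewrite mm mul1r.
rewrite sqZ; last by apply: L2B; exact: L2Z.
rewrite sqrrN exprVn ler_pdivrMl ?exprn_gt0//.
apply: (le_trans Yle); rewrite expr2 -mulrA ler_pM2l//.
Qed.

(* The coefficients come from inverting a Vandermonde matrix in the slopes [j]. *)
Lemma hermite_mul_span (q p : nat) : exists (w al be : 'I_(q + p).+1 -> R),
  (forall j, al j ^+ 2 + be j ^+ 2 = 1) /\
  forall y z, He q y * He p z = \sum_j w j * He (q + p) (al j * y + be j * z).
Proof.
set n := (q + p)%N.
(* [(al j, be j)] is the unit vector of slope j; dividing the degree-n addition formula by be^n
   leaves the powers j^k of a Vandermonde system. *)
pose be (j : 'I_n.+1) : R := (Num.sqrt (1 + j%:R ^+ 2))^-1.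
pose al (j : 'I_n.+1) : R := j%:R * be j.
have s0 (j : 'I_n.+1) : 0 < 1 + j%:R ^+ 2 :> R by rewrite ltr_pwDl// exprn_ge0.
have be0 j : 0 < be j by rewrite invr_gt0 sqrtr_gt0.
have be2 j : be j ^+ 2 * (1 + j%:R ^+ 2) = 1.
  by rewrite /be exprVn sqr_sqrtr ?(ltW (s0 j))// mulVf// gt_eqF.
have ab1 j : al j ^+ 2 + be j ^+ 2 = 1.
  by rewrite -[RHS](be2 j) /al exprMn mulrDr mulr1 addrC [_ ^+ 2 * be _ ^+ 2]mulrC.
pose V : 'M[R]_n.+1 := Vandermonde n.+1 (\row_j (j : nat)%:R).
have Vu : V \in unitmx.
  rewrite unitmxE det_Vandermonde unitfE.
  apply/prodf_neq0 => i _; apply/prodf_neq0 => j ij.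
  by rewrite !mxE subr_eq0 eqr_nat gt_eqF.
have qn : (q < n.+1)%N by rewrite ltnS leq_addr.
pose u : 'cV[R]_n.+1 := invmx V *m delta_mx (Ordinal qn) 0.
have uE (k : 'I_n.+1) : \sum_j u j 0 * j%:R ^+ k = (k == q :> nat)%:R.
  have := congr1 (fun M : 'cV[R]_n.+1 => M k 0) (mulKVmx Vu (delta_mx (Ordinal qn) 0 : 'cV[R]_n.+1)).
  rewrite !mxE eqxx andbT => <-; apply: eq_bigr => j _.
  by rewrite !mxE mulrC.
pose w j := u j 0 * (be j)^-1 ^+ n * (q`!%:R * p`!%:R / n`!%:R).
exists w, al, be; split => // y z.
have f0 k : k`!%:R != 0 :> R by rewrite pnatr_eq0 -lt0n fact_gt0.
have term j : w j * He n (al j * y + be j * z) =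
   (q`!%:R * p`!%:R) * \sum_(k < n.+1) (u j 0 * j%:R ^+ k) * (He k y / k`!%:R * (He (n - k) z / (n - k)`!%:R)).
  have hD := hermiteD n y z (ab1 j).
  have -> : He n (al j * y + be j * z) = n`!%:R * (He n (al j * y + be j * z) / n`!%:R).
    by rewrite mulrCA divff ?mulr1.
  rewrite hD /w.
  have -> : u j 0 * (be j)^-1 ^+ n * (q`!%:R * p`!%:R / n`!%:R) * (n`!%:R * convn (fun k => al j ^+ k * (He k y / k`!%:R)) (fun k => be j ^+ k * (He k z / k`!%:R)) n) =
     (n`!%:R^-1 * n`!%:R) * ((q`!%:R * p`!%:R) * (u j 0 * (be j)^-1 ^+ n * convn (fun k => al j ^+ k * (He k y / k`!%:R)) (fun k => be j ^+ k * (He k z / k`!%:R)) n)).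
    move: (convn _ _ _) ((be j)^-1 ^+ n) (n`!%:R^-1 : R) (n`!%:R : R) (q`!%:R : R) (p`!%:R : R) (u j 0) => a b c e f g h; lra.
  rewrite mulVf// mul1r; congr (_ * _); rewrite /convn mulr_sumr; apply: eq_bigr => k _.
  have kn : (k <= n)%N by rewrite -ltnS.
  have bn : (be j)^-1 ^+ n * (be j ^+ k * be j ^+ (n - k)) = 1.
    by rewrite -exprD subnKC// -exprMn mulVf ?expr1n// gt_eqF.
  rewrite /al exprMn.
  move: bn; move: ((be j)^-1 ^+ n) (be j ^+ k) (be j ^+ (n - k)) (He k y / _) (He (n - k) z / _) (u j 0) (j%:R ^+ k).
  move=> a b c e f g h bn.
  have -> : g * a * (h * b * e * (c * f)) = (a * (b * c)) * (g * h * (e * f)) by lra.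
  by rewrite bn mul1r.
under eq_bigr do rewrite term.
rewrite -mulr_sumr exchange_big/=.
under eq_bigr => k _ do rewrite -mulr_suml uE.
rewrite (bigD1 (Ordinal qn))//= eqxx mul1r big1 ?addr0; last first.
  move=> k kq; rewrite (_ : (k == q :> nat) = false) ?mul0r//.
  by apply/negbTE; apply: contra kq => /eqP kE; apply/eqP/val_inj.
rewrite [(n - q)%N](_ : _ = p); last by rewrite /n addKn.
have e1 : q`!%:R * q`!%:R^-1 = 1 :> R by rewrite divff.
have e2 : p`!%:R * p`!%:R^-1 = 1 :> R by rewrite divff.
move: e1 e2; move: (q`!%:R : R) (p`!%:R : R) (q`!%:R^-1 : R) (p`!%:R^-1 : R) (He q y) (He p z) => a b c e f g e1 e2.
have -> : a * b * (f * c * (g * e)) = (a * c) * (b * e) * (f * g) by lra.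
by rewrite e1 e2 !mul1r.
Qed.

Definition unit_combs d (xi : 'I_d -> T -> R) : set (T -> R) :=
  [set f | exists a : 'I_d -> R, \sum_(i < d) a i ^+ 2 = 1 /\ f = (fun w => \sum_(i < d) a i * xi i w)].

(** [wiener_chaos] is generated by Hermite polynomials of unit vectors, so products have to be
    brought to that form. By induction the first factors become Hermite polynomials of unit
    combinations, with which [hermite_mul_span] merges the last factor. *)
Lemma hermite_prod_span d (xi : 'I_d.+1 -> T -> R) (m : 'I_d.+1 -> nat) :
  linear_span [set (fun w => He (\sum_(i < d.+1) m i) (f w)) | f in unit_combs xi]
    (fun w => \prod_(i < d.+1) He (m i) (xi i w)).
Proof.
elim: d xi m => [|d IH] xi m.
  apply: span_gen; exists (xi ord0); last by apply/funext => w; rewrite !big_ord1.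
  exists (fun=> 1); rewrite big_ord1 expr1n; split => //.
  by apply/funext => w; rewrite big_ord1 mul1r.
pose l (i : 'I_d.+1) : 'I_d.+2 := widen_ord (leqnSn _) i.
have [n [c [X [GX XE]]]] := IH (fun i => xi (l i)) (fun i => m (l i)).
rewrite (_ : (fun w => _) = (fun w => \sum_(k < n) c k * (X k w * He (m ord_max) (xi ord_max w)))); last first.
  apply/funext => w; rewrite big_ord_recr/=.
  have := congr1 (fun f => f w) XE => /= ->.
  by rewrite mulr_suml; apply: eq_bigr => k _; rewrite mulrA.
apply: span_sum => k _; apply: spanZ.
have [f [a [a1 ->]] <-] := GX k.
set q := (\sum_(i < d.+1) m (l i))%N.
have -> : (\sum_(i < d.+2) m i = q + m ord_max)%N by rewrite big_ord_recr.
have [w [al [be [ab wE]]]] := hermite_mul_span q (m ord_max).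
rewrite (_ : (fun w0 => _) = (fun w0 => \sum_j w j * He (q + m ord_max) (al j * (\sum_(i < d.+1) a i * xi (l i) w0) + be j * xi ord_max w0))); last first.
  by apply/funext => w0; rewrite wE.
apply: span_sum => j _; apply: spanZ; apply: span_gen.
exists (fun w0 => al j * (\sum_(i < d.+1) a i * xi (l i) w0) + be j * xi ord_max w0) => //.
exists (fun i => match unlift ord_max i with Some i' => al j * a i' | None => be j end).
have ul (i : 'I_d.+1) : unlift ord_max (l i) = Some i.
  have -> : l i = lift ord_max i by apply: val_inj; rewrite /= /bump leqNgt ltn_ord.
  by rewrite liftK.
split.
  rewrite big_ord_recr/= unlift_none -[RHS](ab j); congr (_ + _).
  under eq_bigr => i _ do rewrite ul exprMn.
  by rewrite -mulr_sumr a1 mulr1.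
apply/funext => w0; rewrite [RHS]big_ord_recr/= unlift_none; congr (_ + _).
by rewrite mulr_sumr; apply: eq_bigr => i _; rewrite ul mulrA.
Qed.

End spans.

(** * The normalized sheet *)

Section restricted_measure.
Context {R : realType} {d : measure_display} {T : measurableType d}.
Local Open Scope ereal_scope.

Lemma ge0_integral_mfrestr (mu : {measure set T -> \bar R}) (D : set T) (mD : measurable D) (Doo : mu D < +oo)
    (f : T -> \bar R) : measurable_fun setT f -> (forall x, 0 <= f x) ->
  \int[mfrestr mD Doo]_x f x = \int[mu]_(x in D) f x.
Proof.
move=> mf f0.
rewrite (@ge0_integral_density R _ T mu (mfrestr mD Doo) (\1_D) f)//.
  by rewrite [RHS]integral_mkcond; apply: eq_integral => x _; rewrite patchE indicE; case: ifPn; rewrite ?mule1 ?mule0.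
by move=> A mA; rewrite integral_indic// /mfrestr /mrestr setIC.
Qed.

End restricted_measure.

Lemma measurable_invr (R : realType) : measurable_fun [set: R] (@GRing.inv R).
Proof.
rewrite (_ : @GRing.inv R = (fun x => if 0 <= x then x `^ (-1) else - ((- x) `^ (-1)))).
  apply: measurable_fun_ifT; first exact: measurable_fun_ler.
    exact: measurable_powR.
  apply: measurableT_comp => //; apply: (measurableT_comp (@measurable_powR R _)).
  exact: oppr_measurable.
apply/funext => x; case: (leP 0 x) => x0; first by rewrite powR_inv1.
by rewrite powR_inv1 ?oppr_ge0 ?(ltW x0)// invrN opprK.
Qed.

Section sheet.
Context {R : realType} {N d : nat} {dO : measure_display} {Omega : measurableType dO}
  (P : probability Omega R) (H K : 'M[R]_(d, N)) (B : N.-tuple R -> Omega -> d.-tuple R) (t : N.-tuple R).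
Hypothesis H01 : forall i j, 0 < H i j < 1.
Hypothesis K01 : forall i j, 0 < K i j <= 1.
Hypothesis hB : bifractional_sheet P H K B.
Hypothesis t0 : forall j, 0 < tnth t j.

Local Notation L2 := (L2 P).
Local Notation ip := (ip P).
Local Notation sq := (sq P).

(* The sheet is only controlled on the orthant, and normalizing it requires a
   positive variance: precomposing with this retraction makes the normalized
   field [xi] total. *)
Definition box_pr (s : N.-tuple R) : N.-tuple R := if s \in posbox t then s else t.

Lemma box_prP s : posbox t (box_pr s).
Proof.
rewrite /box_pr; case: ifPn => [|_ j]; first by rewrite inE.
by rewrite t0 lexx.
Qed.

Lemma box_prE s : posbox t s -> box_pr s = s.
Proof. by move=> st; rewrite /box_pr mem_set. Qed.

Lemma posbox_orthant s : posbox t s -> orthant s.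
Proof. by move=> st j; have /andP[/ltW] := st j. Qed.

Lemma measurable_box_pr : measurable_fun setT box_pr.
Proof.
apply: measurable_fun_ifT => //.
apply: (measurable_fun_bool true); rewrite setTI.
rewrite (_ : _ @^-1` _ = posbox t); first exact: measurable_posbox.
by apply/seteqP; split => s /= => [/set_mem//|]; exact: mem_set.
Qed.

Definition xi i s w : R := component B i (box_pr s) w / sheet_sd H K i (box_pr s).
Definition rho i s u : R := sheet_corr H K i (box_pr s) (box_pr u).

Lemma sd_gt0 i s : 0 < sheet_sd H K i (box_pr s).
Proof. exact: (sheet_sd_gt0 H K i (box_prP s)). Qed.

Lemma measurable_orthant : measurable (@orthant R N).
Proof.
have := @measurable_tuple_box R N (fun j => `[0, +oo[%classic) (fun j => measurable_itv _).
congr (measurable _); apply/seteqP; split => x /= h j; have := h j; rewrite in_itv/= andbT//.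
Qed.

Lemma measurable_sheet : measurable_fun setT (fun sw : N.-tuple R * Omega => B (box_pr sw.1) sw.2).
Proof.
apply: (@measurable_comp _ _ _ _ _ _ (@orthant R N `*` [set: Omega]) (fun sw => B sw.1 sw.2) setT
  (fun sw : N.-tuple R * Omega => (box_pr sw.1, sw.2))).
- by apply: measurableX => //; exact: measurable_orthant.
- by move=> _ [sw _ <-]; split => //=; exact/posbox_orthant/box_prP.
- exact: sheet_measurable hB.
- apply/measurable_fun_pairP; split.
    exact: (measurableT_comp measurable_box_pr (@measurable_fst _ _ _ _)).
  exact: measurable_snd.
Qed.

Lemma measurable_sheet_sd i : measurable_fun setT (sheet_sd H K i).
Proof.
apply: measurable_prod => j _.
by apply: (measurableT_comp (@measurable_powR R _)); exact: measurable_tnth.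
Qed.

Lemma measurable_sd i : measurable_fun setT (fun s => sheet_sd H K i (box_pr s)).
Proof. exact: (measurableT_comp (measurable_sheet_sd i) measurable_box_pr). Qed.

Lemma measurable_xi i : measurable_fun setT (fun sw : N.-tuple R * Omega => xi i sw.1 sw.2).
Proof.
apply: measurable_funM.
  exact: (measurableT_comp (measurable_tnth i) measurable_sheet).
apply: (measurableT_comp (f := fun x : R => x^-1)).
  exact: measurable_invr.
exact: (measurableT_comp (measurable_sd i) (@measurable_fst _ _ _ _)).
Qed.

Lemma measurable_rho i : measurable_fun setT (fun su : N.-tuple R * N.-tuple R => rho i su.1 su.2).
Proof.
have m1 j : measurable_fun setT (fun su : N.-tuple R * N.-tuple R => tnth (box_pr su.1) j).
  exact: (measurableT_comp (measurable_tnth j) (measurableT_comp measurable_box_pr (@measurable_fst _ _ _ _))).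
have m2 j : measurable_fun setT (fun su : N.-tuple R * N.-tuple R => tnth (box_pr su.2) j).
  exact: (measurableT_comp (measurable_tnth j) (measurableT_comp measurable_box_pr (@measurable_snd _ _ _ _))).
have mp (f : N.-tuple R * N.-tuple R -> R) p : measurable_fun setT f -> measurable_fun setT (fun su => f su `^ p).
  by move=> mf; exact: (measurableT_comp (@measurable_powR R p) mf).
apply: measurable_prod => j _; apply: measurable_funM.
  rewrite /bifractional_cov; apply: measurable_funM => //; apply: measurable_funB.
    by apply: (mp); apply: measurable_funD; apply: mp.
  apply: (mp); apply: (measurableT_comp (@normr_measurable R setT)).
  exact: measurable_funB.
apply: (measurableT_comp (f := fun x : R => x^-1)); first exact: measurable_invr.
by apply: measurable_funM; apply: mp.
Qed.

Lemma component_gaussian i s u a b : orthant s -> orthant u ->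
  gaussian_rv P (fun w => a * component B i s w + b * component B i u w).
Proof.
move=> os ou.
have := @sheet_gaussian _ _ _ _ _ _ _ _ _ hB i 2%N (fun k => if k == ord0 then a else b) (fun k => if k == ord0 then s else u).
move=> /(_ _)/= h; have := h; rewrite (_ : (fun w => \sum_(k < 2) _) = (fun w => a * component B i s w + b * component B i u w)).
  by apply => k; case: ifP.
by apply/funext => w; rewrite big_ord_recl big_ord1/=.
Qed.

Lemma component_gaussian1 i s : orthant s -> gaussian_rv P (component B i s).
Proof.
move=> os; have := component_gaussian i 1 0 os os.
by congr gaussian_rv; apply/funext => w; rewrite mul1r mul0r addr0.
Qed.

Lemma component_L2 i s : orthant s -> L2 (component B i s).
Proof. by move=> os; have := gaussian_L2 1 (component_gaussian1 i os); congr (L2 _). Qed.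

Lemma component_ip i s u : orthant s -> orthant u ->
  ip (component B i s) (component B i u) =
  \prod_(j < N) bifractional_cov (H i j) (K i j) (tnth s j) (tnth u j).
Proof.
move=> os ou; have Ls := component_L2 i os; have Lu := component_L2 i ou.
have fP : P setT \is a fin_num by rewrite probability_setT.
have := sheet_cov hB i os ou; rewrite covarianceE.
- rewrite (sheet_centered hB i os) mul0e sube0 unlock => h.
  by rewrite /ip /Rintegral; have -> := congr1 fine h.
- by apply: Lfun_subset12 => //; exact/L2_Lfun.
- by apply: Lfun_subset12 => //; exact/L2_Lfun.
- by apply: Lfun2_mul_Lfun1; exact/L2_Lfun.
Qed.

Lemma component_mean i s : orthant s -> \int[P]_w component B i s w = 0.
Proof. by move=> os; have := sheet_centered hB i os; rewrite unlock /Rintegral => ->. Qed.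

Lemma rho_diag i s : rho i s s = 1.
Proof.
apply: big1 => j _; rewrite bifractional_cov_diag.
- by rewrite divff// gt_eqF// mulr_gt0// powR_gt0//; have /andP[] := box_prP s j.
- by have /andP[] := H01 i j.
- by have /andP[] := K01 i j.
- by have /andP[/ltW] := box_prP s j.
Qed.

Lemma xi_ip i s u : ip (xi i s) (xi i u) = rho i s u.
Proof.
have os := posbox_orthant (box_prP s); have ou := posbox_orthant (box_prP u).
have xiE v : xi i v = (fun w => (sheet_sd H K i (box_pr v))^-1 * component B i (box_pr v) w).
  by apply/funext => w; rewrite mulrC.
have Ls := component_L2 i os; have Lu := component_L2 i ou.
rewrite !xiE ipZl//; last exact: L2Z.
rewrite ipZr// component_ip// /rho /sheet_corr /sheet_sd.
rewrite -!prodfV -!big_split/=; apply: eq_bigr => j _.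
by rewrite invfM mulrA mulrC.
Qed.

Lemma rho01 i s u : 0 <= rho i s u <= 1.
Proof.
have h j : 0 <= bifractional_cov (H i j) (K i j) (tnth (box_pr s) j) (tnth (box_pr u) j) /
    (tnth (box_pr s) j `^ (H i j * K i j) * tnth (box_pr u) j `^ (H i j * K i j)) <= 1.
  have s0 : 0 < tnth (box_pr s) j by have /andP[] := box_prP s j.
  have u0 : 0 < tnth (box_pr u) j by have /andP[] := box_prP u j.
  have den : 0 < tnth (box_pr s) j `^ (H i j * K i j) * tnth (box_pr u) j `^ (H i j * K i j).
    by rewrite mulr_gt0// powR_gt0.
  have /andP[hH _] := H01 i j; have /andP[hK _] := K01 i j.
  rewrite divr_ge0 ?(ltW den) ?bifractional_cov_ge0 ?(ltW s0) ?(ltW u0)//=.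
  rewrite ler_pdivrMr// mul1r.
  have [c [c0 c1 /(_ _ _ s0 u0) le]] := bifractional_cov_le (H01 i j) (K01 i j).
  by apply: (le_trans le); rewrite ler_piMr ?(ltW den)// gerBl mulr_ge0 ?powR_ge0// ltW.
apply/andP; split; first by apply: prodr_ge0 => j _; have /andP[] := h j.
exact: prodr_ile1.
Qed.

Lemma xi_gaussian i s u a b : gaussian_rv P (fun w => a * xi i s w + b * xi i u w).
Proof.
have := component_gaussian i (a / sheet_sd H K i (box_pr s)) (b / sheet_sd H K i (box_pr u))
  (posbox_orthant (box_prP s)) (posbox_orthant (box_prP u)).
by congr gaussian_rv; apply/funext => w; rewrite /xi; congr (_ + _); rewrite mulrAC mulrA.
Qed.

Lemma xi_mean i s : \int[P]_w xi i s w = 0.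
Proof.
have os := posbox_orthant (box_prP s).
under eq_Rintegral do rewrite /xi mulrC.
rewrite RintegralZl//; first by rewrite component_mean// mulr0.
by have := L2_integrableM (component_L2 i os) (L2_cst P 1); under eq_fun do rewrite /= mulr1.
Qed.

Lemma hermiteN_ip i s u n m : ip (fun w => hermiteN n (xi i s w)) (fun w => hermiteN m (xi i u w)) =
  if n == m then rho i s u ^+ n else 0.
Proof.
have x2 v : \int[P]_w (xi i v w ^+ 2) = 1.
  by have := xi_ip i v v; rewrite rho_diag /ip; under eq_Rintegral do rewrite -expr2.
have h := hermite_two_point (xi_gaussian i s u) (xi_mean i s) (xi_mean i u) (x2 s) (x2 u) (xi_ip i s u) n m.
have Ln := L2_hornerX (xi_gaussian i s u) (hermite n).
have Lm := L2_hornerY (xi_gaussian i s u) (hermite m).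
have -> : (fun w => hermiteN n (xi i s w)) = (fun w => (Num.sqrt n`!%:R)^-1 * (hermite n).[xi i s w]).
  by apply/funext => w; rewrite mulrC.
have -> : (fun w => hermiteN m (xi i u w)) = (fun w => (Num.sqrt m`!%:R)^-1 * (hermite m).[xi i u w]).
  by apply/funext => w; rewrite mulrC.
rewrite ipZl//; last exact: L2Z.
rewrite ipZr// h; case: eqP => [<-|_]; last by rewrite !mulr0.
have k0 : (0 : R) < n`!%:R by rewrite ltr0n fact_gt0.
rewrite mulrA -invfM -expr2 sqr_sqrtr ?(ltW k0)// mulKf// gt_eqF.
Qed.

Let Gi i : set (set Omega) := [set component B i s @^-1` U | s in @orthant R N & U in measurable].

Lemma component_sigma_measurable i A : component_sigma B i A -> measurable A.
Proof.
apply: smallest_sub; first exact: sigma_algebra_measurable.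
move=> _ [s os [U mU <-]]; rewrite -[X in measurable X]setTI.
by have [mX _] := component_gaussian1 i os; exact: mX.
Qed.

Lemma Gmeas_sigma i (f : Omega -> R) :
  measurable_fun setT (f : g_sigma_algebraType (Gi i) -> measurableTypeR R) ->
  Gmeas (component_sigma B) i f.
Proof. by move=> mf U mU; have := mf measurableT U mU; rewrite setTI. Qed.

Lemma measurable_sigma_hermiteN i n s :
  measurable_fun setT ((fun w => hermiteN n (xi i s w)) : g_sigma_algebraType (Gi i) -> measurableTypeR R).
Proof.
have mc : measurable_fun setT (component B i (box_pr s) : g_sigma_algebraType (Gi i) -> measurableTypeR R).
  move=> _ U mU; rewrite setTI; apply: sub_gen_smallest.
  by exists (box_pr s); [exact/posbox_orthant/box_prP|exists U].
apply: measurable_funM; last exact: measurable_cst.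
apply: (measurableT_comp (f := fun x : R => (hermite n).[x])).
  by apply: continuous_measurable_fun; exact: continuous_horner.
by apply: measurable_funM; [exact: mc|exact: measurable_cst].
Qed.

Local Notation hp := (hermite_prod xi).

Lemma hermiteN_L2 i n s : L2 (fun w => hermiteN n (xi i s w)).
Proof.
have Ln := L2_hornerX (xi_gaussian i s s) (hermite n).
have := L2Z (Num.sqrt n`!%:R)^-1 Ln; congr (L2 _).
by apply/funext => w; rewrite mulrC.
Qed.

(** Independence of the components enters here: grouping the two factors of each component gives d
    independent variables. *)
Lemma hp_prod_integrable m n s u :
  P.-integrable setT (EFin \o (fun w => hp m s w * hp n u w)) /\
  \int[P]_w (hp m s w * hp n u w) = \prod_(i < d) ip (fun w => hermiteN (m i) (xi i s w)) (fun w => hermiteN (n i) (xi i u w)).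
Proof.
pose Z i w := hermiteN (m i) (xi i s w) * hermiteN (n i) (xi i u w).
have mZ i : Gmeas (component_sigma B) i (Z i).
  by apply: Gmeas_sigma; apply: measurable_funM; exact: measurable_sigma_hermiteN.
have iZ i : P.-integrable setT (EFin \o Z i) by apply: L2_integrableM; exact: hermiteN_L2.
have ZE w : hp m s w * hp n u w = \prod_(i < d) Z i w by rewrite /Z big_split.
have := indep_prod_integrable (component_sigma_measurable) (sheet_independent hB) mZ iZ.
have := indep_prod (component_sigma_measurable) (sheet_independent hB) mZ iZ.
by split; [under eq_fun do rewrite /= ZE|under eq_Rintegral do rewrite ZE].
Qed.

Lemma hp_L2 m s : L2 (hp m s).
Proof.
have mh : measurable_fun setT (hp m s).
  by apply: measurable_prod => i _; have [] := hermiteN_L2 i (m i) s.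
split => //; have [/integrableP[_ +] _] := hp_prod_integrable m m s s.
by under eq_integral do rewrite /= -expr2 ger0_norm ?sqr_ge0//.
Qed.

Lemma hp_ip m n s u : ip (hp m s) (hp n u) =
  if [forall i, m i == n i] then \prod_(i < d) rho i s u ^+ m i else 0.
Proof.
rewrite /ip (hp_prod_integrable m n s u).2; case: ifPn => [/forallP h|].
  by apply: eq_bigr => i _; rewrite hermiteN_ip h.
by rewrite negb_forall => /existsP[i /negbTE h]; rewrite (bigD1 i)//= hermiteN_ip h mul0r.
Qed.

Lemma posbox_lty : (lebesgue_tuple N (posbox t) < +oo)%E.
Proof.
rewrite -[posbox t]setTI -integral_indic//; last exact: measurable_posbox.
rewrite (_ : (\int[_]_(x in _) _)%E = (\int[lebesgue_tuple N]_(x in posbox t) \prod_(j < N) 1)%E); last first.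
  by apply: eq_integral => x _; rewrite indicE in_setT big1.
rewrite (@ge0_integral_posbox_prod R N t (fun _ _ => 1%E))//.
apply: prod_EFin_lty => j; rewrite integral_cst// mul1e measure_ge0/=.
by rewrite lebesgue_measure_itv/= lte_fin t0 -EFinD ltry.
Qed.

End sheet.

Section coefficient_lemmas.
Context {R : realType}.

Lemma measurable_sqrt : measurable_fun setT (@Num.sqrt R).
Proof. by apply: continuous_measurable_fun; exact: sqrt_continuous. Qed.

Lemma measurable_horner (p : {poly R}) : measurable_fun setT (fun x => p.[x]).
Proof. by apply: continuous_measurable_fun; exact: continuous_horner. Qed.

Lemma measurable_coef {dT} {T : measurableType dT} (X S : T -> R) eps k :
  measurable_fun setT X -> measurable_fun setT S ->
  measurable_fun setT (fun z => coef eps (X z) (S z) k).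
Proof.
move=> mX mS.
have mv : measurable_fun setT (fun z => Num.sqrt (S z ^+ 2 + eps)).
  apply: (measurableT_comp measurable_sqrt); apply: measurable_funD => //.
  exact: measurable_funX.
have mvi := measurableT_comp (@measurable_invr R) mv.
have mr : measurable_fun setT (fun z => X z / Num.sqrt (S z ^+ 2 + eps)) by exact: measurable_funM.
rewrite /coef; apply: measurable_funM; last first.
  by apply: measurable_funM => //; exact: (measurableT_comp (measurable_horner _) mr).
apply: measurable_funM; last first.
  apply: measurableT_comp; first exact: measurable_expR.
  by apply: measurable_funM => //; apply: measurableT_comp => //; exact: measurable_funX.
apply: measurable_funM => //; apply: measurable_funM => //.
by apply: measurable_funX; exact: measurable_funM.
Qed.

Lemma ratio_ge0 (eps sg : R) : 0 <= sg -> 0 <= sg / Num.sqrt (sg ^+ 2 + eps).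
Proof. by move=> s0; rewrite divr_ge0// sqrtr_ge0. Qed.

Lemma ratio_lt1 (eps sg : R) : 0 < eps -> 0 <= sg -> sg / Num.sqrt (sg ^+ 2 + eps) < 1.
Proof.
move=> e0 s0; rewrite ltr_pdivrMr ?mul1r; last by rewrite sqrtr_gt0 ltr_wpDl// sqr_ge0.
by rewrite -{1}(ger0_norm s0) -sqrtr_sqr ltr_sqrt ?ltrDl// ltr_wpDl// sqr_ge0.
Qed.

Lemma ratio_le1 (eps sg : R) : 0 <= eps -> 0 <= sg -> 0 <= sg / Num.sqrt (sg ^+ 2 + eps) <= 1.
Proof.
move=> e0 s0; rewrite ratio_ge0//=; case: (ltrgtP 0 eps) e0 => // [e0 _|<- _].
  by rewrite ltW// ratio_lt1.
by rewrite addr0 sqrtr_sqr ger0_norm//; case: (eqVneq sg 0) => [->|?]; rewrite ?mul0r ?divff.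
Qed.

Lemma ratio_homo (eps sg st : R) : 0 < eps -> 0 <= sg -> sg <= st ->
  sg / Num.sqrt (sg ^+ 2 + eps) <= st / Num.sqrt (st ^+ 2 + eps).
Proof.
move=> e0 s0 st0; have st0' := le_trans s0 st0.
have p0 (z : R) : 0 < Num.sqrt (z ^+ 2 + eps) by rewrite sqrtr_gt0 ltr_wpDl// sqr_ge0.
rewrite ler_pdivrMr// mulrAC ler_pdivlMr//.
rewrite -{1}(ger0_norm s0) -{2}(ger0_norm st0') -!sqrtr_sqr -!sqrtrM ?sqr_ge0//.
rewrite ler_sqrt; last by rewrite mulr_ge0 ?sqr_ge0// addr_ge0 ?sqr_ge0 ?(ltW e0).
have : sg ^+ 2 <= st ^+ 2 by rewrite ler_sqr// nnegrE.
nra.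
Qed.

Lemma gdom_le_eps (eps x sg : R) : 0 < eps -> gdom eps x sg <= eps `^ (- (1 / 2)).
Proof.
move=> e0; have v0 : 0 < sg ^+ 2 + eps by rewrite ltr_wpDl// sqr_ge0.
apply: (le_trans (gdom_le _ v0)).
rewrite !powRN lef_pV2 ?posrE ?powR_gt0//.
by apply: powR_homo; rewrite ?(ltW e0)// ler_wpDl// sqr_ge0.
Qed.

Lemma invsqrt4_le1 (k : nat) : 0 <= (Num.sqrt (Num.sqrt (k.+1%:R : R)))^-1 <= 1.
Proof.
rewrite invr_ge0 sqrtr_ge0 invf_le1 ?sqrtr_gt0 ?ltr0n//=.
by do 2 rewrite -[leLHS]sqrtr1 ler_wsqrtr//; rewrite ler1n.
Qed.

Lemma coef_le_gdom (eps x sg : R) k : 0 <= eps -> 0 < sg ->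
  `|coef eps x sg k| <= 2 * gdom eps x sg * (Num.sqrt (Num.sqrt k.+1%:R))^-1.
Proof.
move=> e0 s0; have v0 : 0 < sg ^+ 2 + eps by rewrite ltr_wpDr// exprn_gt0.
have /andP[q0 q1] := invsqrt4_le1 k.
apply: (le_trans (coef_le x k v0 (ltW s0))); apply: ler_piMr.
  by rewrite !mulr_ge0 ?gdom_ge0.
by have /andP[a b] := ratio_le1 e0 (ltW s0); exact: exprn_ile1.
Qed.

End coefficient_lemmas.

(** * Chaos expansion of the regularized local time *)

Section sheet_chaos.
Context {R : realType} {N d : nat} {dO : measure_display} {Omega : measurableType dO}
  (P : probability Omega R) (H K : 'M[R]_(d, N)) (B : N.-tuple R -> Omega -> d.-tuple R) (t : N.-tuple R).
Hypothesis H01 : forall i j, 0 < H i j < 1.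
Hypothesis K01 : forall i j, 0 < K i j <= 1.
Hypothesis hB : bifractional_sheet P H K B.
Hypothesis t0 : forall j, 0 < tnth t j.

Local Notation L2 := (L2 P).
Local Notation ip := (ip P).
Local Notation sq := (sq P).
Local Notation pr := (box_pr t).
Local Notation xi := (xi H K B t).
Local Notation rho := (rho H K t).
Local Notation sd i s := (sheet_sd H K i (pr s)).

Definition box_measure : {finite_measure set (N.-tuple R) -> \bar R} := mfrestr (measurable_posbox t) (posbox_lty t0).
Local Notation nu := box_measure.

Lemma ge0_integral_box_measure (f : N.-tuple R -> \bar R) : measurable_fun setT f -> (forall x, 0 <= f x)%E ->
  (\int[nu]_x f x = \int[lebesgue_tuple N]_(x in posbox t) f x)%E.
Proof. exact: ge0_integral_mfrestr. Qed.

Definition sheet_coef eps (x : d.-tuple R) i k s := coef eps (tnth x i) (sd i s) k.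
Definition sheet_weight eps x (m : 'I_d -> nat) s := \prod_(i < d) sheet_coef eps x i (m i) s.
Definition sheet_kernel eps (x : d.-tuple R) s w :=
  \prod_(i < d) normal_pdf 0 (Num.sqrt eps) (component B i (pr s) w - tnth x i).

Lemma measurable_sheet_coef eps x i k : measurable_fun setT (sheet_coef eps x i k).
Proof. by apply: measurable_coef; [exact: measurable_cst|exact: measurable_sd]. Qed.

Lemma measurable_sheet_weight eps x m : measurable_fun setT (sheet_weight eps x m).
Proof. by apply: measurable_prod => i _; exact: measurable_sheet_coef. Qed.

Lemma sheet_sd_homo i s u : (forall j, 0 <= tnth s j <= tnth u j) -> sheet_sd H K i s <= sheet_sd H K i u.
Proof.
move=> su; apply: ler_prod => j _; rewrite powR_ge0/=.
have /andP[H0 _] := H01 i j; have /andP[K0 _] := K01 i j; have /andP[s0 su'] := su j.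
by apply: ge0_ler_powR; rewrite ?nnegrE ?(le_trans s0 su')// ltW// mulr_gt0.
Qed.

(** For fixed eps > 0 the ratio sd/sqrt(sd^2 + eps) increases with sd, and sd is largest at the
    corner t: the values there give a rate r < 1 valid on the whole box. The rate may degenerate as
    eps tends to 0, so it only serves the expansion at fixed eps. *)
Lemma sheet_coef_geo eps x : 0 < eps -> exists D r, [/\ 0 <= D, 0 <= r < 1 &
  forall i k s, `|sheet_coef eps x i k s| <= D * r ^+ k].
Proof.
move=> e0; pose st i := sheet_sd H K i t.
pose r := \big[Num.max/0]_(i < d) (st i / Num.sqrt (st i ^+ 2 + eps)).
have st0 i : 0 <= st i by apply: prodr_ge0 => j _; exact: powR_ge0.
exists (2 * eps `^ (- (1 / 2))), r; split.
- by rewrite mulr_ge0 ?powR_ge0.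
- rewrite /r; elim/big_ind : _ => [|a b /andP[a0 a1] /andP[b0 b1]|i _]; first by rewrite lexx ltr01.
    by rewrite le_max a0/= gt_max a1.
  by rewrite ratio_ge0//= ratio_lt1.
move=> i k s; have s0 := sd_gt0 H K t0 i s.
have v0 : 0 < sd i s ^+ 2 + eps by rewrite ltr_wpDl// sqr_ge0.
apply: (le_trans (coef_le _ _ v0 (ltW s0))).
apply: ler_pM.
- by rewrite !mulr_ge0 ?gdom_ge0// invr_ge0 sqrtr_ge0.
- by rewrite exprn_ge0// ratio_ge0// ltW.
- have /andP[q0 q1] := @invsqrt4_le1 R k.
  apply: (@le_trans _ _ (2 * gdom eps (tnth x i) (sd i s))); first by apply: ler_piMr => //; rewrite mulr_ge0// gdom_ge0.
  by rewrite ler_pM2l// gdom_le_eps.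
- apply: lerXn2r; rewrite ?nnegrE; first by rewrite ratio_ge0// ltW.
    exact: bigmax_ge_id.
  apply: (@le_trans _ _ (st i / Num.sqrt (st i ^+ 2 + eps))).
    apply: ratio_homo => //; first exact: ltW.
    by apply: sheet_sd_homo => j; have /andP[/ltW-> ->] := box_prP t0 s j.
  exact: (le_bigmax _ (fun i => st i / Num.sqrt (st i ^+ 2 + eps))).
Qed.

Lemma sheet_weight_good eps x : 0 < eps -> good_weight (sheet_weight eps x).
Proof.
move=> e0; have [D [r [D0 /andP[r0 r1] h]]] := sheet_coef_geo x e0.
move=> m; split; first exact: measurable_sheet_weight.
exists (\prod_(i < d) (D * r ^+ m i)) => s; rewrite normr_prod.
by apply: ler_prod => i _; rewrite normr_ge0/=.
Qed.

Lemma measurable_sheet_kernel eps :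
  measurable_fun setT (fun z : d.-tuple R * (N.-tuple R * Omega) => sheet_kernel eps z.1 z.2.1 z.2.2).
Proof.
apply: measurable_prod => i _; apply: measurableT_comp; first exact: measurable_normal_pdf.
apply: measurable_funB.
  exact: (measurableT_comp (measurable_tnth i) (measurableT_comp (measurable_sheet hB t0) (@measurable_snd _ _ _ _))).
exact: (measurableT_comp (measurable_tnth i) (@measurable_fst _ _ _ _)).
Qed.

Lemma sheet_kernel_bound eps : 0 < eps -> exists c, 0 <= c /\ forall x s w, 0 <= sheet_kernel eps x s w <= c.
Proof.
move=> e0; have se : Num.sqrt eps != 0 by rewrite gt_eqF// sqrtr_gt0.
exists (\prod_(i < d) normal_peak (Num.sqrt eps)); split.
  by apply: prodr_ge0 => i _; exact: normal_peak_ge0.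
move=> x s w; apply/andP; split; first by apply: prodr_ge0 => i _; exact: normal_pdf_ge0.
by apply: ler_prod => i _; rewrite normal_pdf_ge0 normal_pdf_ub.
Qed.

Lemma sheet_kernel_field eps x : 0 < eps -> L2field P (sheet_kernel eps x).
Proof.
move=> e0; have [c [c0 hc]] := sheet_kernel_bound e0; split.
  exact: (measurableT_comp (measurable_sheet_kernel eps) (pair1_measurable x)).
exists (c ^+ 2) => s.
apply: (@le_trans _ _ (\int[P]_w (c ^+ 2)%:E)%E).
  apply: ge0_le_integral => //.
  - by move=> w _; rewrite lee_fin sqr_ge0.
  - apply/measurable_EFinP/measurable_funX.
    exact: (measurableT_comp (measurableT_comp (measurable_sheet_kernel eps) (pair1_measurable x)) (pair1_measurable s)).
  - by move=> w _; rewrite lee_fin; have /andP[a b] := hc x s w; rewrite lerXn2r// nnegrE.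
by rewrite integral_cst//= probability_setT mule1.
Qed.

Lemma sheet_expansion eps x : 0 < eps ->
  sq (fun w => pint nu (sheet_kernel eps x) w - \sum_(n < M) chaosJ nu xi (sheet_weight eps x) n w) @[M --> \oo] --> 0.
Proof.
move=> e0; have [D [r [D0 r01 h]]] := sheet_coef_geo x e0.
have := (chaos_expansion nu (measurable_xi hB t0) (hp_L2 hB t0) (hp_ip H01 K01 hB t0)
  (rho_diag H01 K01 t0) (@measurable_sheet_coef eps x) D0 r01 h (sheet_kernel_field x e0)); apply => s w.
apply: cvg_big => [|i _]; first exact: mul_continuous.
have s0 := sd_gt0 H K t0 i s.
have -> : component B i (pr s) w = sd i s * xi i s w by rewrite /xi mulrC divfK// gt_eqF.
exact: (@kernel_expansion R eps (tnth x i) (sd i s) _ e0 (ltW s0)).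
Qed.

End sheet_chaos.

Lemma lev_weight (R : realType) d n (alpha : R) (f : ('I_d -> nat) -> R) :
  (1 + n%:R) `^ alpha * lev n f = lev n (fun m => (1 + (\sum_(i < d) m i)%:R) `^ alpha * f m).
Proof. by rewrite /lev mulr_sumr; apply: eq_bigr => m /eqP ->. Qed.

(** * Energy bound uniform in the regularization, and convergence *)

Section sheet_energy.
Context {R : realType} {N d : nat} {dO : measure_display} {Omega : measurableType dO}
  (P : probability Omega R) (H K : 'M[R]_(d, N)) (B : N.-tuple R -> Omega -> d.-tuple R) (t : N.-tuple R).
Hypothesis N0 : (0 < N)%N.
Hypothesis d0 : (0 < d)%N.
Hypothesis H01 : forall i j, 0 < H i j < 1.
Hypothesis K01 : forall i j, 0 < K i j <= 1.
Hypothesis hB : bifractional_sheet P H K B.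
Hypothesis t0 : forall j, 0 < tnth t j.

Local Notation L2 := (L2 P).
Local Notation ip := (ip P).
Local Notation sq := (sq P).
Local Notation pr := (box_pr t).
Local Notation xi := (xi H K B t).
Local Notation rho := (rho H K t).
Local Notation sd i s := (sheet_sd H K i (pr s)).
Local Notation nu := (box_measure t0).
Local Notation A := (sheet_weight H K t).
Local Notation J eps x n := (chaosJ nu xi (A eps x) n).

(** The levels at which the mean of the regularized local time stays bounded as eps tends to 0. Only
    x = 0 is constrained: there the product of the inverse standard deviations has to be integrable
    near the axes. *)
Definition regular_level (x : d.-tuple R) :=
  (forall i, tnth x i = 0) -> forall j, \sum_(i < d) H i j * K i j < 1.

Lemma sheet_weight_le eps x m s : 0 <= eps ->
  `|A eps x m s| <= 2 ^+ d * (\prod_(i < d) gdom eps (tnth x i) (sd i s)) *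
     \prod_(i < d) (Num.sqrt (Num.sqrt (m i).+1%:R))^-1.
Proof.
move=> e0; rewrite normr_prod.
have -> : (2 : R) ^+ d = \prod_(i < d) 2 by rewrite prodr_const card_ord.
rewrite -!big_split/=; apply: ler_prod => i _; rewrite normr_ge0/=.
exact: coef_le_gdom (sd_gt0 H K t0 i s).
Qed.

Lemma sheet_energy x (alpha : R) : regular_level x -> 0 < alpha ->
  0 < alpha < \sum_(j < N) (2 * col_max H j * col_max K j)^-1 - d%:R / 2 ->
  exists C, forall eps M, 0 < eps <= 1 -> \sum_(n < M) (1 + n%:R) `^ alpha * sq (J eps x n) <= C.
Proof.
move=> reg alpha0 halpha.
(* Rearrangements settled on plain variables, before the large products appear. *)
have alg1 (y gs gu q r : R) : y ^+ 2 * gs * gu * (q * q * r) = (y * gs * q) * (y * gu * q) * r by lra.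
have alg2 (y g g' cs w : R) : y ^+ 2 * (cs * w) * (g * g') = y ^+ 2 * g * g' * (cs * w) by lra.
have alg3 (y cg p p' cs w : R) : y ^+ 2 * (cs * w) * ((cg + 1) * p * ((cg + 1) * p')) =
    (y * (cg + 1)) ^+ 2 * cs * (p' * p * w) by lra.
have [Cg [a [Cg0 a01 dom]]] := @gdom_dominated _ _ _ H K H01 K01 x t reg.
have [Cs [Cs0 hCs]] := sum_multi_index d alpha0.
have beta01 : 0 < alpha + d%:R / 2 < \sum_(j < N) (2 * col_max H j * col_max K j)^-1.
  by have : (0 : R) <= d%:R by []; move: halpha; lra.
have [W [mW W0 Woo hW]] := corr_kernel H01 K01 N0 d0 a01 t0 beta01.
(* [Cg + 1] in place of [Cg] makes [K0] positive, so that [W'] is infinite wherever [W] is. *)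
pose K0 := (2 ^+ d * (Cg + 1)) ^+ 2 * Cs.
have K00 : 0 < K0 by rewrite mulr_gt0// exprn_gt0// mulr_gt0 ?exprn_gt0// ltr_wpDl.
pose W' u s := (K0%:E * W (pr u) (pr s))%E.
have mpr1 : measurable_fun setT (fun us : N.-tuple R * N.-tuple R => pr us.1).
  exact: (measurableT_comp (measurable_box_pr t) (@measurable_fst _ _ _ _)).
have mpr2 : measurable_fun setT (fun us : N.-tuple R * N.-tuple R => pr us.2).
  exact: (measurableT_comp (measurable_box_pr t) (@measurable_snd _ _ _ _)).
have mW' : measurable_fun setT (fun us : N.-tuple R * N.-tuple R => W' us.1 us.2).
  apply: emeasurable_funM; first exact: measurable_cst.
  by apply: (measurableT_comp mW (g := fun us => (pr us.1, pr us.2))); apply/measurable_fun_pairP.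
have W'0 u s : (0 <= W' u s)%E by rewrite mule_ge0// lee_fin ltW.
have mWu u : measurable_fun setT (W ^~ u) by exact: (measurableT_comp mW (pair2_measurable u)).
have W'oo : (\int[nu]_s \int[nu]_u W' u s < +oo)%E.
  rewrite ge0_integral_box_measure; last 2 first.
  - apply: (@measurable_fun_fubini_tonelli_G _ _ _ _ _ nu (fun us => W' us.1 us.2)) => //.
  - by move=> s; apply: integral_ge0.
  rewrite (_ : (\int[_]_(s in _) _)%E = (K0%:E * \int[lebesgue_tuple N]_(u in posbox t) \int[lebesgue_tuple N]_(s in posbox t) W s u)%E); last first.
    rewrite -ge0_integralZl//; last 4 first.
    - exact: measurable_posbox.
    - apply: measurable_funTS.
      rewrite (_ : (fun u => _) = (fun u => \int[nu]_s W s u)%E).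
        exact: (@measurable_fun_fubini_tonelli_G _ _ _ _ _ nu (fun us => W us.1 us.2)).
      by apply/funext => u; rewrite ge0_integral_box_measure.
    - by move=> u _; apply: integral_ge0.
    - by rewrite lee_fin ltW.
    apply: eq_integral => s /set_mem st.
    rewrite ge0_integral_box_measure//; last exact: (measurableT_comp mW' (pair2_measurable s)).
    rewrite -ge0_integralZl//; last 3 first.
    - exact: measurable_posbox.
    - exact: measurable_funTS.
    - by rewrite lee_fin ltW.
    by apply: eq_integral => u /set_mem ut; rewrite /W' !box_prE.
  by rewrite lte_mul_pinfty// lee_fin ltW.
exists (fine (\int[nu]_s \int[nu]_u W' u s)%E) => eps M /andP[e0 e1].
rewrite -lee_fin fineK; last first.
  by rewrite ge0_fin_numE//; apply: integral_ge0 => s _; apply: integral_ge0.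
have := (chaosJ_weighted_sum nu (measurable_xi hB t0) (hp_L2 hB t0) (hp_ip H01 K01 hB t0)
  (rho01 H01 K01 t0) (rho_diag H01 K01 t0) (measurable_rho H K t) (sheet_weight_good H01 K01 t0 x e0) mW' W'0); apply => s u.
have [rb [/andP[rb0 rb1] hr hk hoo]] := hW _ _ (box_prP t0 u) (box_prP t0 s).
have [rb1'|rb1'] := ltP rb 1; last first.
  have /hoo rb1'' : rb = 1 by apply/eqP; rewrite eq_le rb1.
  by rewrite /W' rb1'' gt0_muley ?lte_fin// leey.
apply: (@le_trans _ _ (K0%:E * (\prod_(j < N) tnth (pr u) j `^ (- a j) * \prod_(j < N) tnth (pr s) j `^ (- a j) *
   (1 - rb) `^ (- (alpha + d%:R / 2)))%R%:E)%E); last by rewrite lee_pmul2l ?lte_fin// hk.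
rewrite -EFinM lee_fin.
have eps01 : 0 <= eps <= 1 by rewrite (ltW e0).
have ds := dom _ _ eps01 (box_prP t0 s); have du := dom _ _ eps01 (box_prP t0 u).
set Gs := \prod_(i < d) gdom eps (tnth x i) (sd i s) in ds.
set Gu := \prod_(i < d) gdom eps (tnth x i) (sd i u) in du.
set ps := \prod_(j < N) tnth (pr s) j `^ (- a j) in ds *.
set pu := \prod_(j < N) tnth (pr u) j `^ (- a j) in du *.
have Gs0 : 0 <= Gs by apply: prodr_ge0 => i _; exact: gdom_ge0.
have Gu0 : 0 <= Gu by apply: prodr_ge0 => i _; exact: gdom_ge0.
have ps0 : 0 <= ps by apply: prodr_ge0 => i _; exact: powR_ge0.
have pu0 : 0 <= pu by apply: prodr_ge0 => i _; exact: powR_ge0.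
have hs m := sheet_weight_le x m s (ltW e0); have hu m := sheet_weight_le x m u (ltW e0).
rewrite -/Gs in hs; rewrite -/Gu in hu; clearbody Gs Gu ps pu.
have pos : 0 <= (2 ^+ d) ^+ 2 * Gs * Gu by apply: mulr_ge0 => //; apply: mulr_ge0 => //; rewrite exprn_ge0// exprn_ge0.
have q0 k : 0 <= (Num.sqrt (Num.sqrt (k.+1%:R : R)))^-1 by rewrite invr_ge0 sqrtr_ge0.
under eq_bigr do rewrite lev_weight.
rewrite (sum_lev _ (leqnn M)).
pose T (m : {ffun 'I_d -> 'I_M}) := (1 + (\sum_(i < d) m i)%:R) `^ alpha *
    (\prod_(i < d) ((Num.sqrt (m i).+1%:R)^-1 * rb ^+ m i)).
have T0 m : 0 <= T m.
  rewrite mulr_ge0 ?powR_ge0//; apply: prodr_ge0 => i _.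
  by rewrite mulr_ge0 ?exprn_ge0// invr_ge0 sqrtr_ge0.
(* The condition on the degree is dropped and each correlation is replaced by the common bound [rb].
   The factors (m_i+1)^(-1/4) coming from the two points combine into (m_i+1)^(-1/2). *)
apply: (@le_trans _ _ ((2 ^+ d) ^+ 2 * Gs * Gu * \sum_m T m)).
  rewrite mulr_sumr big_mkcond/=; apply: ler_sum => m _; case: ifP => _; last first.
    exact: mulr_ge0 pos (T0 m).
  rewrite /T [leRHS]mulrCA; apply: ler_wpM2l; first exact: powR_ge0.
  have hq : \prod_(i < d) ((Num.sqrt (m i).+1%:R)^-1 * rb ^+ m i) =
      (\prod_(i < d) (Num.sqrt (Num.sqrt (m i).+1%:R))^-1) * (\prod_(i < d) (Num.sqrt (Num.sqrt (m i).+1%:R))^-1) *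
      \prod_(i < d) rb ^+ m i.
    rewrite -!big_split/=; apply: eq_bigr => i _; congr (_ * _).
    by rewrite -invfM -expr2 sqr_sqrtr// sqrtr_ge0.
  rewrite {}hq; set q := \prod_(i < d) (Num.sqrt (Num.sqrt (m i).+1%:R))^-1.
  have qq0 : 0 <= q by apply: prodr_ge0.
  rewrite alg1; apply: ler_pM.
  - by rewrite mulr_ge0.
  - by apply: prodr_ge0 => i _; rewrite exprn_ge0//; have /andP[] := hr rb1' i.
  - by apply: ler_pM.
  - apply: ler_prod => i _; have /andP[r0 r1] := hr rb1' i.
    by rewrite exprn_ge0//= lerXn2r// nnegrE.
apply: (@le_trans _ _ ((2 ^+ d) ^+ 2 * Gs * Gu * (Cs * (1 - rb) `^ (- (alpha + d%:R / 2))))).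
  by apply: ler_wpM2l; [exact: pos|apply: hCs; rewrite rb0].
rewrite /K0; set z := (1 - rb) `^ _; have z0 : 0 <= z by exact: powR_ge0.
have G1 : Gs <= (Cg + 1) * ps by rewrite mulrDl (le_trans ds)// lerDl mul1r.
have G2 : Gu <= (Cg + 1) * pu by rewrite mulrDl (le_trans du)// lerDl mul1r.
have GG : Gs * Gu <= ((Cg + 1) * ps) * ((Cg + 1) * pu) by apply: ler_pM.
have y0 : 0 <= (2 ^+ d) ^+ 2 * (Cs * z) by rewrite mulr_ge0 ?exprn_ge0// mulr_ge0// ltW.
by have := ler_wpM2l y0 GG; rewrite alg2 alg3.
Qed.

(** An integrable bound uniform in eps, for dominated convergence in each chaos component. *)
Lemma sheet_weight_dominated x : regular_level x -> exists G : N.-tuple R -> R,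
  [/\ measurable_fun setT G, nu.-integrable setT (EFin \o G) &
   forall eps m s, 0 <= eps <= 1 -> `|A eps x m s| <= G s].
Proof.
move=> reg; have [C [a [C0 a01 dom]]] := @gdom_dominated _ _ _ H K H01 K01 x t reg.
pose g s := \prod_(j < N) tnth s j `^ (- a j).
have mpw j : measurable_fun setT (fun r : R => r `^ (- a j)) by exact: measurable_powR.
have mg : measurable_fun setT g.
  by apply: measurable_prod => j _; exact: (measurableT_comp (mpw j) (measurable_tnth j)).
have mG : measurable_fun setT (fun s => 2 ^+ d * C * g (pr s)).
  by apply: measurable_funM => //; exact: (measurableT_comp mg (measurable_box_pr t)).
have g0 s : 0 <= g s by apply: prodr_ge0 => j _; exact: powR_ge0.
have G0 s : 0 <= 2 ^+ d * C * g (pr s) by rewrite !mulr_ge0// exprn_ge0.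
exists (fun s => 2 ^+ d * C * g (pr s)); split => //.
  apply/integrableP; split; first exact/measurable_EFinP.
  rewrite (_ : (\int[_]_x _)%E = (\int[nu]_x ((2 ^+ d * C)%:E * (g (pr x))%:E))%E); last first.
    by apply: eq_integral => s _; rewrite /= ger0_norm.
  rewrite ge0_integralZl//; last 3 first.
  - by apply/measurable_EFinP; exact: (measurableT_comp mg (measurable_box_pr t)).
  - by move=> s _; rewrite lee_fin.
  - by rewrite lee_fin mulr_ge0// exprn_ge0.
  rewrite lte_mul_pinfty ?lee_fin ?mulr_ge0 ?exprn_ge0//.
  rewrite ge0_integral_box_measure; last 2 first.
  - by apply/measurable_EFinP; exact: (measurableT_comp mg (measurable_box_pr t)).
  - by move=> s; rewrite lee_fin.
  rewrite (_ : (\int[_]_(s in _) _)%E = (\int[lebesgue_tuple N]_(s in posbox t) \prod_(j < N) (tnth s j `^ (- a j))%:E)%E); last first.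
    by apply: eq_integral => s /set_mem st; rewrite box_prE// prodEFin.
  rewrite (@ge0_integral_posbox_prod R N t (fun j r => (r `^ (- a j))%:E)); last 2 first.
  - by move=> j; exact/measurable_EFinP.
  - by move=> j r; rewrite lee_fin powR_ge0.
  apply: prod_EFin_lty => j; apply/andP; split; first by apply: integral_ge0 => r _; rewrite lee_fin powR_ge0.
  have b0 : 0 < 1 - a j by have /andP[] := a01 j; rewrite subr_gt0.
  have := integral_powR_le b0 (t0 j); rewrite (_ : 1 - a j - 1 = - a j); last lra.
  by move=> /le_lt_trans; apply; exact: ltry.
move=> eps m s eps01; have /andP[e0 _] := eps01.
apply: (le_trans (sheet_weight_le x m s e0)).
rewrite -mulrA; set q := \prod_(i < d) (Num.sqrt _)^-1.
have q0 : 0 <= q by apply: prodr_ge0 => i _; rewrite invr_ge0 sqrtr_ge0.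
have q1 : q <= 1 by apply: prodr_ile1 => i _; exact: invsqrt4_le1.
rewrite -[leRHS]mulrA ler_pM2l ?exprn_gt0//.
apply: le_trans (dom _ _ eps01 (box_prP t0 s)).
by apply: ler_piMr => //; apply: prodr_ge0 => i _; exact: gdom_ge0.
Qed.

(** At eps = 0 the weights still make sense although the kernel does not. *)
Definition weight_dist eps x m := \int[nu]_s `|A eps x m s - A 0 x m s|.

Lemma weight_dist_ge0 eps x m : 0 <= weight_dist eps x m.
Proof. by rewrite /weight_dist /Rintegral fine_ge0//; apply: integral_ge0 => s _; rewrite lee_fin. Qed.

Lemma weight_integrable eps x m : regular_level x -> 0 <= eps <= 1 -> nu.-integrable setT (EFin \o A eps x m).
Proof.
move=> reg e01; have [G [mG iG hG]] := sheet_weight_dominated reg.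
apply: le_integrable iG => //; first by apply/measurable_EFinP; exact: measurable_sheet_weight.
by move=> s _; rewrite lee_fin (le_trans (hG _ _ _ e01))// ler_norm.
Qed.

Lemma weight_dist_cvg x m : regular_level x -> weight_dist eps x m @[eps --> 0^'+] --> 0.
Proof.
move=> reg; have [G [mG iG hG]] := sheet_weight_dominated reg.
apply/cvg_at_rightP => u [u0 ucvg].
have u1 : \forall n \near \oo, u n <= 1 by near=> n; apply/ltW; near: n; exact: (cvgr_lt 0).
have A01 : 0 <= (0 : R) <= 1 by apply/andP; split.
have [n0 _ hn0] := u1.
pose v n := u (n + n0)%N.
have v01 n : 0 <= v n <= 1 by apply/andP; split; [exact: ltW (u0 _)|exact: (hn0 _ (leq_addl n n0))].
have vcvg : v n @[n --> \oo] --> 0 by rewrite cvg_shiftn.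
suff h : weight_dist (v n) x m @[n --> \oo] --> 0.
  by rewrite -(@cvg_shiftn n0 _ (fun n => weight_dist (u n) x m)); exact: h.
have h1 : \forall s \ae nu, [set: N.-tuple R] s -> (A (v n) x m s)%:E @[n --> \oo] --> (A 0 x m s)%:E.
  apply: aeW => s _; apply: cvg_EFin; first by near=> n.
  apply: cvg_big => [|i _]; first exact: mul_continuous.
  have := @coef_cvg R (tnth x i) (sd i s) (m i) (sd_gt0 H K t0 i s).
  by move/cvg_at_rightP; apply; split => // n; exact: u0.
have h2 : \forall s \ae nu, forall n, [set: N.-tuple R] s -> (`|(A (v n) x m s)%:E| <= (EFin \o G) s)%E.
  by apply: aeW => s n _; rewrite lee_fin hG.
have [_ + _] := @dominated_convergence _ _ _ nu setT measurableT (fun n s => (A (v n) x m s)%:E) (fun s => (A 0 x m s)%:E)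
  (EFin \o G) (fun n => (measurable_EFinP _ _).2 (measurable_sheet_weight H K t (v n) x m))
  ((measurable_EFinP _ _).2 (measurable_sheet_weight H K t 0 x m)) h1 iG h2.
move=> /fine_cvgP[_].
by under eq_fun do rewrite /comp/=.
Unshelve. all: by end_near.
Qed.

Lemma weight_distE eps x m : regular_level x -> 0 <= eps <= 1 ->
  (\int[nu]_s (`|A eps x m s - A 0 x m s|)%:E = (weight_dist eps x m)%:E)%E.
Proof.
move=> reg e01; rewrite /weight_dist /Rintegral fineK//.
have A01 : 0 <= (0 : R) <= 1 by apply/andP; split.
have := integrableB measurableT (weight_integrable m reg e01) (weight_integrable m reg A01).
move=> /integrableP[_]; rewrite ge0_fin_numE; last by apply: integral_ge0 => s _; rewrite lee_fin.
exact.
Qed.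

Lemma good_weightB (B1 B2 : ('I_d -> nat) -> N.-tuple R -> R) : good_weight B1 -> good_weight B2 ->
  good_weight (fun m s => B1 m s - B2 m s).
Proof.
move=> g1 g2 m; have [m1 [c1 h1]] := g1 m; have [m2 [c2 h2]] := g2 m.
split; first exact: measurable_funB.
by exists (c1 + c2) => s; rewrite (le_trans (ler_normB _ _))// lerD.
Qed.

(** The finitely many weights of order n converge in L^1 as eps tends to 0; both regularizations are
    compared with the weights at eps = 0. *)
Lemma chaosJ_cauchy x n del : regular_level x -> 0 < del -> exists e0, 0 < e0 /\
  forall e e', 0 < e <= 1 -> 0 < e' <= 1 -> e <= e0 -> e' <= e0 ->
  sq (fun w => J e x n w - J e' x n w) <= del.
Proof.
move=> reg del0.
pose psi e := \sum_(m : {ffun 'I_d -> 'I_n.+1}) 2 * weight_dist e x (fun i => m i) ^+ 2.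
have psi0 : psi e @[e --> 0^'+] --> 0.
  have h0 : \sum_(m : {ffun 'I_d -> 'I_n.+1}) 2 * 0 ^+ 2 = 0 :> R.
    by rewrite big1// => m _; rewrite expr0n/= mulr0.
  rewrite -[X in _ --> X]h0.
  apply: cvg_big => [|m _]; first exact: add_continuous.
  apply: cvgM; first exact: cvg_cst.
  by rewrite expr2; under eq_fun do rewrite expr2; apply: cvgM; exact: weight_dist_cvg.
have del2 : 0 < del / 2 by rewrite divr_gt0.
have [e0 /= e00 he] : \forall e \near 0^'+, psi e < del / 2 by exact: (cvgr_lt 0).
have hpsi e : 0 < e -> e <= e0 / 2 -> psi e < del / 2.
  by move=> ep ee; apply: he => //=; rewrite sub0r normrN gtr0_norm//; lra.
exists (e0 / 2); split; first by rewrite divr_gt0.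
move=> e e' /andP[ep e1] /andP[ep' e1'] he1 he2.
have gw := sheet_weight_good H01 K01 t0 x ep; have gw' := sheet_weight_good H01 K01 t0 x ep'.
have r1 : 0 <= e <= 1 by rewrite ltW.
have r2 : 0 <= e' <= 1 by rewrite ltW.
rewrite (sq_chaosJB nu (measurable_xi hB t0) (hp_L2 hB t0) (hp_ip H01 K01 hB t0) (rho_diag H01 K01 t0) n gw gw').
have le := sq_chaosJ_le_L1 nu (measurable_xi hB t0) (hp_L2 hB t0) (hp_ip H01 K01 hB t0)
  (rho01 H01 K01 t0) (rho_diag H01 K01 t0) (measurable_rho H K t) n (good_weightB gw gw').
suff : ((sq (chaosJ nu xi (fun m s => A e x m s - A e' x m s) n))%:E <= (psi e + psi e')%:E)%E.
  rewrite lee_fin => /le_trans; apply; apply: ltW.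
  move: (hpsi _ ep he1) (hpsi _ ep' he2); move: (psi e) (psi e') => a b; lra.
apply: (le_trans le); rewrite -big_split/= -sumEFin; apply: lee_sum => m _.
set D := (\int[nu]_s _)%E.
have D0 : (0 <= D)%E by apply: integral_ge0 => s _; rewrite lee_fin.
have mA a : measurable_fun setT (fun s => `|A a x (fun i => m i) s - A 0 x (fun i => m i) s|).
  by apply: measurableT_comp => //; apply: measurable_funB; exact: measurable_sheet_weight.
have Dle : (D <= (weight_dist e x (fun i => m i) + weight_dist e' x (fun i => m i))%:E)%E.
  rewrite EFinD -!weight_distE// -ge0_integralD//; last 2 first.
  - exact/measurable_EFinP.
  - exact/measurable_EFinP.
  apply: ge0_le_integral => //.
  - apply/measurable_EFinP; apply: measurableT_comp => //.
    by apply: measurable_funB; exact: measurable_sheet_weight.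
  - by apply: emeasurable_funD; exact/measurable_EFinP.
  move=> s _; rewrite -EFinD lee_fin.
  set a := A e x _ s; set b := A e' x _ s; set c := A 0 x _ s.
  have -> : a - b = (a - c) - (b - c) by lra.
  exact: ler_normB.
apply: (le_trans (lee_pmul D0 D0 Dle Dle)); rewrite -EFinM lee_fin.
have alg (a b : R) : (a + b) * (a + b) <= 2 * a ^+ 2 + 2 * b ^+ 2.
  by have := sqr_ge0 (a - b); rewrite !expr2; lra.
exact: alg.
Qed.

Local Notation L eps x := (pint nu (sheet_kernel B t eps x)).

Lemma sheet_pint_cauchy x (alpha : R) : regular_level x ->
  0 < alpha < \sum_(j < N) (2 * col_max H j * col_max K j)^-1 - d%:R / 2 ->
  forall del, 0 < del -> exists e0, 0 < e0 /\ forall e e', 0 < e <= 1 -> 0 < e' <= 1 ->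
  e <= e0 -> e' <= e0 -> sq (fun w => L e x w - L e' x w) <= del.
Proof.
move=> reg alpha01; have /andP[alpha0 _] := alpha01.
have [C hC] := sheet_energy reg alpha0 alpha01.
apply: (@hilbert_cauchy _ _ _ P alpha C (fun e => L e x) (fun e n => J e x n) alpha0).
- by move=> e /andP[e0 _]; exact: pint_L2 (sheet_kernel_field hB t0 x e0).
- move=> e n /andP[e0 _].
  exact: (chaosJ_L2 nu (measurable_xi hB t0) (hp_L2 hB t0) (hp_ip H01 K01 hB t0) (rho_diag H01 K01 t0) n
    (sheet_weight_good H01 K01 t0 x e0)).
- move=> e n k /andP[e0 _].
  exact: (chaosJ_orth nu (measurable_xi hB t0) (hp_L2 hB t0) (hp_ip H01 K01 hB t0) (rho_diag H01 K01 t0)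
    (sheet_weight_good H01 K01 t0 x e0)).
- by move=> e /andP[e0 _]; exact: (sheet_expansion H01 K01 hB t0 x e0).
- by move=> e M; exact: hC.
- by move=> n del; exact: chaosJ_cauchy.
Qed.

Lemma sheet_pint_limit x (alpha : R) F : regular_level x ->
  0 < alpha < \sum_(j < N) (2 * col_max H j * col_max K j)^-1 - d%:R / 2 ->
  L2 F -> sq (fun w => L e x w - F w) @[e --> 0^'+] --> 0 ->
  exists (C : R) (Jl : nat -> Omega -> R), [/\ forall n, L2 (Jl n),
    forall n, sq (fun w => J (k.+1%:R^-1) x n w - Jl n w) @[k --> \oo] --> 0,
    sq (fun w => F w - \sum_(n < M) Jl n w) @[M --> \oo] --> 0 &
    forall M, \sum_(n < M) (1 + n%:R) `^ alpha * sq (Jl n) <= C].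
Proof.
move=> reg alpha01 LF LFcvg; have /andP[alpha0 _] := alpha01.
have [C hC] := sheet_energy reg alpha0 alpha01; exists (2 * C).
apply: (@hilbert_limit _ _ _ P alpha C (fun e => L e x) (fun e n => J e x n) alpha0) LF LFcvg.
- by move=> e /andP[e0 _]; exact: pint_L2 (sheet_kernel_field hB t0 x e0).
- move=> e n /andP[e0 _].
  exact: (chaosJ_L2 nu (measurable_xi hB t0) (hp_L2 hB t0) (hp_ip H01 K01 hB t0) (rho_diag H01 K01 t0) n
    (sheet_weight_good H01 K01 t0 x e0)).
- move=> e n k /andP[e0 _].
  exact: (chaosJ_orth nu (measurable_xi hB t0) (hp_L2 hB t0) (hp_ip H01 K01 hB t0) (rho_diag H01 K01 t0)
    (sheet_weight_good H01 K01 t0 x e0)).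
- by move=> e /andP[e0 _]; exact: (sheet_expansion H01 K01 hB t0 x e0).
- by move=> e M; exact: hC.
- by move=> n del; exact: chaosJ_cauchy.
Qed.

End sheet_energy.

(** * Variables with finite moments of all orders *)

Section power_L2.
Context {R : realType} {dT : measure_display} {T : measurableType dT} (P : probability T R).
Local Notation L2 := (L2 P).

(** [sheet_gaussian] treats one component at a time and does not directly make a combination of
    several components Gaussian; finite moments suffice to have Hermite polynomials of such a
    combination in L^2. *)
Definition all_moments (X : T -> R) := measurable_fun setT X /\ forall n, L2 (fun w => X w ^+ n).

Lemma all_momentsZ c X : all_moments X -> all_moments (fun w => c * X w).
Proof.
move=> [mX LX]; split; first exact: measurable_funM.
by move=> n; under eq_fun do rewrite exprMn; exact: L2Z.
Qed.

Lemma all_momentsD X Y : all_moments X -> all_moments Y -> all_moments (fun w => X w + Y w).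
Proof.
move=> [mX LX] [mY LY]; split; first exact: measurable_funD.
move=> n; have LXn : L2 (fun w => `|X w| ^+ n).
  apply: (@L2_le _ _ _ P _ _ 1 _ (LX n)); last by move=> w; rewrite mul1r !normrX normr_id.
  by apply: measurable_funX; exact: measurableT_comp.
have LYn : L2 (fun w => `|Y w| ^+ n).
  apply: (@L2_le _ _ _ P _ _ 1 _ (LY n)); last by move=> w; rewrite mul1r !normrX normr_id.
  by apply: measurable_funX; exact: measurableT_comp.
apply: (@L2_le _ _ _ P _ _ (2 ^+ n) _ (L2D LXn LYn)).
  by apply: measurable_funX; exact: measurable_funD.
move=> w; rewrite normrX.
have hx := exprn_ge0 n (normr_ge0 (X w)); have hy := exprn_ge0 n (normr_ge0 (Y w)).
rewrite [`|_ + _ ^+ n|]ger0_norm ?addr_ge0//.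
have h (a b : R) : 0 <= a -> a <= b -> (a + b) ^+ n <= 2 ^+ n * b ^+ n.
  move=> a0 ab; rewrite -exprMn; have b0 := le_trans a0 ab.
  by apply: lerXn2r; rewrite ?nnegrE; lra.
apply: (le_trans (y := (`|X w| + `|Y w|) ^+ n)).
  by apply: lerXn2r; rewrite ?nnegrE ?addr_ge0// ler_normD.
rewrite mulrDr; case/orP: (le_total `|X w| `|Y w|) => le.
  by apply: (le_trans (h _ _ _ le)) => //; rewrite lerDr mulr_ge0 ?exprn_ge0.
by rewrite addrC; apply: (le_trans (h _ _ _ le)) => //; rewrite lerDl mulr_ge0 ?exprn_ge0.
Qed.

Lemma all_moments_sum (I : Type) (r : seq I) (F : I -> T -> R) :
  (forall i, all_moments (F i)) -> all_moments (fun w => \sum_(i <- r) F i w).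
Proof.
move=> hF; elim: r => [|i r IH].
  under eq_fun do rewrite big_nil; split; first exact: measurable_cst.
  by move=> n; exact: L2_cst.
by under eq_fun do rewrite big_cons; exact: all_momentsD.
Qed.

Lemma all_moments_horner X (p : {poly R}) : all_moments X -> L2 (fun w => p.[X w]).
Proof.
move=> [_ LX]; under eq_fun do rewrite horner_coef.
by apply: L2_sum => i _; exact: L2Z.
Qed.

End power_L2.

Lemma hermite_prod_span_pos {R : realType} {dT : measure_display} {T : measurableType dT} d (xi : 'I_d -> T -> R) (m : 'I_d -> nat) : (0 < d)%N ->
  linear_span [set (fun w => (hermite (\sum_(i < d) m i)).[f w]) | f in unit_combs xi]
    (fun w => \prod_(i < d) (hermite (m i)).[xi i w]).
Proof. by case: d xi m => // d xi m _; exact: hermite_prod_span. Qed.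

(** * Membership in the Wiener chaoses and in the Watanabe space *)

Section sheet_chaoses.
Context {R : realType} {N d : nat} {dO : measure_display} {Omega : measurableType dO}
  (P : probability Omega R) (H K : 'M[R]_(d, N)) (B : N.-tuple R -> Omega -> d.-tuple R) (t : N.-tuple R).
Hypothesis N0 : (0 < N)%N.
Hypothesis d0 : (0 < d)%N.
Hypothesis H01 : forall i j, 0 < H i j < 1.
Hypothesis K01 : forall i j, 0 < K i j <= 1.
Hypothesis hB : bifractional_sheet P H K B.
Hypothesis t0 : forall j, 0 < tnth t j.

Local Notation L2 := (L2 P).
Local Notation ip := (ip P).
Local Notation sq := (sq P).
Local Notation pr := (box_pr t).
Local Notation xi := (xi H K B t).
Local Notation sd i s := (sheet_sd H K i (pr s)).
Local Notation nu := (box_measure t0).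
Local Notation A := (sheet_weight H K t).
Local Notation J eps x n := (chaosJ nu xi (A eps x) n).
Local Notation L eps x := (pint nu (sheet_kernel B t eps x)).

(** Presenting a single component as a Hermite product of degree 1 lets [hp_ip] yield
    orthonormality. *)
Lemma xi_hermite_prod i s : hermite_prod xi (fun k => (k == i) : nat) s = xi i s.
Proof.
apply/funext => w; rewrite /hermite_prod (bigD1 i)//= eqxx big1 ?mulr1.
  by rewrite /hermiteN/= derivC subr0 mulr1 hornerX (_ : 1`! = 1)%N// sqrtr1 divr1.
by move=> k /negbTE ->; rewrite /hermiteN/= hornerC fact0 sqrtr1 divr1.
Qed.

Lemma xi_orthonormal i j s : ip (xi i s) (xi j s) = (i == j)%:R.
Proof.
rewrite -!xi_hermite_prod (hp_ip H01 K01 hB t0); case: eqVneq => [<-|ij].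
  case: ifPn => [_|/negP[]]; last by apply/forallP.
  by apply: big1 => k _; rewrite rho_diag// expr1n.
case: ifPn => // /forallP/(_ i); rewrite eqxx (negbTE ij).
by [].
Qed.

Lemma xi_all_moments i s : all_moments P (xi i s).
Proof.
split; first by have [] := hp_L2 hB t0 (fun k => (k == i) : nat) s; rewrite xi_hermite_prod.
move=> n; have := L2_hornerX (xi_gaussian hB t0 i s s) 'X^n.
by under eq_fun do rewrite hornerXn.
Qed.

Definition level_combs s := unit_combs (fun i => xi i s).

Lemma level_combs_moments s f : level_combs s f -> all_moments P f.
Proof.
by move=> [a [_ ->]]; apply: all_moments_sum => i; apply: all_momentsZ; exact: xi_all_moments.
Qed.

Lemma level_combs_sq s f : level_combs s f -> sq f = 1.
Proof.
move=> [a [a1 ->]]; have Lx i : L2 (xi i s).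
  by have [_ /(_ 1%N)] := xi_all_moments i s; under eq_fun do rewrite expr1.
rewrite sqE ip_suml; last 2 first.
- by move=> i _; exact: L2Z.
- by apply: L2_sum => i _; exact: L2Z.
rewrite -a1; apply: eq_bigr => i _; rewrite ip_sumr; last 2 first.
- by move=> j _; exact: L2Z.
- exact: L2Z.
rewrite (bigD1 i)//= big1 ?addr0; last first.
  move=> j ji; rewrite ipZl//; last exact: L2Z.
  by rewrite ipZr// xi_orthonormal eq_sym (negbTE ji) !mulr0.
rewrite ipZl//; last exact: L2Z.
by rewrite ipZr// xi_orthonormal eqxx mulr1 expr2.
Qed.

Lemma component_gen_L2 :
  [set component B i s | i in [set: 'I_d] & s in @orthant R N] `<=` L2.
Proof. by move=> _ [i _ [s os <-]]; exact: (component_L2 hB). Qed.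

Lemma level_combs_gaussian s : level_combs s `<=` gaussian_space P B.
Proof.
move=> _ [a [_ ->]]; apply: span_closure; first exact: component_gen_L2.
apply: span_sum => i _; apply: spanZ.
rewrite (_ : xi i s = fun w => (sd i s)^-1 * component B i (pr s) w); last first.
  by apply/funext => w; rewrite /xi mulrC.
apply: spanZ; apply: span_gen; exists i => //; exists (pr s) => //.
exact/posbox_orthant/box_prP.
Qed.

(** Generators that involve one time point each. They are enough, since the chaos field at s is a
    combination of generators at s, and integration over s stays in the closed span. *)
Definition level_chaos_gen n : set (Omega -> R) :=
  [set (fun w => (hermite n).[f w]) | f in \bigcup_s level_combs s].

Lemma level_chaos_gen_L2 n : level_chaos_gen n `<=` L2.
Proof.
by move=> _ [f [s _ fs] <-]; apply: all_moments_horner; exact: level_combs_moments fs.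
Qed.

Lemma level_chaos_gen_wiener n :
  L2_closure P (linear_span (level_chaos_gen n)) `<=` wiener_chaos P B n.
Proof.
apply: closure_mono => _ [f [s _ fs] <-]; exists f => //; split; first exact: level_combs_gaussian fs.
have Lf : L2 f by have [_ /(_ 1%N)] := level_combs_moments fs; under eq_fun do rewrite expr1.
by rewrite /= Lnorm2E// (level_combs_sq fs) sqrtr1.
Qed.

Lemma hermite_prod_chaos (m : 'I_d -> nat) s :
  linear_span (level_chaos_gen (\sum_(i < d) m i)) (hermite_prod xi m s).
Proof.
have -> : hermite_prod xi m s = (fun w => (\prod_(i < d) (Num.sqrt (m i)`!%:R)^-1) * \prod_(i < d) (hermite (m i)).[xi i s w]).
  by apply/funext => w; rewrite /hermite_prod -big_split/=; apply: eq_bigr => i _; rewrite mulrC.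
apply: spanZ.
have h : linear_span [set (fun w => (hermite (\sum_(i < d) m i)).[f w]) | f in level_combs s]
    (fun w => \prod_(i < d) (hermite (m i)).[xi i s w]).
  exact: hermite_prod_span_pos.
move: h => [n [c [X [hX ->]]]]; exists n, c, X; split => // k.
by have [f fs <-] := hX k; exists f => //; exists s.
Qed.

Lemma chaosJ_wiener eps x n : 0 < eps -> L2_closure P (linear_span (level_chaos_gen n)) (J eps x n).
Proof.
move=> e0; apply: pint_closure; first exact: level_chaos_gen_L2.
  exact: (chaos_field_L2 (measurable_xi hB t0) (hp_L2 hB t0) (hp_ip H01 K01 hB t0) (rho_diag H01 K01 t0) n
    (sheet_weight_good H01 K01 t0 x e0)).
move=> s; apply: span_sum => m /eqP hm; apply: spanZ.
by have := hermite_prod_chaos (fun i => m i) s; rewrite hm.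
Qed.

Lemma measurable_box : measurable (box t).
Proof.
have := @measurable_tuple_box R N (fun j => `[0, tnth t j]%classic) (fun j => measurable_itv _).
by congr (measurable _); apply/seteqP; split => s /= h j; have := h j; rewrite in_itv/=.
Qed.

Lemma measurable_sheet_path w : measurable_fun (box t) (B ^~ w).
Proof.
have boxor : box t `<=` @orthant R N by move=> s st j; have /andP[] := st j.
apply: (measurable_funS (measurable_orthant (R := R) (N := N)) boxor).
apply: (@measurable_comp _ _ _ _ _ _ (@orthant R N `*` [set: Omega]) (fun sw => B sw.1 sw.2) (@orthant R N) (fun s => (s, w))).
- by apply: measurableX => //; exact: measurable_orthant.
- by move=> _ [s os <-].
- exact: sheet_measurable hB.
- by apply: measurable_funTS; exact: pair2_measurable.
Qed.

Lemma ge0_integral_box f : measurable_fun (box t) f -> (forall s, 0 <= f s)%E ->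
  (\int[lebesgue_tuple N]_(s in box t) f s = \int[lebesgue_tuple N]_(s in posbox t) f s)%E.
Proof.
move=> mf f0; have mbox := measurable_box; have mpb := measurable_posbox t.
have pbox : posbox t `<=` box t by move=> s st j; have /andP[/ltW-> ->] := st j.
rewrite -[in LHS](setDUK pbox) ge0_integral_setU//; last 3 first.
- exact: measurableD.
- by rewrite setDUK.
- by apply/disj_setPS => s [ps [_ nps]]; exact: nps.
rewrite [X in (_ + X)%E](_ : _ = 0%E) ?adde0//.
apply: null_set_integral.
- exact: measurableD.
- by apply: measurable_funS mf => // s [].
apply: measure_negligible; first exact: measurableD.
(* The coordinate hyperplanes, indexed by all naturals so as to form a countable union; the set is
   empty from N on. *)
pose F k := [set s : N.-tuple R | exists2 j : 'I_N, j = k :> nat & tnth s j = 0].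
suff : (lebesgue_tuple N).-negligible (\bigcup_k F k).
  apply: negligibleS => s [bs ps]; have [j sj] : exists j, ~~ (0 < tnth s j).
    apply: contra_notP ps => h j; have /andP[_ ->] := bs j; rewrite andbT.
    by apply/negPn/negP => sj; apply: h; exists j.
  exists j => //; exists j => //; have /andP[s0 _] := bs j.
  by apply/eqP; rewrite eq_le s0 leNgt sj.
apply: negligible_bigcup => k; case: (ltnP k N) => kN; last first.
  rewrite (_ : F k = set0); first exact: negligible_set0.
  by rewrite -subset0 => s [j jk _]; have := ltn_ord j; rewrite jk ltnNge kN.
suff : (lebesgue_tuple N).-negligible [set s : N.-tuple R | tnth s (Ordinal kN) = 0].
  by apply: negligibleS => s [j jk <-]; congr (tnth s _); exact: val_inj.
apply/negligibleP; last exact: lebesgue_tuple_coord0.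
rewrite -[X in measurable X]setTI.
exact: (measurable_tnth (Ordinal kN) measurableT (measurable_set1 0)).
Qed.

Lemma kernel_local_timeE x eps w : 0 < eps -> kernel_local_time B t x eps w = L eps x w.
Proof.
move=> e0; rewrite /kernel_local_time /pint /Rintegral; congr fine.
rewrite ge0_integral_box; last 2 first.
- apply/measurable_EFinP; apply: measurable_prod => i _.
  apply: (measurableT_comp (f := fun z : R => normal_pdf 0 (Num.sqrt eps) (z - tnth x i))).
    by apply: measurableT_comp; [exact: measurable_normal_pdf|exact: measurable_funB].
  apply: (measurableT_comp (f := fun z : d.-tuple R => tnth z i)); first exact: measurable_tnth.
  exact: measurable_sheet_path.
- by move=> s; rewrite lee_fin; apply: prodr_ge0 => i _; exact: normal_pdf_ge0.
rewrite ge0_integral_box_measure; last 2 first.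
- apply/measurable_EFinP.
  exact: (measurableT_comp (measurableT_comp (measurable_sheet_kernel hB t0 eps) (pair1_measurable x)) (pair2_measurable w)).
- by move=> s; rewrite lee_fin; apply: prodr_ge0 => i _; exact: normal_pdf_ge0.
by apply: eq_integral => s /set_mem st; rewrite /sheet_kernel box_prE.
Qed.

Lemma local_time_atP x F : local_time_at P B t x F <->
  L2 F /\ sq (fun w => L e x w - F w) @[e --> 0^'+] --> 0.
Proof.
have kE : \forall e \near (0 : R)^'+, kernel_local_time B t x e = L e x.
  near=> e; apply/funext => w; apply: kernel_local_timeE.
  by near: e; exact: nbhs_right_gt.
have kL2 : \forall e \near (0 : R)^'+, L2 (kernel_local_time B t x e).
  near=> e; have e0 : 0 < e by near: e; exact: nbhs_right_gt.
  have -> : kernel_local_time B t x e = L e x by near: e.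
  exact: pint_L2 (sheet_kernel_field hB t0 x e0).
have sE F' : (sq (fun w => kernel_local_time B t x e w - F' w) @[e --> 0^'+] --> 0) <->
    (sq (fun w => L e x w - F' w) @[e --> 0^'+] --> 0).
  split; apply: cvg_trans; apply: near_eq_cvg; near=> e.
    by have -> : kernel_local_time B t x e = L e x by near: e.
  by have -> : kernel_local_time B t x e = L e x by near: e.
have hP LF := @L2_cvgP R dO Omega P R (0^'+) (kernel_local_time B t x) F _ kL2 LF.
rewrite /local_time_at; split.
  move=> h; have LF : L2 F by apply/L2_Lfun; have [] := h.
  split; first exact: LF.
  exact: (iffLR (sE F) (iffRL (hP _ LF) h)).
by move=> [LF h]; exact: (iffLR (hP _ LF) (iffRL (sE F) h)).
Unshelve. all: by end_near.
Qed.

Lemma sheet_watanabe x (alpha : R) F : regular_level H K x ->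
  0 < alpha < \sum_(j < N) (2 * col_max H j * col_max K j)^-1 - d%:R / 2 ->
  local_time_at P B t x F -> watanabe P B alpha F.
Proof.
move=> reg alpha01 /local_time_atP[LF LFcvg].
have [C [Jl [LJ Jcvg sumJ sumC]]] := sheet_pint_limit N0 d0 H01 K01 hB reg alpha01 LF LFcvg.
exists Jl; split.
- move=> n; apply: level_chaos_gen_wiener; apply: closure_lim (LJ n) (Jcvg n).
    exact: level_chaos_gen_L2.
  by move=> k; apply: chaosJ_wiener; rewrite invr_gt0.
- apply/L2_cvgP => //; first by apply: nearW => M; apply: L2_sum.
  by under eq_fun do rewrite sqBC.
apply: (@le_lt_trans _ _ C%:E); last exact: ltry.
apply: lime_le; first by apply: is_cvg_nneseries => n _ _; rewrite mule_ge0// ?lee_fin ?powR_ge0// expe_ge0// Lnorm_ge0.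
apply: nearW => M; rewrite big_mkord.
under eq_bigr do rewrite Lnorm2_sqr// -EFinM.
by rewrite sumEFin lee_fin.
Qed.

End sheet_chaoses.

(** * The occupation density *)

Section gaussian_kernel.
Context {R : realType} {d : nat}.
Implicit Types x y : d.-tuple R.

Definition gk e x y : R := \prod_(i < d) normal_pdf 0 (Num.sqrt e) (tnth y i - tnth x i).

Lemma gk_ge0 e x y : 0 <= gk e x y.
Proof. by apply: prodr_ge0 => i _; exact: normal_pdf_ge0. Qed.

Lemma measurable_gk e : measurable_fun setT (fun xy : d.-tuple R * d.-tuple R => gk e xy.1 xy.2).
Proof.
apply: measurable_prod => i _; apply: measurableT_comp; first exact: measurable_normal_pdf.
apply: measurable_funB.
  exact: (measurableT_comp (measurable_tnth i) (@measurable_snd _ _ _ _)).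
exact: (measurableT_comp (measurable_tnth i) (@measurable_fst _ _ _ _)).
Qed.

Lemma normal_pdf_sym (s a x : R) : s != 0 -> normal_pdf 0 s (a - x) = normal_pdf a s x.
Proof.
by move=> s0; rewrite !normal_pdfE// /normal_fun subr0 -[a - x]opprB sqrrN.
Qed.

Lemma gk_mass e y : 0 < e -> (\int[lebesgue_tuple d]_x (gk e x y)%:E = 1)%E.
Proof.
move=> e0; have s0 : Num.sqrt e != 0 by rewrite gt_eqF// sqrtr_gt0.
under eq_integral do rewrite -prodEFin.
have := @ge0_integral_tuple_prod R d (fun i (x : R) => (normal_pdf 0 (Num.sqrt e) (tnth y i - x))%:E).
move=> ->; last 2 first.
- move=> i; apply/measurable_EFinP; apply: measurableT_comp; first exact: measurable_normal_pdf.
  exact: measurable_funB.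
- by move=> i x; rewrite lee_fin normal_pdf_ge0.
apply: big1 => i _; under eq_integral do rewrite normal_pdf_sym//.
exact: integral_normal_pdf.
Qed.

(* Half of the exponent is traded for a doubled variance. *)
Lemma gk_tail e del x y i : 0 < e -> 0 < del -> del <= `|tnth y i - tnth x i| ->
  gk e x y <= Num.sqrt 2 ^+ d * (4 * e / del ^+ 2) * gk (2 * e) x y.
Proof.
move=> e0 del0 hi; have e20 : 0 < 2 * e by rewrite mulr_gt0.
have pE z : normal_pdf 0 (Num.sqrt e) z = Num.sqrt 2 * expR (- z ^+ 2 / (4 * e)) * normal_pdf 0 (Num.sqrt (2 * e)) z.
  rewrite !normal_pdfE ?gt_eqF ?sqrtr_gt0// /normal_fun /normal_peak !subr0 !sqr_sqrtr ?(ltW e0) ?(ltW e20)//.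
  rewrite -[RHS]mulrA [expR _ * (_ * _)]mulrCA [RHS]mulrA -expRD; congr (_ * expR _).
    rewrite (_ : 2 * e * pi *+ 2 = 2 * (e * pi *+ 2)); last by rewrite -mulrA mulrnAr.
    by rewrite [in RHS]sqrtrM// invfM mulrA divff ?mul1r// gt_eqF// sqrtr_gt0.
  have -> : 2 * e *+ 2 = e *+ 2 * 2 by rewrite !mulr2n; lra.
  have -> : 4 * e = e *+ 2 * 2 by rewrite mulr2n; lra.
  by rewrite invfM; move: ((e *+ 2)^-1) (z ^+ 2) => a b; lra.
rewrite /gk (eq_bigr _ (fun i _ => pE _)) !big_split/= prodr_const card_ord.
rewrite ler_wpM2r//; first exact: gk_ge0.
rewrite ler_wpM2l ?exprn_ge0 ?sqrtr_ge0//.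
apply: (@le_trans _ _ (expR (- (tnth y i - tnth x i) ^+ 2 / (4 * e)))).
  apply: prod_le_factor => j; rewrite expR_ge0 -expR0 ler_expR mulNr oppr_le0 divr_ge0 ?sqr_ge0//.
  by rewrite mulr_ge0// ltW.
set z := (tnth y i - tnth x i) in hi *.
have z2 : del ^+ 2 <= z ^+ 2 by rewrite -(real_normK (num_real z)) lerXn2r// nnegrE ltW.
have d2 : 0 < del ^+ 2 by rewrite exprn_gt0.
have q0 : 0 < z ^+ 2 / (4 * e) by rewrite divr_gt0//; [exact: lt_le_trans d2 z2|rewrite mulr_gt0].
rewrite mulNr expRN.
apply: (@le_trans _ _ (z ^+ 2 / (4 * e))^-1).
  by rewrite lef_pV2 ?posrE ?expR_gt0// (le_trans _ (expR_ge1Dx _))// lerDr.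
rewrite invf_div ler_wpM2l ?mulr_ge0 ?(ltW e0)//.
by rewrite lef_pV2 ?posrE// (lt_le_trans d2).
Qed.

End gaussian_kernel.

(** * The limit density is dominated by the occupation measure on closed sets *)

Section occupation_le.
Context {R : realType} {d : nat} {dZ : measure_display} {Z : measurableType dZ}
  (Q : {finite_measure set Z -> \bar R}) (Y : Z -> d.-tuple R) (c : Z -> R)
  (ell : d.-tuple R -> \bar R).
Hypothesis mY : measurable_fun setT Y.
Hypothesis mc : measurable_fun setT c.
Hypothesis c01 : forall z, 0 <= c z <= 1.
Hypothesis mell : measurable_fun setT ell.
Hypothesis ell0 : forall x, (0 <= ell x)%E.
Local Notation e_ n := (n.+1%:R^-1 : R).
Variable E0 : set (d.-tuple R).
Hypothesis mE0 : measurable E0.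
Hypothesis E0null : lebesgue_tuple d E0 = 0.
Hypothesis conv : forall x, ~ E0 x ->
  (\int[Q]_z (c z * gk (e_ n) x (Y z))%:E)%E @[n --> \oo] --> ell x.

(** Closedness in quantitative form: around a point outside A, the distance in some coordinate is
    bounded below, which is what [gk_tail] turns into vanishing Gaussian mass. *)
Definition separated (A : set (d.-tuple R)) := measurable A /\
  forall y, ~ A y -> exists del, 0 < del /\ forall x, A x -> exists i, del <= `|tnth y i - tnth x i|.

Let g (A : set (d.-tuple R)) n y := (\int[lebesgue_tuple d]_x (\1_A x * gk (e_ n) x y)%:E)%E.

Let e0 n : 0 < e_ n. Proof. by rewrite invr_gt0. Qed.

Let mg A n : measurable A -> measurable_fun setT (g A n).
Proof.
move=> mA; apply: (@measurable_fun_fubini_tonelli_G _ _ _ _ _ (lebesgue_tuple d) (fun xy => (\1_A xy.1 * gk (e_ n) xy.1 xy.2)%:E)).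
  apply/measurable_EFinP; apply: measurable_funM; last exact: measurable_gk.
  exact: (measurableT_comp (measurable_indic mA) (@measurable_fst _ _ _ _)).
by move=> xy; rewrite lee_fin mulr_ge0// gk_ge0.
Qed.

Let g0 A n y : (0 <= g A n y)%E.
Proof. by apply: integral_ge0 => x _; rewrite lee_fin mulr_ge0// gk_ge0. Qed.

Let mgk e (y : d.-tuple R) : measurable_fun setT (gk e ^~ y).
Proof. exact: (measurableT_comp (measurable_gk e) (pair2_measurable y)). Qed.

Let g1 A n y : measurable A -> (g A n y <= 1)%E.
Proof.
move=> mA; rewrite -(gk_mass y (e0 n)); apply: ge0_le_integral => //.
- by move=> x _; rewrite lee_fin mulr_ge0// gk_ge0.
- by apply/measurable_EFinP; apply: measurable_funM.
- by apply/measurable_EFinP.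
- by move=> x _; rewrite lee_fin ler_piMl ?gk_ge0// indicE lern1 leq_b1.
Qed.

Let g_cvg A y : separated A -> ~ A y -> g A n y @[n --> \oo] --> 0%E.
Proof.
move=> [mA sA] /sA[del [del0 hdel]].
pose c0 := Num.sqrt 2 ^+ d * (4 / del ^+ 2).
have c00 : 0 <= c0 by rewrite mulr_ge0 ?exprn_ge0 ?sqrtr_ge0// divr_ge0// sqr_ge0.
apply: (@squeeze_cvge _ _ _ _ (cst 0%E) _ (fun n => (c0 * e_ n)%:E)).
- apply: nearW => n; rewrite g0/=.
  have e20 : 0 < 2 * e_ n by rewrite mulr_gt0.
  have -> : ((c0 * e_ n)%:E = \int[lebesgue_tuple d]_x ((c0 * e_ n)%:E * (gk (2 * e_ n) x y)%:E))%E.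
    rewrite ge0_integralZl//; last 3 first.
    - exact/measurable_EFinP.
    - by move=> x _; rewrite lee_fin gk_ge0.
    - by rewrite lee_fin mulr_ge0// ltW.
    by rewrite gk_mass// mule1.
  apply: ge0_le_integral => //.
  + by move=> x _; rewrite lee_fin mulr_ge0// gk_ge0.
  + by apply/measurable_EFinP; apply: measurable_funM.
  + by apply/measurable_EFinP; apply: measurable_funM.
  move=> x _; rewrite -EFinM lee_fin indicE; case: (boolP (x \in A)); last first.
    by move=> _; rewrite mul0r; apply: mulr_ge0; [apply: mulr_ge0 => //; exact: ltW|exact: gk_ge0].
  move=> xA; rewrite mul1r; have [i hi] := hdel x (set_mem xA).
  apply: le_trans (gk_tail (e0 n) del0 hi) _.
  apply: ler_wpM2r; first exact: gk_ge0.
  by rewrite /c0; move: (Num.sqrt 2 ^+ d) (del ^+ 2)^-1 (e_ n) => a b z; lra.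
- exact: cvg_cst.
- apply: cvg_EFin; first exact: nearW.
  rewrite -[X in _ --> X](mulr0 c0); apply: cvgM; first exact: cvg_cst.
  exact: cvg_harmonic.
Qed.

(** Fatou's lemma in x, then Tonelli's theorem to integrate the kernel over A first, then dominated
    convergence in z. *)
Lemma occupation_le A : separated A ->
  (\int[lebesgue_tuple d]_x ((\1_A x)%:E * ell x) <= \int[Q]_z (c z * \1_A (Y z))%:E)%E.
Proof.
move=> sA; have [mA _] := sA.
pose q n x := (\int[Q]_z (c z * gk (e_ n) x (Y z))%:E)%E.
have mF n : measurable_fun setT (fun xz : d.-tuple R * Z => (c xz.2 * gk (e_ n) xz.1 (Y xz.2))%:E).
  apply/measurable_EFinP; apply: measurable_funM.
    exact: (measurableT_comp mc (@measurable_snd _ _ _ _)).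
  apply: (measurableT_comp (measurable_gk (e_ n)) (g := fun xz => (xz.1, Y xz.2))).
  apply/measurable_fun_pairP; split; first exact: measurable_fst.
  exact: (measurableT_comp mY (@measurable_snd _ _ _ _)).
have F0 n x z : (0 <= (c z * gk (e_ n) x (Y z))%:E)%E.
  by rewrite lee_fin mulr_ge0 ?gk_ge0//; have /andP[] := c01 z.
have mq n : measurable_fun setT (q n).
  exact: (@measurable_fun_fubini_tonelli_F _ _ _ _ _ Q (fun xz => (c xz.2 * gk (e_ n) xz.1 (Y xz.2))%:E)).
have q0 n x : (0 <= q n x)%E by apply: integral_ge0 => z _.
have i0 x : (0 <= (\1_A x)%:E :> \bar R)%E by rewrite lee_fin.
have mi : measurable_fun setT (fun x => (\1_A x : R)%:E) by exact/measurable_EFinP/measurable_indic.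
have mEc : measurable (~` E0) by exact: measurableC.
(* The limit in n is known only off the null set [E0], so Fatou's lemma is applied on its
   complement. *)
have split_E0 f : measurable_fun setT f -> (forall x, 0 <= f x)%E ->
    (\int[lebesgue_tuple d]_x f x = \int[lebesgue_tuple d]_(x in E0) f x + \int[lebesgue_tuple d]_(x in ~` E0) f x)%E.
  move=> mf f0; rewrite -ge0_integral_setU ?setUv//.
  by apply/disj_setPS => x [].
rewrite split_E0; [|exact: emeasurable_funM|by move=> x; rewrite mule_ge0].
rewrite null_set_integral//; last by apply: measurable_funTS; exact: emeasurable_funM.
rewrite add0e (@eq_integral _ _ _ _ _ (fun x => limn_einf (fun n => (\1_A x)%:E * q n x)%E)); last first.
  move=> x /set_mem /conv hx; rewrite is_cvg_limn_einfE.
    by apply/esym/cvg_lim => //; apply: cvgeZl.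
  by apply/cvg_ex; eexists; apply: cvgeZl hx.
apply: le_trans (fatou _ _ _ _) _ => //.
- by move=> n; apply: measurable_funTS; exact: emeasurable_funM.
- by move=> n x _; rewrite mule_ge0.
have swap n : (\int[lebesgue_tuple d]_x ((\1_A x)%:E * q n x) = \int[Q]_z ((c z)%:E * g A n (Y z)))%E.
  transitivity (\int[lebesgue_tuple d]_x \int[Q]_z (\1_A x * (c z * gk (e_ n) x (Y z)))%:E)%E.
    apply: eq_integral => x _; rewrite -ge0_integralZl//.
    exact: (measurableT_comp (mF n) (pair1_measurable x)).
  rewrite (@fubini_tonelli _ _ _ _ _ (lebesgue_tuple d) Q (fun xz => (\1_A xz.1 * (c xz.2 * gk (e_ n) xz.1 (Y xz.2)))%:E)); last 2 first.
  - apply/measurable_EFinP; apply: measurable_funM; last by apply/measurable_EFinP; exact: (mF n).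
    exact: (measurableT_comp (measurable_indic mA) (@measurable_fst _ _ _ _)).
  - by move=> xz; rewrite lee_fin mulr_ge0//; have := F0 n xz.1 xz.2; rewrite lee_fin.
  apply: eq_integral => z _; rewrite -ge0_integralZl//; last 3 first.
  - by apply/measurable_EFinP; apply: measurable_funM.
  - by move=> x _; rewrite lee_fin mulr_ge0// gk_ge0.
  - by rewrite lee_fin; have /andP[] := c01 z.
  by apply: eq_integral => x _; rewrite -EFinM mulrCA.
have qle n : (\int[lebesgue_tuple d]_(x in ~` E0) ((\1_A x)%:E * q n x) <= \int[Q]_z ((c z)%:E * g A n (Y z)))%E.
  rewrite -swap split_E0; [|exact: emeasurable_funM|by move=> x; rewrite mule_ge0].
  by rewrite leeDr//; apply: integral_ge0 => x _; rewrite mule_ge0.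
(* At a boundary point of A the smoothed indicator [g] need not tend to 1. Its maximum with the
   indicator equals 1 on A and tends to 0 off A, hence converges to the indicator everywhere. *)
pose k n z := (c z * Num.max (fine (g A n (Y z))) (\1_A (Y z)))%R.
have gfin n y : g A n y \is a fin_num.
  by rewrite ge0_fin_numE// (le_lt_trans (g1 _ _ mA))// ltry.
have mk n : measurable_fun setT (k n).
  apply: measurable_funM => //; apply: measurable_maxr.
    apply: (measurableT_comp (f := fine)) => //.
    exact: (measurableT_comp (mg n mA) mY).
  exact: (measurableT_comp (measurable_indic mA) mY).
have m1 : measurable_fun setT (fun z => c z * \1_A (Y z)).
  by apply: measurable_funM => //; exact: (measurableT_comp (measurable_indic mA) mY).
have k01 n z : 0 <= k n z <= 1.
  have /andP[c0 c1] := c01 z; rewrite /k.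
  have f1 : Num.max (fine (g A n (Y z))) (\1_A (Y z)) <= 1.
    rewrite ge_max; apply/andP; split; first by rewrite -lee_fin fineK//; exact: g1.
    by rewrite indicE lern1 leq_b1.
  have f0 : 0 <= Num.max (fine (g A n (Y z))) (\1_A (Y z)) by rewrite le_max fine_ge0.
  by rewrite mulr_ge0//= mulr_ile1.
have h1 : \forall z \ae Q, [set: Z] z -> (k n z)%:E @[n --> \oo] --> (c z * \1_A (Y z))%:E.
  apply: aeW => z _; apply: cvg_EFin; first exact: nearW.
  apply: cvgM; first exact: cvg_cst.
  have [AY|nAY] := pselect (A (Y z)).
    rewrite /= indicE mem_set//; apply: cvg_near_cst; apply: nearW => n.
    by apply/max_idPr; rewrite -lee_fin fineK//; exact: g1.
  have := g_cvg sA nAY; rewrite /= indicE memNset// => /fine_cvgP[_ h].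
  rewrite (_ : (fun n => _) = (fun n => fine (g A n (Y z)))) //; apply/funext => n.
  by apply/max_idPl; rewrite fine_ge0.
have h2 : \forall z \ae Q, forall n, [set: Z] z -> (`|(k n z)%:E| <= (EFin \o cst (1%R : R)) z)%E.
  by apply: aeW => z n _; have /andP[k0 k1] := k01 n z; rewrite lee_fin/= ger0_norm.
have ione : Q.-integrable setT (EFin \o cst (1 : R)) by exact: finite_measure_integrable_cst.
have [_ _ kcvg] := @dominated_convergence _ _ _ Q setT measurableT (fun n z => (k n z)%:E)
  (fun z => (c z * \1_A (Y z))%:E) (EFin \o cst (1 : R)) (fun n => (measurable_EFinP _ _).2 (mk n)) ((measurable_EFinP _ _).2 m1)
  h1 ione h2.
have kle n : (\int[Q]_z ((c z)%:E * g A n (Y z)) <= \int[Q]_z (k n z)%:E)%E.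
  apply: ge0_le_integral => //.
  - by move=> z _; rewrite mule_ge0// lee_fin; have /andP[] := c01 z.
  - apply: emeasurable_funM; first exact/measurable_EFinP.
    exact: (measurableT_comp (mg n mA) mY).
  - exact/measurable_EFinP.
  move=> z _; rewrite /k EFinM lee_wpmul2l ?lee_fin//; first by have /andP[] := c01 z.
  by rewrite -[leLHS]fineK// lee_fin le_max lexx.
rewrite limn_einf_lim -(cvg_lim _ kcvg)//; apply: lee_lim.
- exact: is_cvg_einfs.
- by apply/cvg_ex; eexists; exact: kcvg.
- apply: nearW => n; apply: le_trans (kle n); apply: le_trans (qle n); apply: ereal_inf_lbound; by exists n => /=.
Qed.

End occupation_le.

Section density_measure.
Context {R : realType} {d : measure_display} {T : measurableType d}
  (mu : {measure set T -> \bar R}) (f : T -> \bar R).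
Hypothesis mf : measurable_fun setT f.
Hypothesis f0 : forall x, (0 <= f x)%E.

(** The two proofs are arguments so that the measure structure declared on this function can be
    recovered from the term. *)
Definition density_fun of measurable_fun setT f & (forall x, (0 <= f x)%E) :=
  fun A : set T => (\int[mu]_(x in A) f x)%E.

Local Notation den := (density_fun mf f0).

Let den0 : den set0 = 0%E. Proof. exact: integral_set0. Qed.

Let den_ge0 A : (0 <= den A)%E. Proof. exact: integral_ge0. Qed.

Let den_sigma_additive : semi_sigma_additive den.
Proof.
move=> F mF tF mUF; rewrite /den ge0_integral_bigcup//; last exact: measurable_funTS.
by apply: is_cvg_nneseries => n _ _; exact: integral_ge0.
Qed.

HB.instance Definition _ := isMeasure.Build _ _ _ den den0 den_ge0 den_sigma_additive.

Definition density_measure : {measure set T -> \bar R} := den.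

Lemma density_measureE A : density_measure A = (\int[mu]_(x in A) f x)%E.
Proof. by []. Qed.

End density_measure.

Lemma integral_indic_mul {R : realType} {d : measure_display} {T : measurableType d}
    (mu : {measure set T -> \bar R}) (f : T -> \bar R) (A : set T) :
  (\int[mu]_x ((\1_A x)%:E * f x) = \int[mu]_(x in A) f x)%E.
Proof.
rewrite [RHS]integral_mkcond; apply: eq_integral => x _.
by rewrite patchE indicE; case: ifPn => _; rewrite ?mul1e ?mul0e.
Qed.

(** * Lower orthants with rational corners *)

Section lower_orthants.
Context {R : realType} {d : nat}.

Definition low (q : d.-tuple rat) : set (d.-tuple R) := [set y | forall i, tnth y i <= ratr (tnth q i)].

(** The complement of a lower orthant is not closed in general; these separated sets increase to it
    as k grows. *)
Definition high (q : d.-tuple rat) (k : nat) : set (d.-tuple R) :=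
  [set y | exists i, ratr (tnth q i) + k.+1%:R^-1 <= tnth y i].

Lemma measurable_low q : measurable (low q).
Proof.
have := @measurable_tuple_box R d (fun i => `]-oo, ratr (tnth q i)]%classic) (fun i => measurable_itv _).
by congr (measurable _); apply/seteqP; split => y /= h i; have := h i; rewrite in_itv/=.
Qed.

Lemma measurable_high q k : measurable (high q k).
Proof.
have := @measurable_tuple_box R d (fun i => `]-oo, (ratr (tnth q i) + k.+1%:R^-1)[%classic) (fun i => measurable_itv _).
move=> /measurableC; congr (measurable _); apply/seteqP; split => y /=.
  move=> /existsNP[i]; rewrite in_itv/= => /negP; rewrite -leNgt => h; by exists i.
by move=> [i hi] /(_ i); rewrite in_itv/= ltNge hi.
Qed.

Lemma separated_low q : separated (low q).
Proof.
split; first exact: measurable_low.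
move=> y /existsNP[i /negP]; rewrite -ltNge => h.
exists (tnth y i - ratr (tnth q i)); split; first by rewrite subr_gt0.
move=> x /(_ i) xi; exists i; apply: le_trans (ler_norm _).
by rewrite lerD2l lerN2.
Qed.

Lemma separated_high q k : separated (high q k).
Proof.
split; first exact: measurable_high.
move=> y hy; have yl i : 0 < ratr (tnth q i) + k.+1%:R^-1 - tnth y i.
  by rewrite subr_gt0 ltNge; apply/negP => h; apply: hy; exists i.
exists (\big[Num.min/1]_(i < d) (ratr (tnth q i) + k.+1%:R^-1 - tnth y i)); split.
  by elim/big_ind : _ => // a b a0 b0; rewrite lt_min a0.
move=> x [i xi]; exists i; apply: (@le_trans _ _ (ratr (tnth q i) + k.+1%:R^-1 - tnth y i)).
  by rewrite (bigD1 i)//= ge_min lexx.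
by rewrite distrC; apply: le_trans (ler_norm _); rewrite lerD2r.
Qed.

Lemma setC_low q : ~` low q = \bigcup_k high q k.
Proof.
apply/seteqP; split => y.
  move=> /existsNP[i /negP]; rewrite -ltNge => h.
  have h' : 0 < tnth y i - ratr (tnth q i) by rewrite subr_gt0.
  have [k hk] := ltr_add_invr h.
  by exists k => //; exists i; exact: ltW.
move=> [k _ [i hi]] /(_ i); apply/negP; rewrite -ltNge; apply: lt_le_trans hi.
by rewrite ltrDl invr_gt0.
Qed.

Lemma high_homo q : {homo high q : n m / (n <= m)%N >-> (n <= m)%O}.
Proof.
move=> n m nm; apply/subsetPset => y [i hi]; exists i; apply: le_trans hi.
by rewrite lerD2l lef_pV2 ?posrE// ler_nat.
Qed.

Lemma low_setI : setI_closed (range low).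
Proof.
move=> _ _ [p _ <-] [q _ <-]; exists [tuple Order.min (tnth p i) (tnth q i) | i < d] => //.
apply/seteqP; split => y /=.
  move=> h; split => i; have := h i; rewrite tnth_mktuple => /le_trans; apply; rewrite ler_rat.
    by rewrite ge_min lexx.
  by rewrite ge_min lexx orbT.
move=> [h1 h2] i; rewrite tnth_mktuple; have := h1 i; have := h2 i.
by case: (leP (tnth p i) (tnth q i)).
Qed.

Definition low_nat (n : nat) := low [tuple (n%:R : rat) | i < d].

Lemma low_nat_cover : \bigcup_n low_nat n = setT.
Proof.
rewrite -subTset => y _; have [n hn] : exists n : nat, forall i, tnth y i <= n%:R.
  exists (\max_(i < d) Num.bound `|tnth y i|) => i.
  apply: (le_trans (ler_norm _)); apply: (le_trans (ltW (archi_boundP (normr_ge0 _)))).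
  by rewrite ler_nat (leq_bigmax i).
by exists n => // i; rewrite tnth_mktuple ratr_nat.
Qed.

(** Rational corners keep the generating family countable, so that almost sure equalities can be
    intersected; density of the rationals recovers every half-line. *)
Lemma low_generates : @measurable _ (d.-tuple R) = <<s range low >>.
Proof.
apply/seteqP; split; last first.
  apply: smallest_sub; first exact: sigma_algebra_measurable.
  by move=> _ [q _ <-]; exact: measurable_low.
pose id' : g_sigma_algebraType (range low) -> d.-tuple R := id.
suff mid : measurable_fun setT id'.
  by move=> A mA; have := mid measurableT A mA; rewrite setTI.
have mlow q : measurable (low q : set (g_sigma_algebraType (range low))).
  by apply: sub_gen_smallest; exists q.
apply/measurable_fun_tnthP => i.
have mle (q : rat) : measurable ([set y | tnth y i <= ratr q] : set (g_sigma_algebraType (range low))).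
  rewrite (_ : [set y | _] = \bigcup_n low [tuple (if j == i then q else n%:R) | j < d]).
    exact: bigcupT_measurable.
  apply/seteqP; split => y /=.
    move=> yq; have : setT y by []; rewrite -low_nat_cover => -[n _ yn]; exists n => // j.
    rewrite tnth_mktuple; case: eqP => [->//|_].
    by have := yn j; rewrite tnth_mktuple.
  by move=> [n _ /(_ i)]; rewrite tnth_mktuple eqxx.
apply: (measurability _ (RGenOInfty.measurableE R)).
move=> _ [_ [r ->] <-]; rewrite setTI.
rewrite (_ : _ @^-1` _ = \bigcup_(q : rat) (if r < ratr q then ~` [set y | tnth y i <= ratr q] else set0)).
  by apply: bigcupT_measurable_rat => q; case: ifP => _ //; exact: measurableC.
apply/seteqP; split => y /=.
  rewrite in_itv/= andbT => ry; have [q] := rat_in_itvoo ry.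
  rewrite in_itv/= => /andP[rq qy]; exists q => //=; rewrite rq.
  by apply/negP; rewrite -ltNge.
move=> [q _]; case: ifP => // rq /negP; rewrite -ltNge => qy.
by rewrite in_itv/= andbT; exact: lt_trans qy.
Qed.

End lower_orthants.

Lemma eq_of_le_sum (R : realType) (a a' b b' : \bar R) :
  (a <= b -> a' <= b' -> 0 <= a -> 0 <= a' -> b + b' <= a + a' -> b + b' < +oo -> a = b)%E.
Proof.
move=> ab ab' a0 a'0 le boo.
have b0 := le_trans a0 ab; have b'0 := le_trans a'0 ab'.
have bf : b \is a fin_num by rewrite ge0_fin_numE// (le_lt_trans _ boo)// leeDl.
have b'f : b' \is a fin_num by rewrite ge0_fin_numE// (le_lt_trans _ boo)// leeDr.
apply/eqP; rewrite eq_le ab/=; have := le_trans le (leeD2l a ab').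
by rewrite leeD2rE.
Qed.

(** * Identification of the density *)

Section abstract_occupation.
Context {R : realType} {d : nat} {dS : measure_display} {S : measurableType dS}
  (nu : {finite_measure set S -> \bar R})
  {dT : measure_display} {T : measurableType dT} (P : probability T R).
Variables (Y : S -> T -> d.-tuple R) (ell : d.-tuple R -> T -> R) (E0 : set (d.-tuple R)).
Hypothesis mY : measurable_fun setT (fun sw : S * T => Y sw.1 sw.2).
Hypothesis mell : measurable_fun setT (fun xw : d.-tuple R * T => ell xw.1 xw.2).
Hypothesis ell0 : forall x w, 0 <= ell x w.
Hypothesis mE0 : measurable E0.
Hypothesis E0null : lebesgue_tuple d E0 = 0.
Hypothesis conv : forall x C, ~ E0 x -> measurable C ->
  (\int[P]_w \int[nu]_s (\1_C w * gk (n.+1%:R^-1) x (Y s w))%:E)%E @[n --> \oo] -->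
  (\int[P]_w (\1_C w * ell x w)%:E)%E.
Hypothesis total : (\int[lebesgue_tuple d]_x \int[P]_w (ell x w)%:E = nu setT)%E.

Local Notation lam := (lebesgue_tuple d).
Local Notation low := (@low R d).

Let ellC (C : set T) x := (\int[P]_w (\1_C w * ell x w)%:E)%E.
(** The event [C] is what later turns equality of means into almost sure equality. *)
Let M1 (C : set T) A := (\int[P]_w \int[nu]_s (\1_C w * \1_A (Y s w))%:E)%E.
Let M2 (C : set T) A := (\int[lam]_(x in A) ellC C x)%E.

Let mellC C : measurable C -> measurable_fun setT (ellC C).
Proof.
move=> mC; apply: (@measurable_fun_fubini_tonelli_F _ _ _ _ _ P (fun xw : d.-tuple R * T => (\1_C xw.2 * ell xw.1 xw.2)%:E)).
  apply/measurable_EFinP; apply: measurable_funM => //.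
  exact: (measurableT_comp (measurable_indic mC) (@measurable_snd _ _ _ _)).
by move=> xw; rewrite lee_fin mulr_ge0.
Qed.

Let ellC0 C x : (0 <= ellC C x)%E.
Proof. by apply: integral_ge0 => w _; rewrite lee_fin mulr_ge0. Qed.

Let mYw w : measurable_fun setT (Y ^~ w).
Proof. exact: (measurableT_comp mY (pair2_measurable w)). Qed.

Let PnuT : ((P \x nu)%E setT < +oo)%E.
Proof.
rewrite -setXTT product_measure1E// [X in (X * _)%E](_ : _ = 1%E); last exact: probability_setT.
rewrite mul1e; exact: finite_measure_lty.
Qed.

Let Q : {finite_measure set (T * S)%type -> \bar R} := mfrestr measurableT PnuT.

Let QE (f : T * S -> \bar R) : measurable_fun setT f -> (forall z, 0 <= f z)%E ->
  (\int[Q]_z f z = \int[P]_w \int[nu]_s f (w, s))%E.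
Proof. by move=> mf f0; rewrite ge0_integral_mfrestr// fubini_tonelli1. Qed.

Let mYQ : measurable_fun setT (fun z : T * S => Y z.2 z.1).
Proof.
apply: (measurableT_comp mY (g := fun z : T * S => (z.2, z.1))).
by apply/measurable_fun_pairP; split; [exact: measurable_snd|exact: measurable_fst].
Qed.

Let mCQ C : measurable C -> measurable_fun setT (fun z : T * S => \1_C z.1 : R).
Proof. by move=> mC; exact: (measurableT_comp (measurable_indic mC) (@measurable_fst _ _ _ _)). Qed.

Let mAQ A : measurable A -> measurable_fun setT (fun z : T * S => \1_A (Y z.2 z.1) : R).
Proof. by move=> mA; exact: (measurableT_comp (measurable_indic mA) mYQ). Qed.

Let M1E C A : measurable C -> measurable A -> M1 C A = (\int[Q]_z (\1_C z.1 * \1_A (Y z.2 z.1))%:E)%E.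
Proof.
move=> mC mA; rewrite QE//.
by apply/measurable_EFinP; apply: measurable_funM; [exact: mCQ|exact: mAQ].
Qed.

Let M_le_sep C A : measurable C -> separated A -> (M2 C A <= M1 C A)%E.
Proof.
move=> mC sA; have [mA _] := sA; rewrite M1E//.
rewrite /M2 -(integral_indic_mul lam (ellC C)).
apply: (occupation_le mYQ (mCQ mC) _ (mellC mC) (ellC0 C) mE0 E0null _ sA).
  by move=> z; rewrite indicE; case: (_ \in _); rewrite /= ?lexx ler01.
move=> x E0x; suff QP : (fun n => \int[Q]_z (\1_C z.1 * gk (n.+1%:R^-1) x (Y z.2 z.1))%:E)%E =
    (fun n => \int[P]_w \int[nu]_s (\1_C w * gk (n.+1%:R^-1) x (Y s w))%:E)%E.
  by rewrite QP; exact: conv.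
apply/funext => n; rewrite QE//.
  apply/measurable_EFinP; apply: measurable_funM; first exact: mCQ.
  exact: (measurableT_comp (measurableT_comp (measurable_gk _) (pair1_measurable x)) mYQ).
by move=> z; rewrite lee_fin mulr_ge0// gk_ge0.
Qed.

Let M1_mono C A A' : measurable C -> measurable A -> measurable A' -> A `<=` A' -> (M1 C A <= M1 C A')%E.
Proof.
move=> mC mA mA' AA'; rewrite !M1E//; apply: ge0_le_integral => //.
- by apply/measurable_EFinP; apply: measurable_funM; [exact: mCQ|exact: mAQ].
- by apply/measurable_EFinP; apply: measurable_funM; [exact: mCQ|exact: mAQ].
move=> z _; rewrite lee_fin ler_wpM2l// !indicE ler_nat.
by case: (boolP (_ \in A)) => // /set_mem/AA'/mem_set ->.
Qed.

Let M_le_low C q : measurable C -> (M2 C (low q) <= M1 C (low q))%E.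
Proof. by move=> mC; apply: M_le_sep => //; exact: separated_low. Qed.

Let M_le_Clow C q : measurable C -> (M2 C (~` low q) <= M1 C (~` low q))%E.
Proof.
move=> mC; rewrite setC_low.
have mh k : measurable (high q k : set (d.-tuple R)) by exact: measurable_high.
have mU : measurable (\bigcup_k (high q k : set (d.-tuple R))) by exact: bigcup_measurable.
have cv := @nondecreasing_cvg_mu _ _ _ (density_measure lam (mellC mC) (ellC0 C)) (high q) mh mU (high_homo q).
have -> : M2 C (\bigcup_k high q k) = density_measure lam (mellC mC) (ellC0 C) (\bigcup_k high q k) by [].
rewrite -(cvg_lim _ cv)//; apply: lime_le; first by apply/cvg_ex; eexists; exact: cv.
apply: nearW => k /=; apply: (@le_trans _ _ (M1 C (high q k))).
  by apply: M_le_sep => //; exact: separated_high.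
by apply: M1_mono => // y hy; exists k.
Qed.

Let M1D C q : measurable C -> (M1 C (low q) + M1 C (~` low q) = M1 C setT)%E.
Proof.
move=> mC; have ml := @measurable_low R d q; have mlC := measurableC ml.
rewrite !M1E// -ge0_integralD//; last 2 first.
- by apply/measurable_EFinP; apply: measurable_funM; [exact: mCQ|exact: mAQ].
- by apply/measurable_EFinP; apply: measurable_funM; [exact: mCQ|exact: mAQ].
apply: eq_integral => z _; rewrite -EFinD -mulrDr; congr (_ * _)%:E.
by rewrite !indicE in_setT in_setC; case: (_ \in _); rewrite ?addr0 ?add0r.
Qed.

Let M1C A C : measurable C -> measurable A -> (M1 C A + M1 (~` C) A = M1 setT A)%E.
Proof.
move=> mC mA; have mCC := measurableC mC.
rewrite !M1E// -ge0_integralD//; last 2 first.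
- by apply/measurable_EFinP; apply: measurable_funM; [exact: mCQ|exact: mAQ].
- by apply/measurable_EFinP; apply: measurable_funM; [exact: mCQ|exact: mAQ].
apply: eq_integral => z _; rewrite -EFinD -mulrDl; congr (_ * _)%:E.
by rewrite !indicE in_setT in_setC; case: (_ \in _); rewrite ?addr0 ?add0r.
Qed.

Let M2D C A : measurable C -> measurable A -> (M2 C A + M2 C (~` A) = M2 C setT)%E.
Proof.
move=> mC mA; rewrite /M2 -ge0_integral_setU ?setUv//; first exact: measurableC.
  exact: mellC.
by apply/disj_setPS => x [].
Qed.

Let M2C C A : measurable C -> measurable A -> (M2 C A + M2 (~` C) A = M2 setT A)%E.
Proof.
move=> mC mA; have mCC := measurableC mC; rewrite /M2 -ge0_integralD//; last 2 first.
- by apply: measurable_funTS; exact: mellC.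
- by apply: measurable_funTS; exact: mellC.
apply: eq_integral => x _; rewrite /ellC.
have ml : measurable_fun setT (ell x) by exact: (measurableT_comp mell (pair1_measurable x)).
rewrite -ge0_integralD//; last 4 first.
- by move=> w _; rewrite lee_fin mulr_ge0.
- by apply/measurable_EFinP; apply: measurable_funM.
- by move=> w _; rewrite lee_fin mulr_ge0.
- by apply/measurable_EFinP; apply: measurable_funM.
apply: eq_integral => w _; rewrite -EFinD -mulrDl; congr (_ * _)%:E.
by rewrite !indicE in_setT in_setC; case: (_ \in _); rewrite ?addr0 ?add0r.
Qed.

Let M2_ge0 C A : (0 <= M2 C A)%E. Proof. by apply: integral_ge0 => x _; exact: ellC0. Qed.

Let M1TT : M1 setT setT = nu setT.
Proof.
rewrite /M1; under eq_integral do under eq_integral do rewrite !indicE !in_setT mulr1.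
under eq_integral do rewrite integral_cst//= mul1e.
by rewrite integral_cst//= [X in (_ * X)%E]probability_setT mule1.
Qed.

Let M2TT : M2 setT setT = nu setT.
Proof.
rewrite -total; apply: eq_integral => x _; apply: eq_integral => w _.
by rewrite indicE in_setT mul1r.
Qed.

Let M1_lty C A : measurable C -> measurable A -> (M1 C A < +oo)%E.
Proof.
move=> mC mA; apply: (@le_lt_trans _ _ (M1 setT A)).
  rewrite -(M1C mC mA) leeDl//; apply: integral_ge0 => w _; apply: integral_ge0 => s _.
  by rewrite lee_fin mulr_ge0.
apply: (@le_lt_trans _ _ (M1 setT setT)); first exact: M1_mono.
by rewrite M1TT; exact: finite_measure_lty.
Qed.

(** [eq_of_le_sum] is used twice: on the whole space, against the complement of the orthant, the
    totals agreeing by [total]; then on the fixed orthant, against the complement of [C], the totals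
    agreeing by the first case. *)
Lemma occupation_low_eq C q : measurable C -> M2 C (low q) = M1 C (low q).
Proof.
move=> mC; have ml := @measurable_low R d q; have mCC := measurableC mC.
have hT : M2 setT (low q) = M1 setT (low q).
  apply: (eq_of_le_sum (M_le_low q measurableT) (M_le_Clow q measurableT)) => //.
    by rewrite M1D// M2D// M1TT M2TT.
  by rewrite M1D//; exact: M1_lty.
apply: (eq_of_le_sum (M_le_low q mC) (M_le_low q mCC)) => //.
  by rewrite M1C// M2C// hT.
by rewrite M1C//; exact: M1_lty.
Qed.

Let xiA A w := (\int[lam]_(x in A) (ell x w)%:E)%E.
Let etaA A w := (\int[nu]_s (\1_A (Y s w))%:E)%E.

Let low_ae q : {ae P, forall w, etaA (low q) w = xiA (low q) w}.
Proof.
have ml := @measurable_low R d q.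
have meta : measurable_fun setT (etaA (low q)).
  apply: (@measurable_fun_fubini_tonelli_F _ _ _ _ _ nu (fun z : T * S => (\1_(low q) (Y z.2 z.1))%:E)).
    by apply/measurable_EFinP; exact: mAQ.
  by move=> z; rewrite lee_fin.
have mxiF : measurable_fun setT (fun xw : d.-tuple R * T => (\1_(low q) xw.1 * ell xw.1 xw.2)%:E).
  apply/measurable_EFinP; apply: measurable_funM => //.
  exact: (measurableT_comp (measurable_indic ml) (@measurable_fst _ _ _ _)).
have xiE w : xiA (low q) w = (\int[lam]_x (\1_(low q) x * ell x w)%:E)%E.
  by rewrite /xiA -integral_indic_mul.
have mxi : measurable_fun setT (xiA (low q)).
  rewrite (_ : xiA _ = (fun w => \int[lam]_x (\1_(low q) x * ell x w)%:E)%E); last exact/funext.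
  apply: (@measurable_fun_fubini_tonelli_G _ _ _ _ _ lam (fun xw : d.-tuple R * T => (\1_(low q) xw.1 * ell xw.1 xw.2)%:E)) => //.
  by move=> z; rewrite lee_fin mulr_ge0.
have eta0 w : (0 <= etaA (low q) w)%E by apply: integral_ge0 => s _; rewrite lee_fin.
have ieta : P.-integrable setT (etaA (low q)).
  apply/integrableP; split => //; under eq_integral do rewrite gee0_abs//.
  suff -> : (\int[P]_w etaA (low q) w = M1 setT (low q))%E by exact: M1_lty.
  by apply: eq_integral => w _; apply: eq_integral => s _; rewrite [X in _ = (X * _)%:E]indicE in_setT mul1r.
have := integral_ae_eq measurableT ieta mxi _; move=> h.
have : ae_eq P setT (etaA (low q)) (xiA (low q)).
  apply: h => C _ mC; rewrite -(integral_indic_mul P (etaA (low q)) C) -(integral_indic_mul P (xiA (low q)) C).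
  transitivity (M1 C (low q)).
    apply: eq_integral => w _; rewrite -ge0_integralZl//.
    by apply/measurable_EFinP; exact: (measurableT_comp (measurable_indic ml) (mYw w)).
  rewrite -occupation_low_eq// /M2 -(integral_indic_mul lam (ellC C)).
  transitivity (\int[lam]_x \int[P]_w (\1_(low q) x * (\1_C w * ell x w))%:E)%E.
    apply: eq_integral => x _; rewrite -ge0_integralZl//.
    - apply/measurable_EFinP; apply: measurable_funM => //.
      exact: (measurableT_comp mell (pair1_measurable x)).
    - by move=> w _; rewrite lee_fin mulr_ge0.
  rewrite (@fubini_tonelli _ _ _ _ _ lam P (fun xw => (\1_(low q) xw.1 * (\1_C xw.2 * ell xw.1 xw.2))%:E)).
  - apply: eq_integral => w _; rewrite xiE -ge0_integralZl//.
    + by apply: eq_integral => x _; rewrite -EFinM mulrCA.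
    + exact: (measurableT_comp mxiF (pair2_measurable w)).
    + by move=> x _; rewrite lee_fin mulr_ge0.
  - apply/measurable_EFinP; apply: measurable_funM.
      exact: (measurableT_comp (measurable_indic ml) (@measurable_fst _ _ _ _)).
    apply: measurable_funM => //.
    exact: (measurableT_comp (measurable_indic mC) (@measurable_snd _ _ _ _)).
  - by move=> z; rewrite lee_fin mulr_ge0// mulr_ge0.
by apply: filterS => w; exact.
Qed.

Lemma abstract_occupation_density : {ae P, forall w A, measurable A ->
  (\int[nu]_s (\1_A (Y s w))%:E = \int[lam]_(x in A) (ell x w)%:E)%E}.
Proof.
(* Enumerating the rational corners gives one null set for all of them. *)
have : {ae P, forall w, forall n, if @unpickle (d.-tuple rat) n is Some q then etaA (low q) w = xiA (low q) w else True}.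
  apply/ae_foralln => n; case: unpickle => [q|]; first exact: low_ae.
  exact: aeW.
apply: filterS => w hw.
have hq q : etaA (low q) w = xiA (low q) w by have := hw (pickle q); rewrite pickleK.
have mlw : measurable_fun setT (fun x => (ell x w)%:E).
  by apply/measurable_EFinP; exact: (measurableT_comp mell (pair2_measurable w)).
have lw0 x : (0 <= (ell x w)%:E)%E by rewrite lee_fin.
pose f : {mfun S >-> d.-tuple R} := mfun_Sub (mem_set (mYw w)).
have fE A : measurable A -> pushforward nu f A = etaA A w.
  move=> mA; rewrite /etaA /pushforward (_ : f @^-1` A = (Y ^~ w) @^-1` A) //.
  rewrite -(setIT (_ @^-1` A)) -integral_indic//.
  by rewrite -[X in measurable X]setTI; exact: mYw.
move=> A mA; rewrite -[LHS](fE A mA) -[RHS](density_measureE lam mlw lw0).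
apply: (measure_unique (range low) (@low_nat R d)) => //.
- exact: low_generates.
- exact: low_setI.
- exact: low_nat_cover.
- by move=> _ [q _ <-]; exact: etrans (fE _ (measurable_low q)) (hq q).
- move=> n; apply: (@le_lt_trans _ _ (nu setT)); last exact: finite_measure_lty.
  suff : (nu ((Y ^~ w) @^-1` low_nat n) <= nu setT)%E by exact.
  apply: le_measure => //; rewrite inE// -[X in measurable X]setTI.
  by apply: (mYw w) => //; exact: measurable_low.
Qed.

End abstract_occupation.

(** * Existence of the local time *)

Section mean.
Context {R : realType} {N d : nat} {dO : measure_display} {Omega : measurableType dO}
  (P : probability Omega R) (H K : 'M[R]_(d, N)) (B : N.-tuple R -> Omega -> d.-tuple R) (t : N.-tuple R).
Hypothesis N0 : (0 < N)%N.
Hypothesis d0 : (0 < d)%N.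
Hypothesis H01 : forall i j, 0 < H i j < 1.
Hypothesis K01 : forall i j, 0 < K i j <= 1.
Hypothesis hB : bifractional_sheet P H K B.
Hypothesis t0 : forall j, 0 < tnth t j.

Local Notation L2 := (L2 P).
Local Notation ip := (ip P).
Local Notation sq := (sq P).
Local Notation pr := (box_pr t).
Local Notation xi := (xi H K B t).
Local Notation sd i s := (sheet_sd H K i (pr s)).
Local Notation nu := (box_measure t0).
Local Notation A := (sheet_weight H K t).
Local Notation J eps x n := (chaosJ nu xi (A eps x) n).
Local Notation L eps x := (pint nu (sheet_kernel B t eps x)).

Lemma ip_cvg (I : Type) (F : set_system I) {FF : Filter F} (f : I -> Omega -> R) g Z :
  L2 Z -> (forall n, L2 (f n)) -> L2 g -> sq (fun w => f n w - g w) @[n --> F] --> 0 ->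
  ip Z (f n) @[n --> F] --> ip Z g.
Proof.
move=> LZ Lf Lg h; apply/cvgrPdist_le => e e0.
have e2 : 0 < e ^+ 2 / (sq Z + 1) by rewrite divr_gt0 ?exprn_gt0// ltr_wpDl ?sq_ge0.
move/cvgrPdist_le : h => /(_ _ e2); apply: filterS => n.
rewrite sub0r normrN ger0_norm ?sq_ge0// => hn.
have LB : L2 (fun w => f n w - g w) by exact: L2B.
have -> : ip Z g - ip Z (f n) = - ip Z (fun w => f n w - g w).
  by rewrite -[in RHS](ipC P) ipBl// !(ipC P _ Z) opprB.
rewrite normrN -(@ler_pXn2r _ 2) ?nnegrE ?(ltW e0)// real_normK ?num_real//.
apply: (le_trans (cauchy_schwarz LZ LB)).
have z0 := sq_ge0 P Z; have b0 := sq_ge0 P (fun w => f n w - g w).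
apply: (@le_trans _ _ (sq Z * (e ^+ 2 / (sq Z + 1)))); first exact: ler_wpM2l.
by rewrite mulrCA ler_piMr ?sqr_ge0// ler_pdivrMr ?mul1r ?lerDl ?ltr_wpDl.
Qed.

Let hp0 s : hermite_prod xi (fun=> 0%N) s = cst 1.
Proof.
apply/funext => w; apply: big1 => i _.
by rewrite /hermiteN/= hornerC fact0 sqrtr1 divr1.
Qed.

Let good eps x : 0 < eps -> good_weight (A eps x).
Proof. exact: sheet_weight_good. Qed.

Lemma mean_chaosJ eps x n : 0 < eps ->
  ip (cst 1) (J eps x n) = if n == 0%N then \int[nu]_s A eps x (fun=> 0%N) s else 0.
Proof.
move=> e0; have Lc := L2_cst P 1.
have LX := chaos_field_L2 (measurable_xi hB t0) (hp_L2 hB t0) (hp_ip H01 K01 hB t0) (rho_diag H01 K01 t0) n (good x e0).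
rewrite (ip_pint nu LX Lc).
have h s : ip (cst 1) (chaos_field xi (A eps x) n s) =
    lev n (fun m => A eps x m s * (if [forall i, 0%N == m i] then 1 else 0)).
  have LZ m : L2 (fun w => A eps x m s * hermite_prod xi m s w) by apply: L2Z; exact: hp_L2.
  rewrite /chaos_field /lev ip_sumr//; apply: eq_bigr => m _.
  rewrite ipZr//; last exact: hp_L2.
  rewrite -(hp0 s) (hp_ip H01 K01 hB t0); congr (_ * _).
  by case: ifP => // _; apply: big1 => i _.
case: eqVneq => [n0|n0].
  apply: eq_Rintegral => s _; rewrite h n0 /lev (big_pred1 [ffun=> ord0]).
    rewrite ifT ?mulr1; last by apply/forallP => i; rewrite ffunE.
    by congr (A eps x _ s); apply/funext => i; rewrite ffunE.
  move=> m /=; rewrite (_ : m = [ffun=> ord0]) ?eqxx.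
    by rewrite big1// => i _; rewrite ffunE.
  by apply/ffunP => i; rewrite ffunE; exact: ord1.
rewrite (@eq_Rintegral _ _ _ _ _ (fun=> 0)); first by rewrite /Rintegral integral0.
move=> s _; rewrite h /lev big1// => m /eqP mn; case: ifPn => [/forallP m0|]; last by rewrite mulr0.
by case/negP: n0; rewrite -mn big1// => i _; apply/esym/eqP; exact: m0.
Qed.

(** The mean is read off the chaos expansion, in which the components of positive order are
    centered. *)
Lemma mean_kernel eps x : 0 < eps -> ip (cst 1) (L eps x) = \int[nu]_s A eps x (fun=> 0%N) s.
Proof.
move=> e0; have Lc := L2_cst P 1.
have LL := pint_L2 nu (sheet_kernel_field hB t0 x e0).
have LJ n : L2 (J eps x n).
  exact: (chaosJ_L2 nu (measurable_xi hB t0) (hp_L2 hB t0) (hp_ip H01 K01 hB t0) (rho_diag H01 K01 t0) n (good x e0)).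
have LS M : L2 (fun w => \sum_(n < M) J eps x n w) by apply: L2_sum => n _; exact: LJ.
have ex := sheet_expansion H01 K01 hB t0 x e0.
have cv : ip (cst 1) (fun w => \sum_(n < M) J eps x n w) @[M --> \oo] --> ip (cst 1) (L eps x).
  by apply: ip_cvg => //; under eq_fun do rewrite sqBC.
have cv' : ip (cst 1) (fun w => \sum_(n < M.+1) J eps x n w) @[M --> \oo] --> ip (cst 1) (L eps x).
  by rewrite (cvg_shiftS (fun M => ip (cst 1) (fun w => \sum_(n < M) J eps x n w))).
apply: (cvg_unique _ cv') => //=; apply: cvg_near_cst; apply: nearW => M.
rewrite ip_sumr// big_ord_recl/= mean_chaosJ//= big1 ?addr0// => i _.
by rewrite mean_chaosJ.
Qed.

(** At eps = 0 the mean of the kernel becomes the density of a centered Gaussian law at x; its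
    integral over x being 1, the limit density has the right total mass. *)
Lemma coef0E (x sg : R) : 0 < sg -> coef 0 x sg 0 = normal_pdf 0 sg x.
Proof.
move=> s0; rewrite /coef addr0 sqrtr_sqr gtr0_norm// expr0 mul1r /hermiteN/= hornerC fact0 sqrtr1 divr1 mulr1.
rewrite normal_pdfE ?gt_eqF// /normal_fun /normal_peak subr0.
rewrite -invfM; congr (_^-1 * expR _).
  rewrite -mulrnAr sqrtrM ?sqr_ge0// sqrtr_sqr gtr0_norm//.
rewrite exprMn exprVn -[sg ^+ 2 *+ 2]mulr_natr invfM; move: (sg ^+ 2)^-1 (x ^+ 2) => a b; lra.
Qed.

Lemma weight0E x s : A 0 x (fun=> 0%N) s = \prod_(i < d) normal_pdf 0 (sd i s) (tnth x i).
Proof. by apply: eq_bigr => i _; apply: coef0E; exact: sd_gt0. Qed.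

Lemma weight0_ge0 eps x s : 0 <= A eps x (fun=> 0%N) s.
Proof.
apply: prodr_ge0 => i _; rewrite /sheet_coef /coef/= /hermiteN/= hornerC fact0 sqrtr1 divr1 mulr1 expr0 mul1r.
by rewrite !mulr_ge0 ?expR_ge0// invr_ge0 sqrtr_ge0.
Qed.

Lemma integral_weight0 s : (\int[lebesgue_tuple d]_x (A 0 x (fun=> 0%N) s)%:E = 1)%E.
Proof.
under eq_integral do rewrite weight0E -prodEFin.
rewrite (@ge0_integral_tuple_prod R d (fun i (x : R) => (normal_pdf 0 (sd i s) x)%:E)); last 2 first.
- by move=> i; apply/measurable_EFinP; exact: measurable_normal_pdf.
- by move=> i x; rewrite lee_fin normal_pdf_ge0.
by apply: big1 => i _; exact: integral_normal_pdf.
Qed.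

Lemma EFin_integral_weight0 eps x : 0 < eps ->
  (\int[nu]_s (A eps x (fun=> 0%N) s)%:E = (\int[nu]_s A eps x (fun=> 0%N) s)%:E)%E.
Proof.
move=> e0; have [mA [c hc]] := good x e0 (fun=> 0%N).
rewrite /Rintegral fineK// ge0_fin_numE; last by apply: integral_ge0 => s _; rewrite lee_fin weight0_ge0.
apply: (@le_lt_trans _ _ (\int[nu]_s (cst c%:E s))%E).
  apply: ge0_le_integral => //.
  - by move=> s _; rewrite lee_fin weight0_ge0.
  - exact/measurable_EFinP.
  - by move=> s _; rewrite lee_fin (le_trans _ (hc s))// ler_norm.
by rewrite integral_cst// lte_mul_pinfty ?finite_measure_lty// lee_fin (le_trans _ (hc t)).
Qed.

End mean.

Section local_time.
Context {R : realType} {N d : nat} {dO : measure_display} {Omega : measurableType dO}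
  (P : probability Omega R) (H K : 'M[R]_(d, N)) (B : N.-tuple R -> Omega -> d.-tuple R) (t : N.-tuple R).
Hypothesis N0 : (0 < N)%N.
Hypothesis d0 : (0 < d)%N.
Hypothesis H01 : forall i j, 0 < H i j < 1.
Hypothesis K01 : forall i j, 0 < K i j <= 1.
Hypothesis hB : bifractional_sheet P H K B.
Hypothesis t0 : forall j, 0 < tnth t j.

Local Notation L2 := (L2 P).
Local Notation ip := (ip P).
Local Notation sq := (sq P).
Local Notation pr := (box_pr t).
Local Notation sd i s := (sheet_sd H K i (pr s)).
Local Notation nu := (box_measure t0).
Local Notation A := (sheet_weight H K t).
Local Notation L eps x := (pint nu (sheet_kernel B t eps x)).
Local Notation e_ n := (n.+1%:R^-1 : R).

Let e0 n : 0 < e_ n. Proof. by rewrite invr_gt0. Qed.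
Let e1 n : e_ n <= 1. Proof. by rewrite invf_le1// ler1n. Qed.
Let e_cvg : e_ n @[n --> \oo] --> 0. Proof. exact: cvg_harmonic. Qed.

Let L_L2 eps x : 0 < eps -> L2 (L eps x).
Proof. by move=> ep; exact: pint_L2 (sheet_kernel_field hB t0 x ep). Qed.

Lemma prod_ereal_lty (I : finType) (f : I -> \bar R) j : (forall i, 0 < f i)%E ->
  (\prod_(i in I) f i < +oo)%E -> (f j < +oo)%E.
Proof.
move=> f0 foo; rewrite ltey; apply/eqP => fj.
by move: foo; rewrite (prod_pinfty f0 fj) ltxx.
Qed.

(** Convergence in L^2 makes the means converge, and at x = 0 the limiting mean integrand is, up to
    a constant, the product of the s_k^(- a k). Its integral is a product of positive integrals, so
    each of them is finite and a k < 1. *)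
Lemma local_time_at_regular x F : local_time_at P B t x F -> regular_level H K x.
Proof.
move=> /(local_time_atP hB t0)[LF hF] x0 j.
pose a k := \sum_(i < d) H i k * K i k.
have a0 k : 0 <= a k.
  apply: sumr_ge0 => i _; have /andP[/ltW h1 _] := H01 i k; have /andP[/ltW h2 _] := K01 i k.
  exact: mulr_ge0.
have hFn : sq (fun w => L (e_ n) x w - F w) @[n --> \oo] --> 0.
  by move/cvg_at_rightP : hF; apply; split.
have cvm : ip (cst 1) (L (e_ n) x) @[n --> \oo] --> ip (cst 1) F.
  by apply: ip_cvg hFn => // [|n]; [exact: L2_cst|exact: L_L2].
have m0 eps : measurable_fun setT (fun s => (A eps x (fun=> 0%N) s)%:E).
  by apply/measurable_EFinP; exact: measurable_sheet_weight.
(* Fatou's lemma along eps = 1/(n+1), with the mean of [F] as bound. *)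
have fin : (\int[nu]_s (A 0 x (fun=> 0%N) s)%:E < +oo)%E.
  apply: (@le_lt_trans _ _ (ip (cst 1) F)%:E); last exact: ltry.
  rewrite (@eq_integral _ _ _ _ _ (fun s => limn_einf (fun n => (A (e_ n) x (fun=> 0%N) s)%:E))); last first.
    move=> s _; have cv : (A (e_ n) x (fun=> 0%N) s)%:E @[n --> \oo] --> (A 0 x (fun=> 0%N) s)%:E.
      apply: cvg_EFin; first exact: nearW.
      apply: cvg_big => [|i _]; first exact: mul_continuous.
      have := @coef_cvg R (tnth x i) (sd i s) 0 (sd_gt0 H K t0 i s).
      by move/cvg_at_rightP; apply; split.
    by rewrite (cvg_limn_einf_sup cv).
  apply: le_trans (fatou _ _ _ _) _ => //.
    by move=> n s _; rewrite lee_fin weight0_ge0.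
  have cvE : (\int[nu]_s (A (e_ n) x (fun=> 0%N) s)%:E)%E @[n --> \oo] --> (ip (cst 1) F)%:E.
    apply: cvg_EFin.
      by apply: nearW => n; rewrite (EFin_integral_weight0 H01 K01 t0 x (e0 n)).
    rewrite (_ : fine \o _ = (fun n => ip (cst 1) (L (e_ n) x))) //; apply/funext => n.
    by rewrite /= (EFin_integral_weight0 H01 K01 t0 x (e0 n))/= (mean_kernel H01 K01 hB).
  by rewrite (cvg_limn_einf_sup cvE).
have p0 : 0 < Num.sqrt (pi *+ 2) :> R by rewrite sqrtr_gt0 mulrn_wgt0// pi_gt0.
have AE s : posbox t s -> A 0 x (fun=> 0%N) s = (Num.sqrt (pi *+ 2))^-1 ^+ d * \prod_(k < N) tnth s k `^ (- a k).
  move=> st; rewrite (weight0E H K t0).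
  transitivity (\prod_(i < d) ((Num.sqrt (pi *+ 2))^-1 * \prod_(k < N) tnth s k `^ (- (H i k * K i k)))).
    apply: eq_bigr => i _; have s0 := sd_gt0 H K t0 i s.
    rewrite x0 normal_pdfE ?gt_eqF// /normal_fun /normal_peak subr0 expr0n/= oppr0 mul0r expR0 mulr1.
    rewrite -mulrnAr sqrtrM ?sqr_ge0// sqrtr_sqr gtr0_norm// invfM mulrC; congr (_ * _).
    rewrite box_prE// /sheet_sd -prodfV; apply: eq_bigr => k _; rewrite powRN//.
  rewrite big_split/= prodr_const card_ord exchange_big/=; congr (_ * _); apply: eq_bigr => k _.
  have /andP[sk _] := st k.
  by rewrite -powR_sum// sumrN.
move: fin; rewrite ge0_integral_box_measure//; last by move=> s; rewrite lee_fin weight0_ge0.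
rewrite (@eq_integral _ _ _ _ _ (fun s => ((Num.sqrt (pi *+ 2))^-1 ^+ d)%:E * \prod_(k < N) (tnth s k `^ (- a k))%:E)%E); last first.
  by move=> s /set_mem st; rewrite AE// EFinM -prodEFin.
have mpw k : measurable_fun setT (fun r : R => (r `^ (- a k))%:E).
  by apply/measurable_EFinP; exact: measurable_powR.
have pw0 k (r : R) : (0 <= (r `^ (- a k))%:E)%E by rewrite lee_fin powR_ge0.
have c0 : 0 < (Num.sqrt (pi *+ 2))^-1 ^+ d :> R by rewrite exprn_gt0// invr_gt0.
rewrite ge0_integralZl; last 4 first.
- exact: measurable_posbox.
- apply: measurable_funTS; exact: (measurable_tuple_prod mpw).
- by move=> s _; apply: prode_ge0 => k _.
- by rewrite lee_fin ltW.
rewrite (@ge0_integral_posbox_prod R N t (fun k r => (r `^ (- a k))%:E))//.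
move=> fin; apply: (integral_powR_lty (t0 j)).
apply: (@prod_ereal_lty _ (fun k => \int[lebesgue_measure]_(r in `]0%R, tnth t k]) (r `^ (- a k))%:E)%E).
  move=> k; apply: (@lt_le_trans _ _ (\int[lebesgue_measure]_(r in `]0%R, tnth t k]) (tnth t k `^ (- a k))%:E)%E).
    rewrite integral_cst//= lebesgue_measure_itv/= lte_fin t0 -EFinD -EFinM lte_fin subr0.
    by rewrite mulr_gt0// powR_gt0.
  apply: ge0_le_integral => //.
  - by apply: measurable_funTS; exact: mpw.
  move=> r; rewrite /= in_itv/= => /andP[r0 rt]; rewrite lee_fin !powRN lef_pV2 ?posrE ?powR_gt0//.
  by apply: powR_homo => //; exact: ltW.
by rewrite ltey; apply/eqP => foo; move: fin; rewrite foo gt0_muley ?lte_fin// ltxx.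
Qed.

Lemma EFin_pint eps x w : 0 < eps -> (\int[nu]_s (sheet_kernel B t eps x s w)%:E = (L eps x w)%:E)%E.
Proof.
move=> ep; have [c [c0 hc]] := @sheet_kernel_bound _ _ _ _ _ B t eps ep.
have mk : measurable_fun setT (fun s => (sheet_kernel B t eps x s w)%:E).
  apply/measurable_EFinP.
  exact: (measurableT_comp (measurableT_comp (measurable_sheet_kernel hB t0 eps) (pair1_measurable x)) (pair2_measurable w)).
have k0 s : (0 <= (sheet_kernel B t eps x s w)%:E)%E by rewrite lee_fin; have /andP[] := hc x s w.
rewrite /pint /Rintegral fineK// ge0_fin_numE; last exact: integral_ge0.
apply: (@le_lt_trans _ _ (\int[nu]_s (cst c%:E s))%E).
  by apply: ge0_le_integral => // s _; rewrite lee_fin; have /andP[] := hc x s w.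
by rewrite integral_cst// lte_mul_pinfty ?finite_measure_lty// lee_fin.
Qed.

Lemma measurable_pint_joint eps :
  measurable_fun setT (fun xw : d.-tuple R * Omega => L eps xw.1 xw.2).
Proof.
apply: (measurableT_comp (f := fine)) => //.
apply: (@measurable_fun_fubini_tonelli_F _ _ _ _ _ nu
  (fun z : (d.-tuple R * Omega) * N.-tuple R => (sheet_kernel B t eps z.1.1 z.2 z.1.2)%:E)).
  apply/measurable_EFinP; apply: (measurableT_comp (measurable_sheet_kernel hB t0 eps)
    (g := fun z : (d.-tuple R * Omega) * N.-tuple R => (z.1.1, (z.2, z.1.2)))).
  apply/measurable_fun_pairP; split => /=.
    exact: (measurableT_comp (@measurable_fst _ _ _ _) (@measurable_fst _ _ _ _)).
  apply/measurable_fun_pairP; split => /=; first exact: measurable_snd.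
  exact: (measurableT_comp (@measurable_snd _ _ _ _) (@measurable_fst _ _ _ _)).
by move=> z; rewrite lee_fin; apply: prodr_ge0 => i _; exact: normal_pdf_ge0.
Qed.

(** Completeness is applied along eps = 1/(n+1), in the version with a jointly measurable limit; the
    Cauchy property in eps then gives convergence for all eps tending to 0. *)
Lemma local_time_exists (alpha : R) :
  0 < alpha < \sum_(j < N) (2 * col_max H j * col_max K j)^-1 - d%:R / 2 ->
  exists Lf : d.-tuple R -> Omega -> R,
    [/\ measurable_fun setT (fun xw : d.-tuple R * Omega => Lf xw.1 xw.2),
        forall x w, 0 <= Lf x w,
        forall x, regular_level H K x -> L2 (Lf x) &
        forall x, regular_level H K x -> sq (fun w => L e x w - Lf x w) @[e --> 0^'+] --> 0].
Proof.
move=> alpha01.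
have cau x del : regular_level H K x -> 0 < del -> exists n0, forall e e', 0 < e <= e_ n0 -> 0 < e' <= e_ n0 ->
    sq (fun w => L e x w - L e' x w) <= del.
  move=> reg del0; have [r [r0 hr]] := sheet_pint_cauchy N0 d0 H01 K01 hB t0 reg alpha01 del0.
  have [n0] := ltr_add_invr r0; rewrite add0r => hn; exists n0 => e e' /andP[ep en] /andP[ep' en'].
  by apply: hr; rewrite ?ep ?ep' ?(le_trans en) ?(le_trans en')//= ltW.
have cauN x : regular_level H K x -> forall del, 0 < del -> exists n0, forall m n, (n0 <= m)%N -> (n0 <= n)%N ->
    sq (fun w => L (e_ m) x w - L (e_ n) x w) <= del.
  move=> reg del del0; have [n0 hn0] := cau x del reg del0; exists n0 => m n mn nn.
  by apply: hn0; rewrite e0/= lef_pV2 ?posrE// ler_nat ltnS.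
have [Lp [mLp hLp]] := @L2_complete_param _ _ _ P _ _ (fun n x w => L (e_ n) x w) (regular_level H K)
  (fun n => measurable_pint_joint (e_ n)) (fun x _ n => L_L2 x (e0 n)) cauN.
(* The limit obtained need not be nonnegative at every x and w, as [occupation_density] demands.
   Taking its positive part does not increase the distance to the nonnegative regularizations. *)
have mmax : measurable_fun setT (fun xw : d.-tuple R * Omega => Num.max 0 (Lp xw.1 xw.2)).
  by apply: measurable_maxr.
have mLx x : measurable_fun setT (fun w => Num.max 0 (Lp x w)).
  exact: (measurableT_comp mmax (pair1_measurable x)).
have LLf x : regular_level H K x -> L2 (fun w => Num.max 0 (Lp x w)).
  move=> reg; have [LLp _] := hLp x reg; apply: (@L2_le _ _ _ P _ _ 1 (mLx x) LLp) => w.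
  by rewrite mul1r; case: (leP 0 (Lp x w)) => // _; rewrite normr0.
exists (fun x w => Num.max 0 (Lp x w)); split => //.
  by move=> x w; rewrite le_max lexx.
move=> x reg; have [LLp hcv] := hLp x reg.
have Lge0 e w : 0 <= L e x w.
  rewrite /pint /Rintegral fine_ge0//; apply: integral_ge0 => s _; rewrite lee_fin.
  by apply: prodr_ge0 => i _; exact: normal_pdf_ge0.
apply/cvgrPdist_le => del del0; have d4 : 0 < del / 4 by rewrite divr_gt0.
have [n0 hn0] := cau x _ reg d4.
move/cvgrPdist_le : hcv => /(_ _ d4)[n1 _ hn1].
have := hn1 (maxn n0 n1) (leq_maxr _ _); rewrite /= sub0r normrN ger0_norm ?sq_ge0//.
set n := maxn n0 n1 => hn.
have hle : sq (fun w => L (e_ n) x w - Num.max 0 (Lp x w)) <= del / 4.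
  apply: le_trans hn; apply: sq_le.
  - by apply: measurable_funB => //; have [] := L_L2 x (e0 n).
  - by apply: L2B => //; exact: L_L2.
  move=> w; have := Lge0 (e_ n) w; case: (leP 0 (Lp x w)) => // l0 L0.
  rewrite subr0 !ger0_norm//; last by rewrite subr_ge0 (le_trans (ltW l0)).
  by rewrite lerBrDr gerDl ltW.
near=> e; rewrite sub0r normrN ger0_norm ?sq_ge0//.
have ep : 0 < e by near: e; exact: nbhs_right_gt.
have en : e <= e_ n0 by near: e; exact: nbhs_right_le.
have h1 : sq (fun w => L e x w - L (e_ n) x w) <= del / 4.
  by apply: hn0; rewrite ?ep// e0/= lef_pV2 ?posrE// ler_nat ltnS leq_maxl.
apply: (le_trans (sq_triangle (L_L2 x ep) (L_L2 x (e0 n)) (LLf x reg))).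
lra.
Unshelve. all: by end_near.
Qed.

Lemma sheet_occupation_density (Lf : d.-tuple R -> Omega -> R) :
  measurable_fun setT (fun xw : d.-tuple R * Omega => Lf xw.1 xw.2) ->
  (forall x w, 0 <= Lf x w) -> (forall x, regular_level H K x -> L2 (Lf x)) ->
  (forall x, regular_level H K x -> sq (fun w => L e x w - Lf x w) @[e --> 0^'+] --> 0) ->
  occupation_density P B t Lf.
Proof.
move=> mLf Lf0 LLf cLf; split => //.
pose i0 : 'I_d := Ordinal d0.
(* A null set of levels containing 0, the only level that may fail to be regular. *)
pose E0 := [set x : d.-tuple R | tnth x i0 = 0].
have mE0 : measurable E0.
  rewrite -[X in measurable X]setTI.
  exact: (measurable_tnth i0 measurableT (measurable_set1 0)).
have E0null : lebesgue_tuple d E0 = 0 by exact: lebesgue_tuple_coord0.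
have reg x : ~ E0 x -> regular_level H K x by move=> nx /(_ i0) x0; case: nx.
pose Y s w := B (pr s) w.
have mY : measurable_fun setT (fun sw : N.-tuple R * Omega => Y sw.1 sw.2) by exact: measurable_sheet hB t0.
have cvn x : ~ E0 x -> sq (fun w => L (e_ n) x w - Lf x w) @[n --> \oo] --> 0.
  by move=> /reg/cLf/cvg_at_rightP; apply; split.
have EFip f g : L2 f -> L2 g -> (\int[P]_w (f w * g w)%:E = (ip f g)%:E)%E.
  move=> Lf' Lg; rewrite /ip /Rintegral fineK//.
  exact: integrable_fin_num (L2_integrableM Lf' Lg).
have conv x C : ~ E0 x -> measurable C ->
  (\int[P]_w \int[nu]_s (\1_C w * gk (n.+1%:R^-1) x (Y s w))%:E)%E @[n --> \oo] -->
  (\int[P]_w (\1_C w * Lf x w)%:E)%E.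
  move=> nx mC; have LC : L2 (\1_C).
    apply: (@L2_le _ _ _ P _ _ 1 (measurable_indic mC) (L2_cst P 1)) => w.
    by rewrite mul1r normr1 ger0_norm// indicE lern1 leq_b1.
  rewrite (EFip _ _ LC (LLf x (reg x nx))).
  rewrite (_ : (fun n => _) = (fun n => (ip (\1_C) (L (e_ n) x))%:E)); last first.
    apply/funext => n; rewrite -EFip//; last exact: L_L2.
    apply: eq_integral => w _; rewrite EFinM -EFin_pint// -ge0_integralZl//.
    - apply/measurable_EFinP.
      exact: (measurableT_comp (measurableT_comp (measurable_sheet_kernel hB t0 (e_ n)) (pair1_measurable x)) (pair2_measurable w)).
    - by move=> s _; rewrite lee_fin; apply: prodr_ge0 => i _; exact: normal_pdf_ge0.
  apply: cvg_EFin; first exact: nearW.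
  by apply: ip_cvg (cvn x nx) => // [n|]; [exact: L_L2|exact/LLf/reg].
have mean_eq x : ~ E0 x -> (\int[P]_w (Lf x w)%:E = \int[nu]_s (A 0 x (fun=> 0%N) s)%:E)%E.
  move=> nx; have A01 : 0 <= (0 : R) <= 1 by apply/andP; split.
  have iA0 := weight_integrable H01 K01 t0 (fun=> 0%N) (reg x nx) A01.
  transitivity (ip (cst 1) (Lf x))%:E.
    rewrite -EFip; [|exact: L2_cst|exact/LLf/reg].
    by apply: eq_integral => w _; rewrite mul1r.
  transitivity (\int[nu]_s A 0 x (fun=> 0%N) s)%:E; last first.
    by rewrite /Rintegral fineK//; exact: integrable_fin_num iA0.
  congr EFin.
  have c1 : ip (cst 1) (L (e_ n) x) @[n --> \oo] --> ip (cst 1) (Lf x).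
    by apply: ip_cvg (cvn x nx) => // [|n|]; [exact: L2_cst|exact: L_L2|exact/LLf/reg].
  apply: (cvg_unique _ c1) => //=.
  rewrite (_ : (fun n => _) = (fun n => \int[nu]_s A (e_ n) x (fun=> 0%N) s)); last first.
    by apply/funext => n; rewrite (mean_kernel H01 K01 hB).
  have /cvg_at_rightP wd := weight_dist_cvg H01 K01 t0 (fun=> 0%N) (reg x nx).
  have wdn : weight_dist H K t0 (e_ n) x (fun=> 0%N) @[n --> \oo] --> 0 by apply: wd; split.
  apply/cvgrPdist_le => e ep; move/cvgrPdist_le : wdn => /(_ _ ep); apply: filterS => n.
  have en01 : 0 <= e_ n <= 1 by rewrite (ltW (e0 n)) e1.
  have iAn := weight_integrable H01 K01 t0 (fun=> 0%N) (reg x nx) en01.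
  rewrite sub0r normrN ger0_norm ?weight_dist_ge0//; apply: le_trans.
  rewrite -RintegralB//; apply: le_trans (le_normr_Rintegral _ _) _ => //.
    exact: (integrableB measurableT iA0 iAn).
  by rewrite /weight_dist; under [leRHS]eq_Rintegral do rewrite distrC.
have mAx : measurable_fun setT (fun xs : d.-tuple R * N.-tuple R => (A 0 xs.1 (fun=> 0%N) xs.2)%:E).
  apply/measurable_EFinP; apply: measurable_prod => i _; apply: measurable_coef.
    exact: (measurableT_comp (measurable_tnth i) (@measurable_fst _ _ _ _)).
  exact: (measurableT_comp (measurable_sd H K t i) (@measurable_snd _ _ _ _)).
have A0 x s : (0 <= (A 0 x (fun=> 0%N) s)%:E)%E by rewrite lee_fin weight0_ge0.
(* By Tonelli's theorem the mass is the integral over s of Gaussian densities in x, each of mass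
   1. *)
have total : (\int[lebesgue_tuple d]_x \int[P]_w (Lf x w)%:E = nu setT)%E.
  transitivity (\int[lebesgue_tuple d]_x \int[nu]_s (A 0 x (fun=> 0%N) s)%:E)%E.
    apply: ge0_ae_eq_integral => //.
    - apply: (@measurable_fun_fubini_tonelli_F _ _ _ _ _ P (fun xw : d.-tuple R * Omega => (Lf xw.1 xw.2)%:E)).
        exact/measurable_EFinP.
      by move=> xw; rewrite lee_fin.
    - exact: (@measurable_fun_fubini_tonelli_F _ _ _ _ _ nu (fun xs : d.-tuple R * N.-tuple R => (A 0 xs.1 (fun=> 0%N) xs.2)%:E)).
    - by move=> x _; apply: integral_ge0 => w _; rewrite lee_fin.
    - by move=> x _; apply: integral_ge0.
    exists E0; split => // x /= h; apply: contrapT => nx; apply: h => _; exact: mean_eq.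
  rewrite (@fubini_tonelli _ _ _ _ _ (lebesgue_tuple d) nu (fun xs : d.-tuple R * N.-tuple R => (A 0 xs.1 (fun=> 0%N) xs.2)%:E))//.
  under eq_integral do rewrite (integral_weight0 H K t0).
  by rewrite integral_cst// mul1e.
have := abstract_occupation_density mY mLf Lf0 mE0 E0null conv total.
apply: filterS => w hw C mC; rewrite -hw// /occupation.
have mCB : measurable_fun (box t) (fun s => (\1_C (B s w) : R)%:E).
  apply/measurable_EFinP; apply: (measurableT_comp (measurable_indic mC)).
  exact: (measurable_sheet_path hB w).
rewrite ge0_integral_box//.
rewrite ge0_integral_box_measure; last 2 first.
- apply/measurable_EFinP; apply: (measurableT_comp (measurable_indic mC)).
  exact: (measurableT_comp mY (pair2_measurable w)).
- by move=> s; rewrite lee_fin.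
by apply: eq_integral => s /set_mem st; rewrite /Y box_prE.
Qed.

End local_time.

Theorem corollary4p16 (R : realType) (N d : nat)
    (dO : measure_display) (Omega : measurableType dO) (P : probability Omega R)
    (H K : 'M[R]_(d, N)) (B : N.-tuple R -> Omega -> d.-tuple R) :
  (0 < N)%N -> (0 < d)%N ->
  (forall i j, 0 < H i j < 1) -> (forall i j, 0 < K i j <= 1) ->
  bifractional_sheet P H K B ->
  forall t : N.-tuple R, (forall j, 0 < tnth t j) ->
  forall alpha : R,
    0 < alpha < \sum_(j < N)
      (2 * col_max H j * col_max K j)^-1
      - d%:R / 2 ->
  exists L : d.-tuple R -> Omega -> R,
    [/\ occupation_density P B t L,
        forall x : d.-tuple R,
          ((forall i, tnth x i = 0) ->
             forall j, \sum_(i < d) H i j * K i j < 1) ->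
          local_time_at P B t x (L x) &
        forall (x : d.-tuple R) (F : Omega -> R),
          local_time_at P B t x F -> watanabe P B alpha F].
Proof.
move=> N0 d0 H01 K01 hB t t0 alpha alpha01.
have [L [mL L0 LL cL]] := local_time_exists N0 d0 H01 K01 hB t0 alpha01.
exists L; split.
- exact: (sheet_occupation_density d0 H01 K01 hB mL L0 LL cL).
- by move=> x reg; apply/(local_time_atP hB t0); split; [exact: LL|exact: cL].
(* The existence of [F] already makes the level x regular. *)
- move=> x F hF; apply: (sheet_watanabe N0 d0 H01 K01 hB t0 _ alpha01 hF).
  exact: (local_time_at_regular H01 K01 hB t0 hF).
Qed.
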